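(* (Small hitting sets exist in $\mathsf{S^1_2}+\mathsf{dWPHP}(\mathsf{PV})$.) The theory $\mathsf{S^1_2}+\mathsf{dWPHP}(\mathsf{PV})$ proves: for every definable class $\mathscr{C}$ of algebraic circuits, every parameter $e$ for its decoding function, and all $n,d,s,q,r,m \in \mathrm{Log}$ such that $q \geq 2dn$ and $r > m + n|q|$, there exists $H \in (S_q^n)^r$ that is a hitting set for $\mathscr{C}_e(n,d,s,m)$ over $S_q$.
   Context: $\mathsf{S^1_2}$ denotes Buss's bounded arithmetic theory $\mathsf{S^1_2}$ extended with a symbol for every polynomial-time function ($\mathsf{PV}$) and their defining equations; objects are coded by natural numbers, integers in sign-magnitude. $\mathsf{dWPHP}(\mathsf{PV})$: for every $\mathsf{PV}$-symbol $f$, the universal closure of $(b\ge 2a \wedge a\ge1)\to\exists y\in[b]\,\forall x\in[a]\ f(x,c)\ne y$, $[k]=\{1,\ldots,k\}$. $\mathrm{Log}$ = binary lengths; $|q|$ is the binary length of $q$. $\mathrm{Ckt}(n,d,s)$ = algebraic circuits over $\mathbb{Z}$ (straight-line programs with variables, plugged integer constants, $+$, $\times$) with at most $n$ indeterminates, maximum syntactic individual degree (over variables and parameters; max at $+$, sum at $\times$) at most $d$, representation size at most $s$. A definable class of algebraic circuits is a set $\mathscr{C}$ of circuits with a $\mathsf{PV}$ decoding function $g$ surjective onto $\mathscr{C}$ such that, given $n,d,s$ in unary and $x\in\{0,1\}^m$, $g_e(n,d,s,x)\in\mathrm{Ckt}(n,d,s)$ for every parameter $e$; its slice is $\mathscr{C}_e(n,d,s,m)=\{g_e(n,d,s,x):x\in\{0,1\}^m\}$.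 $S_q=\{0,\ldots,q-1\}$. $H=(\overline{h}_1,\ldots,\overline{h}_r)\in(S_q^n)^r$ is a hitting set for the slice over $S_q$ if for every $P$ in the slice, if $P(\overline{a})\ne 0$ for some $\overline{a}\in\mathbb{Z}^n$, then $P(\overline{h}_i)\neq0$ for some $i\in[r]$. *)

(* Defs.v *)
From Stdlib Require List.
From mathcomp Require Import all_boot.

Set Implicit Arguments.
Unset Strict Implicit.
Unset Printing Implicit Defensive.

(** * Function symbols

   [pv n] is the type of n-ary PV function symbols, generated as in Cobham's
   characterization of the polynomial-time functions.  The function symbols of
   Buss's language are among the initial functions.  [pv_lrec g h0 h1 k] is
   recursion on notation bounded by [k]: instead of asking for a proof that the
   bound holds, every value is cut down to the minimum with the bound (see
   [pv_def]), so that all symbols are polynomial-time and all polynomial-time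
   functions have a symbol. *)

Inductive pv : nat -> Type :=
| pv_zero : pv 0
| pv_succ : pv 1
| pv_half : pv 1                                    (* floor (x / 2) *)
| pv_len : pv 1                                     (* binary length |x| *)
| pv_add : pv 2
| pv_mul : pv 2
| pv_smash : pv 2                                   (* 2 ^ (|x| * |y|) *)
| pv_proj n : 'I_n -> pv n
| pv_comp k n : pv k -> ('I_k -> pv n) -> pv n
| pv_lrec n : pv n -> pv n.+2 -> pv n.+2 -> pv n.+1 -> pv n.+1.

(** * First-order logic, with de Bruijn indices *)

Inductive term : Type :=
| Var : nat -> term
| App n : pv n -> ('I_n -> term) -> term.

Inductive form : Type :=
| FBot
| FEq of term & term
| FLe of term & term
| FImp of form & form
| FAnd of form & form
| FOr of form & form
| FAll of form
| FEx of form.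

Definition args (ts : seq term) {n : nat} : 'I_n -> term :=
  fun i => nth (Var 0) ts i.

Definition argcons n (t : term) (ts : 'I_n -> term) : 'I_n.+1 -> term :=
  fun i => oapp ts t (unlift ord0 i).

Fixpoint tsubst (sigma : nat -> term) (t : term) : term :=
  match t with
  | Var i => sigma i
  | App _ f ts => App f (fun i => tsubst sigma (ts i))
  end.

Definition tshift : term -> term := tsubst (fun i => Var i.+1).

Definition scons (t : term) (sigma : nat -> term) : nat -> term :=
  fun i => if i is j.+1 then sigma j else t.

Definition up (sigma : nat -> term) : nat -> term :=
  scons (Var 0) (fun i => tshift (sigma i)).

Fixpoint fsubst (sigma : nat -> term) (A : form) : form :=
  match A with
  | FBot => FBot
  | FEq s t => FEq (tsubst sigma s) (tsubst sigma t)
  | FLe s t => FLe (tsubst sigma s) (tsubst sigma t)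
  | FImp A B => FImp (fsubst sigma A) (fsubst sigma B)
  | FAnd A B => FAnd (fsubst sigma A) (fsubst sigma B)
  | FOr A B => FOr (fsubst sigma A) (fsubst sigma B)
  | FAll A => FAll (fsubst (up sigma) A)
  | FEx A => FEx (fsubst (up sigma) A)
  end.

Definition fshift : form -> form := fsubst (fun i => Var i.+1).

Definition finst (A : form) (t : term) : form := fsubst (scons t Var) A.

(* Classical natural deduction with equality.  Axioms of [T] may have free
   variables and stand for their universal closures: the eigenvariable
   conditions of [p_allI] and [p_exE] only concern the context. *)
Inductive proves (T : form -> Prop) : seq form -> form -> Prop :=
| p_ax Gamma A : T A -> proves T Gamma A
| p_hyp Gamma A : List.In A Gamma -> proves T Gamma A
| p_impI Gamma A B : proves T (A :: Gamma) B -> proves T Gamma (FImp A B)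
| p_impE Gamma A B :
    proves T Gamma (FImp A B) -> proves T Gamma A -> proves T Gamma B
| p_andI Gamma A B :
    proves T Gamma A -> proves T Gamma B -> proves T Gamma (FAnd A B)
| p_andE1 Gamma A B : proves T Gamma (FAnd A B) -> proves T Gamma A
| p_andE2 Gamma A B : proves T Gamma (FAnd A B) -> proves T Gamma B
| p_orI1 Gamma A B : proves T Gamma A -> proves T Gamma (FOr A B)
| p_orI2 Gamma A B : proves T Gamma B -> proves T Gamma (FOr A B)
| p_orE Gamma A B C :
    proves T Gamma (FOr A B) ->
    proves T (A :: Gamma) C -> proves T (B :: Gamma) C -> proves T Gamma C
| p_contra Gamma A : proves T (FImp A FBot :: Gamma) FBot -> proves T Gamma A
| p_allI Gamma A : proves T (map fshift Gamma) A -> proves T Gamma (FAll A)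
| p_allE Gamma A t : proves T Gamma (FAll A) -> proves T Gamma (finst A t)
| p_exI Gamma A t : proves T Gamma (finst A t) -> proves T Gamma (FEx A)
| p_exE Gamma A C :
    proves T Gamma (FEx A) ->
    proves T (A :: map fshift Gamma) (fshift C) -> proves T Gamma C
| p_eqI Gamma t : proves T Gamma (FEq t t)
| p_eqE Gamma A s t :
    proves T Gamma (FEq s t) ->
    proves T Gamma (finst A s) -> proves T Gamma (finst A t).

(** * Formulas with named binders

   A [bterm] or [bform] is a term or formula as a function of the number of
   binders above it, so that bound variables can be Rocq variables: the variable
   bound under [k] binders is, under [l] binders, the index [l - k.+1]. *)

Definition bterm := nat -> term.
Definition bform := nat -> form.

Definition bapp n (f : pv n) (ts : seq bterm) : bterm :=
  fun l => App f (args [seq t l | t <- ts]).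

Definition bbot : bform := fun=> FBot.
Definition beq (s t : bterm) : bform := fun l => FEq (s l) (t l).
Definition ble (s t : bterm) : bform := fun l => FLe (s l) (t l).
Definition bimp (A B : bform) : bform := fun l => FImp (A l) (B l).
Definition band (A B : bform) : bform := fun l => FAnd (A l) (B l).
Definition bor (A B : bform) : bform := fun l => FOr (A l) (B l).
Definition bvar (k : nat) : bterm := fun l => Var (l - k.+1).
Definition ball (A : bterm -> bform) : bform :=
  fun k => FAll (A (bvar k) k.+1).
Definition bex (A : bterm -> bform) : bform :=
  fun k => FEx (A (bvar k) k.+1).

Definition close (A : bform) : form := A 0.

Definition zero : bterm := bapp pv_zero [::].
Definition Sc (t : bterm) : bterm := bapp pv_succ [:: t].
Definition Half (t : bterm) : bterm := bapp pv_half [:: t].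
Definition one : bterm := Sc zero.
Definition two : bterm := Sc one.
Definition three : bterm := Sc two.

Declare Scope fo_scope.
Delimit Scope fo_scope with fo.
Notation "'ALL' x .. y , A" := (ball (fun x => .. (ball (fun y => A)) ..))
  (at level 200, x binder, y binder, right associativity) : fo_scope.
Notation "'EX' x .. y , A" := (bex (fun x => .. (bex (fun y => A)) ..))
  (at level 200, x binder, y binder, right associativity) : fo_scope.
Notation "s + t" := (bapp pv_add [:: s; t]) : fo_scope.
Notation "s * t" := (bapp pv_mul [:: s; t]) : fo_scope.
Notation "s # t" := (bapp pv_smash [:: s; t])
  (at level 40, left associativity) : fo_scope.
Notation "`| t |" := (bapp pv_len [:: t]) : fo_scope.
Notation "s == t" := (beq s t) : fo_scope.
Notation "s != t" := (bimp (beq s t) bbot) : fo_scope.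
Notation "s <= t" := (ble s t) : fo_scope.
Notation "s < t" := (ble (Sc s) t) : fo_scope.
Notation "A ~~> B" := (bimp A B)
  (at level 99, right associativity) : fo_scope.
Notation "A /\ B" := (band A B) : fo_scope.
Notation "A \/ B" := (bor A B) : fo_scope.
Notation "A <~~> B" := (band (bimp A B) (bimp B A))
  (at level 95, no associativity) : fo_scope.

Local Open Scope fo_scope.

(** * Buss's theory S^1_2 over the PV symbols *)

Definition BASIC : seq bform := [::
  ALL x y, y <= x ~~> y <= Sc x;
  ALL x, x != Sc x;
  ALL x, zero <= x;
  ALL x y, (x <= y /\ x != y) <~~> Sc x <= y;
  ALL x, x != zero ~~> two * x != zero;
  ALL x y, y <= x \/ x <= y;
  ALL x y, (x <= y /\ y <= x) ~~> x == y;
  ALL x y z, (x <= y /\ y <= z) ~~> x <= z;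
  `|zero| == zero;
  ALL x, x != zero ~~>
    (`|two * x| == Sc `|x| /\ `|Sc (two * x)| == Sc `|x|);
  `|one| == one;
  ALL x y, x <= y ~~> `|x| <= `|y|;
  ALL x y, `|x # y| == Sc (`|x| * `|y|);
  ALL y, zero # y == one;
  ALL x, x != zero ~~>
    (one # (two * x) == two * (one # x) /\
     one # (Sc (two * x)) == two * (one # x));
  ALL x y, x # y == y # x;
  ALL x y z, `|x| == `|y| ~~> x # z == y # z;
  ALL x y u v, `|x| == `|u| + `|v| ~~> x # y == (u # y) * (v # y);
  ALL x y, x <= x + y;
  ALL x y, (x <= y /\ x != y) ~~>
    (Sc (two * x) <= two * y /\ Sc (two * x) != two * y);
  ALL x y, x + y == y + x;
  ALL x, x + zero == x;
  ALL x y, x + Sc y == Sc (x + y);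
  ALL x y z, (x + y) + z == x + (y + z);
  ALL x y z, (x + y <= x + z) <~~> (y <= z);
  ALL x, x * zero == zero;
  ALL x y, x * Sc y == x * y + x;
  ALL x y, x * y == y * x;
  ALL x y z, x * (y + z) == x * y + x * z;
  ALL x y z, one <= x ~~> ((x * y <= x * z) <~~> (y <= z));
  ALL x, x != zero ~~> `|x| == Sc `|Half x|;
  ALL x y, (x == Half y) <~~> (two * x == y \/ Sc (two * x) == y)].

(* [F] is the minimum of [h] and [k]. *)
Definition is_min (F h k : term) : form :=
  FAnd (FImp (FLe h k) (FEq F h)) (FImp (FLe k h) (FEq F k)).

Definition tzero : term := zero 0.
Definition tdouble (t : term) : term := (two * (fun=> t)) 0.
Definition tdoubleS (t : term) : term := Sc (two * (fun=> t)) 0.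
Definition thalf (t : term) : term := Half (fun=> t) 0.
Definition tlen (t : term) : term := `|fun=> t| 0.

(* Defining equations of the non-initial symbols:
   - F(0, y) = min (g(y), k(0, y)),
   - F(2x, y) = min (h0(F(x, y), x, y), k(2x, y)) for x <> 0,
   - F(2x+1, y) = min (h1(F(x, y), x, y), k(2x+1, y)). *)
Inductive pv_def : form -> Prop :=
| def_proj n (i : 'I_n) (xs : 'I_n -> term) :
    pv_def (FEq (App (pv_proj i) xs) (xs i))
| def_comp k n (f : pv k) (gs : 'I_k -> pv n) (xs : 'I_n -> term) :
    pv_def (FEq (App (pv_comp f gs) xs) (App f (fun i => App (gs i) xs)))
| def_rec0 n (g : pv n) h0 h1 k (ys : 'I_n -> term) :
    pv_def (is_min (App (pv_lrec g h0 h1 k) (argcons tzero ys))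
                   (App g ys)
                   (App k (argcons tzero ys)))
| def_rec_even n (g : pv n) h0 h1 k (x : term) (ys : 'I_n -> term) :
    let F := pv_lrec g h0 h1 k in
    pv_def (FImp (FImp (FEq x tzero) FBot)
      (is_min (App F (argcons (tdouble x) ys))
         (App h0 (argcons (App F (argcons x ys)) (argcons x ys)))
         (App k (argcons (tdouble x) ys))))
| def_rec_odd n (g : pv n) h0 h1 k (x : term) (ys : 'I_n -> term) :
    let F := pv_lrec g h0 h1 k in
    pv_def (is_min (App F (argcons (tdoubleS x) ys))
         (App h1 (argcons (App F (argcons x ys)) (argcons x ys)))
         (App k (argcons (tdoubleS x) ys))).

(* Quantifiers bounded by [t]; the bound does not contain the bound variable. *)
Definition allb (t : term) (A : form) : form :=
  FAll (FImp (FLe (Var 0) (tshift t)) A).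
Definition exb (t : term) (A : form) : form :=
  FEx (FAnd (FLe (Var 0) (tshift t)) A).

Inductive sharply_bounded : form -> Prop :=
| sb_bot : sharply_bounded FBot
| sb_eq s t : sharply_bounded (FEq s t)
| sb_le s t : sharply_bounded (FLe s t)
| sb_imp A B :
    sharply_bounded A -> sharply_bounded B -> sharply_bounded (FImp A B)
| sb_and A B :
    sharply_bounded A -> sharply_bounded B -> sharply_bounded (FAnd A B)
| sb_or A B :
    sharply_bounded A -> sharply_bounded B -> sharply_bounded (FOr A B)
| sb_all t A : sharply_bounded A -> sharply_bounded (allb (tlen t) A)
| sb_ex t A : sharply_bounded A -> sharply_bounded (exb (tlen t) A).

Inductive Sigma1b : form -> Prop :=
| sg_sb A : sharply_bounded A -> Sigma1b A
| sg_imp A B : Pi1b A -> Sigma1b B -> Sigma1b (FImp A B)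
| sg_and A B : Sigma1b A -> Sigma1b B -> Sigma1b (FAnd A B)
| sg_or A B : Sigma1b A -> Sigma1b B -> Sigma1b (FOr A B)
| sg_all t A : Sigma1b A -> Sigma1b (allb (tlen t) A)
| sg_ex t A : Sigma1b A -> Sigma1b (exb t A)
with Pi1b : form -> Prop :=
| pi_sb A : sharply_bounded A -> Pi1b A
| pi_imp A B : Sigma1b A -> Pi1b B -> Pi1b (FImp A B)
| pi_and A B : Pi1b A -> Pi1b B -> Pi1b (FAnd A B)
| pi_or A B : Pi1b A -> Pi1b B -> Pi1b (FOr A B)
| pi_ex t A : Pi1b A -> Pi1b (exb (tlen t) A)
| pi_all t A : Pi1b A -> Pi1b (allb t A).

(* Induction on notation for [A], in its variable of index 0. *)
Definition PIND (A : form) : form :=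
  FImp (FAnd (finst A tzero)
             (FAll (FImp (fsubst (scons (thalf (Var 0)) (fun i => Var i.+1)) A)
                         A)))
       (FAll A).

Definition dWPHP (f : pv 2) : bform :=
  ALL a b c, (two * a <= b /\ one <= a) ~~>
    EX y, (one <= y /\ y <= b) /\
      ALL x, (one <= x /\ x <= a) ~~> bapp f [:: x; c] != y.

Inductive S12 : form -> Prop :=
| S12_basic A : List.In A BASIC -> S12 (close A)
| S12_pv A : pv_def A -> S12 A
| S12_pind A : Sigma1b A -> S12 (PIND A).

Inductive S12_dWPHP : form -> Prop :=
| S12_dWPHP_S12 A : S12 A -> S12_dWPHP A
| S12_dWPHP_dWPHP f : S12_dWPHP (close (dWPHP f)).

(** * Coding in bounded arithmetic *)

Definition in_Log (n : bterm) : bform := EX z, `|z| == n.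

(* [u] is n in unary, as the string 1^n, i.e. the number 2^n - 1. *)
Definition unary (u n : bterm) : bform := `|u| == n /\ Sc u == u # one.

(* [x] codes a string in {0,1}^m: its binary expansion is the string preceded
   by a leading 1, so that strings of different lengths have distinct codes. *)
Definition is_string (x m : bterm) : bform := `|x| == Sc m.

(* Cantor's pairing bijection. *)
Definition is_pair (z x y : bterm) : bform :=
  two * z == (x + y) * Sc (x + y) + two * x.

(* A sequence is coded by a pair <b, y>: its i-th entry is the i-th least
   significant block of |y| bits of b.  Here i is in Log, y # 1 = 2 ^ |y| and
   u # y = 2 ^ (i |y|).  The length of a sequence is not part of the code. *)
Definition entry (w i v : bterm) : bform :=
  EX b y u hi lo,
    is_pair w b y /\ `|u| == i /\ v < y # one /\ lo < u # y /\
    b == (hi * (y # one) + v) * (u # y) + lo.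

(* Integers in sign-magnitude: 2 p codes p and 2 q + 1 codes - q, where q <> 0.
   [int_parts z p q] expresses that z codes p - q, where p or q is 0. *)
Definition int_parts (z p q : bterm) : bform :=
  (z == two * p /\ q == zero) \/
  (z == Sc (two * q) /\ p == zero /\ q != zero).

Definition is_int (z : bterm) : bform := EX p q, int_parts z p q.

Definition int_add (x y z : bterm) : bform :=
  EX p q p' q' p'' q'',
    int_parts x p q /\ int_parts y p' q' /\ int_parts z p'' q'' /\
    p + p' + q'' == q + q' + p''.

Definition int_mul (x y z : bterm) : bform :=
  EX p q p' q' p'' q'',
    int_parts x p q /\ int_parts y p' q' /\ int_parts z p'' q'' /\
    p * p' + q * q' + q'' == p * q' + q * p' + p''.

(** * Algebraic circuits over the integers

   A circuit is a straight-line program in variables and parameters, together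
   with the integers plugged for the parameters.  It is coded by
   <1^L, <1^p, <G, C>>> where L is the number of gates, p the number of
   parameters, G the sequence of gates and C the sequence of plugged integers.
   A gate is coded by <tag, <j, k>>; the last gate is the output. *)

Definition circuit (P L p G C : bterm) : bform :=
  EX u v w w', unary u L /\ unary v p /\
    is_pair P u w /\ is_pair w v w' /\ is_pair w' G C.

Definition gate (G i tag j k : bterm) : bform :=
  EX g w, entry G i g /\ is_pair g tag w /\ is_pair w j k.

Definition var_gate (G i j : bterm) : bform := gate G i zero j zero.
Definition par_gate (G i j : bterm) : bform := gate G i one j zero.
Definition add_gate (G i j k : bterm) : bform := gate G i two j k.
Definition mul_gate (G i j k : bterm) : bform := gate G i three j k.

Definition well_formed (n L p G C : bterm) : bform :=
  one <= L /\
  (ALL i, i < L ~~>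
     ((EX j, j < n /\ var_gate G i j) \/
      (EX j, j < p /\ par_gate G i j) \/
      (EX j k, j < i /\ k < i /\ (add_gate G i j k \/ mul_gate G i j k)))) /\
  (ALL j, j < p ~~> EX c, entry C j c /\ is_int c).

(* [D] lists the syntactic degrees of the gates in one input: the variable of
   index j0 if [tag] = 0, the parameter of index j0 if [tag] = 1. *)
Definition degrees (G L tag j0 D : bterm) : bform :=
  ALL i, i < L ~~> EX e, entry D i e /\
    (gate G i tag j0 zero ~~> e == one) /\
    (ALL tag' j, (tag' <= one /\ gate G i tag' j zero /\
                  (tag' != tag \/ j != j0)) ~~> e == zero) /\
    (ALL j k, add_gate G i j k ~~> EX a b, entry D j a /\ entry D k b /\
       ((a <= b ~~> e == b) /\ (b <= a ~~> e == a))) /\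
    (ALL j k, mul_gate G i j k ~~> EX a b, entry D j a /\ entry D k b /\
       e == a + b).

(* The representation size of a circuit is the binary length of its code; its
   degrees are those of the output gate. *)
Definition Ckt (n d s P : bterm) : bform :=
  `|P| <= s /\
  EX L p G C, circuit P L p G C /\ well_formed n L p G C /\
    ALL tag j, ((tag == zero /\ j < n) \/ (tag == one /\ j < p)) ~~>
      EX D l e, degrees G L tag j D /\ L == Sc l /\ entry D l e /\ e <= d.

Definition is_point (n a : bterm) : bform :=
  ALL j, j < n ~~> EX z, entry a j z /\ is_int z.

(* [v] is the value of P at the point a, as witnessed by a table [t].  An entry
   z + 1 of the table is the value z of a gate, an entry 0 leaves the gate
   without value; this is needed because gates on which the output does not
   depend may have values of exponential length. *)
Definition evaluates (P a v : bterm) : bform :=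
  EX L p G C t l, circuit P L p G C /\ L == Sc l /\ entry t l (Sc v) /\
    ALL i z, (i < L /\ entry t i (Sc z)) ~~>
      ((EX j, var_gate G i j /\ entry a j z) \/
       (EX j, par_gate G i j /\ entry C j z) \/
       (EX j k x y, entry t j (Sc x) /\ entry t k (Sc y) /\
          ((add_gate G i j k /\ int_add x y z) \/
           (mul_gate G i j k /\ int_mul x y z)))).

Definition nonzero_at (P a : bterm) : bform :=
  EX v, evaluates P a v /\ v != zero.

(** * Definable classes and hitting sets *)

Definition in_slice (g : pv 5) (e n d s m P : bterm) : bform :=
  EX n1 d1 s1 x,
    unary n1 n /\ unary d1 d /\ unary s1 s /\ is_string x m /\
    P == bapp g [:: e; n1; d1; s1; x].

(* The class decoded by [g] is its range, and [in_slice] is the slice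
   C_e(n,d,s,m).  [decodes] is the condition g_e(n,d,s,x) in Ckt(n,d,s) that
   makes [g] a decoding function, at the given arguments.  It cannot be imposed
   at all n, d, s at once: Ckt(n,0,s) and Ckt(n,d,0) are empty. *)
Definition decodes (g : pv 5) (e n d s m : bterm) : bform :=
  ALL P, in_slice g e n d s m P ~~> Ckt n d s P.

(* [h] is in S_q^n; the number x < q is the integer coded by 2 x. *)
Definition in_grid (q n h : bterm) : bform :=
  ALL j, j < n ~~> EX x, x < q /\ entry h j (two * x).

(* [H] is in (S_q^n)^r. *)
Definition grid_points (q n r H : bterm) : bform :=
  ALL i, i < r ~~> EX h, entry H i h /\ in_grid q n h.

Definition hitting_set (g : pv 5) (e n d s m r H : bterm) : bform :=
  ALL P, in_slice g e n d s m P ~~>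
    (EX a, is_point n a /\ nonzero_at P a) ~~>
    EX i h, i < r /\ entry H i h /\ nonzero_at P h.

Definition small_hitting_sets (g : pv 5) : bform :=
  ALL e n d s q r m,
    (in_Log n /\ in_Log d /\ in_Log s /\ in_Log q /\ in_Log r /\ in_Log m) ~~>
    decodes g e n d s m ~~>
    two * d * n <= q ~~>
    m + n * `|q| < r ~~>
    EX H, grid_points q n r H /\ hitting_set g e n d s m r H.

(* Main.v *)
(* By completeness it suffices to find [H] in every model of the theory, where the weak pigeonhole
   principle holds for functions definable by PV symbols with parameters.

   Suppose that [H] is not a hitting set: some [P] of the slice vanishes at all points [h] of [H] but
   not at some point [a], which can be moved to the grid one coordinate at a time.  Replacing the
   coordinates of [a] by those of [h] one by one, we meet a line parallel to the i-th axis on which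
   [P] is not identically zero, but vanishes at the i-th coordinate of [h].  There are at most [d]
   such zeros, so [h] can be recovered from [P], [a], [i], the rank of the zero and the other n - 1
   coordinates of [h].  Thus [H] is determined by [P], [a] and [r] numbers below
   d n q^(n-1) <= q^n / 2, that is, by a number below 2^m 2^(n|q|) (q^n / 2)^r <= (q^n)^r / 2, and
   the pigeonhole principle gives an [H] that is not obtained in this way.

   The bound on the zeros of [P] on a line is proved without polynomials.  At the point of the line
   with parameter X = 2^K, for [K] large, the value of [P] is nonzero and at most 2^(E + K d), where
   [E] does not depend on [K]: the values of the gates are bounded by the degrees, which add up along
   multiplications.  It is congruent to P(v) modulo X - v for every [v].  The product of the X - v over
   the zeros v < q divides a multiple of this value by an integer of length at most |q| q^2, since the
   X - v have small gcds; hence [c] zeros give K c <= K d + o(K), and c <= d. *)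

From HB Require Import structures.
From Stdlib Require Import Ring.
From mathcomp Require Import all_boot all_order all_algebra boolp.
Require Import Defs.

Set Implicit Arguments.
Unset Strict Implicit.
Unset Printing Implicit Defensive.

Import Order.TTheory GRing.Theory Num.Theory.

(** * Substitution *)

(** The obstacle is the weakness of induction. It is available for Sigma^b_1 formulas along the bits
    of a number, so iterations have a length in Log, and degrees, values, root counts and ranks of
    roots must be computed by PV functions with parameters before anything is proved about them.

    Values of gates may be exponentially long. The output has a value because its total degree in
    variables and parameters is at most (n + p) d, which bounds its length.

    P does not vanish at X because P(X) is congruent to P(a) modulo X - a_i, and |P(a)| is smaller
    than this modulus once K exceeds the length of P(a).

    The gcds are replaced by one computation: modulo X - t, the product of the X - v over the roots
    v < t is the product of the t - v, which has at most |q| t bits. Multiplying by it is the price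
    of the new factor X - t; over all t < q this costs at most |q| q^2 bits.

    In the final count each of the r points saves one bit, because 2 d n q^(n-1) <= q^n. Of these
    bits m + n|q| pay for P and a, and one more gives the gap required by the pigeonhole
    principle. *)

Lemma tsubst_ext s1 s2 t : (forall i, s1 i = s2 i) -> tsubst s1 t = tsubst s2 t.
Proof. by move=> /funext ->. Qed.

Lemma tsubst_comp s1 s2 t : tsubst s2 (tsubst s1 t) = tsubst (fun i => tsubst s2 (s1 i)) t.
Proof. by elim: t => //= n f ts IH; congr App; apply/funext => i. Qed.

Lemma tsubst_id t : tsubst Var t = t.
Proof. by elim: t => //= n f ts IH; congr App; apply/funext => i. Qed.

Lemma up_comp s1 s2 : (fun i => tsubst (up s2) (up s1 i)) = up (fun i => tsubst s2 (s1 i)).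
Proof.
by apply/funext => -[|i] //=; rewrite /up /= /tshift !tsubst_comp; apply: tsubst_ext.
Qed.

Lemma up_id : up Var = Var.
Proof. by apply/funext => -[|i]. Qed.

Lemma fsubst_comp A : forall s1 s2,
  fsubst s2 (fsubst s1 A) = fsubst (fun i => tsubst s2 (s1 i)) A.
Proof.
by elim: A => //= [s t|s t|A IHA B IHB|A IHA B IHB|A IHA B IHB|A IH|A IH] s1 s2;
   rewrite ?tsubst_comp ?IHA ?IHB ?IH ?up_comp.
Qed.

Lemma fsubst_id A : fsubst Var A = A.
Proof.
by elim: A => //= [s t|s t|A -> B ->|A -> B ->|A -> B ->|A IH|A IH];
   rewrite ?tsubst_id ?up_id ?IH.
Qed.

Lemma fsubst_finst s A t : fsubst s (finst A t) = finst (fsubst (up s) A) (tsubst s t).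
Proof.
rewrite /finst !fsubst_comp; congr fsubst; apply/funext => -[|i] //=.
by rewrite /up /= /tshift tsubst_comp /= tsubst_id.
Qed.

Lemma fsubst_up_fshift s A : fsubst (up s) (fshift A) = fshift (fsubst s A).
Proof. by rewrite /fshift !fsubst_comp. Qed.

(** Free variables are never computed: that they lie below [N] is expressed by the effect of
    substitutions, which is the form in which renaming arguments use it. *)
Definition tfree_below N t := forall s1 s2,
  (forall i, i < N -> s1 i = s2 i) -> tsubst s1 t = tsubst s2 t.
Definition ffree_below N A := forall s1 s2,
  (forall i, i < N -> s1 i = s2 i) -> fsubst s1 A = fsubst s2 A.

Lemma tfree_below_le N M t : N <= M -> tfree_below N t -> tfree_below M t.
Proof. by move=> NM h s1 s2 e; apply: h => i iN; apply: e; apply: leq_trans NM. Qed.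

Lemma ffree_below_le N M A : N <= M -> ffree_below N A -> ffree_below M A.
Proof. by move=> NM h s1 s2 e; apply: h => i iN; apply: e; apply: leq_trans NM. Qed.

Lemma tfree_App N n (f : pv n) ts : (forall i, tfree_below N (ts i)) -> tfree_below N (App f ts).
Proof. by move=> h s1 s2 e /=; congr App; apply/funext => i; apply: h. Qed.

Lemma tfree_ex t : exists N, tfree_below N t.
Proof.
elim: t => [i|n f ts IH]; first by exists i.+1 => s1 s2; apply.
have /fin_all_exists[N hN] := IH; exists (\max_i N i).
by apply: tfree_App => i; apply: tfree_below_le (hN i); apply: leq_bigmax.
Qed.

Lemma up_eq_below N s1 s2 : (forall i, i < N -> s1 i = s2 i) ->
  forall i, i < N.+1 -> up s1 i = up s2 i.
Proof. by move=> e [|i] //= iN; rewrite /up /= e. Qed.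

Lemma ffree_All N A : ffree_below N.+1 A -> ffree_below N (FAll A).
Proof. by move=> h s1 s2 e /=; congr FAll; apply: h; apply: up_eq_below. Qed.

Lemma ffree_Ex N A : ffree_below N.+1 A -> ffree_below N (FEx A).
Proof. by move=> h s1 s2 e /=; congr FEx; apply: h; apply: up_eq_below. Qed.

Lemma ffree_ex A : exists N, ffree_below N A.
Proof.
have L a b : a <= maxn a b by apply: leq_maxl.
have R a b : b <= maxn a b by apply: leq_maxr.
elim: A => [|s t|s t|A [a hA] B [b hB]|A [a hA] B [b hB]|A [a hA] B [b hB]|A [a hA]|A [a hA]].
- by exists 0.
- have [a ha] := tfree_ex s; have [b hb] := tfree_ex t; exists (maxn a b) => s1 s2 e /=.
  by rewrite (tfree_below_le (L a b) ha e) (tfree_below_le (R a b) hb e).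
- have [a ha] := tfree_ex s; have [b hb] := tfree_ex t; exists (maxn a b) => s1 s2 e /=.
  by rewrite (tfree_below_le (L a b) ha e) (tfree_below_le (R a b) hb e).
- by exists (maxn a b) => s1 s2 e /=; rewrite (ffree_below_le (L a b) hA e) (ffree_below_le (R a b) hB e).
- by exists (maxn a b) => s1 s2 e /=; rewrite (ffree_below_le (L a b) hA e) (ffree_below_le (R a b) hB e).
- by exists (maxn a b) => s1 s2 e /=; rewrite (ffree_below_le (L a b) hA e) (ffree_below_le (R a b) hB e).
- by exists a; apply/ffree_All/(ffree_below_le _ hA).
- by exists a; apply/ffree_Ex/(ffree_below_le _ hA).
Qed.

Lemma ffree_list_ex (Gamma : seq form) :
  exists N, forall A, List.In A Gamma -> ffree_below N A.
Proof.
elim: Gamma => [|A Gamma [N h]]; first by exists 0.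
have [a ha] := ffree_ex A; exists (maxn a N) => B [<-|/h hB].
  by apply: ffree_below_le ha; apply: leq_maxl.
by apply: ffree_below_le hB; apply: leq_maxr.
Qed.

(** * Semantics *)

Record structure := Structure {
  carrier :> Type;
  interp : forall n, pv n -> ('I_n -> carrier) -> carrier;
  lle : carrier -> carrier -> Prop }.

Definition econs (T : Type) (x : T) (rho : nat -> T) : nat -> T :=
  fun i => if i is j.+1 then rho j else x.

Fixpoint eval (M : structure) (rho : nat -> M) (t : term) : M :=
  match t with
  | Var i => rho i
  | App _ f ts => interp f (fun i => eval rho (ts i))
  end.

Fixpoint sat (M : structure) (rho : nat -> M) (A : form) : Prop :=
  match A with
  | FBot => False
  | FEq s t => eval rho s = eval rho t
  | FLe s t => lle (eval rho s) (eval rho t)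
  | FImp A B => sat rho A -> sat rho B
  | FAnd A B => sat rho A /\ sat rho B
  | FOr A B => sat rho A \/ sat rho B
  | FAll A => forall x, sat (econs x rho) A
  | FEx A => exists x, sat (econs x rho) A
  end.

Lemma eval_tsubst (M : structure) (rho : nat -> M) s t :
  eval rho (tsubst s t) = eval (fun i => eval rho (s i)) t.
Proof. by elim: t => //= n f ts IH; congr interp; apply/funext => i. Qed.

Lemma eval_up (M : structure) (rho : nat -> M) s x :
  (fun i => eval (econs x rho) (up s i)) = econs x (fun i => eval rho (s i)).
Proof. by apply/funext => -[|i] //=; rewrite /up /= /tshift eval_tsubst. Qed.

Lemma sat_fsubst (M : structure) A : forall (rho : nat -> M) s,
  sat rho (fsubst s A) <-> sat (fun i => eval rho (s i)) A.
Proof.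
elim: A => //= [s t|s t|A IHA B IHB|A IHA B IHB|A IHA B IHB|A IH|A IH] rho s0;
  rewrite ?eval_tsubst ?IHA ?IHB //.
- by split=> h x; move: (h x); rewrite IH eval_up.
- by split=> -[x h]; exists x; move: h; rewrite IH eval_up.
Qed.

Definition satisfies (M : structure) (T : form -> Prop) :=
  forall A, T A -> forall rho : nat -> M, sat rho A.

(** * Countability of the language *)

Definition pv_default n : pv n :=
  pv_comp pv_zero (fun i : 'I_0 => False_rect _ (notF (ltn_ord i))).

Definition cast_pv n (f : {k & pv k}) : pv n :=
  if eqVneq (tag f) n is EqNotNeq e then eq_rect _ pv (tagged f) _ e else pv_default n.

Lemma cast_pvK n (f : pv n) : cast_pv n (Tagged pv f) = f.
Proof. by rewrite /cast_pv; case: eqVneq => [e|/eqP] //=; rewrite (eq_irrelevance e (erefl n)). Qed.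

(** Because of the dependent arities, a surjection from trees is easier to define than an injection
    into them, and it is enough for an enumeration of the language. Trees with wrong arities are
    sent to default symbols. *)
Fixpoint decode_pv (t : GenTree.tree nat) : {n & pv n} :=
  match t with
  | GenTree.Leaf 0 => Tagged pv pv_zero
  | GenTree.Leaf 1 => Tagged pv pv_succ
  | GenTree.Leaf 2 => Tagged pv pv_half
  | GenTree.Leaf 3 => Tagged pv pv_len
  | GenTree.Leaf 4 => Tagged pv pv_add
  | GenTree.Leaf 5 => Tagged pv pv_mul
  | GenTree.Leaf 6 => Tagged pv pv_smash
  | GenTree.Node 0 [:: GenTree.Leaf n; GenTree.Leaf i] =>
      if insub i is Some i' then Tagged pv (@pv_proj n i') else Tagged pv pv_zero
  | GenTree.Node 1 (GenTree.Leaf k :: GenTree.Leaf n :: t :: ts) =>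
      Tagged pv (pv_comp (cast_pv k (decode_pv t))
        (fun i : 'I_k => cast_pv n (nth (Tagged pv pv_zero) (map decode_pv ts) i)))
  | GenTree.Node 2 [:: GenTree.Leaf n; g; h0; h1; k] =>
      Tagged pv (pv_lrec (cast_pv n (decode_pv g)) (cast_pv n.+2 (decode_pv h0))
        (cast_pv n.+2 (decode_pv h1)) (cast_pv n.+1 (decode_pv k)))
  | _ => Tagged pv pv_zero
  end.

Lemma nth_map_choice (T : Type) (f : GenTree.tree nat -> T) x0 k (us : 'I_k -> T) :
  (forall i, exists t, f t = us i) ->
  exists ts, forall i : 'I_k, nth x0 (map f ts) i = us i.
Proof.
move=> /boolp.choice[g hg].
exists (map g (enum 'I_k)) => i; rewrite -map_comp.
by rewrite (nth_map i) ?size_enum_ord //= nth_ord_enum hg.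
Qed.

Lemma decode_pv_surj n (f : pv n) : exists t, decode_pv t = Tagged pv f.
Proof.
elim: n / f => [||||||| n i | k n f [t ht] gs IH | n g [tg hg] h0 [t0 ht0] h1 [t1 ht1] k [tk htk]].
- by exists (GenTree.Leaf 0).
- by exists (GenTree.Leaf 1).
- by exists (GenTree.Leaf 2).
- by exists (GenTree.Leaf 3).
- by exists (GenTree.Leaf 4).
- by exists (GenTree.Leaf 5).
- by exists (GenTree.Leaf 6).
- by exists (GenTree.Node 0 [:: GenTree.Leaf n; GenTree.Leaf (val i)]) => /=; rewrite valK.
- have [ts hts] := nth_map_choice (Tagged pv pv_zero) IH.
  exists (GenTree.Node 1 (GenTree.Leaf k :: GenTree.Leaf n :: t :: ts)) => /=.
  rewrite ht cast_pvK; congr (Tagged pv (pv_comp _ _)).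
  by apply/funext => i; rewrite hts cast_pvK.
- exists (GenTree.Node 2 [:: GenTree.Leaf n; tg; t0; t1; tk]) => /=.
  by rewrite hg ht0 ht1 htk !cast_pvK.
Qed.

Fixpoint decode_term (t : GenTree.tree nat) : term :=
  match t with
  | GenTree.Leaf i => Var i
  | GenTree.Node _ (GenTree.Leaf n :: f :: ts) =>
      App (cast_pv n (decode_pv f)) (fun i => nth (Var 0) (map decode_term ts) i)
  | _ => Var 0
  end.

Lemma decode_term_surj t : exists u, decode_term u = t.
Proof.
elim: t => [i|n f ts IH]; first by exists (GenTree.Leaf i).
have [u hu] := decode_pv_surj f; have [us hus] := nth_map_choice (Var 0) IH.
exists (GenTree.Node 0 (GenTree.Leaf n :: u :: us)) => /=.
by rewrite hu cast_pvK; congr App; apply/funext.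
Qed.

Fixpoint decode_form (t : GenTree.tree nat) : form :=
  match t with
  | GenTree.Node 0 [:: s; t] => FEq (decode_term s) (decode_term t)
  | GenTree.Node 1 [:: s; t] => FLe (decode_term s) (decode_term t)
  | GenTree.Node 2 [:: s; t] => FImp (decode_form s) (decode_form t)
  | GenTree.Node 3 [:: s; t] => FAnd (decode_form s) (decode_form t)
  | GenTree.Node 4 [:: s; t] => FOr (decode_form s) (decode_form t)
  | GenTree.Node 5 [:: s] => FAll (decode_form s)
  | GenTree.Node 6 [:: s] => FEx (decode_form s)
  | _ => FBot
  end.

Lemma decode_form_surj A : exists u, decode_form u = A.
Proof.
elim: A => [|s t|s t|A [u <-] B [v <-]|A [u <-] B [v <-]|A [u <-] B [v <-]|A [u <-]|A [u <-]].
- by exists (GenTree.Leaf 0).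
- have [u <-] := decode_term_surj s; have [v <-] := decode_term_surj t.
  by exists (GenTree.Node 0 [:: u; v]).
- have [u <-] := decode_term_surj s; have [v <-] := decode_term_surj t.
  by exists (GenTree.Node 1 [:: u; v]).
- by exists (GenTree.Node 2 [:: u; v]).
- by exists (GenTree.Node 3 [:: u; v]).
- by exists (GenTree.Node 4 [:: u; v]).
- by exists (GenTree.Node 5 [:: u]).
- by exists (GenTree.Node 6 [:: u]).
Qed.

Lemma form_enum : exists E : nat -> form, forall A, exists n, E n = A.
Proof.
exists (fun n => if unpickle n is Some t then decode_form t else FBot) => A.
by have [u <-] := decode_form_surj A; exists (pickle u); rewrite pickleK.
Qed.

(** * Completeness *)

Section Completeness.

Variable T : form -> Prop.
Hypothesis T_fsubst : forall A s, T A -> T (fsubst s A).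

Notation neg A := (FImp A FBot).

Lemma incl_map_fsubst s Gamma Delta :
  List.incl Gamma Delta -> List.incl (map (fsubst s) Gamma) (map (fsubst s) Delta).
Proof. exact: List.incl_map. Qed.

Lemma incl_cons2 (A : form) Gamma Delta :
  List.incl Gamma Delta -> List.incl (A :: Gamma) (A :: Delta).
Proof. by move=> h B [->|/h]; [left|right]. Qed.

Lemma weaken Gamma Delta A : proves T Gamma A -> List.incl Gamma Delta -> proves T Delta A.
Proof.
move=> pr; elim: pr Delta =>
  [G B TB|G B hB|G B C _ IH|G B C _ IH1 _ IH2|G B C _ IH1 _ IH2|G B C _ IH|G B C _ IH
  |G B C _ IH|G B C _ IH|G B C D _ IH1 _ IH2 _ IH3|G B _ IH|G B _ IH|G B t _ IH
  |G B t _ IH|G B C _ IH1 _ IH2|G t|G B s t _ IH1 _ IH2] D' sub.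
- exact: p_ax.
- by apply/p_hyp/sub.
- by apply/p_impI/IH/incl_cons2.
- by apply: p_impE (IH1 _ sub) (IH2 _ sub).
- by apply: p_andI (IH1 _ sub) (IH2 _ sub).
- exact: p_andE1 (IH _ sub).
- exact: p_andE2 (IH _ sub).
- exact: p_orI1 (IH _ sub).
- exact: p_orI2 (IH _ sub).
- by apply: p_orE (IH1 _ sub) _ _; [apply: IH2|apply: IH3]; apply: incl_cons2.
- by apply/p_contra/IH/incl_cons2.
- by apply/p_allI/IH/incl_map_fsubst.
- exact: p_allE (IH _ sub).
- exact: p_exI (IH _ sub).
- by apply: p_exE (IH1 _ sub) _; apply: IH2; apply/incl_cons2/incl_map_fsubst.
- exact: p_eqI.
- exact: p_eqE (IH1 _ sub) (IH2 _ sub).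
Qed.

Lemma map_up_fshift s Gamma :
  map (fsubst (up s)) (map fshift Gamma) = map fshift (map (fsubst s) Gamma).
Proof. by rewrite -!map_comp; apply: eq_map => A /=; apply: fsubst_up_fshift. Qed.

(** This is where closure of [T] under substitution enters. It lets variables of the language play
    the role of Henkin constants. *)
Lemma proves_fsubst Gamma A : proves T Gamma A ->
  forall s, proves T (map (fsubst s) Gamma) (fsubst s A).
Proof.
elim =>
  [G B TB|G B hB|G B C _ IH|G B C _ IH1 _ IH2|G B C _ IH1 _ IH2|G B C _ IH|G B C _ IH
  |G B C _ IH|G B C _ IH|G B C D _ IH1 _ IH2 _ IH3|G B _ IH|G B _ IH|G B t _ IH
  |G B t _ IH|G B C _ IH1 _ IH2|G t|G B u t _ IH1 _ IH2] s /=.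
- by apply/p_ax/T_fsubst.
- by apply/p_hyp/List.in_map.
- exact/p_impI/IH.
- exact: p_impE (IH1 s) (IH2 s).
- exact: p_andI (IH1 s) (IH2 s).
- exact: p_andE1 (IH s).
- exact: p_andE2 (IH s).
- exact: p_orI1 (IH s).
- exact: p_orI2 (IH s).
- exact: p_orE (IH1 s) (IH2 s) (IH3 s).
- exact/p_contra/IH.
- by apply: p_allI; rewrite -map_up_fshift; apply: IH.
- by rewrite fsubst_finst; apply: p_allE (IH s).
- by apply: (@p_exI _ _ _ (tsubst s t)); rewrite -fsubst_finst; apply: IH.
- apply: p_exE (IH1 s) _; rewrite -map_up_fshift -fsubst_up_fshift.
  exact: IH2.
- exact: p_eqI.
- rewrite fsubst_finst; apply: (@p_eqE _ _ _ (tsubst s u)); first exact: IH1.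
  by rewrite -fsubst_finst; apply: IH2.
Qed.

Definition consistent Gamma := ~ proves T Gamma FBot.

Lemma proves_neg Gamma A : ~ consistent (A :: Gamma) -> proves T Gamma (neg A).
Proof. by move=> /contrapT; apply: p_impI. Qed.

Lemma consistent_neg Gamma A :
  consistent Gamma -> ~ consistent (A :: Gamma) -> consistent (neg A :: Gamma).
Proof.
move=> cG /proves_neg nA hn; apply: cG; apply: p_impE nA _.
exact: p_contra.
Qed.

(** The variable [k] is fresh, hence as good as a new constant: renaming turns a refutation that
    uses the witness [Var k] into the second premise of [p_exE]. *)
Lemma witness_consistent Gamma C k :
  ffree_below k (FEx C) -> (forall B, List.In B Gamma -> ffree_below k B) ->
  consistent (FEx C :: Gamma) -> consistent (finst C (Var k) :: FEx C :: Gamma).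
Proof.
move=> hC hG cons pr; apply: cons; apply: (@p_exE T _ C); first by apply: p_hyp; left.
(* The fresh variable becomes the eigenvariable of index 0, all others are shifted; so
   [finst C (Var k)] becomes [C] and the context becomes its shift. *)
pose s i := if i == k then Var 0 else Var i.+1.
have sk i : i < k -> s i = Var i.+1 by rewrite /s => /ltn_eqF ->.
have e1 : fsubst s (finst C (Var k)) = C.
  rewrite /finst fsubst_comp.
  have h : fsubst (fun i => if i is j.+1 then s j else Var 0) C = C.
    have [h] : fsubst s (FEx C) = fsubst (fun i => Var i.+1) (FEx C) by apply: hC.
    move/(congr1 (fsubst (scons (Var 0) Var))): h; rewrite !fsubst_comp.
    set s1 := (fun i => _); set s2 := (fun i => _).
    have -> : s2 = Var by apply/funext => -[|i].
    have -> : s1 = (fun i => if i is j.+1 then s j else Var 0).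
      by apply/funext => -[|i] //=; rewrite /s1 /up /= /s; case: eqP.
    by rewrite fsubst_id.
  rewrite -[RHS]h; congr fsubst; apply/funext => -[|i] //=.
  by rewrite /s eqxx.
have e2 : map (fsubst s) (FEx C :: Gamma) = map fshift (FEx C :: Gamma).
  have h B : List.In B (FEx C :: Gamma) -> fsubst s B = fshift B.
    by case=> [<-|hB]; [apply: hC|apply: hG hB _ _ _].
  by elim: (_ :: Gamma) h => //= B Delta IH h; rewrite h ?IH //; [move=> ? ?; apply: h; right|left].
have := proves_fsubst pr s; rewrite [map _ _]/= -[_ :: map _ _]/(map (fsubst s) (FEx C :: Gamma)).
by rewrite e2 e1.
Qed.

Section Henkin.

Variable Gamma0 : seq form.
Hypothesis Gamma0_consistent : consistent Gamma0.

Let E := sval (cid form_enum).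
Let E_surj : forall A, exists n, E n = A := svalP (cid form_enum).

(** Consistency of [Gamma] is a hypothesis on the properties of [Delta] and not on its existence, so
    that the stages can be defined by plain recursion before they are shown consistent. *)
Lemma step_ex Gamma A : exists Delta,
  consistent Gamma ->
  [/\ consistent Delta, List.incl Gamma Delta,
     List.In A Delta \/ List.In (neg A) Delta &
     forall C, A = FEx C -> List.In A Delta -> exists k, List.In (finst C (Var k)) Delta].
Proof.
case: (pselect (consistent (A :: Gamma))) => [cA|ncA].
  case: (pselect (exists C, A = FEx C)) => [[C eA]|nC].
    have [a ha] := ffree_list_ex (A :: Gamma).
    exists (finst C (Var a) :: A :: Gamma) => _; split.
    - by subst A; apply: witness_consistent => // [|B hB]; apply: ha; [left|right].
    - by move=> B hB; right; right.
    - by left; right; left.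
    - by move=> C' eC' _; exists a; left; move: eC'; rewrite eA => -[->].
  exists (A :: Gamma) => _; split=> //.
  - by move=> B; right.
  - by left; left.
  - by move=> C eC; case: nC; exists C.
exists (neg A :: Gamma) => cG; split.
- exact: consistent_neg.
- by move=> B; right.
- by right; left.
- move=> C eC hA; exfalso; apply: (consistent_neg cG ncA).
  by apply: p_impE (p_hyp _ hA); apply: p_hyp; left.
Qed.

Definition step Gamma A := sval (cid (step_ex Gamma A)).
Definition stepP Gamma A := svalP (cid (step_ex Gamma A)).

Fixpoint stage n := if n is m.+1 then step (stage m) (E m) else Gamma0.

Lemma stage_consistent n : consistent (stage n).
Proof. by elim: n => //= n IH; case: (stepP (E n) IH). Qed.

Lemma stage_incl m n : m <= n -> List.incl (stage m) (stage n).
Proof.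
elim: n => [|n IH]; first by rewrite leqn0 => /eqP->; apply: List.incl_refl.
rewrite leq_eqVlt => /predU1P[->|/IH h]; first exact: List.incl_refl.
apply: List.incl_tran h _.
by have [_ h _ _] := stepP (E n) (@stage_consistent n).
Qed.

Definition theory A := exists n, List.In A (stage n).

Lemma theory_list Gamma : (forall A, List.In A Gamma -> theory A) ->
  exists n, List.incl Gamma (stage n).
Proof.
elim: Gamma => [|A Gamma IH] h; first by exists 0 => ? [].
have [n hn] := h A (or_introl erefl).
have [m hm] : exists m, List.incl Gamma (stage m) by apply: IH => B hB; apply: h; right.
exists (maxn n m) => B [<-|hB]; first exact: (stage_incl (leq_maxl n m)).
exact: (stage_incl (leq_maxr n m)) (hm _ hB).
Qed.

Lemma theory_total A : theory A \/ theory (neg A).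
Proof.
have [n <-] := E_surj A.
by have [_ _ [h|h] _] := stepP (E n) (@stage_consistent n); [left|right]; exists n.+1.
Qed.

Lemma theory_closed Gamma A :
  (forall B, List.In B Gamma -> theory B) -> proves T Gamma A -> theory A.
Proof.
move=> /theory_list[n hn] pr; case: (theory_total A) => // -[m hm]; exfalso.
apply: (@stage_consistent (maxn n m)); apply: (@p_impE _ _ A).
  by apply: p_hyp; apply: stage_incl hm; apply: leq_maxr.
by apply: weaken pr _; apply: List.incl_tran hn _; apply/stage_incl/leq_maxl.
Qed.

Lemma theory0 A : proves T [::] A -> theory A.
Proof. by apply: theory_closed. Qed.

Lemma theory1 A B : theory A -> proves T [:: A] B -> theory B.
Proof. by move=> hA; apply: theory_closed => C [<-|[]]. Qed.

Lemma theory2 A B C : theory A -> theory B -> proves T [:: A; B] C -> theory C.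
Proof. by move=> hA hB; apply: theory_closed => D [<-|[<-|[]]]. Qed.

Lemma theory_ax A : T A -> theory A.
Proof. by move=> h; apply/theory0/p_ax. Qed.

Lemma theory_bot : ~ theory FBot.
Proof. by move=> [n hn]; apply: (@stage_consistent n); apply: p_hyp. Qed.

Lemma theory_imp A B : theory (FImp A B) <-> (theory A -> theory B).
Proof.
split=> [h hA|h].
  by apply: (theory2 h hA); apply: p_impE; apply: p_hyp; [left|right; left].
case: (theory_total A) => [/h hB|nA].
  by apply: (theory1 hB); apply/p_impI/p_hyp; right; left.
apply: (theory1 nA); apply/p_impI/p_contra.
by apply: (@p_impE _ _ A); apply: p_hyp; [right; right; left|right; left].
Qed.

Lemma theory_and A B : theory (FAnd A B) <-> theory A /\ theory B.
Proof.
split=> [h|[hA hB]].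
  by split; apply: (theory1 h); [apply: (@p_andE1 _ _ _ B)|apply: (@p_andE2 _ _ A)]; apply: p_hyp; left.
by apply: (theory2 hA hB); apply: p_andI; apply: p_hyp; [left|right; left].
Qed.

Lemma theory_or A B : theory (FOr A B) <-> theory A \/ theory B.
Proof.
split=> [h|[hA|hB]].
- case: (theory_total A) => [|nA]; [by left|right].
  apply: (theory2 h nA); apply: (@p_orE _ _ A B); first by apply: p_hyp; left.
    apply: p_contra; apply: (@p_impE _ _ A); apply: p_hyp.
      by right; right; right; left.
    by right; left.
  by apply: p_hyp; left.
- by apply: (theory1 hA); apply/p_orI1/p_hyp; left.
- by apply: (theory1 hB); apply/p_orI2/p_hyp; left.
Qed.

Lemma theory_ex C : theory (FEx C) <-> exists t, theory (finst C t).
Proof.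
split=> [[m hm]|[t h]]; last first.
  by apply: (theory1 h); apply: (@p_exI _ _ _ t); apply: p_hyp; left.
have [n En] := E_surj (FEx C).
have [_ _ hd wit] := stepP (E n) (@stage_consistent n).
case: hd => hd.
  by have [k hk] := wit C En hd; exists (Var k), n.+1.
exfalso; apply: (@stage_consistent (maxn m n.+1)); apply: (@p_impE _ _ (E n)).
  by apply: p_hyp; apply: (stage_incl (leq_maxr _ _)).
by apply: p_hyp; rewrite En; apply: (stage_incl (leq_maxl _ _)).
Qed.

Lemma theory_all C : theory (FAll C) <-> forall t, theory (finst C t).
Proof.
split=> [h t|h]; first by apply: (theory1 h); apply: p_allE; apply: p_hyp; left.
case: (theory_total (FAll C)) => // nC.
have : theory (FEx (neg C)).
  apply: (theory1 nC); apply: p_contra.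
  apply: (@p_impE _ _ (FAll C)); first by apply: p_hyp; right; left.
  apply: p_allI => /=; apply: p_contra.
  apply: (@p_impE _ _ (fshift (FEx (neg C)))); first by apply: p_hyp; right; left.
  apply: (@p_exI _ _ _ (Var 0)).
  rewrite [finst _ _](_ : _ = neg C); first by apply: p_hyp; left.
  rewrite /finst /= /fshift /= fsubst_comp; congr FImp; rewrite -[RHS]fsubst_id.
  by congr fsubst; apply/funext => -[|i].
move=> /theory_ex[t]; rewrite -[finst _ _]/(neg (finst C t)) => ht.
by case: (theory_bot); move/theory_imp: ht; apply; apply: h.
Qed.

Lemma theory_eqE A s t : theory (FEq s t) -> theory (finst A s) -> theory (finst A t).
Proof.
move=> h1 h2; apply: (theory2 h1 h2).
by apply: (@p_eqE _ _ _ s); apply: p_hyp; [left|right; left].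
Qed.

Lemma theory_refl t : theory (FEq t t).
Proof. exact/theory0/p_eqI. Qed.

Lemma tsubst_tshift t u : tsubst (scons t Var) (tshift u) = u.
Proof. by rewrite /tshift tsubst_comp /= tsubst_id. Qed.

Lemma theory_sym s t : theory (FEq s t) -> theory (FEq t s).
Proof.
move=> h; have := @theory_eqE (FEq (Var 0) (tshift s)) s t h.
by rewrite /finst /= !tsubst_tshift; apply; apply: theory_refl.
Qed.

Lemma theory_trans s t u : theory (FEq s t) -> theory (FEq t u) -> theory (FEq s u).
Proof.
move=> h1 h2; have := @theory_eqE (FEq (tshift s) (Var 0)) t u h2.
by rewrite /finst /= !tsubst_tshift; apply.
Qed.

(** The rule [p_eqE] replaces one term at a time: [hyb k] has its first [k] arguments already
    replaced. *)
Lemma theory_App n (f : pv n) (ts us : 'I_n -> term) :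
  (forall i, theory (FEq (ts i) (us i))) -> theory (FEq (App f ts) (App f us)).
Proof.
move=> h; pose hyb k := fun i : 'I_n => if i < k then us i else ts i.
suff H k : theory (FEq (App f ts) (App f (hyb k))).
  have -> : us = hyb n by apply/funext => i; rewrite /hyb ltn_ord.
  exact: H.
elim: k => [|k IH].
  have -> : hyb 0 = ts by apply/funext.
  exact: theory_refl.
case: (ltnP k n) => kn; last first.
  have -> // : hyb k.+1 = hyb k.
  by apply/funext => i; rewrite /hyb !ltnS (leq_trans _ kn) ?(leq_trans (ltn_ord i)) // ltnW.
apply: theory_trans IH _.
pose A := FEq (tshift (App f (hyb k)))
  (App f (fun i => if i == Ordinal kn then Var 0 else tshift (hyb k i))).
have := @theory_eqE A (ts (Ordinal kn)) (us (Ordinal kn)) (h _).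
rewrite /A /finst /=.
have aux t : (fun i => tsubst (scons t Var)
    (if i == Ordinal kn then Var 0 else tshift (hyb k i)))
    = (fun i : 'I_n => if i == Ordinal kn then t else hyb k i).
  by apply/funext => i; case: eqP => // _; rewrite tsubst_tshift.
rewrite !aux.
have aux2 t : (fun i : 'I_n => tsubst (scons t Var) (tsubst (fun i0 => Var i0.+1) (hyb k i))) = hyb k.
  by apply/funext => i; rewrite [LHS]tsubst_tshift.
rewrite !aux2.
have -> : (fun i => if i == Ordinal kn then ts (Ordinal kn) else hyb k i) = hyb k.
  by apply/funext => i; case: eqP => [->|//]; rewrite /hyb ltnn.
have -> : (fun i => if i == Ordinal kn then us (Ordinal kn) else hyb k i) = hyb k.+1.
  apply/funext => i; rewrite /hyb [in RHS]ltnS [in RHS]leq_eqVlt -(inj_eq (@ord_inj n)) /=.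
  by case: eqP => //= e; congr us; apply: ord_inj.
by apply; apply: theory_refl.
Qed.

Lemma theory_le s t s' t' : theory (FEq s s') -> theory (FEq t t') ->
  theory (FLe s t) -> theory (FLe s' t').
Proof.
move=> h1 h2 h.
have := @theory_eqE (FLe (Var 0) (tshift t)) s s' h1.
rewrite /finst /= !tsubst_tshift => /(_ h) {}h.
have := @theory_eqE (FLe (tshift s') (Var 0)) t t' h2.
by rewrite /finst /= !tsubst_tshift => /(_ h).
Qed.

(** The carrier of the term model is the quotient of terms by provable equality. Classes are
    predicates, so that extensionality identifies equal classes, and representatives are chosen. *)
Definition is_class (P : term -> Prop) := exists t, P = fun s => theory (FEq t s).
Definition class (t : term) : {P | is_class P} :=
  exist is_class (fun s => theory (FEq t s)) (ex_intro _ t erefl).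
Definition repr (c : {P | is_class P}) : term := sval (cid (svalP c)).

Lemma class_eq s t : class s = class t <-> theory (FEq s t).
Proof.
split=> [/(congr1 (fun c => sval c t)) /= ->|h]; first exact: theory_refl.
apply: eq_exist; apply/funext => u; apply/propext; split.
  by apply: theory_trans; apply: theory_sym.
exact: theory_trans.
Qed.

Lemma class_repr c : class (repr c) = c.
Proof. by case: c => P hP; apply: eq_exist; rewrite /repr; case: cid => t /= ->. Qed.

Definition term_model : structure :=
  @Structure {P | is_class P}
    (fun n f xs => class (App f (fun i => repr (xs i))))
    (fun x y => theory (FLe (repr x) (repr y))).

Lemma repr_class t : theory (FEq (repr (class t)) t).
Proof. by apply/class_eq; rewrite class_repr. Qed.

Lemma eval_term_model (s : nat -> term) t :
  eval (M := term_model) (fun i => class (s i)) t = class (tsubst s t).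
Proof.
elim: t => //= n f ts IH; apply/class_eq/theory_App => i.
by rewrite IH; apply: repr_class.
Qed.

Lemma econs_class s t : econs (class t) (fun i => class (s i)) = fun i => class (scons t s i).
Proof. by apply/funext => -[]. Qed.

Lemma finst_up A s t : finst (fsubst (up s) A) t = fsubst (scons t s) A.
Proof.
rewrite /finst fsubst_comp; congr fsubst; apply/funext => -[|i] //=.
by rewrite /up /= tsubst_tshift.
Qed.

Lemma sat_term_model A : forall s : nat -> term,
  sat (M := term_model) (fun i => class (s i)) A <-> theory (fsubst s A).
Proof.
elim: A => [|t u|t u|A IHA B IHB|A IHA B IHB|A IHA B IHB|A IH|A IH] s /=.
- by split=> // /theory_bot.
- by rewrite !eval_term_model; apply: class_eq.
- rewrite !eval_term_model; split; apply: theory_le; try exact: repr_class;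
    exact/theory_sym/repr_class.
- by rewrite theory_imp IHA IHB.
- by rewrite theory_and IHA IHB.
- by rewrite theory_or IHA IHB.
- rewrite theory_all; split=> h.
    by move=> t; rewrite finst_up -IH -econs_class; apply: h.
  by move=> x; rewrite -(class_repr x) econs_class IH -finst_up.
- rewrite theory_ex; split=> -[].
    by move=> x; rewrite -(class_repr x) econs_class IH -finst_up => h; exists (repr x).
  by move=> t; rewrite finst_up -IH -econs_class => h; exists (class t).
Qed.

Lemma term_model_satisfies : satisfies term_model T.
Proof.
move=> A TA rho.
have -> : rho = fun i => class (repr (rho i)) by apply/funext => i; rewrite class_repr.
by rewrite sat_term_model; apply/theory_ax/T_fsubst.
Qed.

End Henkin.

Theorem completeness A :
  (forall M, satisfies M T -> forall rho : nat -> M, sat rho A) -> proves T [::] A.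
Proof.
move=> h; apply: contrapT => nA.
have c : consistent [:: neg A] by move=> pr; apply/nA/p_contra.
have := h _ (term_model_satisfies c) (fun i => class [:: neg A] (Var i)).
rewrite (sat_term_model c) fsubst_id => hA; apply: (theory_bot c).
have : theory [:: neg A] (neg A) by exists 0; left.
by move/(theory_imp c); apply.
Qed.

End Completeness.

(** * Closure of the theory under substitution *)

(** Under [l] binders, with [l] at least [k], the indices that occur are below [l]: nothing refers
    beyond the binders. For [k = 0] this says that [close] gives a sentence, which substitutions
    leave alone. *)
Definition btfree k (t : bterm) := forall l, k <= l -> tfree_below l (t l).
Definition bffree k (A : bform) := forall l, k <= l -> ffree_below l (A l).

Lemma btfree_le k k' t : k <= k' -> btfree k t -> btfree k' t.
Proof. by move=> kk h l kl; apply/h/(leq_trans kk). Qed.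

Lemma btfree_bvar k : btfree k.+1 (bvar k).
Proof. by move=> l kl s1 s2; apply; rewrite ltn_subrL /= (leq_trans _ kl). Qed.

Lemma btfree_app k n (f : pv n) ts :
  size ts = n -> (forall i, i < size ts -> btfree k (nth (bvar 0) ts i)) -> btfree k (bapp f ts).
Proof.
move=> sz h l kl; apply: tfree_App => i; rewrite /args.
by rewrite (nth_map (bvar 0)) ?sz //; apply: h; rewrite ?sz.
Qed.

Lemma btfree_app0 k (f : pv 0) : btfree k (bapp f [::]).
Proof. exact: btfree_app. Qed.
Lemma btfree_app1 k (f : pv 1) t : btfree k t -> btfree k (bapp f [:: t]).
Proof. by move=> h; apply: btfree_app => // -[]. Qed.
Lemma btfree_app2 k (f : pv 2) t u : btfree k t -> btfree k u -> btfree k (bapp f [:: t; u]).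
Proof. by move=> h h'; apply: btfree_app => // -[|[|]]. Qed.

Lemma bffree_eq k s t : btfree k s -> btfree k t -> bffree k (beq s t).
Proof. by move=> hs ht l kl s1 s2 e /=; rewrite (hs l kl _ _ e) (ht l kl _ _ e). Qed.
Lemma bffree_le k s t : btfree k s -> btfree k t -> bffree k (ble s t).
Proof. by move=> hs ht l kl s1 s2 e /=; rewrite (hs l kl _ _ e) (ht l kl _ _ e). Qed.
Lemma bffree_bot k : bffree k bbot.
Proof. by []. Qed.
Lemma bffree_imp k A B : bffree k A -> bffree k B -> bffree k (bimp A B).
Proof. by move=> hA hB l kl s1 s2 e /=; rewrite (hA l kl _ _ e) (hB l kl _ _ e). Qed.
Lemma bffree_and k A B : bffree k A -> bffree k B -> bffree k (band A B).
Proof. by move=> hA hB l kl s1 s2 e /=; rewrite (hA l kl _ _ e) (hB l kl _ _ e). Qed.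
Lemma bffree_or k A B : bffree k A -> bffree k B -> bffree k (bor A B).
Proof. by move=> hA hB l kl s1 s2 e /=; rewrite (hA l kl _ _ e) (hB l kl _ _ e). Qed.
Lemma bffree_all k A :
  (forall k' t, k <= k' -> btfree k' t -> bffree k' (A t)) -> bffree k (ball A).
Proof.
move=> h l kl; apply: ffree_All.
exact: (h l.+1 _ (leqW kl) (@btfree_bvar l) _ (leqnn _)).
Qed.
Lemma bffree_ex k A :
  (forall k' t, k <= k' -> btfree k' t -> bffree k' (A t)) -> bffree k (bex A).
Proof.
move=> h l kl; apply: ffree_Ex.
exact: (h l.+1 _ (leqW kl) (@btfree_bvar l) _ (leqnn _)).
Qed.

Ltac bfree :=
  repeat match goal with
  | H : is_true (?k <= ?k'), H' : btfree ?k ?t |- _ => apply (btfree_le H) in H'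
  | |- bffree _ (ball _) => apply: bffree_all => ? ? ? ?
  | |- bffree _ (bex _) => apply: bffree_ex => ? ? ? ?
  | |- bffree _ (bimp _ _) => apply: bffree_imp
  | |- bffree _ (band _ _) => apply: bffree_and
  | |- bffree _ (bor _ _) => apply: bffree_or
  | |- bffree _ (beq _ _) => apply: bffree_eq
  | |- bffree _ (ble _ _) => apply: bffree_le
  | |- bffree _ bbot => apply: bffree_bot
  | |- btfree _ (bapp _ [::]) => apply: btfree_app0
  | |- btfree _ (bapp _ [:: _]) => apply: btfree_app1
  | |- btfree _ (bapp _ [:: _; _]) => apply: btfree_app2
  | |- _ => assumption
  end.

Lemma fsubst_close A s : bffree 0 A -> fsubst s (close A) = close A.
Proof. by move=> h; rewrite -[RHS]fsubst_id; apply: h. Qed.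

Lemma BASIC_free A : List.In A BASIC -> bffree 0 A.
Proof.
rewrite /BASIC /Defs.two /Defs.one /Defs.zero /Sc /Half.
do 32! (case=> [<-|]; first by bfree).
by [].
Qed.

Lemma dWPHP_free f : bffree 0 (dWPHP f).
Proof. by rewrite /dWPHP /Defs.two /Defs.one /Defs.zero /Sc; bfree. Qed.

Lemma tsubst_app0 s (f : pv 0) : tsubst s (App f (args [::])) = App f (args [::]).
Proof. by rewrite /=; congr App; apply/funext => -[]. Qed.
Lemma tsubst_app1 s (f : pv 1) t : tsubst s (App f (args [:: t])) = App f (args [:: tsubst s t]).
Proof. by rewrite /=; congr App; apply/funext => -[[]]. Qed.
Lemma tsubst_app2 s (f : pv 2) t u :
  tsubst s (App f (args [:: t; u])) = App f (args [:: tsubst s t; tsubst s u]).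
Proof. by rewrite /=; congr App; apply/funext => -[[|[]]]. Qed.

Lemma tsubst_tzero s : tsubst s tzero = tzero.
Proof. exact: tsubst_app0. Qed.
Lemma tsubst_tlen s t : tsubst s (tlen t) = tlen (tsubst s t).
Proof. exact: tsubst_app1. Qed.
Lemma tsubst_thalf s t : tsubst s (thalf t) = thalf (tsubst s t).
Proof. exact: tsubst_app1. Qed.
Lemma tsubst_tdouble s t : tsubst s (tdouble t) = tdouble (tsubst s t).
Proof.
rewrite /tdouble /bapp [LHS]tsubst_app2; congr (App _ (args [:: _; _])).
by rewrite /Defs.two /Defs.one /Defs.zero /Sc /bapp !tsubst_app1 tsubst_app0.
Qed.
Lemma tsubst_tdoubleS s t : tsubst s (tdoubleS t) = tdoubleS (tsubst s t).
Proof. by rewrite /tdoubleS /Sc /bapp [LHS]tsubst_app1 [tsubst _ _]tsubst_tdouble. Qed.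

Lemma tsubst_argcons s n t (ts : 'I_n -> term) :
  (fun i => tsubst s (argcons t ts i)) = argcons (tsubst s t) (fun i => tsubst s (ts i)).
Proof. by apply/funext => i; rewrite /argcons; case: unliftP. Qed.

Lemma pv_def_fsubst A s : pv_def A -> pv_def (fsubst s A).
Proof.
case=> [n i xs|k n f gs xs|n g h0 h1 k ys|n g h0 h1 k x ys F|n g h0 h1 k x ys F];
  try (rewrite /F => {F}); rewrite /is_min; cbn [fsubst tsubst];
  rewrite ?tsubst_argcons ?tsubst_tzero ?tsubst_tdouble ?tsubst_tdoubleS; cbn [tsubst];
  rewrite ?tsubst_argcons.
- exact: def_proj.
- exact: def_comp.
- exact: def_rec0.
- exact: def_rec_even.
- exact: def_rec_odd.
Qed.

Lemma fsubst_allb s t A : fsubst s (allb t A) = allb (tsubst s t) (fsubst (up s) A).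
Proof. by rewrite /allb /= /tshift !tsubst_comp. Qed.
Lemma fsubst_exb s t A : fsubst s (exb t A) = exb (tsubst s t) (fsubst (up s) A).
Proof. by rewrite /exb /= /tshift !tsubst_comp. Qed.

Lemma sharply_bounded_fsubst A : sharply_bounded A -> forall s, sharply_bounded (fsubst s A).
Proof.
elim=> [|u t|u t|B C _ IHB _ IHC|B C _ IHB _ IHC|B C _ IHB _ IHC|t B _ IH|t B _ IH] s;
  rewrite ?fsubst_allb ?fsubst_exb ?tsubst_tlen /=; by constructor.
Qed.

Scheme Sigma1b_mind := Minimality for Sigma1b Sort Prop
  with Pi1b_mind := Minimality for Pi1b Sort Prop.

Lemma Sigma1b_fsubst A : Sigma1b A -> forall s, Sigma1b (fsubst s A).
Proof.
apply: (@Sigma1b_mind (fun A => forall s, Sigma1b (fsubst s A))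
  (fun A => forall s, Pi1b (fsubst s A)))
  => [{}A h|{}A B _ IHA _ IHB|{}A B _ IHA _ IHB|{}A B _ IHA _ IHB|t {}A _ IH|t {}A _ IH
     |{}A h|{}A B _ IHA _ IHB|{}A B _ IHA _ IHB|{}A B _ IHA _ IHB|t {}A _ IH|t {}A _ IH] s;
  rewrite ?fsubst_allb ?fsubst_exb ?tsubst_tlen /=.
1: by apply/sg_sb/sharply_bounded_fsubst.
6: by apply/pi_sb/sharply_bounded_fsubst.
all: by constructor.
Qed.

Lemma fsubst_PIND A s : fsubst s (PIND A) = PIND (fsubst (up s) A).
Proof.
rewrite /PIND /= fsubst_finst tsubst_tzero !fsubst_comp.
congr (FImp (FAnd _ (FAll (FImp _ _))) _); congr fsubst; apply/funext => -[|i].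
  exact: tsubst_thalf.
by rewrite /up /= /tshift !tsubst_comp.
Qed.

Lemma S12_dWPHP_fsubst A s : S12_dWPHP A -> S12_dWPHP (fsubst s A).
Proof.
case=> [{}A [{}A hA|{}A hA|{}A hA]|f].
- by rewrite fsubst_close; [apply/S12_dWPHP_S12/S12_basic|apply: BASIC_free].
- exact/S12_dWPHP_S12/S12_pv/pv_def_fsubst.
- by rewrite fsubst_PIND; apply/S12_dWPHP_S12/S12_pind/Sigma1b_fsubst.
- by rewrite fsubst_close; [apply: S12_dWPHP_dWPHP|apply: dWPHP_free].
Qed.

(** * Semantics of formulas with named binders *)

Record model := Model {
  model_structure :> structure;
  model_axioms : satisfies model_structure S12_dWPHP }.

Definition m0 (M : structure) : M := interp pv_zero (fun i : 'I_0 => False_rect _ (notF (ltn_ord i))).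

Definition appl (M : structure) n (f : pv n) (xs : seq M) : M :=
  interp f (fun i => nth (m0 M) xs i).

Section Denotation.

Variable M : structure.
Implicit Types (x y : M) (st : seq M) (P Q : Prop).

Definition env rho st : nat -> M := foldr (@econs M) rho st.

Definition ext st st' := exists pre, st' = pre ++ st.

(** [st] lists the values of the binders crossed so far, innermost first. Quantifying over all
    extensions of [st] builds weakening into the notion: a term that denotes [x] keeps denoting [x]
    under further binders, as a named variable should. *)
Definition den st (t : bterm) x := forall rho st', ext st st' -> eval (env rho st') (t (size st')) = x.
Definition denP st (A : bform) P := forall rho st', ext st st' -> (sat (env rho st') (A (size st')) <-> P).

Inductive dens st : seq bterm -> seq M -> Prop :=
| dens_nil : dens st [::] [::]
| dens_cons t x ts xs : den st t x -> dens st ts xs -> dens st (t :: ts) (x :: xs).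

Lemma ext_trans st st' st'' : ext st st' -> ext st' st'' -> ext st st''.
Proof. by move=> [p ->] [q ->]; exists (q ++ p); rewrite catA. Qed.

Lemma ext_cons st x : ext st (x :: st).
Proof. by exists [:: x]. Qed.

Lemma ext_refl st : ext st st.
Proof. by exists [::]. Qed.

Lemma den_ext st st' t x : ext st st' -> den st t x -> den st' t x.
Proof. by move=> e h rho st2 e2; apply/h/(ext_trans e). Qed.

Lemma den_bvar st x : den (x :: st) (bvar (size st)) x.
Proof.
move=> rho _ [pre ->]; rewrite /bvar /=.
have -> : (size (pre ++ x :: st) - (size st).+1) = size pre by rewrite size_cat addnK.
by elim: pre.
Qed.

Lemma den_app st n (f : pv n) ts xs :
  dens st ts xs -> size ts = n -> den st (bapp f ts) (appl f xs).
Proof.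
move=> h sz rho st' e; rewrite /bapp /= /appl; congr interp; apply/funext => i.
rewrite /args; have := ltn_ord i; rewrite -[X in _ < X]sz; move: (nat_of_ord i) => {sz} {}i.
elim: h i => // t x {}ts {}xs ht _ IH [_|i hi] /=; first exact: ht.
exact: IH.
Qed.

Lemma denP_bot st : denP st bbot False.
Proof. by []. Qed.
Lemma denP_eq st s t x y : den st s x -> den st t y -> denP st (beq s t) (x = y).
Proof. by move=> h1 h2 rho st' e /=; rewrite h1 // h2. Qed.
Lemma denP_le st s t x y : den st s x -> den st t y -> denP st (ble s t) (lle x y).
Proof. by move=> h1 h2 rho st' e /=; rewrite h1 // h2. Qed.
Lemma denP_imp st A B P Q : denP st A P -> denP st B Q -> denP st (bimp A B) (P -> Q).
Proof. by move=> h1 h2 rho st' e /=; rewrite h1 // h2. Qed.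
Lemma denP_and st A B P Q : denP st A P -> denP st B Q -> denP st (band A B) (P /\ Q).
Proof. by move=> h1 h2 rho st' e /=; rewrite h1 // h2. Qed.
Lemma denP_or st A B P Q : denP st A P -> denP st B Q -> denP st (bor A B) (P \/ Q).
Proof. by move=> h1 h2 rho st' e /=; rewrite h1 // h2. Qed.
Lemma denP_all st A (P : M -> Prop) :
  (forall st' t x, ext st st' -> den st' t x -> denP st' (A t) (P x)) ->
  denP st (ball A) (forall x, P x).
Proof.
move=> h rho st' e.
have hx x := h (x :: st') _ x (ext_trans e (ext_cons st' x)) (@den_bvar st' x) rho _ (ext_refl _).
by split=> H x; apply/hx; apply: H.
Qed.
Lemma denP_ex st A (P : M -> Prop) :
  (forall st' t x, ext st st' -> den st' t x -> denP st' (A t) (P x)) ->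
  denP st (bex A) (exists x, P x).
Proof.
move=> h rho st' e.
have hx x := h (x :: st') _ x (ext_trans e (ext_cons st' x)) (@den_bvar st' x) rho _ (ext_refl _).
by split=> -[x H]; exists x; apply/hx; apply: H.
Qed.

Lemma denP_close A P (rho : nat -> M) : denP [::] A P -> sat rho (close A) <-> P.
Proof. by move=> h; apply: (h rho [::]); apply: ext_refl. Qed.

End Denotation.

Create HintDb den.

Ltac den0 :=
  repeat match goal with
  | E : ext ?st ?st', H : den ?st ?t ?x |- _ => apply (den_ext E) in H
  | |- denP _ (ball _) _ => apply: denP_all => ? ? ? ? ?
  | |- denP _ (bex _) _ => apply: denP_ex => ? ? ? ? ?
  | |- denP _ (bimp _ _) _ => apply: denP_imp
  | |- denP _ (band _ _) _ => apply: denP_and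
  | |- denP _ (bor _ _) _ => apply: denP_or
  | |- denP _ (beq _ _) _ => apply: denP_eq
  | |- denP _ (ble _ _) _ => apply: denP_le
  | |- denP _ bbot _ => apply: denP_bot
  | |- den _ (bapp _ _) _ => apply: den_app; last by []
  | |- dens _ [::] _ => apply: dens_nil
  | |- dens _ (_ :: _) _ => apply: dens_cons
  | |- _ => assumption
  end.

#[global] Hint Extern 0 (den _ _ _) => solve [den0] : den.
Ltac den := den0; try solve [eauto 3 with den nocore].

Ltac den_unfold := rewrite /Defs.two /Defs.one /Defs.zero /Sc /Half.

(** * Basic facts in a model *)

Section Model.

Variable M : model.
Implicit Types x y z u v : M.

Definition zeroM : M := appl pv_zero [::].
Definition Su x : M := appl pv_succ [:: x].
Definition halfM x : M := appl pv_half [:: x].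
Definition len x : M := appl pv_len [:: x].
Definition add x y : M := appl pv_add [:: x; y].
Definition mul x y : M := appl pv_mul [:: x; y].
Definition smash x y : M := appl pv_smash [:: x; y].
Definition le x y : Prop := lle x y.
Definition oneM := Su zeroM.
Definition twoM := Su oneM.

Lemma use_axiom A P : S12_dWPHP (close A) -> denP (M := M) [::] A P -> P.
Proof. by move=> h h'; have [hP _] := denP_close (fun=> zeroM) h'; apply: hP; apply: (model_axioms h). Qed.

Lemma use_basic i P : i < 32 -> denP (M := M) [::] (nth bbot BASIC i) P -> P.
Proof.
move=> hi; apply: use_axiom; apply/S12_dWPHP_S12/S12_basic.
by do 32! (case: i hi => [_|i hi]; first by do ?[by left|right]).
Qed.

Ltac basic i := by apply: (@use_basic i) => //=; den_unfold; den.

Lemma basic_le_S x y : le y x -> le y (Su x). Proof. move: x y; basic 0. Qed.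
Lemma basic_ge0 x : le zeroM x. Proof. move: x; basic 2. Qed.
Lemma basic_lt x y : (le x y /\ (x = y -> False) -> le (Su x) y) /\
  (le (Su x) y -> le x y /\ (x = y -> False)). Proof. move: x y; basic 3. Qed.
Lemma basic_total x y : le y x \/ le x y. Proof. move: x y; basic 5. Qed.
Lemma basic_anti x y : le x y /\ le y x -> x = y. Proof. move: x y; basic 6. Qed.
Lemma basic_trans x y z : le x y /\ le y z -> le x z. Proof. move: x y z; basic 7. Qed.
Lemma basic_len0 : len zeroM = zeroM. Proof. basic 8. Qed.
Lemma basic_len1 : len oneM = oneM. Proof. basic 10. Qed.
Lemma basic_len_le x y : le x y -> le (len x) (len y). Proof. move: x y; basic 11. Qed.
Lemma basic_len_smash x y : len (smash x y) = Su (mul (len x) (len y)).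
Proof. move: x y; basic 12. Qed.
Lemma basic_smash0 y : smash zeroM y = oneM. Proof. move: y; basic 13. Qed.
Lemma basic_smash1 x : (x = zeroM -> False) ->
  smash oneM (mul twoM x) = mul twoM (smash oneM x) /\
  smash oneM (Su (mul twoM x)) = mul twoM (smash oneM x). Proof. move: x; basic 14. Qed.
Lemma basic_smashC x y : smash x y = smash y x. Proof. move: x y; basic 15. Qed.
Lemma basic_smash_len x y z : len x = len y -> smash x z = smash y z.
Proof. move: x y z; basic 16. Qed.
Lemma basic_smashD x y u v : len x = add (len u) (len v) -> smash x y = mul (smash u y) (smash v y).
Proof. move: x y u v; basic 17. Qed.
Lemma basic_addC x y : add x y = add y x. Proof. move: x y; basic 20. Qed.
Lemma basic_add0 x : add x zeroM = x. Proof. move: x; basic 21. Qed.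
Lemma basic_addS x y : add x (Su y) = Su (add x y). Proof. move: x y; basic 22. Qed.
Lemma basic_addA x y z : add (add x y) z = add x (add y z). Proof. move: x y z; basic 23. Qed.
Lemma basic_le_add x y z : (le (add x y) (add x z) -> le y z) /\ (le y z -> le (add x y) (add x z)).
Proof. move: x y z; basic 24. Qed.
Lemma basic_mul0 x : mul x zeroM = zeroM. Proof. move: x; basic 25. Qed.
Lemma basic_mulS x y : mul x (Su y) = add (mul x y) x. Proof. move: x y; basic 26. Qed.
Lemma basic_mulC x y : mul x y = mul y x. Proof. move: x y; basic 27. Qed.
Lemma basic_mulDr x y z : mul x (add y z) = add (mul x y) (mul x z).
Proof. move: x y z; basic 28. Qed.
Lemma basic_le_mul x y z : le oneM x ->
  (le (mul x y) (mul x z) -> le y z) /\ (le y z -> le (mul x y) (mul x z)).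
Proof. move: x y z; basic 29. Qed.
Lemma basic_len_half x : (x = zeroM -> False) -> len x = Su (len (halfM x)).
Proof. move: x; basic 30. Qed.
Lemma basic_half x y : (x = halfM y -> mul twoM x = y \/ Su (mul twoM x) = y) /\
  (mul twoM x = y \/ Su (mul twoM x) = y -> x = halfM y). Proof. move: x y; basic 31. Qed.

(** ** Defining equations *)

Definition vcons n (T : Type) (x : T) (xs : 'I_n -> T) : 'I_n.+1 -> T :=
  fun i => oapp xs x (unlift ord0 i).

Definition is_minM (F h k : M) := (le h k -> F = h) /\ (le k h -> F = k).

Lemma eval_argcons n (rho : nat -> M) t (ts : 'I_n -> term) :
  (fun i => eval rho (argcons t ts i)) = vcons (eval rho t) (fun i => eval rho (ts i)).
Proof. by apply/funext => i; rewrite /argcons /vcons; case: unliftP. Qed.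

Lemma interp1 (f : pv 1) (g : 'I_1 -> M) : interp f g = appl f [:: g ord0].
Proof. by rewrite /appl; congr interp; apply/funext => i; rewrite ord1. Qed.
Lemma interp2 (f : pv 2) (g : 'I_2 -> M) : interp f g = appl f [:: g ord0; g ord_max].
Proof.
rewrite /appl; congr interp; apply/funext => -[[|[|//]]] h /=; congr g; exact: val_inj.
Qed.
Lemma interp0 (f : pv 0) (g : 'I_0 -> M) : interp f g = appl f [::].
Proof. by rewrite /appl; congr interp; apply/funext => -[]. Qed.

Lemma eval_tzero (rho : nat -> M) : eval rho tzero = zeroM.
Proof. by rewrite /tzero /Defs.zero /bapp /= interp0. Qed.
Lemma eval_thalf (rho : nat -> M) t : eval rho (thalf t) = halfM (eval rho t).
Proof. by rewrite /thalf /Half /bapp /= interp1. Qed.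
Lemma eval_tlen (rho : nat -> M) t : eval rho (tlen t) = len (eval rho t).
Proof. by rewrite /tlen /bapp /= interp1. Qed.
Lemma eval_tdouble (rho : nat -> M) t : eval rho (tdouble t) = mul twoM (eval rho t).
Proof.
rewrite /tdouble /bapp /= interp2; congr (appl pv_mul [:: _; _]).
by rewrite /= interp1 /= interp1 /= interp0.
Qed.
Lemma eval_tdoubleS (rho : nat -> M) t : eval rho (tdoubleS t) = Su (mul twoM (eval rho t)).
Proof. by rewrite -eval_tdouble /tdoubleS /Sc /bapp /= interp1. Qed.

Lemma use_pv A : pv_def A -> forall rho : nat -> M, sat rho A.
Proof. by move=> h rho; apply/model_axioms/S12_dWPHP_S12/S12_pv. Qed.

Definition vars n (xs : 'I_n -> M) : nat -> M :=
  fun i => if insub i is Some j then xs j else zeroM.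
Lemma vars_eval n (xs : 'I_n -> M) : (fun i : 'I_n => vars xs i) = xs.
Proof. by apply/funext => i; rewrite /vars valK. Qed.

Lemma interp_proj n (i : 'I_n) (xs : 'I_n -> M) : interp (pv_proj i) xs = xs i.
Proof. by have /= := use_pv (def_proj i (fun j => Var j)) (vars xs); rewrite vars_eval /vars valK. Qed.

Lemma interp_comp k n (f : pv k) (gs : 'I_k -> pv n) (xs : 'I_n -> M) :
  interp (pv_comp f gs) xs = interp f (fun i => interp (gs i) xs).
Proof. by have /= := use_pv (def_comp f gs (fun j => Var j)) (vars xs); rewrite vars_eval. Qed.

Lemma interp_rec0 n (g : pv n) h0 h1 k (xs : 'I_n -> M) :
  is_minM (interp (pv_lrec g h0 h1 k) (vcons zeroM xs)) (interp g xs) (interp k (vcons zeroM xs)).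
Proof.
have := use_pv (def_rec0 g h0 h1 k (fun j => Var j)) (vars xs).
rewrite /is_min; cbn [sat eval].
by rewrite !eval_argcons eval_tzero vars_eval.
Qed.

Lemma interp_rec_even n (g : pv n) h0 h1 k (x : M) (xs : 'I_n -> M) :
  let F := pv_lrec g h0 h1 k in x <> zeroM ->
  is_minM (interp F (vcons (mul twoM x) xs))
    (interp h0 (vcons (interp F (vcons x xs)) (vcons x xs)))
    (interp k (vcons (mul twoM x) xs)).
Proof.
have := use_pv (def_rec_even g h0 h1 k (Var 0) (fun j => Var j.+1)) (econs x (vars xs)).
rewrite /is_min; cbn [sat eval].
rewrite !eval_argcons; cbn [eval]; rewrite !eval_argcons !eval_tdouble eval_tzero.
by cbn [eval econs]; rewrite vars_eval.
Qed.

Lemma interp_rec_odd n (g : pv n) h0 h1 k (x : M) (xs : 'I_n -> M) :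
  let F := pv_lrec g h0 h1 k in
  is_minM (interp F (vcons (Su (mul twoM x)) xs))
    (interp h1 (vcons (interp F (vcons x xs)) (vcons x xs)))
    (interp k (vcons (Su (mul twoM x)) xs)).
Proof.
have := use_pv (def_rec_odd g h0 h1 k (Var 0) (fun j => Var j.+1)) (econs x (vars xs)).
rewrite /is_min; cbn [sat eval].
rewrite !eval_argcons; cbn [eval]; rewrite !eval_argcons !eval_tdoubleS.
by cbn [eval econs]; rewrite vars_eval.
Qed.

Lemma use_pind A (rho : nat -> M) : Sigma1b A ->
  sat (econs zeroM rho) A ->
  (forall x, sat (econs (halfM x) rho) A -> sat (econs x rho) A) ->
  forall x, sat (econs x rho) A.
Proof.
move=> hA h0 hS.
have := model_axioms (S12_dWPHP_S12 (S12_pind hA)) rho; rewrite /PIND; cbn [sat]; apply; split.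
  rewrite /finst sat_fsubst (_ : (fun i => _) = econs zeroM rho) //.
  by apply/funext => -[|i] //; exact: eval_tzero.
move=> x; rewrite sat_fsubst (_ : (fun i => _) = econs (halfM x) rho); first exact: hS.
by apply/funext => -[|i] //; exact: eval_thalf.
Qed.

Lemma use_dwphp (f : pv 2) a b c : le (mul twoM a) b -> le oneM a ->
  exists y, le oneM y /\ le y b /\ forall x, le oneM x -> le x a -> appl f [:: x; c] <> y.
Proof.
move=> h1 h2.
suff [y [[hy1 hy2] hy]] : exists y, (le oneM y /\ le y b) /\
    forall x, le oneM x /\ le x a -> (appl f [:: x; c] = y -> False).
  by exists y; split=> //; split=> // x hx1 hx2; apply: hy.
move: (conj h1 h2); move: a b c {h1 h2}.
by apply: (@use_axiom (dWPHP f)); [apply: S12_dWPHP_dWPHP|rewrite /dWPHP; den_unfold; den].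
Qed.

End Model.

Arguments zeroM {M}.
Arguments oneM {M}.
Arguments twoM {M}.

(** * Definable functions and predicates *)

Section Definability.

Variable M : model.
Implicit Types (rho : nat -> M) (K : M -> Prop) (f g : (nat -> M) -> M).
Implicit Types A B : (nat -> M) -> Prop.

Definition mix rho rho' : nat -> M := fun i => if odd i then rho' i./2 else rho i./2.

(** Functions given by a term with parameters: arguments sit at even variables, parameters at odd
    ones. [K] restricts the parameters, with zero always allowed as the default; [noc] thus
    describes parameter-free functions and [anyc] arbitrary parameters. *)
Definition PF K f := exists t rho', (forall i, K (rho' i) \/ rho' i = zeroM) /\
  forall rho, f rho = eval (mix rho rho') t.

Lemma mix_even rho rho' i : mix rho rho' i.*2 = rho i.
Proof. by rewrite /mix odd_double doubleK. Qed.
Lemma mix_odd rho rho' i : mix rho rho' i.*2.+1 = rho' i.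
Proof. by rewrite /mix /= odd_double uphalf_double. Qed.

Lemma PF_var K i : PF K (fun rho => rho i).
Proof.
by exists (Var i.*2), (fun=> zeroM); split=> [j|rho]; [right|rewrite /= mix_even].
Qed.

Lemma PF_const K c : K c -> PF K (fun=> c).
Proof. by move=> h; exists (Var 1), (fun=> c); split=> // i; left. Qed.

Lemma PF_subst K f (s : nat -> (nat -> M) -> M) :
  PF K f -> (forall i, PF K (s i)) -> PF K (fun rho => f (fun i => s i rho)).
Proof.
move=> [t [r [hr ht]]] /boolp.choice[ts /boolp.choice[rs hs]].
(* Infinitely many terms are substituted, each with its own list of parameters: parameter [k] of the
   [i]-th one is stored at [pickle (i, k)], next to the parameters of [f]. *)
pose r' j : M := if odd j then
    (if @unpickle (nat * nat)%type j./2 is Some (i, k) then rs i k else zeroM) else r j./2.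
pose ren (i v : nat) := if odd v then Var (pickle (i, v./2)).*2.+1.*2.+1 else Var v.
exists (tsubst (fun v => if odd v then Var (v./2.*2.*2.+1) else tsubst (ren v./2) (ts v./2)) t), r'.
split=> [j|rho].
  rewrite /r'; case: ifP => // _; case: unpickle => [[i k]|]; last by right.
  by case: (hs i).
rewrite ht eval_tsubst; congr eval; apply/funext => v; rewrite {1}/mix.
case: ifP => ov /=; first by rewrite mix_odd /r' odd_double doubleK.
have [_ ->] := hs v./2; rewrite eval_tsubst; congr eval; apply/funext => w.
rewrite /mix /ren; case: ifP => ow /=; last by rewrite ow.
by rewrite odd_double /= uphalf_double /r' /= odd_double /= uphalf_double pickleK.
Qed.

Lemma PF_ext K f g : f =1 g -> PF K f -> PF K g.
Proof. by move=> /funext ->. Qed.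

Lemma PF_sub K K' f : (forall c, K c -> K' c) -> PF K f -> PF K' f.
Proof.
move=> h [t [r [hr ht]]]; exists t, r; split=> // i.
by case: (hr i) => [/h|]; [left|right].
Qed.

Lemma PF_interp K n (F : pv n) (a : 'I_n -> (nat -> M) -> M) :
  (forall i, PF K (a i)) -> PF K (fun rho => interp F (fun i => a i rho)).
Proof.
move=> h.
pose s i : (nat -> M) -> M := if insub i is Some j then a j else fun rho => rho 0.
have hF : PF K (fun rho => interp F (fun i : 'I_n => rho i)).
  exists (App F (fun i => Var (i : nat).*2)), (fun=> zeroM); split=> [i|rho]; first by right.
  by rewrite /=; congr interp; apply/funext => i; rewrite mix_even.
apply: (@PF_ext _ _ _ _ (PF_subst (s := s) hF _)) => [rho|i].
  by congr interp; apply/funext => i; rewrite /s valK.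
rewrite /s; case: insubP => [j _ _|_]; first exact: h.
exact: PF_var.
Qed.

Inductive PFs K : seq ((nat -> M) -> M) -> Prop :=
| PFs_nil : PFs K [::]
| PFs_cons f fs : PF K f -> PFs K fs -> PFs K (f :: fs).

Lemma PFs_nth K d fs i : PF K d -> PFs K fs -> PF K (nth d fs i).
Proof. by move=> hd h; elim: h i => [|f {}fs hf _ IH] [|i] //=. Qed.

Lemma PF_zero K : PF K (fun=> zeroM).
Proof.
exists (App pv_zero (fun i : 'I_0 => Var 0)), (fun=> zeroM); split=> [i|rho]; first by right.
by rewrite /= interp0.
Qed.

Lemma PF_appl K n (F : pv n) fs : PFs K fs ->
  PF K (fun rho => appl F [seq f rho | f <- fs]).
Proof.
move=> h; apply: (@PF_ext _ (fun rho => interp F (fun i : 'I_n => nth (fun=> m0 M) fs i rho))).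
  move=> rho; rewrite /appl; congr interp; apply/funext => i.
  elim: fs (i : nat) {h} => [|f fs IH] [|j] //=; exact: IH.
apply: PF_interp => i; apply: PFs_nth h.
by rewrite (_ : m0 M = zeroM); [apply: PF_zero|apply: interp0].
Qed.

Lemma PF_appl1 K (F : pv 1) f : PF K f -> PF K (fun rho => appl F [:: f rho]).
Proof. by move=> h; apply: (@PF_appl _ _ _ [:: f]); do !constructor. Qed.
Lemma PF_appl2 K (F : pv 2) f g : PF K f -> PF K g -> PF K (fun rho => appl F [:: f rho; g rho]).
Proof. by move=> h h'; apply: (@PF_appl _ _ _ [:: f; g]); do !constructor. Qed.

Lemma PF_S K f : PF K f -> PF K (fun rho => Su (f rho)). Proof. exact: PF_appl1. Qed.
Lemma PF_half K f : PF K f -> PF K (fun rho => halfM (f rho)). Proof. exact: PF_appl1. Qed.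
Lemma PF_len K f : PF K f -> PF K (fun rho => len (f rho)). Proof. exact: PF_appl1. Qed.
Lemma PF_add K f g : PF K f -> PF K g -> PF K (fun rho => add (f rho) (g rho)).
Proof. exact: PF_appl2. Qed.
Lemma PF_mul K f g : PF K f -> PF K g -> PF K (fun rho => mul (f rho) (g rho)).
Proof. exact: PF_appl2. Qed.
Lemma PF_smash K f g : PF K f -> PF K g -> PF K (fun rho => smash (f rho) (g rho)).
Proof. exact: PF_appl2. Qed.
Lemma PF_one K : PF K (fun=> oneM). Proof. exact/PF_S/PF_zero. Qed.
Lemma PF_two K : PF K (fun=> twoM). Proof. exact/PF_S/PF_one. Qed.

Lemma PF_shift K f : PF K f -> PF K (fun rho => f (fun i => rho i.+1)).
Proof. by move=> h; apply: (PF_subst (s := fun i rho => rho i.+1)) => // i; apply: PF_var. Qed.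

Definition lenv (xs : seq M) : nat -> M := fun i => nth (zeroM) xs i.

Lemma PF_lenv K f gs : PF K f -> PFs K gs -> PF K (fun rho => f (lenv [seq g rho | g <- gs])).
Proof.
move=> hf hgs; apply: (@PF_ext _ (fun rho => f (fun i => nth (fun=> zeroM) gs i rho))).
  move=> rho; congr f; apply/funext => i; rewrite /lenv.
  by elim: gs i {hgs} => [|h gs IH] [|j] //=; apply: IH.
by apply: PF_subst => // i; apply: PFs_nth hgs; apply: PF_zero.
Qed.

Definition anyc : M -> Prop := fun=> True.
Definition noc : M -> Prop := fun=> False.

(** ** Formulas *)

(** As in [PF], the odd variables hold parameters, here arbitrary elements of the model. *)
Definition SB A := exists F rho', sharply_bounded F /\
  forall rho, A rho <-> sat (mix rho rho') F.
Definition Sg A := exists F rho', Sigma1b F /\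
  forall rho, A rho <-> sat (mix rho rho') F.

(** Moves the parameters along [h] and keeps the arguments. To combine two formulas, their parameter
    lists are interleaved, by [h] being k -> 2k for one and k -> 2k + 1 for the other. *)
Definition ren (h : nat -> nat) v := if odd v then Var (h v./2).*2.+1 else Var v.

Lemma eval_ren (h : nat -> nat) (r r' : nat -> M) rho t : (forall k, r' (h k) = r k) ->
  eval (mix rho r') (tsubst (ren h) t) = eval (mix rho r) t.
Proof.
move=> e; rewrite eval_tsubst; congr eval; apply/funext => v; rewrite /ren {2}/mix.
by case: ifP => ov; rewrite /= ?mix_odd // /mix ov.
Qed.

Lemma sat_ren (h : nat -> nat) (r r' : nat -> M) rho (A : form) : (forall k, r' (h k) = r k) ->
  sat (mix rho r') (fsubst (ren h) A) <-> sat (mix rho r) A.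
Proof.
move=> e; rewrite sat_fsubst; set r1 := (fun i => _).
have -> // : r1 = mix rho r.
apply/funext => v; rewrite /r1 /ren {2}/mix.
by case: ifP => ov; rewrite /= ?mix_odd // /mix ov.
Qed.

Definition ren_up (h : nat -> nat) v :=
  if odd v then Var (h v./2).*2.+2 else if v./2 is i.+1 then Var i.*2.+1 else Var 0.

Lemma sat_ren_up (h : nat -> nat) (r r' : nat -> M) rho x (A : form) : (forall k, r' (h k) = r k) ->
  sat (econs x (mix rho r')) (fsubst (ren_up h) A) <-> sat (mix (econs x rho) r) A.
Proof.
move=> e; rewrite sat_fsubst; set r1 := (fun i => _).
have -> // : r1 = mix (econs x rho) r.
apply/funext => v; rewrite /r1 /ren_up {2}/mix.
case: ifP => ov; first by rewrite /= mix_odd.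
by case: v./2 => [|i] //=; rewrite mix_even.
Qed.

Lemma mix_merge (r r' : nat -> M) : exists r'' : nat -> M,
  (forall k, r'' k.*2 = r k) /\ (forall k, r'' k.*2.+1 = r' k).
Proof. by exists (mix r r'); split=> k; rewrite ?mix_even ?mix_odd. Qed.

Lemma SB_eq f g : PF anyc f -> PF anyc g -> SB (fun rho => f rho = g rho).
Proof.
move=> [t [r [_ ht]]] [u [r' [_ hu]]]; have [r'' [e e']] := mix_merge r r'.
exists (FEq (tsubst (ren double) t) (tsubst (ren (fun k => k.*2.+1)) u)), r''.
by split=> [|rho]; [constructor|rewrite /= (eval_ren _ _ e) (eval_ren _ _ e') ht hu].
Qed.

Lemma SB_le f g : PF anyc f -> PF anyc g -> SB (fun rho => le (f rho) (g rho)).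
Proof.
move=> [t [r [_ ht]]] [u [r' [_ hu]]]; have [r'' [e e']] := mix_merge r r'.
exists (FLe (tsubst (ren double) t) (tsubst (ren (fun k => k.*2.+1)) u)), r''.
by split=> [|rho]; [constructor|rewrite /= (eval_ren _ _ e) (eval_ren _ _ e') ht hu].
Qed.

Lemma SB_False : SB (fun=> False).
Proof. by exists FBot, (fun=> zeroM); split=> //; constructor. Qed.

Lemma SB_imp A B : SB A -> SB B -> SB (fun rho => A rho -> B rho).
Proof.
move=> [F [r [cF hF]]] [G [r' [cG hG]]]; have [r'' [e e']] := mix_merge r r'.
exists (FImp (fsubst (ren double) F) (fsubst (ren (fun k => k.*2.+1)) G)), r''.
split=> [|rho]; first by constructor; apply: sharply_bounded_fsubst.
by rewrite /= (sat_ren _ _ e) (sat_ren _ _ e') hF hG.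
Qed.

Lemma SB_not A : SB A -> SB (fun rho => ~ A rho).
Proof. by move=> h; apply: SB_imp h SB_False. Qed.

Lemma SB_and A B : SB A -> SB B -> SB (fun rho => A rho /\ B rho).
Proof.
move=> [F [r [cF hF]]] [G [r' [cG hG]]]; have [r'' [e e']] := mix_merge r r'.
exists (FAnd (fsubst (ren double) F) (fsubst (ren (fun k => k.*2.+1)) G)), r''.
split=> [|rho]; first by constructor; apply: sharply_bounded_fsubst.
by rewrite /= (sat_ren _ _ e) (sat_ren _ _ e') hF hG.
Qed.

Lemma eval_tshift_econs rho x t : eval (econs x rho) (tshift t) = eval rho t.
Proof. by rewrite /tshift eval_tsubst. Qed.

Lemma SB_all (A : M -> (nat -> M) -> Prop) b : PF anyc b ->
  SB (fun rho => A (rho 0) (fun i => rho i.+1)) ->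
  SB (fun rho => forall x, le x (len (b rho)) -> A x rho).
Proof.
move=> [t [r [_ ht]]] [G [r' [cG hG]]]; have [r'' [e e']] := mix_merge r r'.
exists (allb (tlen (tsubst (ren double) t)) (fsubst (ren_up (fun k => k.*2.+1)) G)), r''.
split=> [|rho]; first by constructor; apply: sharply_bounded_fsubst.
rewrite /allb; cbn [sat]; split=> h x; move: (h x);
  rewrite (sat_ren_up _ _ _ e') eval_tshift_econs eval_tlen (eval_ren _ _ e) -ht -hG //=.
Qed.

Lemma Sg_SB A : SB A -> Sg A.
Proof. by move=> [F [r [hF h]]]; exists F, r; split=> //; apply: sg_sb. Qed.

Lemma Sg_imp A B : SB A -> Sg B -> Sg (fun rho => A rho -> B rho).
Proof.
move=> [F [r [cF hF]]] [G [r' [cG hG]]]; have [r'' [e e']] := mix_merge r r'.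
exists (FImp (fsubst (ren double) F) (fsubst (ren (fun k => k.*2.+1)) G)), r''.
split=> [|rho]; last by rewrite /= (sat_ren _ _ e) (sat_ren _ _ e') hF hG.
by constructor; [apply/pi_sb/sharply_bounded_fsubst|apply: Sigma1b_fsubst].
Qed.

Lemma Sg_and A B : Sg A -> Sg B -> Sg (fun rho => A rho /\ B rho).
Proof.
move=> [F [r [cF hF]]] [G [r' [cG hG]]]; have [r'' [e e']] := mix_merge r r'.
exists (FAnd (fsubst (ren double) F) (fsubst (ren (fun k => k.*2.+1)) G)), r''.
split=> [|rho]; first by constructor; apply: Sigma1b_fsubst.
by rewrite /= (sat_ren _ _ e) (sat_ren _ _ e') hF hG.
Qed.

Lemma Sg_or A B : Sg A -> Sg B -> Sg (fun rho => A rho \/ B rho).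
Proof.
move=> [F [r [cF hF]]] [G [r' [cG hG]]]; have [r'' [e e']] := mix_merge r r'.
exists (FOr (fsubst (ren double) F) (fsubst (ren (fun k => k.*2.+1)) G)), r''.
split=> [|rho]; first by constructor; apply: Sigma1b_fsubst.
by rewrite /= (sat_ren _ _ e) (sat_ren _ _ e') hF hG.
Qed.

Lemma Sg_all (A : M -> (nat -> M) -> Prop) b : PF anyc b ->
  Sg (fun rho => A (rho 0) (fun i => rho i.+1)) ->
  Sg (fun rho => forall x, le x (len (b rho)) -> A x rho).
Proof.
move=> [t [r [_ ht]]] [G [r' [cG hG]]]; have [r'' [e e']] := mix_merge r r'.
exists (allb (tlen (tsubst (ren double) t)) (fsubst (ren_up (fun k => k.*2.+1)) G)), r''.
split=> [|rho]; first by constructor; apply: Sigma1b_fsubst.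
rewrite /allb; cbn [sat]; split=> h x; move: (h x);
  rewrite (sat_ren_up _ _ _ e') eval_tshift_econs eval_tlen (eval_ren _ _ e) -ht -hG //=.
Qed.

Lemma Sg_ex (A : M -> (nat -> M) -> Prop) b : PF anyc b ->
  Sg (fun rho => A (rho 0) (fun i => rho i.+1)) ->
  Sg (fun rho => exists x, le x (b rho) /\ A x rho).
Proof.
move=> [t [r [_ ht]]] [G [r' [cG hG]]]; have [r'' [e e']] := mix_merge r r'.
exists (exb (tsubst (ren double) t) (fsubst (ren_up (fun k => k.*2.+1)) G)), r''.
split=> [|rho]; first by constructor; apply: Sigma1b_fsubst.
rewrite /exb; cbn [sat]; split=> -[x h]; exists x; move: h;
  rewrite (sat_ren_up _ _ _ e') eval_tshift_econs (eval_ren _ _ e) -ht -hG //=.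
Qed.

Lemma PIND_Sg (A : M -> Prop) : Sg (fun rho => A (rho 0)) ->
  A (zeroM) -> (forall x, A (halfM x) -> A x) -> forall x, A x.
Proof.
move=> [F [r [cF hF]]] h0 hS x.
have key y : sat (econs y r) (fsubst (fun v => if odd v then Var v./2.+1 else Var 0) F) <-> A y.
  rewrite sat_fsubst (hF (fun=> y)) (_ : (fun i => _) = mix (fun=> y) r) //.
  by apply/funext => v; rewrite /mix; case: ifP.
apply/key; apply: use_pind; first exact: Sigma1b_fsubst.
  exact/key.
by move=> y /key /hS /key.
Qed.

End Definability.

Arguments anyc {M} _.
Arguments noc {M} _.

Create HintDb pf.
#[global] Hint Resolve PF_var PF_zero PF_one PF_two PF_S PF_half PF_len PF_add PF_mul PF_smash : pf.
#[global] Hint Extern 5 (PF anyc (fun _ => ?c)) => simple apply (@PF_const _ anyc c I) : pf.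
#[global] Hint Extern 4 (PF _ (fun rho => ?f (fun i => rho i.+1))) => simple apply (@PF_shift _ _ f) : pf.

Create HintDb sb.
#[global] Hint Extern 1 (PF _ _) => solve [eauto 60 with pf nocore] : sb.
#[global] Hint Resolve SB_eq SB_le SB_False SB_imp SB_not SB_and SB_all : sb.

Ltac pf := cbv beta; solve [eauto 60 with pf nocore].
Ltac sb := cbv beta; solve [eauto 60 with sb nocore].
Ltac sg := cbv beta; repeat (first
  [ apply: Sg_SB; sb
  | apply: Sg_and | apply: Sg_or | (apply: Sg_imp; [sb|]) | (apply: Sg_all; [pf|]) | (apply: Sg_ex; [pf|])]).

(** * Induction *)

Section Induction.

Variable M : model.
Implicit Types (x y z u v i j : M).

Lemma mle_refl x : le x x.
Proof. by case: (basic_total x x). Qed.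
Lemma mle_trans y x z : le x y -> le y z -> le x z.
Proof. by move=> h h'; apply: (basic_trans (y := y)). Qed.
Lemma mle_anti x y : le x y -> le y x -> x = y.
Proof. by move=> h h'; apply: basic_anti. Qed.
Lemma le_zero x : le x zeroM -> x = zeroM.
Proof. by move=> h; apply: mle_anti h (basic_ge0 _). Qed.
Lemma le_S x : le x (Su x).
Proof. exact/basic_le_S/mle_refl. Qed.
Lemma le_Su_neq x y : le (Su x) y -> x <> y.
Proof. by move=> /(basic_lt x y).2[]. Qed.
Lemma le_Su_le x y : le (Su x) y -> le x y.
Proof. by move=> /(basic_lt x y).2[]. Qed.
Lemma le_neq_lt x y : le x y -> x <> y -> le (Su x) y.
Proof. by move=> h h'; apply: (basic_lt x y).1. Qed.
Lemma nlt x : ~ le (Su x) x.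
Proof. by move/le_Su_neq. Qed.
Lemma le_or_lt x y : le x y \/ le (Su y) x.
Proof.
case: (basic_total x y) => h; last by left.
by case: (pselect (y = x)) => [->|ne]; [left; apply: mle_refl|right; apply: le_neq_lt].
Qed.
Lemma not_le_lt x y : ~ le x y <-> le (Su y) x.
Proof.
split=> [h|h h']; first by case: (le_or_lt x y).
exact: (@nlt y (mle_trans h h')).
Qed.
Lemma le_SS x y : le (Su x) (Su y) <-> le x y.
Proof.
split=> h.
  case: (le_or_lt x y) => // h'; exfalso.
  case: (le_Su_neq (mle_trans h' (le_Su_le (mle_trans h (mle_refl _))))) => //.
  have := mle_trans h h' => h1; have e := mle_anti h1 (le_S x).
  by case: (@nlt x); rewrite e; apply: mle_refl.
apply: le_neq_lt; first exact: mle_trans h (le_S _).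
by move=> e; apply: (@nlt y); rewrite -e.
Qed.
Lemma Su_inj x y : Su x = Su y -> x = y.
Proof. by move=> e; apply: mle_anti; apply/le_SS; rewrite e; apply: mle_refl. Qed.
Lemma Su_neq0 x : Su x <> zeroM.
Proof. by move=> e; apply: (@nlt x); rewrite e; apply: basic_ge0. Qed.
Lemma le_one x : x <> zeroM -> le oneM x.
Proof. by move=> h; apply: le_neq_lt; [apply: basic_ge0|move=> e; apply: h]. Qed.

Lemma madd0r x : add zeroM x = x. Proof. by rewrite basic_addC basic_add0. Qed.
Lemma madd1r x : add oneM x = Su x. Proof. by rewrite basic_addC basic_addS basic_add0. Qed.
Lemma maddr1 x : add x oneM = Su x. Proof. by rewrite basic_addS basic_add0. Qed.
Lemma mul2 x : mul twoM x = add x x.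
Proof. by rewrite basic_mulC !basic_mulS basic_mul0 madd0r. Qed.
Lemma maddI x y z : add x y = add x z -> y = z.
Proof. by move=> e; apply: mle_anti; apply: (basic_le_add x _ _).1; rewrite e; apply: mle_refl. Qed.
Lemma le_addr x y : le x (add x y).
Proof. by rewrite -[X in le X _]basic_add0; apply: (basic_le_add _ _ _).2; apply: basic_ge0. Qed.
Lemma le_addl x y : le x (add y x).
Proof. by rewrite basic_addC; apply: le_addr. Qed.
Lemma le_add2 x y u v : le x u -> le y v -> le (add x y) (add u v).
Proof.
move=> h h'; apply: (mle_trans (y := add x v)); first exact: (basic_le_add _ _ _).2.
by rewrite ![add _ v]basic_addC; apply: (basic_le_add _ _ _).2.
Qed.

Lemma half_cases y : mul twoM (halfM y) = y \/ Su (mul twoM (halfM y)) = y.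
Proof. exact: (basic_half _ _).1. Qed.
Lemma mhalf0 : halfM zeroM = zeroM :> M.
Proof. by apply/esym/(basic_half _ _).2; left; rewrite mul2 basic_add0. Qed.
Lemma half_double x : halfM (mul twoM x) = x.
Proof. by apply/esym/(basic_half _ _).2; left. Qed.
Lemma half_doubleS x : halfM (Su (mul twoM x)) = x.
Proof. by apply/esym/(basic_half _ _).2; right. Qed.
Lemma half_le x : le (halfM x) x.
Proof.
case: (half_cases x) => {2}<-; rewrite mul2; first exact: le_addr.
exact: mle_trans (le_addr _ _) (le_S _).
Qed.

Lemma mlen0 : len zeroM = zeroM :> M. Proof. exact: basic_len0. Qed.
Lemma mlen_half x : x <> zeroM -> len x = Su (len (halfM x)). Proof. exact: basic_len_half. Qed.
Lemma len_eq0 x : len x = zeroM -> x = zeroM.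
Proof. by move=> h; apply: contrapT => /mlen_half; rewrite h => /esym /Su_neq0. Qed.

Lemma halves x : x <> zeroM -> halfM x = zeroM -> x = oneM.
Proof.
move=> nx h; case: (half_cases x); rewrite h mul2 basic_add0 => // e.
by case: nx.
Qed.

(** [E2 v] is [2 ^ |v|]. *)
Definition E2 v := smash v oneM.

Lemma mmulr1 x : mul x oneM = x.
Proof. by rewrite basic_mulS basic_mul0 madd0r. Qed.
Lemma mmul1r x : mul oneM x = x.
Proof. by rewrite basic_mulC mmulr1. Qed.

Lemma one_neq0 : oneM <> zeroM :> M. Proof. exact: Su_neq0. Qed.

Lemma mlen2 : len twoM = twoM :> M.
Proof.
rewrite mlen_half; last exact: Su_neq0.
have -> : twoM = mul twoM oneM :> M by rewrite mmulr1.
by rewrite half_double basic_len1 mmulr1.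
Qed.

(** The axioms give 1 # 1 only indirectly: 2 # 1 is (1 # 1)^2 by additivity in the length and 2 (1 #
    1) by the doubling axiom, and the nonzero factor 1 # 1 cancels. *)
Lemma smash11 : smash oneM oneM = twoM :> M.
Proof.
have h1 : smash twoM oneM = mul (smash oneM oneM) (smash oneM oneM) :> M.
  by apply: basic_smashD; rewrite mlen2 basic_len1 maddr1.
have [h2 _] := basic_smash1 (@one_neq0).
rewrite mmulr1 basic_smashC h1 in h2.
have ge1 : le oneM (smash oneM oneM : M).
  apply: le_one => h; have := basic_len_smash (oneM : M) oneM.
  by rewrite h mlen0 => /esym /Su_neq0.
rewrite [RHS]basic_mulC in h2.
by apply: mle_anti; apply: (basic_le_mul _ _ ge1).1; rewrite h2; apply: mle_refl.
Qed.

Lemma E2_0 : E2 zeroM = oneM. Proof. exact: basic_smash0. Qed.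
Lemma E2_half x : x <> zeroM -> E2 x = mul twoM (E2 (halfM x)).
Proof.
move=> nx; case: (pselect (halfM x = zeroM)) => [h|h].
  by rewrite h E2_0 mmulr1 (halves nx h) /E2 smash11.
rewrite /E2 ![smash _ oneM]basic_smashC.
by case: (half_cases x) => {1}<-; [apply: (basic_smash1 h).1|apply: (basic_smash1 h).2].
Qed.
Lemma E2_len x y : len x = len y -> E2 x = E2 y.
Proof. exact: basic_smash_len. Qed.

Lemma lt_E2 x : le (Su x) (E2 x).
Proof.
move: x; apply: PIND_Sg; first by rewrite /E2; sg.
  by rewrite E2_0; apply: mle_refl.
move=> x h; case: (pselect (x = zeroM)) => [->|nx]; first by rewrite E2_0; apply: mle_refl.
rewrite E2_half // mul2; apply: mle_trans (le_add2 h h).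
rewrite basic_addS basic_addC basic_addS -mul2.
by case: (half_cases x) => {1}<-; rewrite ?le_SS; [apply: le_S|apply: mle_refl].
Qed.

Definition subst1 (t : term) (k : nat) : term :=
  if odd k then Var (k./2.*2.*2.+1) else tsubst (ren (fun k => k.*2.+1)) t.

Lemma sat_subst1 (r r' r'' rho : nat -> M) t (F : form) :
  (forall k, r'' k.*2 = r k) -> (forall k, r'' k.*2.+1 = r' k) ->
  sat (mix rho r'') (fsubst (subst1 t) F) <-> sat (mix (fun=> eval (mix rho r') t) r) F.
Proof.
move=> e e'; rewrite sat_fsubst; set r1 := (fun k => _).
have -> // : r1 = mix (fun=> eval (mix rho r') t) r.
apply/funext => k; rewrite /r1 /subst1 {2}/mix; case: ifP => ok; first by rewrite /= mix_odd e.
by rewrite (eval_ren _ _ e').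
Qed.

Lemma Sg_comp (A : M -> Prop) f : Sg (fun rho => A (rho 0)) -> PF anyc f ->
  Sg (fun rho => A (f rho)).
Proof.
move=> [F [r [cF hF]]] [t [r' [_ ht]]]; have [r'' [e e']] := mix_merge r r'.
exists (fsubst (subst1 t) F), r''; split=> [|rho]; first exact: Sigma1b_fsubst.
by rewrite (sat_subst1 _ _ _ e e') -(hF (fun=> _)) ht.
Qed.

Lemma SB_comp (A : M -> Prop) f : SB (fun rho => A (rho 0)) -> PF anyc f ->
  SB (fun rho => A (f rho)).
Proof.
move=> [F [r [cF hF]]] [t [r' [_ ht]]]; have [r'' [e e']] := mix_merge r r'.
exists (fsubst (subst1 t) F), r''; split=> [|rho]; first exact: sharply_bounded_fsubst.
by rewrite (sat_subst1 _ _ _ e e') -(hF (fun=> _)) ht.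
Qed.

Lemma len_down (z i : M) : le i (len z) -> exists u, le u z /\ len u = i.
Proof.
move: z; apply: (PIND_Sg (A := fun z => le i (len z) -> exists u, le u z /\ len u = i)).
- by sg.
- by rewrite mlen0 => /le_zero ->; exists zeroM; split; [apply: mle_refl|apply: mlen0].
move=> z IH; case: (pselect (z = zeroM)) => [->|nz].
  by rewrite mlen0 => /le_zero ->; exists zeroM; split; [apply: mle_refl|apply: mlen0].
case: (pselect (i = len z)) => [->|ne]; first by exists z; split=> //; apply: mle_refl.
move=> h; have := le_neq_lt h ne; rewrite (mlen_half nz) le_SS => /IH[u [h1 h2]].
by exists u; split=> //; apply: mle_trans (half_le z).
Qed.

(** Halving lowers the length by one, so induction on notation for [A (len u)] is ordinary induction
    for [A] up to a length. *)
Lemma LIND (A : M -> Prop) (z : M) : Sg (fun rho => A (rho 0)) ->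
  A zeroM -> (forall i : M, le (Su i) (len z) -> A i -> A (Su i)) -> forall i, le i (len z) -> A i.
Proof.
move=> sA h0 hS i hi; have [u [_ eu]] := len_down hi.
suff : le (len u) (len z) -> A (len u) by rewrite eu; apply.
move: u {i hi eu}; apply: (PIND_Sg (A := fun u => le (len u) (len z) -> A (len u))).
- by apply: Sg_imp; [sb|apply: (Sg_comp sA); pf].
- by rewrite mlen0.
move=> x IH; case: (pselect (x = zeroM)) => [->|nx]; first by rewrite mlen0.
by rewrite (mlen_half nx) => h; apply: (hS _ h); apply/IH/le_Su_le.
Qed.

(* Binary search for [z] with [A z] and not [A (z + 2 ^ |v|)], with |v| decreasing. *)
Lemma open_search (A : M -> Prop) y : SB (fun rho => A (rho 0)) ->
  A zeroM -> (forall z, le (Su y) z -> ~ A z) -> exists z, le z y /\ A z /\ ~ A (Su z).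
Proof.
move=> sA h0 hy.
have Ale z : A z -> le z y.
  by move=> hA; case: (le_or_lt z y) => // /hy.
pose B u := le (Su (len y)) (len u) \/ exists v, le v y /\ exists z, le z y /\
  (add (len u) (len v) = len y /\ (A z /\ ~ A (add z (E2 v)))).
have : B y.
  suff: forall u, B u by apply.
  apply: PIND_Sg; rewrite /B.
  - rewrite /E2; apply: Sg_or; first by sg.
    apply: Sg_ex; first by pf.
    apply: Sg_ex; first by pf.
    apply: Sg_and; first by sg.
    apply/Sg_SB/SB_and; first by apply: (SB_comp sA); pf.
    by apply/SB_not/(SB_comp sA); pf.
  - right; exists y; split; first exact: mle_refl.
    exists zeroM; split; first exact: basic_ge0.
    by rewrite mlen0 !madd0r; split=> //; split=> //; apply/hy/lt_E2.
  move=> x IH; case: (pselect (x = zeroM)) => [e|nx].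
    by move: IH; rewrite e mhalf0.
  rewrite (mlen_half nx); case: IH => [h|].
    by left; apply: mle_trans h (le_S _).
  move=> [v [hv [z [hz [e [Az nAz]]]]]].
  case: (pselect (v = zeroM)) => [v0|nv].
    by left; rewrite -e v0 mlen0 basic_add0; apply: mle_refl.
  right; exists (halfM v); split; first exact: mle_trans (half_le v) hv.
  have e' : add (Su (len (halfM x))) (len (halfM v)) = len y.
    by rewrite -e (mlen_half nv) basic_addS basic_addC basic_addS basic_addC.
  move: nAz; rewrite (E2_half nv) mul2 -basic_addA => nAz.
  case: (pselect (A (add z (E2 (halfM v))))) => h.
    by exists (add z (E2 (halfM v))); split=> //; apply: Ale.
  by exists z.
case=> [/nlt//|[v [hv [z [hz [e [Az nAz]]]]]]]; exists z; split=> //; split=> //.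
suff v0 : v = zeroM by rewrite v0 E2_0 maddr1 in nAz.
by apply: len_eq0; apply: (@maddI (len y)); rewrite e basic_add0.
Qed.

(** For sharply bounded predicates induction reaches all numbers and not only lengths: if [A] failed
    at [y], binary search would find a place where the step fails. The conjunct [le z y] makes the
    searched predicate false above [y]. *)
Lemma IND (A : M -> Prop) : SB (fun rho => A (rho 0)) ->
  A zeroM -> (forall i, A i -> A (Su i)) -> forall y, A y.
Proof.
move=> sA h0 hS y; apply: contrapT => nA.
have [z [hz [[hz' Az] nAz]]] : exists z, le z y /\ (le z y /\ A z) /\ ~ (le (Su z) y /\ A (Su z)).
  apply: (@open_search (fun z => le z y /\ A z)).
  - by apply: SB_and => //; sb.
  - by split=> //; apply: basic_ge0.
  - by move=> z h [h' _]; apply: (@nlt y); apply: mle_trans h h'.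
apply: nAz; split; last exact: hS.
by apply: le_neq_lt => // e; apply: nA; rewrite -e.
Qed.

Lemma mmulA x y z : mul (mul x y) z = mul x (mul y z).
Proof.
move: z; apply: IND; first by sb.
  by rewrite !basic_mul0.
by move=> z IH; rewrite !basic_mulS IH basic_mulDr.
Qed.

Lemma sub_ex x y : le x y -> exists z, add x z = y.
Proof.
move=> h; have [z [_ [h1 h2]]] : exists z, le z y /\ le (add x z) y /\ ~ le (add x (Su z)) y.
  apply: (@open_search (fun z => le (add x z) y)); first by sb.
    by rewrite basic_add0.
  by move=> z /not_le_lt hz hz'; apply: hz; apply: mle_trans hz'; apply: le_addl.
exists z; apply: mle_anti => //; apply: contrapT => /not_le_lt h3; apply: h2.
by rewrite basic_addS.
Qed.

End Induction.

(** * The ring of integers of a model *)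

Section Grothendieck.

Variable M : model.
Implicit Types (x y z u v : M) (p q r : M * M).

Lemma semiring_M : semi_ring_theory (zeroM : M) oneM (@add M) (@mul M) eq.
Proof.
constructor.
- exact: madd0r.
- exact: basic_addC.
- by move=> x y z; rewrite basic_addA.
- exact: mmul1r.
- by move=> x; rewrite basic_mulC basic_mul0.
- exact: basic_mulC.
- by move=> x y z; rewrite mmulA.
- by move=> x y z; rewrite ![mul _ z]basic_mulC basic_mulDr.
Qed.
Add Ring semiring_M : semiring_M.

(** The pair (x, y) stands for x - y. The model embeds in its ordered ring of differences, so that
    [ring], [lra] and [nra] can do the arithmetic of the model. *)
Definition zrel p q := add p.1 q.2 = add q.1 p.2.

Lemma zrel_trans p q r : zrel p q -> zrel q r -> zrel p r.
Proof.
move=> h h'; apply: (@maddI _ (add q.1 q.2)).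
transitivity (add (add p.1 q.2) (add q.1 r.2)); first by ring.
by rewrite h h'; ring.
Qed.

Lemma zrel_sym p q : zrel p q -> zrel q p.
Proof. exact: esym. Qed.

Definition is_zclass (C : M * M -> Prop) := exists p, C = zrel p.
Definition zring := {C | is_zclass C}.
HB.instance Definition _ := gen_eqMixin zring.
HB.instance Definition _ := gen_choiceMixin zring.

Definition zcl p : zring := exist is_zclass (zrel p) (ex_intro _ p erefl).
Definition zrep (C : zring) : M * M := sval (cid (svalP C)).

Lemma zcl_eq p q : zcl p = zcl q <-> zrel p q.
Proof.
split=> [/(congr1 (fun C => sval C q)) /= -> //|h].
apply: eq_exist; apply/funext => r; apply/propext; split.
  by apply: zrel_trans; apply: zrel_sym.
exact: zrel_trans.
Qed.

Lemma zclK C : zcl (zrep C) = C.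
Proof. by case: C => C hC; apply: eq_exist; rewrite /zrep; case: cid => p /= ->. Qed.

Lemma zrepP p : zrel (zrep (zcl p)) p.
Proof. by apply/zcl_eq; rewrite zclK. Qed.

Lemma zring_ind (P : zring -> Prop) : (forall x y, P (zcl (x, y))) -> forall C, P C.
Proof. by move=> h C; rewrite -(zclK C); case: (zrep C). Qed.

Definition zadd (C D : zring) : zring :=
  zcl (add (zrep C).1 (zrep D).1, add (zrep C).2 (zrep D).2).
Definition zmul (C D : zring) : zring :=
  zcl (add (mul (zrep C).1 (zrep D).1) (mul (zrep C).2 (zrep D).2),
       add (mul (zrep C).1 (zrep D).2) (mul (zrep C).2 (zrep D).1)).
Definition zopp (C : zring) : zring := zcl ((zrep C).2, (zrep C).1).
Definition zle (C D : zring) : bool :=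
  `[< le (add (zrep C).1 (zrep D).2) (add (zrep D).1 (zrep C).2) >].

Lemma zaddE p q : zadd (zcl p) (zcl q) = zcl (add p.1 q.1, add p.2 q.2).
Proof.
apply/zcl_eq; have := zrepP p; have := zrepP q; rewrite /zrel /=.
move: (zrep (zcl p)) (zrep (zcl q)) => p' q' hq hp.
transitivity (add (add p'.1 p.2) (add q'.1 q.2)); first by ring.
by rewrite hp hq; ring.
Qed.

Lemma zmulE p q : zmul (zcl p) (zcl q) =
  zcl (add (mul p.1 q.1) (mul p.2 q.2), add (mul p.1 q.2) (mul p.2 q.1)).
Proof.
apply/zcl_eq; move: (zrep (zcl p)) (zrep (zcl q)) (zrepP p) (zrepP q) => p' q' hp hq.
apply: (@zrel_trans _ (add (mul p.1 q'.1) (mul p.2 q'.2), add (mul p.1 q'.2) (mul p.2 q'.1)));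
  rewrite /zrel /= in hp hq *.
  transitivity (add (mul q'.1 (add p'.1 p.2)) (mul q'.2 (add p.1 p'.2))); first by ring.
  transitivity (add (mul q'.1 (add p.1 p'.2)) (mul q'.2 (add p'.1 p.2))); first by rewrite hp.
  by ring.
transitivity (add (mul p.1 (add q'.1 q.2)) (mul p.2 (add q.1 q'.2))); first by ring.
transitivity (add (mul p.1 (add q.1 q'.2)) (mul p.2 (add q'.1 q.2))); first by rewrite hq.
by ring.
Qed.

Lemma zoppE p : zopp (zcl p) = zcl (p.2, p.1).
Proof.
apply/zcl_eq; have := zrepP p; rewrite /zrel /= => h.
by rewrite basic_addC -h basic_addC.
Qed.

Lemma zleE p q : zle (zcl p) (zcl q) = `[< le (add p.1 q.2) (add q.1 p.2) >].
Proof.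
apply: asbool_equiv_eq; have := zrepP p; have := zrepP q; rewrite /zrel /=.
move: (zrep (zcl p)) (zrep (zcl q)) => p' q' hq hp.
have e1 : add (add p.2 q.2) (add p'.1 q'.2) = add (add p'.2 q'.2) (add p.1 q.2).
  transitivity (add (add p'.1 p.2) (add q.2 q'.2)); first by ring.
  by rewrite hp; ring.
have e2 : add (add p.2 q.2) (add q'.1 p'.2) = add (add p'.2 q'.2) (add q.1 p.2).
  transitivity (add (add q'.1 q.2) (add p.2 p'.2)); first by ring.
  by rewrite hq; ring.
split=> h.
  by apply: (basic_le_add (add p'.2 q'.2) _ _).1; rewrite -e1 -e2; apply: (basic_le_add _ _ _).2.
by apply: (basic_le_add (add p.2 q.2) _ _).1; rewrite e1 e2; apply: (basic_le_add _ _ _).2.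
Qed.

Definition zint x : zring := zcl (x, zeroM).

Ltac zring_tac := repeat (let x := fresh "x" in let y := fresh "y" in elim/zring_ind => x y);
  rewrite ?(zaddE, zmulE, zoppE) //=; apply/zcl_eq; rewrite /zrel /=; ring.

Lemma zaddA : associative zadd. Proof. zring_tac. Qed.
Lemma zaddC : commutative zadd. Proof. zring_tac. Qed.
Lemma zadd0 : left_id (zint zeroM) zadd. Proof. zring_tac. Qed.
Lemma zaddN : left_inverse (zint zeroM) zopp zadd. Proof. zring_tac. Qed.

HB.instance Definition _ := GRing.isZmodule.Build zring zaddA zaddC zadd0 zaddN.

Lemma zmulA : associative zmul. Proof. zring_tac. Qed.
Lemma zmulC : commutative zmul. Proof. zring_tac. Qed.
Lemma zmul1 : left_id (zint oneM) zmul. Proof. zring_tac. Qed.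
Lemma zmulDl : left_distributive zmul zadd. Proof. zring_tac. Qed.
Lemma zint_inj : injective zint.
Proof. by move=> x y /zcl_eq; rewrite /zrel /= !basic_add0. Qed.
Lemma zone_neq0 : zint oneM != zint zeroM.
Proof. by apply/eqP => /zint_inj /one_neq0. Qed.

HB.instance Definition _ := GRing.Zmodule_isComNzRing.Build zring
  zmulA zmulC zmul1 zmulDl zone_neq0.

Definition zunit := [qualify a C : zring | `[< exists D : zring, (D * C = 1)%R >]].
Definition zinv (C : zring) : zring :=
  if pselect (exists D : zring, (D * C = 1)%R) is left h then sval (cid h) else C.

Lemma zmulV : {in zunit, left_inverse 1%R zinv *%R}.
Proof.
move=> C; rewrite qualifE => /asboolP h; rewrite /zinv.
by case: pselect => // h'; case: cid.
Qed.
Lemma zunitP (C D : zring) : (D * C = 1)%R -> C \is a zunit.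
Proof. by move=> h; rewrite qualifE; apply/asboolP; exists D. Qed.
Lemma zinv_out : {in [predC zunit], zinv =1 id}.
Proof.
move=> C; rewrite inE /= qualifE => /asboolP h; rewrite /zinv.
by case: pselect.
Qed.

HB.instance Definition _ := GRing.ComNzRing_hasMulInverse.Build zring zmulV zunitP zinv_out.

Lemma zint_cases (C : zring) : exists x, C = zint x \/ C = (- zint x)%R.
Proof.
elim/zring_ind: C => x y; case: (basic_total x y) => /sub_ex[z h]; exists z.
  by left; apply/zcl_eq; rewrite /zrel /= -h; ring.
by right; rewrite [RHS]zoppE; apply/zcl_eq; rewrite /zrel /= -h; ring.
Qed.

Lemma zintD x y : zint (add x y) = (zint x + zint y)%R.
Proof. by rewrite [RHS]zaddE; apply/zcl_eq; rewrite /zrel /=; ring. Qed.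
Lemma zintM x y : zint (mul x y) = (zint x * zint y)%R.
Proof. by rewrite [RHS]zmulE; apply/zcl_eq; rewrite /zrel /=; ring. Qed.

Lemma mul_eq0 x y : mul x y = zeroM -> x = zeroM \/ y = zeroM.
Proof.
move=> h; case: (pselect (x = zeroM)) => [|/le_one hx]; [by left|right].
by apply: le_zero; apply: (basic_le_mul _ _ hx).1; rewrite h basic_mul0; apply: mle_refl.
Qed.

Lemma zmul_eq0 (C D : zring) : (C * D = 0)%R -> (C == 0%R) || (D == 0%R).
Proof.
have [x hx] := zint_cases C; have [y hy] := zint_cases D => h.
have : zint (mul x y) = zint zeroM.
  rewrite zintM -[RHS]/(0%R : zring).
  by case: hx hy h => -> [] ->; rewrite ?mulrN ?mulNr ?opprK // => /eqP; rewrite oppr_eq0 => /eqP.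
move=> /zint_inj /mul_eq0 [e|e]; apply/orP; [left|right]; apply/eqP.
  by case: hx => ->; rewrite e ?oppr0.
by case: hy => ->; rewrite e ?oppr0.
Qed.

HB.instance Definition _ := GRing.ComUnitRing_isIntegral.Build zring zmul_eq0.

Definition znorm (C : zring) : zring := if zle 0%R C then C else (- C)%R.

Lemma zle0E p : zle 0%R (zcl p) = `[< le p.2 p.1 >].
Proof. by rewrite (zleE (zeroM, zeroM)) /= basic_add0 madd0r. Qed.

Lemma zle0_add (C D : zring) : zle 0%R C -> zle 0%R D -> zle 0%R (C + D)%R.
Proof.
elim/zring_ind: C => x y; elim/zring_ind: D => u v.
rewrite [(_ + _)%R]zaddE !zle0E => /asboolP h /asboolP h'.
by apply/asboolP; apply: le_add2.
Qed.
Lemma zle0_cases (C : zring) : zle 0%R C <-> exists x, C = zint x.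
Proof.
split=> [|[x ->]]; last by rewrite zle0E; apply/asboolP/basic_ge0.
elim/zring_ind: C => x y; rewrite zle0E /= => /asboolP /sub_ex[z <-].
by exists z; apply/zcl_eq; rewrite /zrel /=; ring.
Qed.
Lemma zle0_mul (C D : zring) : zle 0%R C -> zle 0%R D -> zle 0%R (C * D)%R.
Proof.
move=> /zle0_cases[x ->] /zle0_cases[y ->]; apply/zle0_cases.
by exists (mul x y); rewrite zintM.
Qed.
Lemma zle0_anti (C : zring) : zle 0%R C -> zle C 0%R -> C = 0%R.
Proof.
move=> /zle0_cases[x ->]; rewrite (zleE _ (zeroM, zeroM)) /= !basic_add0 => /asboolP /le_zero.
by move=> ->.
Qed.
Lemma zsub_ge0 (C D : zring) : zle 0%R (D - C)%R = zle C D.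
Proof.
elim/zring_ind: C => x y; elim/zring_ind: D => u v.
rewrite [(- _)%R]zoppE [(_ + _)%R]zaddE zle0E zleE /=.
by rewrite [add v x]basic_addC.
Qed.
Lemma zle0_total (C : zring) : zle 0%R C || zle C 0%R.
Proof.
elim/zring_ind: C => x y; rewrite zle0E (zleE _ (zeroM, zeroM)) /= basic_add0 madd0r.
by apply/orP; case: (basic_total x y) => h; [left|right]; apply/asboolP.
Qed.
Lemma znormN (C : zring) : znorm (- C)%R = znorm C.
Proof.
rewrite /znorm; have := zle0_total C; have := @zle0_anti C.
have -> : zle 0%R (- C)%R = zle C 0%R by rewrite -(zsub_ge0 C) sub0r.
case: (zle 0%R C) (zle C 0%R) => [] [] //= h _; rewrite ?opprK //.
by rewrite h // oppr0.
Qed.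
Lemma zge0_norm (C : zring) : zle 0%R C -> znorm C = C.
Proof. by rewrite /znorm => ->. Qed.

HB.instance Definition _ := Num.IntegralDomain_isLeReal.Build zring
  zle0_add zle0_mul zle0_anti zsub_ge0 zle0_total znormN zge0_norm (fun _ _ => erefl).

Lemma zint_le x y : (zint x <= zint y)%R <-> le x y.
Proof.
rewrite -[(_ <= _)%R]/(zle _ _) zleE /= !basic_add0.
by split=> [/asboolP|h]; last exact/asboolP.
Qed.
Lemma zint_ex (C : zring) : (0 <= C)%R -> exists x, C = zint x.
Proof. by move/zle0_cases. Qed.

End Grothendieck.

(* Packed behind an opaque constant, so that the decision procedures for ordered rings do not
   unfold the construction. *)
Record int_ring (M : model) := IntRing {
  intr :> realDomainType;
  intr_of : M -> intr;
  intr_inj : injective intr_of;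
  intr_D : forall x y, intr_of (add x y) = (intr_of x + intr_of y)%R;
  intr_M : forall x y, intr_of (mul x y) = (intr_of x * intr_of y)%R;
  intr_0 : intr_of zeroM = 0%R;
  intr_1 : intr_of oneM = 1%R;
  intr_le : forall x y, (intr_of x <= intr_of y)%R <-> le x y;
  intr_ex : forall r, (0 <= r)%R -> exists x, r = intr_of x }.

Lemma int_ringP (M : model) : int_ring M.
Proof.
exact: (IntRing (@zint_inj M) (@zintD M) (@zintM M) erefl erefl (@zint_le M) (@zint_ex M)).
Qed.

Section IntRing.

Variable M : model.
Implicit Types x y : M.

Definition Z : realDomainType := int_ringP M.
Definition zi : M -> Z := @intr_of M (int_ringP M).

Lemma zi_inj : injective zi. Proof. exact: intr_inj. Qed.
Lemma ziD x y : zi (add x y) = (zi x + zi y)%R. Proof. exact: intr_D. Qed.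
Lemma ziM x y : zi (mul x y) = (zi x * zi y)%R. Proof. exact: intr_M. Qed.
Lemma zi0 : zi zeroM = 0%R. Proof. exact: intr_0. Qed.
Lemma zi1 : zi oneM = 1%R. Proof. exact: intr_1. Qed.
Lemma zi_le x y : (zi x <= zi y)%R <-> le x y. Proof. exact: intr_le. Qed.
Lemma zi_ex (r : Z) : (0 <= r)%R -> exists x, r = zi x. Proof. exact: intr_ex. Qed.
Lemma zi_ge0 x : (0 <= zi x)%R. Proof. by rewrite -zi0; apply/zi_le/basic_ge0. Qed.
Lemma ziS x : zi (Su x) = (zi x + 1)%R. Proof. by rewrite -maddr1 ziD zi1. Qed.
Lemma zi2 : zi twoM = 2%:R%R. Proof. by rewrite /twoM ziS zi1. Qed.
Lemma zi_lt x y : (zi x < zi y)%R <-> le (Su x) y.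
Proof.
rewrite ltNge; split=> [/negP h|h]; last first.
  by apply/negP => /zi_le h'; apply: (not_le_lt y x).2 h'.
by apply/not_le_lt => h'; apply/h/zi_le.
Qed.

End IntRing.

From mathcomp Require Import zify ring lra.

(** * Arithmetic in a model through its ring of integers *)

Definition zE := (ziD, ziM, zi1, zi0, zi2, ziS).

#[global] Hint Rewrite ziD ziM ziS zi0 zi1 zi2 : ziE.

(** Goals and hypotheses about the model are sent by [zi] to the ordered ring [Z M], where the atoms
    are nonnegative; everything but equations and inequalities is dropped before [lra] or [nra] is
    called. *)
Ltac mz_goal :=
  match goal with
  | |- le _ _ => apply/zi_le
  | |- @eq (carrier _) _ _ => apply: zi_inj
  | |- @eq _ (_ : carrier _) _ => apply: zi_inj
  | |- _ <> _ => let H := fresh "H" in move=> H; exfalso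
  | |- ~ le _ _ => let H := fresh "H" in move=> H; exfalso
  | |- False => idtac
  | |- _ => exfalso
  end.

Ltac mz_hyps :=
  repeat match goal with
  | H : le ?x ?y |- _ => let H' := fresh H in pose proof ((zi_le x y).2 H) as H'; clear H
  | H : ~ le ?x ?y |- _ => let H' := fresh H in pose proof ((not_le_lt x y).1 H) as H'; clear H
  | H : @eq (carrier (model_structure ?M)) _ _ |- _ =>
    let H' := fresh H in pose proof (f_equal (@zi M) H) as H'; clear H
  end;
  repeat match goal with
  | H : context [zi (add _ _)] |- _ => autorewrite with ziE in H
  | H : context [zi (mul _ _)] |- _ => autorewrite with ziE in H
  | H : context [zi (Su _)] |- _ => autorewrite with ziE in H
  | H : context [zi zeroM] |- _ => autorewrite with ziE in H
  | H : context [zi oneM] |- _ => autorewrite with ziE in H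
  | H : context [zi twoM] |- _ => autorewrite with ziE in H
  end;
  rewrite ?zE.

Ltac mz_pos :=
  repeat match goal with
  | |- context [zi ?x] =>
    lazymatch goal with
    | H : is_true (0 <= zi x)%R |- _ => fail
    | _ => pose proof (zi_ge0 x)
    end
  | _ : context [zi ?x] |- _ =>
    lazymatch goal with
    | H : is_true (0 <= zi x)%R |- _ => fail
    | _ => pose proof (zi_ge0 x)
    end
  end.

Ltac mz_clear :=
  repeat match goal with
  | H : ?T |- _ =>
    lazymatch T with
    | is_true (_ <= _)%R => fail
    | is_true (_ < _)%R => fail
    | @eq (Num.RealDomain.sort _) _ _ => fail
    | _ => clear H
    end
  end.
Ltac mz0 := mz_goal; mz_hyps; mz_pos; mz_clear.
Ltac mz := solve [mz0; lra].
Ltac mznra := solve [mz0; nra].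
Ltac mring := solve [apply: zi_inj; rewrite ?zE; ring].

(** * Recursion *)

Section Recursion.

Variable M : model.
Implicit Types (K : M -> Prop) (f g : (nat -> M) -> M).

(** A term contains finitely many variables. All large arities are allowed, so that several terms
    can be given symbols of a common arity. *)
Lemma pv_of_term (t : term) : exists N, forall n, N <= n -> exists F : pv n,
  forall (xs : 'I_n -> M) (rho : nat -> M), (forall i : 'I_n, rho i = xs i) ->
  interp F xs = eval rho t.
Proof.
elim: t => [i|k f ts IH].
  exists i.+1 => n hn; exists (pv_proj (Ordinal hn)) => xs rho e.
  by rewrite interp_proj -e.
have /fin_all_exists[N hN] := IH; exists (\max_i N i) => n hn.
have /fin_all_exists[G hG] : forall i, exists F : pv n,
    forall (xs : 'I_n -> M) (rho : nat -> M), (forall i : 'I_n, rho i = xs i) ->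
    interp F xs = eval rho (ts i).
  by move=> i; apply: hN; apply: leq_trans hn; apply: leq_bigmax.
exists (pv_comp f G) => xs rho e; rewrite interp_comp /=; congr interp.
by apply/funext => i; apply: hG.
Qed.

Definition econs2 (x y : M) (rho : nat -> M) := econs x (econs y rho).

Definition ren1 (h : nat -> nat) v :=
  if odd v then Var (h v./2).*2.+2 else if v./2 is i.+1 then Var i.*2.+1 else Var 0.
Definition ren2 (h : nat -> nat) v :=
  if odd v then Var (h v./2).*2.+3 else
  if v./2 is i.+1 then (if i is j.+1 then Var j.*2.+2 else Var 1) else Var 0.

Lemma eval_ren1 (h : nat -> nat) (r r' : nat -> M) rho x (t : term) : (forall k, r' (h k) = r k) ->
  eval (econs x (mix rho r')) (tsubst (ren1 h) t) = eval (mix (econs x rho) r) t.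
Proof.
move=> e; rewrite eval_tsubst; congr eval; apply/funext => v; rewrite /ren1 {2}/mix.
case: ifP => ov; first by rewrite /= mix_odd.
by case: v./2 => [|i] //=; rewrite mix_even.
Qed.

Lemma eval_ren2 (h : nat -> nat) (r r' : nat -> M) rho x y (t : term) : (forall k, r' (h k) = r k) ->
  eval (econs2 x y (mix rho r')) (tsubst (ren2 h) t) = eval (mix (econs2 x y rho) r) t.
Proof.
move=> e; rewrite eval_tsubst; congr eval; apply/funext => v; rewrite /ren2 {2}/mix.
case: ifP => ov; first by rewrite /= mix_odd.
by case: v./2 => [|[|i]] //=; rewrite mix_even.
Qed.

Lemma vcons0 n (x : M) (xs : 'I_n -> M) : vcons x xs ord0 = x.
Proof. by rewrite /vcons unlift_none. Qed.
Lemma vconsS n (x : M) (xs : 'I_n -> M) i : vcons x xs (lift ord0 i) = xs i.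
Proof. by rewrite /vcons liftK. Qed.
Lemma vcons_econs n (x : M) (xs : 'I_n -> M) (rho : nat -> M) (i : 'I_n.+1) :
  (forall i : 'I_n, rho i = xs i) -> econs x rho i = vcons x xs i.
Proof.
move=> e; case: (unliftP ord0 i) => [j|] ->; last by rewrite vcons0.
by rewrite vconsS /= e.
Qed.

Lemma PF_vcons K n a (b : 'I_n -> (nat -> M) -> M) (i : 'I_n.+1) :
  PF K a -> (forall i, PF K (b i)) -> PF K (fun rho => vcons (a rho) (fun j => b j rho) i).
Proof.
move=> ha hb; rewrite /vcons; case: (unlift ord0 i) => [j|] /=; [exact: hb|exact: ha].
Qed.

Lemma PF_mix K (r : nat -> M) i : (forall i, K (r i) \/ r i = zeroM) ->
  PF K (fun rho => mix (fun i => rho i.+1) r i).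
Proof.
move=> hr; rewrite /mix; case: odd; last exact: PF_var.
by case: (hr i./2) => [/PF_const|->] //; apply: PF_zero.
Qed.

(** [pv_lrec] works on symbols, which carry no parameters. The four data become symbols of matching
    arities, and their parameters travel through the recursion as additional arguments. *)
Lemma rec_ex K g (h0 h1 k : (nat -> M) -> M) : PF K g -> PF K h0 -> PF K h1 -> PF K k ->
  exists R : M -> (nat -> M) -> M,
  [/\ PF K (fun rho => R (rho 0) (fun i => rho i.+1)),
      forall rho, is_minM (R zeroM rho) (g rho) (k (econs zeroM rho)),
      forall x rho, x <> zeroM -> is_minM (R (mul twoM x) rho)
        (h0 (econs2 (R x rho) x rho)) (k (econs (mul twoM x) rho)) &
      forall x rho, is_minM (R (Su (mul twoM x)) rho)
        (h1 (econs2 (R x rho) x rho)) (k (econs (Su (mul twoM x)) rho))].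
Proof.
move=> [tg [rg [Kg hg]]] [t0 [r0 [K0 ht0]]] [t1 [r1 [K1 ht1]]] [tk [rk [Kk hk]]].
(* The four lists of parameters occupy the residue classes modulo 4. *)
pose r := mix (mix rg r0) (mix r1 rk).
have e1 i : r i.*2.*2 = rg i by rewrite /r !mix_even.
have e2 i : r i.*2.+1.*2 = r0 i by rewrite /r mix_even mix_odd.
have e3 i : r i.*2.*2.+1 = r1 i by rewrite /r mix_odd mix_even.
have e4 i : r i.*2.+1.*2.+1 = rk i by rewrite /r !mix_odd.
have Kr i : K (r i) \/ r i = zeroM by rewrite /r /mix; do 2 case: odd.
have [N0 H0] := pv_of_term (tsubst (ren (fun i => i.*2.*2)) tg).
have [N1 H1] := pv_of_term (tsubst (ren2 (fun i => i.*2.+1.*2)) t0).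
have [N2 H2] := pv_of_term (tsubst (ren2 (fun i => i.*2.*2.+1)) t1).
have [N3 H3] := pv_of_term (tsubst (ren1 (fun i => i.*2.+1.*2.+1)) tk).
pose n := N0 + N1 + N2 + N3.
have [G hG] : exists G : pv n, _ := H0 n ltac:(rewrite /n -!addnA leq_addr //).
have [P0 hP0] : exists G : pv n.+2, _ := H1 n.+2 ltac:(rewrite /n; lia).
have [P1 hP1] : exists G : pv n.+2, _ := H2 n.+2 ltac:(rewrite /n; lia).
have [P2 hP2] : exists G : pv n.+1, _ := H3 n.+1 ltac:(rewrite /n; lia).
pose ys rho := fun i : 'I_n => mix rho r i.
exists (fun x rho => interp (pv_lrec G P0 P1 P2) (vcons x (ys rho))); split.
- apply: PF_interp => i; apply: (@PF_vcons _ _ _ (fun j rho => ys (fun i => rho i.+1) j)).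
    exact: PF_var.
  by move=> j; apply: PF_mix.
- move=> rho; have := interp_rec0 G P0 P1 P2 (ys rho).
  rewrite (hG _ (mix rho r)) // (hP2 _ (econs zeroM (mix rho r))); last by move=> i; apply: vcons_econs.
  by rewrite (eval_ren _ _ e1) (eval_ren1 _ _ _ e4) -hg -hk.
- move=> x rho nx; have := interp_rec_even G P0 P1 P2 (ys rho) nx.
  set v := interp (pv_lrec _ _ _ _) (vcons x _).
  rewrite (hP0 _ (econs2 v x (mix rho r))); last by move=> i; rewrite /econs2; do 2 (apply: vcons_econs => ?).
  rewrite (hP2 _ (econs (mul twoM x) (mix rho r))); last by move=> i; apply: vcons_econs.
  by rewrite (eval_ren2 _ _ _ _ e2) (eval_ren1 _ _ _ e4) -ht0 -hk.
- move=> x rho; have := interp_rec_odd G P0 P1 P2 x (ys rho); cbv zeta.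
  set v := interp (pv_lrec _ _ _ _) (vcons x _).
  rewrite (hP1 _ (econs2 v x (mix rho r))); last by move=> i; rewrite /econs2; do 2 (apply: vcons_econs => ?).
  rewrite (hP2 _ (econs (Su (mul twoM x)) (mix rho r))); last by move=> i; apply: vcons_econs.
  by rewrite (eval_ren2 _ _ _ _ e3) (eval_ren1 _ _ _ e4) -ht1 -hk.
Qed.

Lemma is_minM_le (F h k : M) : is_minM F h k -> le h k -> F = h.
Proof. by case. Qed.

Definition PV1 (F : M -> M) := forall K a, PF K a -> PF K (fun rho => F (a rho)).
Definition PV2 (F : M -> M -> M) := forall K a b, PF K a -> PF K b ->
  PF K (fun rho => F (a rho) (b rho)).
Definition PV3 (F : M -> M -> M -> M) := forall K a b c, PF K a -> PF K b -> PF K c ->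
  PF K (fun rho => F (a rho) (b rho) (c rho)).
Definition PV4 (F : M -> M -> M -> M -> M) := forall K a b c d,
  PF K a -> PF K b -> PF K c -> PF K d ->
  PF K (fun rho => F (a rho) (b rho) (c rho) (d rho)).
Definition PV5 (F : M -> M -> M -> M -> M -> M) := forall K a b c d e,
  PF K a -> PF K b -> PF K c -> PF K d -> PF K e ->
  PF K (fun rho => F (a rho) (b rho) (c rho) (d rho) (e rho)).

Lemma PF_noc K f : PF noc f -> PF K f.
Proof. by apply: PF_sub. Qed.

Lemma PV1_env f : PF noc f -> PV1 (fun x => f (lenv [:: x])).
Proof. by move=> h K a ha; apply: (PF_lenv (gs := [:: a])); [apply: PF_noc|do !constructor]. Qed.
Lemma PV2_env f : PF noc f -> PV2 (fun x y => f (lenv [:: x; y])).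
Proof. by move=> h K a b ha hb; apply: (PF_lenv (gs := [:: a; b])); [apply: PF_noc|do !constructor]. Qed.
Lemma PV3_env f : PF noc f -> PV3 (fun x y z => f (lenv [:: x; y; z])).
Proof.
by move=> h K a b c ha hb hc; apply: (PF_lenv (gs := [:: a; b; c])); [apply: PF_noc|do !constructor].
Qed.

Lemma half_ind (P : M -> Prop) x : (halfM x <> zeroM -> P (mul twoM (halfM x))) ->
  P (Su (mul twoM (halfM x))) -> x <> zeroM -> P x.
Proof.
move=> h0 h1 nx; case: (half_cases x) => e; last by rewrite -e.
by rewrite -e; apply: h0 => h; apply: nx; rewrite -e h basic_mul0.
Qed.

(** ** Conditionals *)

(** The cut built into the recursion is itself a minimum: the value at 0 of a recursion with base
    [x] and bound [y]. *)
Lemma min_ex : exists F : M -> M -> M, PV2 F /\ forall x y, is_minM (F x y) x y.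
Proof.
have [R [hR h _ _]] := @rec_ex noc _ _ _ _ (PF_var noc 0) (PF_var noc 0) (PF_var noc 0)
  (PF_var noc 2).
exists (fun x y => R zeroM (lenv [:: x; y])); split.
  apply: (PV2_env (f := fun rho => R zeroM rho)).
  by apply: (PF_subst hR (s := fun i => if i is j.+1 then fun rho => rho j else fun=> zeroM));
    case=> [|i]; [apply: PF_zero|apply: PF_var].
by move=> x y; apply: (h (lenv [:: x; y])).
Qed.
Definition minM := sval (cid min_ex).
Lemma PV_min : PV2 minM. Proof. by case: (svalP (cid min_ex)). Qed.
Lemma minP x y : is_minM (minM x y) x y. Proof. by case: (svalP (cid min_ex)). Qed.

(** A recursion whose base is [x] and whose steps return [y]; the bound [x + y] never cuts. *)
Lemma ifz_ex : exists F : M -> M -> M -> M, PV3 F /\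
  (forall x y, F zeroM x y = x) /\ (forall c x y, c <> zeroM -> F c x y = y).
Proof.
have hk : PF noc (fun rho : nat -> M => add (rho 1) (rho 2)) by pf.
have [R [hR h he ho]] := @rec_ex noc _ _ _ _ (PF_var noc 0) (PF_var noc 3) (PF_var noc 3) hk.
exists (fun c x y => R c (lenv [:: x; y])); split; first exact: (PV3_env hR).
split=> [x y|c x y nc]; first by apply: (is_minM_le (h _)); apply: le_addr.
apply: (@half_ind (fun c => R c (lenv [:: x; y]) = y)) nc => [nh|].
  by apply: (is_minM_le (he _ _ nh)); apply: le_addl.
by apply: (is_minM_le (ho _ _)); apply: le_addl.
Qed.
Definition ifz := sval (cid ifz_ex).
Lemma PV_ifz : PV3 ifz. Proof. by case: (svalP (cid ifz_ex)). Qed.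
Lemma ifz0 x y : ifz zeroM x y = x. Proof. by case: (svalP (cid ifz_ex)) => _ []. Qed.
Lemma ifz1 c x y : c <> zeroM -> ifz c x y = y.
Proof. by case: (svalP (cid ifz_ex)) => _ [_]; apply. Qed.

Lemma parity_ex : exists F : M -> M, PV1 F /\
  (forall x, F (mul twoM x) = zeroM) /\ (forall x, F (Su (mul twoM x)) = oneM).
Proof.
have [R [hR h he ho]] := @rec_ex noc _ _ _ _ (PF_zero noc) (PF_zero noc) (PF_one noc) (PF_one noc).
exists (fun c => R c (lenv [::])); split.
  exact: (PV1_env hR).
split=> x; last by apply: (is_minM_le (ho _ _)); apply: mle_refl.
case: (pselect (x = zeroM)) => [->|nx].
  by rewrite basic_mul0; apply: (is_minM_le (h _)); apply: basic_ge0.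
by apply: (is_minM_le (he _ _ nx)); apply: basic_ge0.
Qed.
Definition parity := sval (cid parity_ex).
Lemma PV_parity : PV1 parity. Proof. by case: (svalP (cid parity_ex)). Qed.
Lemma parity_even x : parity (mul twoM x) = zeroM.
Proof. by case: (svalP (cid parity_ex)) => _ []. Qed.
Lemma parity_odd x : parity (Su (mul twoM x)) = oneM.
Proof. by case: (svalP (cid parity_ex)) => _ []. Qed.

(** Predicates with a PV characteristic function, where 0 means true and 1 means false. *)
Definition PD K (A : (nat -> M) -> Prop) := exists c, PF K c /\
  forall rho, (A rho -> c rho = zeroM) /\ (~ A rho -> c rho = oneM).

(* [min (2 x) (2 y + 1)] is even if and only if [x <= y]. *)
Lemma PD_le K f g : PF K f -> PF K g -> PD K (fun rho => le (f rho) (g rho)).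
Proof.
move=> hf hg.
exists (fun rho => parity (minM (mul twoM (f rho)) (Su (mul twoM (g rho))))); split.
  by apply: PV_parity; apply: PV_min; pf.
move=> rho; have [h1 h2] := minP (mul twoM (f rho)) (Su (mul twoM (g rho))); split=> h.
  by rewrite h1 ?parity_even //; mz.
by rewrite h2 ?parity_odd //; mz.
Qed.

Lemma PD_not K A : PD K A -> PD K (fun rho => ~ A rho).
Proof.
move=> [c [hc h]]; exists (fun rho => ifz (c rho) oneM zeroM); split.
  by apply: PV_ifz => //; pf.
move=> rho; have [h1 h2] := h rho; split=> h3; last by rewrite h1 ?ifz0 //; apply: contrapT.
by rewrite ifz1 // h2 //; apply: one_neq0.
Qed.

Lemma PD_and K A B : PD K A -> PD K B -> PD K (fun rho => A rho /\ B rho).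
Proof.
move=> [c [hc h]] [c' [hc' h']]; exists (fun rho => ifz (c rho) (c' rho) oneM); split.
  by apply: PV_ifz => //; pf.
move=> rho; have [h1 h2] := h rho; have [h1' h2'] := h' rho; split=> [[h3 h4]|h3].
  by rewrite h1 // ifz0 h1'.
case: (pselect (A rho)) => hA; last by rewrite h2 // ifz1 //; apply: one_neq0.
by rewrite h1 // ifz0 h2' // => hB; apply: h3.
Qed.

Lemma PD_ext K A B : (forall rho, A rho <-> B rho) -> PD K A -> PD K B.
Proof. by move=> e; rewrite (_ : A = B) //; apply/funext => rho; apply/propext. Qed.

Lemma PD_or K A B : PD K A -> PD K B -> PD K (fun rho => A rho \/ B rho).
Proof.
move=> hA hB; apply: PD_ext (PD_not (PD_and (PD_not hA) (PD_not hB))) => rho.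
split; last by move=> [h|h] [].
by move=> h; apply: contrapT => h'; apply: h; split=> h1; apply: h'; [left|right].
Qed.

Lemma PD_eq K f g : PF K f -> PF K g -> PD K (fun rho => f rho = g rho).
Proof.
move=> hf hg; apply: PD_ext (PD_and (PD_le hf hg) (PD_le hg hf)) => rho.
by split=> [[]|->]; [apply: mle_anti|split; apply: mle_refl].
Qed.

(** A PV predicate is an equation between terms, so induction applies to it however complicated its
    definition is. *)
Lemma SB_PD A : PD anyc A -> SB A.
Proof.
move=> [c [hc h]]; have [F [r [hF e]]] := SB_eq hc (PF_zero anyc).
exists F, r; split=> // rho; rewrite -e; have [h1 h2] := h rho; split=> // h3.
by apply: contrapT => /h2; rewrite h3 => /esym/one_neq0.
Qed.

Definition ite (A : Prop) (x y : M) := if pselect A then x else y.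
Lemma iteT (A : Prop) x y : A -> ite A x y = x.
Proof. by rewrite /ite; case: pselect. Qed.
Lemma iteF (A : Prop) x y : ~ A -> ite A x y = y.
Proof. by rewrite /ite; case: pselect. Qed.

Lemma PF_ite K A f g : PD K A -> PF K f -> PF K g -> PF K (fun rho => ite (A rho) (f rho) (g rho)).
Proof.
move=> [c [hc h]] hf hg; apply: (@PF_ext _ _ (fun rho => ifz (c rho) (f rho) (g rho))).
  move=> rho; have [h1 h2] := h rho; rewrite /ite; case: pselect => h3; first by rewrite h1 ?ifz0.
  by rewrite h2 ?ifz1 //; apply: one_neq0.
exact: PV_ifz.
Qed.

End Recursion.

#[global] Hint Resolve PD_le PD_eq PD_not PD_and PD_or PF_ite : pf.
#[global] Hint Extern 2 (PF _ (fun _ => minM _ _)) => apply PV_min : pf.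
#[global] Hint Extern 2 (PF _ (fun _ => E2 _)) => apply (@PF_smash) : pf.

(** * Strings of ones, iteration along them, and powers *)

Section Strings.

Variable M : model.
Implicit Types (x y z u v i j : M) (K : M -> Prop) (rho : nat -> M).

Lemma le_mul2 x y u v : le x y -> le u v -> le (mul x u) (mul y v).
Proof. by move=> h h'; mznra. Qed.

Lemma is_minM_eq (F h k : M) : is_minM F h k -> F = minM h k.
Proof.
move=> [h1 h2]; have [h3 h4] := minP h k.
by case: (basic_total h k) => h5; [rewrite h2 // h4|rewrite h1 // h3].
Qed.
Lemma min_l x y : le x y -> minM x y = x. Proof. by case: (minP x y) => h _ /h. Qed.
Lemma min_r x y : le y x -> minM x y = y. Proof. by case: (minP x y) => _ h /h. Qed.
Lemma min_le_l x y : le (minM x y) x.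
Proof. by case: (basic_total x y) => h; [rewrite min_r|rewrite min_l //; apply: mle_refl]. Qed.
Lemma min_le_r x y : le (minM x y) y.
Proof. by case: (basic_total x y) => h; [rewrite min_r //; apply: mle_refl|rewrite min_l]. Qed.

Lemma E2_doubleS x : E2 (Su (mul twoM x)) = mul twoM (E2 x).
Proof. by rewrite E2_half ?half_doubleS //; apply: Su_neq0. Qed.
Lemma len_doubleS x : len (Su (mul twoM x)) = Su (len x).
Proof. by rewrite mlen_half ?half_doubleS //; apply: Su_neq0. Qed.
Lemma E2_ge1 x : le oneM (E2 x).
Proof. by have := lt_E2 x => h; mz. Qed.

(** Counting up to a number in Log needs a string of that length to recurse on. The recursion
    follows the bits of [z] and appends a one as long as fewer than [i] have been produced. *)
Lemma un_ex : exists F : M -> M -> M, [/\ PV2 F,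
  forall i, F zeroM i = zeroM,
  forall z i, le (Su (F z i)) (E2 z) &
  forall z i, z <> zeroM ->
    F z i = ite (le (Su (len (halfM z))) i) (Su (mul twoM (F (halfM z) i))) (F (halfM z) i)].
Proof.
have hh : PF noc (fun rho : nat -> M =>
    ite (le (Su (len (rho 1))) (rho 2)) (Su (mul twoM (rho 0))) (rho 0)) by pf.
have hk : PF noc (fun rho : nat -> M => E2 (rho 0)) by pf.
have [R [hR h he ho]] := @rec_ex M noc _ _ _ _ (PF_zero noc) hh hh hk.
pose F z i := R z (lenv [:: i]).
have pF : PV2 F by apply: (PV2_env hR).
have F0 i : F zeroM i = zeroM by apply: (is_minM_le (h _)); apply: basic_ge0.
have step z i : z <> zeroM -> is_minM (F z i)
    (ite (le (Su (len (halfM z))) i) (Su (mul twoM (F (halfM z) i))) (F (halfM z) i)) (E2 z).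
  by apply: (@half_ind M (fun z => is_minM (F z i)
    (ite (le (Su (len (halfM z))) i) (Su (mul twoM (F (halfM z) i))) (F (halfM z) i)) (E2 z)))
    => [nh|]; rewrite ?half_double ?half_doubleS; [apply: he|apply: ho].
have Hs z i : z <> zeroM -> le (Su (F (halfM z) i)) (E2 (halfM z)) ->
    le (Su (ite (le (Su (len (halfM z))) i) (Su (mul twoM (F (halfM z) i))) (F (halfM z) i))) (E2 z).
  move=> nz h1; rewrite (E2_half nz); case: (pselect (le (Su (len (halfM z))) i)) => h2;
    by [rewrite iteT //; mz|rewrite iteF //; mz].
have Fb z i : le (Su (F z i)) (E2 z).
  move: z; apply: (PIND_Sg (A := fun z => le (Su (F z i)) (E2 z))).
  - by apply/Sg_SB/SB_le; [apply: PF_S; apply: pF; pf|pf].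
  - by rewrite F0 E2_0; apply: mle_refl.
  move=> z IH; case: (pselect (z = zeroM)) => [->|nz]; first by rewrite F0 E2_0; apply: mle_refl.
  apply: mle_trans (Hs _ _ nz IH); apply/le_SS.
  by rewrite (is_minM_eq (step z i nz)); apply: min_le_l.
exists F; split=> // z i nz; apply: (is_minM_le (step z i nz)).
exact/le_Su_le/Hs.
Qed.

(** The string of [i] ones, cut down to the length of [z]. *)
Definition un := sval (cid un_ex).
Lemma PV_un : PV2 un. Proof. by case: (svalP (cid un_ex)). Qed.
Lemma un0 i : un zeroM i = zeroM. Proof. by case: (svalP (cid un_ex)). Qed.
Lemma un_half z i : z <> zeroM ->
  un z i = ite (le (Su (len (halfM z))) i) (Su (mul twoM (un (halfM z) i))) (un (halfM z) i).
Proof. by case: (svalP (cid un_ex)) => _ _ _; apply. Qed.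
End Strings.

#[global] Hint Extern 2 (PF _ (fun _ => un _ _)) => apply PV_un : pf.

Section Strings2.

Variable M : model.
Implicit Types (x y z u v i j : M) (K : M -> Prop) (rho : nat -> M).

Lemma len_un_ge z i : le (len z) i -> len (un z i) = len z.
Proof.
move: z; apply: (PIND_Sg (A := fun z => le (len z) i -> len (un z i) = len z)).
- by sg.
- by rewrite un0.
move=> z IH; case: (pselect (z = zeroM)) => [->|nz]; first by rewrite un0.
by rewrite (mlen_half nz) un_half // => h; rewrite iteT // len_doubleS IH //; apply: le_Su_le.
Qed.

Lemma len_un z i : le i (len z) -> len (un z i) = i.
Proof.
move: z; apply: (PIND_Sg (A := fun z => le i (len z) -> len (un z i) = i)).
- by sg.
- by rewrite mlen0 un0 mlen0 => /le_zero.
move=> z IH; case: (pselect (z = zeroM)) => [->|nz].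
  by rewrite mlen0 un0 mlen0 => /le_zero.
rewrite (mlen_half nz) un_half // => h.
case: (le_or_lt i (len (halfM z))) => h'; first by rewrite iteF ?IH // => /(mle_trans)/(_ h')/nlt; apply.
rewrite iteT // len_doubleS len_un_ge; last exact: le_Su_le.
exact: mle_anti.
Qed.

Lemma Su_un z i : Su (un z i) = E2 (un z i).
Proof.
move: z; apply: (PIND_Sg (A := fun z => Su (un z i) = E2 (un z i))).
- by sg.
- by rewrite un0 E2_0.
move=> z IH; case: (pselect (z = zeroM)) => [->|nz]; first by rewrite un0 E2_0.
rewrite un_half //; case: (pselect (le (Su (len (halfM z))) i)) => h; last by rewrite iteF.
by rewrite iteT // E2_doubleS -IH; mring.
Qed.

(** By this the unary arguments of a decoding function are known once their lengths are. *)
Lemma un_uniq z i u : le i (len z) -> len u = i -> Su u = E2 u -> u = un z i.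
Proof.
move=> hi hu e; apply: Su_inj; rewrite e Su_un; apply: E2_len.
by rewrite len_un.
Qed.

Lemma un_0 z : un z zeroM = zeroM.
Proof. by apply/len_eq0/len_un/basic_ge0. Qed.

Lemma un_S z i : le (Su i) (len z) -> un z (Su i) = Su (mul twoM (un z i)).
Proof.
move=> h; symmetry; apply: un_uniq => //; first by rewrite len_doubleS len_un //; apply: le_Su_le.
by rewrite E2_doubleS -Su_un; mring.
Qed.

(** Iteration up to [len z] times is recursion on notation along the string of [i] ones; the length
    of the string reached so far is the loop counter given to [h]. *)
Lemma iter_ex K g (h k : (nat -> M) -> M) : PF K g -> PF K h -> PF K k ->
  exists R : M -> M -> (nat -> M) -> M,
  [/\ PF K (fun rho => R (rho 0) (rho 1) (fun n => rho n.+2)),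
     forall z rho, R z zeroM rho = minM (g rho) (k rho) &
     forall z i rho, le (Su i) (len z) ->
       R z (Su i) rho = minM (h (econs2 (R z i rho) i rho)) (k rho)].
Proof.
move=> hg hh hk.
have hh' : PF K (fun rho => h (econs2 (rho 0) (len (rho 1)) (fun n => rho n.+2))).
  apply: (PF_subst hh (s := fun n rho => econs2 (rho 0) (len (rho 1)) (fun n => rho n.+2) n)).
  by case=> [|[|n]]; rewrite /econs2 /=; pf.
have [R [hR h0 _ ho]] := rec_ex hg hh' hh' (PF_shift hk).
exists (fun z i rho => R (un z i) rho); split.
- apply: (PF_subst hR (s := fun n rho => if n is m.+1 then rho m.+2 else un (rho 0) (rho 1))).
  by case=> [|n]; pf.
- by move=> z rho; rewrite un_0 (is_minM_eq (h0 _)).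
move=> z i rho hi; rewrite un_S // (is_minM_eq (ho _ _)) /econs2 /=.
by rewrite len_un //; apply: le_Su_le.
Qed.

(** ** Powers of two *)

Definition pw z i : M := E2 (un z i).

Lemma pw0 z : pw z zeroM = oneM. Proof. by rewrite /pw un_0 E2_0. Qed.
Lemma pwS z i : le (Su i) (len z) -> pw z (Su i) = mul twoM (pw z i).
Proof. by move=> h; rewrite /pw un_S // E2_doubleS. Qed.
Lemma pwD z i j : le (add i j) (len z) -> pw z (add i j) = mul (pw z i) (pw z j).
Proof.
move=> h; apply: basic_smashD; rewrite !len_un //.
  by apply: mle_trans h; apply: le_addl.
by apply: mle_trans h; apply: le_addr.
Qed.
Lemma pw_ge1 z i : le oneM (pw z i). Proof. exact: E2_ge1. Qed.
Lemma pw_E2 z x : le (len x) (len z) -> pw z (len x) = E2 x.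
Proof. by move=> h; apply: E2_len; rewrite len_un. Qed.

Lemma pw_le z i j : le i j -> le j (len z) -> le (pw z i) (pw z j).
Proof.
move=> /sub_ex[d <-] h; rewrite pwD //.
have := pw_ge1 z d => h1; have := zi_ge0 (pw z i) => h2.
by mznra.
Qed.
Lemma pw_lt z i j : le (Su i) j -> le j (len z) -> le (Su (pw z i)) (pw z j).
Proof.
move=> h h'; apply: mle_trans (pw_le h h'); rewrite pwS; last exact: mle_trans h h'.
by have := pw_ge1 z i => h1; mz.
Qed.
Lemma pw_le_inv z i j : le i (len z) -> le (pw z i) (pw z j) -> le i j.
Proof.
move=> hi h; case: (le_or_lt i j) => // h'; exfalso.
exact: (@nlt M (pw z j)) (mle_trans (pw_lt h' hi) h).
Qed.
Lemma lt_pw_len z x : le (len x) (len z) -> le (Su x) (pw z (len x)).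
Proof. by move=> h; rewrite pw_E2 //; apply: lt_E2. Qed.
Lemma E2_le x : x <> zeroM -> le (E2 x) (mul twoM x).
Proof.
move: x; apply: (PIND_Sg (A := fun x => x <> zeroM -> le (E2 x) (mul twoM x))).
- by apply/Sg_SB/SB_imp; [apply: SB_not; sb|sb].
- by [].
move=> x IH nx; rewrite (E2_half nx); case: (pselect (halfM x = zeroM)) => [h|/IH h].
  by rewrite h E2_0 (halves nx h); mz.
by case: (half_cases x) => e; rewrite -{2}e; mz.
Qed.
Lemma le_pw_len z x : x <> zeroM -> le (len x) (len z) -> le (pw z (len x)) (mul twoM x).
Proof. by move=> h h'; rewrite pw_E2 //; apply: E2_le. Qed.
Lemma le_len x : le (len x) x.
Proof.
move: x; apply: PIND_Sg; first by sg.
  by rewrite mlen0; apply: mle_refl.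
move=> x IH; case: (pselect (x = zeroM)) => [->|nx]; first by rewrite mlen0; apply: mle_refl.
rewrite (mlen_half nx); case: (pselect (halfM x = zeroM)) => [h|h].
  by rewrite h mlen0 (halves nx h); apply: mle_refl.
have h1 := le_one h; case: (half_cases x) => e; rewrite -{2}e; mz.
Qed.

Lemma smash_le x y w : le (len x) (len y) -> le (smash x w) (smash y w).
Proof.
move=> /sub_ex[d hd]; have [v [_ hv]] : exists v, le v y /\ len v = d.
  by apply: len_down; rewrite -hd; apply: le_addl.
rewrite (basic_smashD (x := y) w (u := x) (v := v)) ?hv //.
have h1 : le oneM (smash v w).
  apply: le_one => h; have := basic_len_smash v w.
  by rewrite h mlen0 => /esym /Su_neq0.
by have := zi_ge0 (smash x w) => h2; mznra.
Qed.

(** The bound z # B does not cut, because the i-th power is at most ([un z i]) # B: appending a one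
    to the string multiplies this by 1 # B, which is at least B. *)
Lemma powB_ex : exists F : M -> M -> M -> M, [/\ PV3 F,
  forall z B, F z B zeroM = oneM &
  forall z B i, le (Su i) (len z) -> F z B (Su i) = mul (F z B i) B].
Proof.
have hg : PF noc (fun rho : nat -> M => oneM) by pf.
have hh : PF noc (fun rho : nat -> M => mul (rho 0) (rho 2)) by pf.
have hk : PF noc (fun rho : nat -> M => smash (rho 1) (rho 0)) by pf.
have [R [hR h0 hS]] := iter_ex hg hh hk.
pose F z B i := R z i (lenv [:: B; z]).
have hF : PV3 F.
  move=> K a b c ha hb hc.
  by apply (PF_lenv (gs := [:: a; c; b; a]) (PF_noc K hR)); do !constructor.
have FS z B i : le (Su i) (len z) -> F z B (Su i) = minM (mul (F z B i) B) (smash z B).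
  exact: hS.
have F0 z B : F z B zeroM = oneM.
  rewrite /F h0 min_l //= /lenv /=; apply: le_one => h; have := basic_len_smash z B.
  by rewrite h mlen0 => /esym /Su_neq0.
have bd z B i : le i (len z) -> le (F z B i) (smash (un z i) B).
  move: i; apply: LIND.
  - by apply/Sg_SB/SB_le; [apply: hF; pf|pf].
  - by rewrite F0 un_0 basic_smash0; apply: mle_refl.
  move=> i hi IH; rewrite FS //; apply: mle_trans (min_le_l _ _) _.
  rewrite (basic_smashD (x := un z (Su i)) B (u := un z i) (v := oneM)); last first.
    by rewrite basic_len1 maddr1 !len_un //; apply: le_Su_le.
  have : le B (smash oneM B) by rewrite basic_smashC; apply/le_Su_le/lt_E2.
  exact: le_mul2.
exists F; split=> // z B i hi.
rewrite FS // min_l //.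
have h1 := bd z B i (le_Su_le hi).
have h2 : le B (smash oneM B) by rewrite basic_smashC; apply/le_Su_le/lt_E2.
apply: (mle_trans (y := smash (un z (Su i)) B)); last first.
  by apply: smash_le; rewrite len_un.
rewrite (basic_smashD (x := un z (Su i)) B (u := un z i) (v := oneM)); last first.
  by rewrite basic_len1 maddr1 !len_un //; apply: le_Su_le.
exact: le_mul2.
Qed.
(** [B ^ i], for [i <= |z|]. *)
Definition powB := sval (cid powB_ex).
Lemma PV_powB : PV3 powB. Proof. by case: (svalP (cid powB_ex)). Qed.
Lemma powB0 z B : powB z B zeroM = oneM. Proof. by case: (svalP (cid powB_ex)). Qed.
Lemma powBS z B i : le (Su i) (len z) -> powB z B (Su i) = mul (powB z B i) B.
Proof. by case: (svalP (cid powB_ex)) => _ _; apply. Qed.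

End Strings2.

#[global] Hint Extern 2 (PF _ (fun _ => pw _ _)) => apply (@PF_smash); [|] : pf.
#[global] Hint Extern 2 (PF _ (fun _ => powB _ _ _)) => apply PV_powB : pf.

(** * Binary search by PV functions *)

Section Search.

Variable M : model.
Implicit Types (x y z u v i j : M) (K : M -> Prop) (rho : nat -> M).

Lemma PD_subst K A (s : nat -> (nat -> M) -> M) :
  PD K A -> (forall n, PF K (s n)) -> PD K (fun rho => A (fun n => s n rho)).
Proof.
move=> [c [hc h]] hs; exists (fun rho => c (fun n => s n rho)); split=> //.
exact: PF_subst.
Qed.

(** The number without its [i] last bits. What matters is that it is a PV way to reach the length
    |y| - i, hence a power of two with that exponent. *)
Lemma shr_ex : exists F : M -> M -> M, PV2 F /\
  forall y i, le i (len y) -> add (len (F y i)) i = len y.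
Proof.
have hh : PF noc (fun rho : nat -> M => halfM (rho 0)) by pf.
have [R [hR h0 hS]] := iter_ex (PF_var noc 0) hh (PF_var noc 0).
pose F y i := R y i (lenv [:: y]); exists F.
have hF : PV2 F.
  by move=> K a b ha hb; apply (PF_lenv (gs := [:: a; b; a]) (PF_noc K hR)); do !constructor.
have F0 y : F y zeroM = y by rewrite /F h0 min_l //; apply: mle_refl.
have FS y i : le (Su i) (len y) -> F y (Su i) = minM (halfM (F y i)) y by apply: hS.
split=> // y i hi.
suff: le (F y i) y /\ add (len (F y i)) i = len y by case.
move: i hi; apply: LIND.
- apply: Sg_and; apply: Sg_SB; first by apply: SB_le; [apply: hF|]; pf.
  by apply: SB_eq; [apply: PF_add; [apply: PF_len; apply: hF|]|]; pf.
- by rewrite F0 basic_add0; split=> //; apply: mle_refl.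
move=> i hi [l IH].
have nz : F y i <> zeroM by move=> e0; move: IH; rewrite e0 mlen0 => h; mz.
have l' : le (halfM (F y i)) y by apply: mle_trans l; apply: half_le.
by rewrite FS // min_l //; split=> //; rewrite -IH (mlen_half nz); mring.
Qed.
Definition shr := sval (cid shr_ex).
Lemma PV_shr : PV2 shr. Proof. by case: (svalP (cid shr_ex)). Qed.
Lemma len_shr y i : le i (len y) -> add (len (shr y i)) i = len y.
Proof. by case: (svalP (cid shr_ex)) => _; apply. Qed.

(* Binary search from the most significant bit. *)
Lemma search_ex K (B : M -> (nat -> M) -> Prop) (y : (nat -> M) -> M) :
  PF K y -> PD K (fun rho => B (rho 0) (fun n => rho n.+1)) ->
  exists F : (nat -> M) -> M, PF K F /\ forall rho,
    B zeroM rho -> (forall z, le (Su (y rho)) z -> ~ B z rho) ->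
    [/\ le (F rho) (y rho), B (F rho) rho & ~ B (Su (F rho)) rho].
Proof.
move=> hy hB.
pose w (env : nat -> M) := add (env 0) (E2 (shr (y (fun n => env n.+2)) (Su (env 1)))).
have hw : PF K w.
  apply: PF_add; first exact: PF_var.
  apply: PF_smash; last exact: PF_one.
  apply: PV_shr; last by pf.
  by apply: (PF_shift (PF_shift hy)).
have hA : PD K (fun env => B (w env) (fun n => env n.+2)).
  apply: (PD_subst hB (s := fun n env => if n is m.+1 then env m.+2 else w env)).
  by case=> [|n] //; apply: PF_var.
have hh : PF K (fun env => ite (B (w env) (fun n => env n.+2)) (w env) (env 0)).
  by apply: PF_ite => //; apply: PF_var.
have [R [hR h0 hS]] := iter_ex (PF_zero K) hh hy.
exists (fun rho => R (y rho) (len (y rho)) rho); split.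
  apply: (PF_subst hR (s := fun n rho =>
    if n is m.+1 then if m is k.+1 then rho k else len (y rho) else y rho)).
  by case=> [|[|n]] //; [apply: PF_len|apply: PF_var].
move=> rho B0 By.
have ByN z : B z rho -> le z (y rho).
  by move=> h; apply: contrapT => /not_le_lt /By; apply.
have sB f : PF anyc f -> SB (fun env => B (f env) rho).
  move=> hf; apply: SB_PD.
  have hB' : PD anyc (fun rho => B (rho 0) (fun n => rho n.+1)).
    by have [c [hc h]] := hB; exists c; split=> //; apply: PF_sub hc.
  apply: (PD_subst hB' (s := fun n env => if n is m.+1 then rho m else f env)).
  by case=> [|n] //; apply: PF_const.
have pR f : PF anyc f -> PF anyc (fun env => R (y rho) (f env) rho).
  have hR' : PF anyc (fun rho => R (rho 0) (rho 1) (fun n => rho n.+2)) by apply: PF_sub hR.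
  move=> hf; apply: (PF_subst hR' (s := fun n env =>
    if n is m.+1 then if m is k.+1 then rho k else f env else y rho)).
  by case=> [|[|n]] //; apply: PF_const.
(* After [i] steps the current value satisfies [B] and adding 2^(|y| - i) to it leaves [B]; after
   |y| steps this power is 1. *)
have inv : forall i, le i (len (y rho)) -> B (R (y rho) i rho) rho /\
    ~ B (add (R (y rho) i rho) (E2 (shr (y rho) i))) rho.
  apply: LIND.
  - apply/Sg_SB/SB_and; first by apply: sB; apply: pR; pf.
    apply/SB_not/sB/PF_add; first by apply: pR; pf.
    by apply: PF_smash; [apply: PV_shr|]; pf.
  - rewrite h0 min_l; last exact: basic_ge0.
    split=> //; apply: By; rewrite madd0r.
    have := len_shr (basic_ge0 (len (y rho))); rewrite basic_add0 => /E2_len ->.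
    exact: lt_E2.
  move=> i hi [Bi nBi].
  set W := add (R (y rho) i rho) (E2 (shr (y rho) (Su i))).
  have e : R (y rho) (Su i) rho = minM (ite (B W rho) W (R (y rho) i rho)) (y rho) by apply: hS.
  have eE : E2 (shr (y rho) i) = mul twoM (E2 (shr (y rho) (Su i))).
    have h1 := len_shr (le_Su_le hi); have h2 := len_shr hi.
    have nz : shr (y rho) i <> zeroM by move=> e0; move: h1; rewrite e0 mlen0 => h; mz.
    by rewrite (E2_half nz); congr mul; apply: E2_len; move: h1; rewrite (mlen_half nz) => h1; mz.
  case: (pselect (B W rho)) => hW.
    rewrite e iteT // min_l; last exact: ByN.
    split=> //; move: nBi; rewrite eE (_ : add _ (mul _ _) = add W (E2 (shr (y rho) (Su i)))) //.
    by rewrite /W; mring.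
  by rewrite e iteF // min_l //; apply: ByN.
have [h1 h2] := inv _ (mle_refl _); split=> //; first exact: ByN.
move: h2; have l := len_shr (mle_refl (len (y rho))).
rewrite (_ : E2 _ = oneM) ?maddr1 //.
by rewrite -E2_0; apply: E2_len; rewrite mlen0; mz.
Qed.

End Search.

#[global] Hint Extern 2 (PF _ (fun _ => shr _ _)) => apply PV_shr : pf.

Section Division.

Variable M : model.
Implicit Types (x y z u v i j : M) (K : M -> Prop) (rho : nat -> M).

(** ** Truncated subtraction and division *)

Lemma sub_ex2 : exists F : M -> M -> M, PV2 F /\
  forall x y, (le y x -> add y (F x y) = x) /\ (le x y -> F x y = zeroM).
Proof.
(* The alternative [z = zeroM] makes the search succeed at 0 also when the subtraction is
   truncated. *)
have [f [hf h]] := @search_ex M noc (fun z rho => le (add (rho 1) z) (rho 0) \/ z = zeroM)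
  (fun rho => rho 0) (PF_var noc 0) ltac:(pf).
exists (fun x y => f (lenv [:: x; y])); split; first exact: (PV2_env hf).
move=> x y; have [||h1 h2 h3] := h (lenv [:: x; y]); first by right.
  by move=> z; rewrite /lenv /= => hz [h4|h4]; mz.
move: (f _) h1 h2 h3 => w; rewrite /lenv /= => h1 h2 h3.
have {}h3 : le (Su x) (add y (Su w)) by apply/not_le_lt => h4; apply: h3; left.
split=> h4.
  by case: h2 => [h2|e]; [|rewrite e in h3 *]; apply: mle_anti; mz.
by case: h2 => // h2; mz.
Qed.
Definition subM := sval (cid sub_ex2).
Lemma PV_sub : PV2 subM. Proof. by case: (svalP (cid sub_ex2)). Qed.
Lemma subMK x y : le y x -> add y (subM x y) = x.
Proof. by case: (svalP (cid sub_ex2)) => _ h; have [] := h x y. Qed.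
Lemma zi_sub x y : le y x -> zi (subM x y) = (zi x - zi y)%R.
Proof. by move=> h; have := congr1 (@zi M) (subMK h); rewrite ziD => <-; ring. Qed.

Lemma div_ex : exists F : M -> M -> M, PV2 F /\
  forall x y, le (mul y (F x y)) x /\ (y <> zeroM -> le (Su x) (mul y (Su (F x y)))).
Proof.
(* The bound [z <= x] keeps the search finite for divisor 0. Then the remainder is [x] itself, as
   congruence modulo 0 requires. *)
have [f [hf h]] := @search_ex M noc (fun z rho => le (mul (rho 1) z) (rho 0) /\ le z (rho 0))
  (fun rho => rho 0) (PF_var noc 0) ltac:(pf).
exists (fun x y => f (lenv [:: x; y])); split; first exact: (PV2_env hf).
move=> x y; have [||h1 h2 h3] := h (lenv [:: x; y]).
- by rewrite basic_mul0; split; apply: basic_ge0.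
- by move=> z; rewrite /lenv /= => hz [_ h1]; mz.
move: (f _) h1 h2 h3 => w; rewrite /lenv /= => h1 [h2 _] h3; split=> // ny.
apply/not_le_lt => h4; apply: h3; split=> //.
by have := le_one ny => h5; have h6 := le_mul2 h5 (mle_refl (Su w)); mz.
Qed.
Definition divM := sval (cid div_ex).
Lemma PV_div : PV2 divM. Proof. by case: (svalP (cid div_ex)). Qed.
Lemma divM_le x y : le (mul y (divM x y)) x.
Proof. by case: (svalP (cid div_ex)) => _ h; have [] := h x y. Qed.
Lemma divM_lt x y : y <> zeroM -> le (Su x) (mul y (Su (divM x y))).
Proof. by case: (svalP (cid div_ex)) => _ h; have [] := h x y. Qed.
Definition modM x y : M := subM x (mul y (divM x y)).

Lemma divM_eq x y : x = add (mul y (divM x y)) (modM x y).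
Proof. by rewrite /modM subMK //; apply: divM_le. Qed.
Lemma modM_lt x y : y <> zeroM -> le (Su (modM x y)) y.
Proof. by move=> ny; have h1 := divM_eq x y; have h2 := divM_lt x ny; mz. Qed.
Lemma modM0 x : modM x zeroM = x.
Proof. by have h := divM_eq x zeroM; mz. Qed.

Lemma div_mod_uniq y q r q' r' : le (Su r) y -> le (Su r') y ->
  add (mul y q) r = add (mul y q') r' -> q = q' /\ r = r'.
Proof.
move=> h1 h2 e.
have e1 : q = q'.
  apply: mle_anti; apply: contrapT => /not_le_lt h3.
    by have h4 := le_mul2 (mle_refl y) h3; mz.
  by have h4 := le_mul2 (mle_refl y) h3; mz.
by subst q'; split=> //; apply: maddI e.
Qed.
Lemma divM_uniq x y q r : le (Su r) y -> x = add (mul y q) r -> divM x y = q /\ modM x y = r.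
Proof.
move=> h e; apply: (@div_mod_uniq y) => //; last by rewrite -divM_eq.
by apply: modM_lt => ey; rewrite ey in h; mz.
Qed.
Lemma modM_small x y : le (Su x) y -> modM x y = x.
Proof. by move=> h; have [] := @divM_uniq x y zeroM x h; rewrite ?basic_mul0 ?madd0r. Qed.
Lemma divM_small x y : le (Su x) y -> divM x y = zeroM.
Proof. by move=> h; have [] := @divM_uniq x y zeroM x h; rewrite ?basic_mul0 ?madd0r. Qed.

(** ** Cantor pairing *)

Lemma triangle_even (w : M) : mul twoM (halfM (mul w (Su w))) = mul w (Su w).
Proof.
move: w; apply: IND; first by sb.
  by rewrite (basic_mulC zeroM) basic_mul0 mhalf0 basic_mul0.
move=> w IH; have -> : mul (Su w) (Su (Su w)) = mul twoM (add (halfM (mul w (Su w))) (Su w)).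
  by mz.
by rewrite half_double.
Qed.

(** In Cantor's enumeration of pairs, this is the number x + y of the antidiagonal on which the pair
    coded by z lies. *)
Lemma triangle_ex : exists F : M -> M, PV1 F /\
  forall z, le (mul (F z) (Su (F z))) (mul twoM z) /\
    le (Su (mul twoM z)) (mul (Su (F z)) (Su (Su (F z)))).
Proof.
have [f [hf h]] := @search_ex M noc (fun w rho => le (mul w (Su w)) (mul twoM (rho 0)))
  (fun rho => mul twoM (rho 0)) ltac:(pf) ltac:(pf).
exists (fun z => f (lenv [:: z])); split; first exact: (PV1_env hf).
move=> z; have [||h1 h2 h3] := h (lenv [:: z]).
- by rewrite (basic_mulC zeroM) basic_mul0; apply: basic_ge0.
- move=> w; rewrite /lenv /= => hw h1.
  by have h2 := le_mul2 (mle_refl w) (le_mul2 (mle_refl oneM) (basic_ge0 w)); mznra.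
by split=> //; apply/not_le_lt.
Qed.
Definition triangle := sval (cid triangle_ex).
Lemma PV_triangle : PV1 triangle. Proof. by case: (svalP (cid triangle_ex)). Qed.
Lemma triangle_le z : le (mul (triangle z) (Su (triangle z))) (mul twoM z).
Proof. by case: (svalP (cid triangle_ex)) => _ h; have [] := h z. Qed.
Lemma triangle_lt z : le (Su (mul twoM z)) (mul (Su (triangle z)) (Su (Su (triangle z)))).
Proof. by case: (svalP (cid triangle_ex)) => _ h; have [] := h z. Qed.

Definition p1 z : M := halfM (subM (mul twoM z) (mul (triangle z) (Su (triangle z)))).
Definition p2 z : M := subM (triangle z) (p1 z).
Definition pair x y : M := add (halfM (mul (add x y) (Su (add x y)))) x.

Definition is_pairM z x y := mul twoM z = add (mul (add x y) (Su (add x y))) (mul twoM x).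

Lemma is_pairM_pair x y : is_pairM (pair x y) x y.
Proof. by have h := triangle_even (add x y); rewrite /is_pairM /pair; mz. Qed.

Lemma triangle_uniq z w : le (mul w (Su w)) (mul twoM z) ->
  le (Su (mul twoM z)) (mul (Su w) (Su (Su w))) -> w = triangle z.
Proof.
have aux a b : le (mul a (Su a)) (mul twoM z) -> le (Su (mul twoM z)) (mul (Su b) (Su (Su b))) ->
    le a b.
  move=> h1 h2; apply: contrapT => /not_le_lt h3.
  have h4 := le_mul2 h3 ((le_SS _ _).2 h3).
  by mz.
by move=> h1 h2; apply: mle_anti; apply: aux => //; [apply: triangle_lt|apply: triangle_le].
Qed.

Lemma is_pairMP z x y : is_pairM z x y <-> x = p1 z /\ y = p2 z.
Proof.
split=> [h|[-> ->]].
  have hw : add x y = triangle z by apply: triangle_uniq; rewrite h; mz.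
  have hx : x = p1 z.
    rewrite /p1 -hw h; rewrite -[LHS]half_double; congr halfM.
    by apply: (@maddI _ (mul (add x y) (Su (add x y)))); rewrite subMK //; apply: le_addr.
  split=> //; rewrite /p2 -hx -hw.
  by apply: (@maddI _ x); rewrite subMK //; apply: le_addr.
have h1 := triangle_le z; have h2 := triangle_lt z; have h3 := triangle_even (triangle z).
have e : mul twoM (p1 z) = subM (mul twoM z) (mul (triangle z) (Su (triangle z))).
  rewrite /p1 -h3; have := subMK h1; rewrite -{1}h3; set s := subM _ _ => h4.
  case: (half_cases s) => h5; first by rewrite h3.
  exfalso.
  have [e1 _] := @div_mod_uniq twoM z zeroM (add (halfM (mul (triangle z) (Su (triangle z)))) (halfM s)) oneM
    ltac:(mz) ltac:(mz) ltac:(mz).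
  by mz.
have e2 := subMK h1; rewrite -e in e2.
have e3 : le (p1 z) (triangle z) by apply: contrapT => /not_le_lt h4; mz.
by have e4 := subMK e3; rewrite /is_pairM /p2 e4; mz.
Qed.

Lemma p1_pair x y : p1 (pair x y) = x.
Proof. by have /is_pairMP [<-] := is_pairM_pair x y. Qed.
Lemma p2_pair x y : p2 (pair x y) = y.
Proof. by have /is_pairMP [_ <-] := is_pairM_pair x y. Qed.
Lemma le_sqr x : le x (mul x x).
Proof.
case: (pselect (x = zeroM)) => [->|/le_one h]; first by rewrite basic_mul0; apply: mle_refl.
by rewrite -{1}[x]mmulr1; apply: le_mul2 => //; apply: mle_refl.
Qed.
Lemma pair_bounds z x y : is_pairM z x y -> le x z /\ le y z.
Proof.
rewrite /is_pairM => h; have h1 := le_sqr y; have h2 := le_sqr x.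
have h3 := basic_ge0 (mul x y).
by split; mz.
Qed.
Lemma p1_le z : le (p1 z) z.
Proof. by have [] : le (p1 z) z /\ le (p2 z) z by apply/pair_bounds/is_pairMP. Qed.
Lemma p2_le z : le (p2 z) z.
Proof. by have [] : le (p1 z) z /\ le (p2 z) z by apply/pair_bounds/is_pairMP. Qed.

End Division.

#[global] Hint Extern 2 (PF _ (fun _ => subM _ _)) => apply PV_sub : pf.
#[global] Hint Extern 2 (PF _ (fun _ => divM _ _)) => apply PV_div : pf.
#[global] Hint Extern 2 (PF _ (fun _ => triangle _)) => apply PV_triangle : pf.

Lemma PV_mod (M : model) : PV2 (@modM M).
Proof. by move=> K a b ha hb; rewrite /modM; pf. Qed.
Lemma PV_p1 (M : model) : PV1 (@p1 M).
Proof. by move=> K a ha; rewrite /p1; pf. Qed.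
#[global] Hint Extern 2 (PF _ (fun _ => modM _ _)) => apply PV_mod : pf.
#[global] Hint Extern 2 (PF _ (fun _ => p1 _)) => apply PV_p1 : pf.
Lemma PV_p2 (M : model) : PV1 (@p2 M).
Proof. by move=> K a ha; rewrite /p2; pf. Qed.
Lemma PV_pair (M : model) : PV2 (@pair M).
Proof. by move=> K a b ha hb; rewrite /pair; pf. Qed.
#[global] Hint Extern 2 (PF _ (fun _ => p2 _)) => apply PV_p2 : pf.
#[global] Hint Extern 2 (PF _ (fun _ => pair _ _)) => apply PV_pair : pf.

(** * Digits and coded sequences *)

Section Digits.

Variable M : model.
Implicit Types (x y z u v w i j p t B : M) (K : M -> Prop) (rho : nat -> M).

Lemma mul_neq0 x y : x <> zeroM -> y <> zeroM -> mul x y <> zeroM.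
Proof. by move=> hx hy /mul_eq0[]. Qed.
Lemma ge1_neq0 x : le oneM x -> x <> zeroM.
Proof. by move=> h; mz. Qed.

Lemma divM_addM x p k : p <> zeroM -> divM (add x (mul p k)) p = add (divM x p) k.
Proof.
move=> hp; have [] // := @divM_uniq M (add x (mul p k)) p (add (divM x p) k) (modM x p).
  exact: modM_lt.
by have := divM_eq x p => h; mz.
Qed.
Lemma modM_addM x p k : p <> zeroM -> modM (add x (mul p k)) p = modM x p.
Proof.
move=> hp; have [] // := @divM_uniq M (add x (mul p k)) p (add (divM x p) k) (modM x p).
  exact: modM_lt.
by have := divM_eq x p => h; mz.
Qed.
Lemma modM_mul t p B : p <> zeroM -> B <> zeroM ->
  modM t (mul p B) = add (modM t p) (mul p (modM (divM t p) B)).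
Proof.
move=> hp hB; have h1 := divM_eq t p; have h2 := divM_eq (divM t p) B.
have h3 := modM_lt t hp; have h4 := modM_lt (divM t p) hB.
have [] // := @divM_uniq M t (mul p B) (divM (divM t p) B)
  (add (modM t p) (mul p (modM (divM t p) B))).
  by have h5 := le_mul2 (mle_refl p) h4; mz.
by rewrite {1}h1 {1}h2; mring.
Qed.

Lemma powB_neq0 z B i : B <> zeroM -> le i (len z) -> powB z B i <> zeroM.
Proof.
move=> hB; move: i; apply: LIND; first by sg.
  by rewrite powB0; apply: one_neq0.
by move=> i hi IH; rewrite powBS //; apply: mul_neq0.
Qed.
Lemma powBD z B i j : le (add i j) (len z) -> powB z B (add i j) = mul (powB z B i) (powB z B j).
Proof.
move=> h; have hj : le j (len z) by mz.
suff: forall j, le j (len z) -> le (add i j) (len z) ->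
    powB z B (add i j) = mul (powB z B i) (powB z B j) by apply.
apply: LIND; first by sg.
  by rewrite basic_add0 powB0 mmulr1.
move=> k hk IH h'; rewrite basic_addS !powBS //; last by mz.
by rewrite IH ?mmulA //; mz.
Qed.
Lemma powB_indep z z' B i : le i (len z) -> le i (len z') -> powB z B i = powB z' B i.
Proof.
move: i; apply: LIND; first by sg.
  by rewrite !powB0.
by move=> i hi IH h; rewrite !powBS // IH //; apply: le_Su_le.
Qed.
Lemma powB_E2 z y i : le i (len z) -> powB z (E2 y) i = smash (un z i) y.
Proof.
move: i; apply: LIND; first by sg.
  by rewrite powB0 un_0 basic_smash0.
move=> i hi IH; rewrite powBS // IH /E2 (basic_smashC y).
rewrite (basic_smashD (x := un z (Su i)) y (u := un z i) (v := oneM)) //.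
by rewrite basic_len1 maddr1 !len_un //; apply: le_Su_le.
Qed.
Lemma powB_le_smash z B i : le i (len z) -> le (powB z B i) (smash z B).
Proof.
move=> hi; apply: (@mle_trans _ (smash (un z i) B)); last by apply: smash_le; rewrite len_un.
move: i hi; apply: LIND; first by sg.
  by rewrite powB0 un_0 basic_smash0; apply: mle_refl.
move=> i hi IH; rewrite powBS //.
rewrite (basic_smashD (x := un z (Su i)) B (u := un z i) (v := oneM)); last first.
  by rewrite basic_len1 maddr1 !len_un //; apply: le_Su_le.
by apply: le_mul2 => //; rewrite basic_smashC; apply/le_Su_le/lt_E2.
Qed.

(** Digit [j] of [t] in base [B]; [z] has to be long enough for the exponent. Several bases occur:
    powers of two for coded sequences, [q] for points of the grid, [q^n] for families of such
    points, and a smaller base for compressed families. *)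
Definition dig z B t j : M := modM (divM t (powB z B j)) B.

Lemma dig_lt z B t j : B <> zeroM -> le (Su (dig z B t j)) B.
Proof. exact: modM_lt. Qed.

Lemma modM_powBS z B t i : B <> zeroM -> le (Su i) (len z) ->
  modM t (powB z B (Su i)) = add (modM t (powB z B i)) (mul (powB z B i) (dig z B t i)).
Proof.
by move=> hB hi; rewrite powBS // modM_mul //; apply: powB_neq0 => //; apply: le_Su_le.
Qed.

Lemma dig_ext z B t t' i : B <> zeroM -> le i (len z) ->
  (forall j, le (Su j) i -> dig z B t j = dig z B t' j) ->
  modM t (powB z B i) = modM t' (powB z B i).
Proof.
move=> hB hi h.
suff: forall k, le k (len z) -> le k i -> modM t (powB z B k) = modM t' (powB z B k).
  by apply=> //; apply: mle_refl.
apply: LIND; first by sg.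
  move=> _; rewrite powB0; have ne := @one_neq0 M.
  by have h1 := modM_lt t ne; have h2 := modM_lt t' ne; mz.
move=> k hk IH hk'; rewrite !modM_powBS // IH ?h //.
exact: le_Su_le.
Qed.

(** Sums [sum_(j < i) c j * B ^ j]. *)
Section Table.

Variables (z B : M) (T c : M -> M).
Hypothesis B_neq0 : B <> zeroM.
Hypothesis T_PF : PF anyc (fun rho => T (rho 0)).
Hypothesis T0 : T zeroM = zeroM.
Hypothesis TS : forall i, le (Su i) (len z) -> T (Su i) = add (T i) (mul (c i) (powB z B i)).
Hypothesis c_lt : forall i, le (Su i) (len z) -> le (Su (c i)) B.

Lemma table_lt i : le i (len z) -> le (Su (T i)) (powB z B i).
Proof.
move: i; apply: LIND.
- by apply/Sg_SB/SB_le; [apply: PF_S|]; pf.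
- by rewrite T0 powB0; apply: mle_refl.
move=> i hi IH; rewrite TS // powBS //.
by have h := le_mul2 (c_lt hi) (mle_refl (powB z B i)); mz.
Qed.

Lemma dig_table i j : le i (len z) -> le (Su j) i -> dig z B (T i) j = c j.
Proof.
move=> hi hj; move: hi hj; move: i; apply: LIND.
- apply/Sg_SB/SB_imp; first by sb.
  apply: SB_eq; last by pf.
  by apply: PV_mod; [apply: PV_div; [apply: T_PF|]|]; pf.
- by move=> h; mz.
move=> i hi IH hj; rewrite TS //; have li := le_Su_le hi.
case: (pselect (j = i)) => [e|ne]; rewrite /dig.
  subst j; have np := powB_neq0 B_neq0 li.
  have [-> _] := @divM_uniq M (add (T i) (mul (c i) (powB z B i))) (powB z B i) (c i) (T i)
     (table_lt li) ltac:(mring).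
  by apply: modM_small; apply: c_lt.
have hji : le (Su j) i by apply: le_neq_lt => //; apply/le_SS.
have np := powB_neq0 B_neq0 (mle_trans (le_Su_le hji) li).
have [d hd] := sub_ex hji.
have e : powB z B i = mul (powB z B j) (mul B (powB z B d)).
  rewrite -hd powBD ?hd // powBS; last exact: mle_trans hji li.
  by rewrite mmulA.
rewrite e (_ : mul (c i) _ = mul (powB z B j) (mul B (mul (c i) (powB z B d)))); last by mring.
by rewrite divM_addM // modM_addM // -[RHS]IH.
Qed.

End Table.

(* Course-of-values recursion: [h] computes the next digit from the table of the previous ones. *)
Lemma cov_ex K (h B : (nat -> M) -> M) : PF K h -> PF K B ->
  exists T : M -> M -> (nat -> M) -> M,
  PF K (fun rho => T (rho 0) (rho 1) (fun n => rho n.+2)) /\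
  forall z rho, B rho <> zeroM ->
    T z zeroM rho = zeroM /\
    forall i, le (Su i) (len z) -> T z (Su i) rho =
      add (T z i rho) (mul (minM (h (econs2 (T z i rho) i rho)) (subM (B rho) oneM))
                           (powB z (B rho) i)).
Proof.
move=> hh hB.
pose hc (env : nat -> M) := minM (h (econs2 (env 0) (env 1) (fun n => env n.+3)))
  (subM (B (fun n => env n.+3)) oneM).
have pB : PF K (fun env => B (fun n => env n.+3)).
  by apply: (PF_shift (PF_shift (PF_shift hB))).
have pc : PF K hc.
  apply: PV_min; last by pf.
  apply: (PF_subst hh (s := fun n env => econs2 (env 0) (env 1) (fun n => env n.+3) n)).
  by case=> [|[|n]]; apply: PF_var.
have pst : PF K (fun env => add (env 0) (mul (hc env) (powB (env 2) (B (fun n => env n.+3)) (env 1)))).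
  by pf.
have pk : PF K (fun env => smash (env 0) (B (fun n => env n.+1))) by pf.
have [R [hR h0 hS]] := iter_ex (PF_zero K) pst pk.
exists (fun z i rho => R z i (econs z rho)); split.
  apply: (PF_subst hR (s := fun n rho => if n is m.+1 then
    if m is k.+1 then if k is l.+1 then rho l.+2 else rho 0 else rho 1 else rho 0)).
  by case=> [|[|[|n]]]; apply: PF_var.
move=> z rho nB.
pose T i := R z i (econs z rho).
pose c i := minM (h (econs2 (T i) i rho)) (subM (B rho) oneM).
have T0 : T zeroM = zeroM by rewrite /T h0 min_l //; apply: basic_ge0.
have TS i : le (Su i) (len z) ->
    T (Su i) = minM (add (T i) (mul (c i) (powB z (B rho) i))) (smash z (B rho)) by apply: hS.
have ec i : le (Su (c i)) (B rho).
  have h1 := min_le_r (h (econs2 (T i) i rho)) (subM (B rho) oneM).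
  by have h2 := subMK (le_one nB); rewrite /c; mz.
have pT : PF anyc (fun rho => T (rho 0)).
  have hR' : PF anyc (fun rho => R (rho 0) (rho 1) (fun n => rho n.+2)) by apply: PF_sub hR.
  apply: (PF_subst hR' (s := fun n env => if n is m.+1 then
    if m is k.+1 then econs z rho k else env 0 else z)).
  by case=> [|[|n]]; pf.
have bd i : le i (len z) -> le (Su (T i)) (powB z (B rho) i).
  move: i; apply: LIND.
  - by apply/Sg_SB/SB_le; [apply: PF_S|]; pf.
  - by rewrite T0 powB0; apply: mle_refl.
  move=> i hi IH; rewrite TS // powBS //.
  have l := min_le_l (add (T i) (mul (c i) (powB z (B rho) i))) (smash z (B rho)).
  by have h1 := le_mul2 (ec i) (mle_refl (powB z (B rho) i)); mz.
split=> // i hi; rewrite -/(T i) -/(T (Su i)) TS // min_l //.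
apply: mle_trans (powB_le_smash _ hi); rewrite powBS //.
have h1 := bd i (le_Su_le hi).
by have h2 := le_mul2 (ec i) (mle_refl (powB z (B rho) i)); mz.
Qed.

(** ** Entries of sequences *)

Definition entryM w i v := exists b y u hi lo,
  is_pairM w b y /\ (len u = i /\ (le (Su v) (smash y oneM) /\ (le (Su lo) (smash u y) /\
  b = add (mul (add (mul hi (smash y oneM)) v) (smash u y)) lo))).

(** The existentially quantified string of length [i] in [entryM] is replaced by [un z i], which
    makes entries a PV function for [i] up to [len z]. *)
Definition ent z w i : M := modM (divM (p1 w) (smash (un z i) (p2 w))) (E2 (p2 w)).

Lemma smash_neq0 x y : smash x y <> zeroM.
Proof. by move=> h; have := basic_len_smash x y; rewrite h mlen0 => /esym /Su_neq0. Qed.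
Lemma E2_neq0 x : E2 x <> zeroM. Proof. exact: smash_neq0. Qed.

Lemma ent_lt z w i : le (Su (ent z w i)) (E2 (p2 w)).
Proof. by apply: modM_lt; apply: E2_neq0. Qed.

Lemma entryMP z w i v : le i (len z) -> entryM w i v <-> v = ent z w i.
Proof.
move=> hi; split=> [[b [y [u [hi' [lo [/is_pairMP[-> ->] [hu [hv [hlo e]]]]]]]]]|->].
  have hs : smash u (p2 w) = smash (un z i) (p2 w) by apply: basic_smash_len; rewrite len_un.
  rewrite /ent -hs e.
  have [-> _] := @divM_uniq M (add (mul (add (mul hi' (smash (p2 w) oneM)) v) (smash u (p2 w))) lo)
     (smash u (p2 w)) (add (mul hi' (smash (p2 w) oneM)) v) lo hlo ltac:(mring).
  have [_ ->] // := @divM_uniq M (add (mul hi' (smash (p2 w) oneM)) v) (E2 (p2 w)) hi' v hv ltac:(rewrite /E2; mring).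
exists (p1 w), (p2 w), (un z i), (divM (divM (p1 w) (smash (un z i) (p2 w))) (E2 (p2 w))),
  (modM (p1 w) (smash (un z i) (p2 w))); split; first exact/is_pairMP.
split; first exact: len_un.
split; first exact: ent_lt.
split; first by apply: modM_lt; apply: smash_neq0.
rewrite {1}(divM_eq (p1 w) (smash (un z i) (p2 w))).
rewrite {1}(divM_eq (divM (p1 w) (smash (un z i) (p2 w))) (E2 (p2 w))) -/(ent z w i).
by rewrite -/(E2 (p2 w)); mring.
Qed.

Lemma ent_indep z z' w i : le i (len z) -> le i (len z') -> ent z w i = ent z' w i.
Proof. by move=> h h'; apply/(entryMP w _ h')/(entryMP w _ h). Qed.

Lemma ent_pair z t y j : le j (len z) -> ent z (pair t y) j = dig z (E2 y) t j.
Proof. by move=> hj; rewrite /ent /dig p1_pair p2_pair powB_E2. Qed.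

End Digits.

Lemma PV_dig (M : model) : PV4 (@dig M).
Proof. by move=> K a b c d ha hb hc hd; rewrite /dig; pf. Qed.
Lemma PV_ent (M : model) : PV3 (@ent M).
Proof. by move=> K a b c ha hb hc; rewrite /ent; pf. Qed.
#[global] Hint Extern 2 (PF _ (fun _ => dig _ _ _ _)) => apply PV_dig : pf.
#[global] Hint Extern 2 (PF _ (fun _ => ent _ _ _)) => apply PV_ent : pf.

(** * The notions of the theorem in a model *)

Section Mirror.

Variable M : model.
Implicit Types (n d s m q r e x y z u v w i j k p t P L G C D H a h tag l : M).

(** These definitions follow the formulas connective by connective, down to the nesting of
    conjunctions and to negations as implications, so that their agreement with the formulas is
    proved by structural rules alone. *)
Definition in_LogM n := exists z, len z = n.
Definition unaryM u n := len u = n /\ Su u = smash u oneM.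
Definition is_stringM x m := len x = Su m.
Definition int_partsM z p q :=
  (z = mul twoM p /\ q = zeroM) \/ (z = Su (mul twoM q) /\ (p = zeroM /\ (q = zeroM -> False))).
Definition is_intM z := exists p q, int_partsM z p q.
Definition int_addM x y z := exists p q p' q' p'' q'',
  int_partsM x p q /\ (int_partsM y p' q' /\ (int_partsM z p'' q'' /\
  add (add p p') q'' = add (add q q') p'')).
Definition int_mulM x y z := exists p q p' q' p'' q'',
  int_partsM x p q /\ (int_partsM y p' q' /\ (int_partsM z p'' q'' /\
  add (add (mul p p') (mul q q')) q'' = add (add (mul p q') (mul q p')) p'')).
Definition circuitM P L p G C := exists u v w w',
  unaryM u L /\ (unaryM v p /\ (is_pairM P u w /\ (is_pairM w v w' /\ is_pairM w' G C))).
Definition gateM G i tag j k := exists g w,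
  entryM G i g /\ (is_pairM g tag w /\ is_pairM w j k).
Definition threeM : M := Su twoM.
Definition well_formedM n L p G C :=
  le oneM L /\
  ((forall i, le (Su i) L ->
     ((exists j, le (Su j) n /\ gateM G i zeroM j zeroM) \/
      ((exists j, le (Su j) p /\ gateM G i oneM j zeroM) \/
       (exists j k, le (Su j) i /\ (le (Su k) i /\ (gateM G i twoM j k \/ gateM G i threeM j k)))))) /\
  (forall j, le (Su j) p -> exists c, entryM C j c /\ is_intM c)).
Definition degreesM G L tag j0 D := forall i, le (Su i) L -> exists e, entryM D i e /\
  ((gateM G i tag j0 zeroM -> e = oneM) /\
  ((forall tag' j, (le tag' oneM /\ (gateM G i tag' j zeroM /\
      ((tag' = tag -> False) \/ (j = j0 -> False)))) -> e = zeroM) /\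
  ((forall j k, gateM G i twoM j k -> exists a b, entryM D j a /\ (entryM D k b /\
      ((le a b -> e = b) /\ (le b a -> e = a)))) /\
   (forall j k, gateM G i threeM j k -> exists a b, entryM D j a /\ (entryM D k b /\
      e = add a b))))).
Definition CktM n d s P := le (len P) s /\
  (exists L p G C, circuitM P L p G C /\ (well_formedM n L p G C /\
    forall tag j, ((tag = zeroM /\ le (Su j) n) \/ (tag = oneM /\ le (Su j) p)) ->
      exists D l e, degreesM G L tag j D /\ (L = Su l /\ (entryM D l e /\ le e d)))).
Definition is_pointM n a := forall j, le (Su j) n -> exists z, entryM a j z /\ is_intM z.
Definition tableM L G C a t := forall i z, (le (Su i) L /\ entryM t i (Su z)) ->
  ((exists j, gateM G i zeroM j zeroM /\ entryM a j z) \/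
   ((exists j, gateM G i oneM j zeroM /\ entryM C j z) \/
    (exists j k x y, entryM t j (Su x) /\ (entryM t k (Su y) /\
      ((gateM G i twoM j k /\ int_addM x y z) \/ (gateM G i threeM j k /\ int_mulM x y z)))))).
Definition evaluatesM P a v := exists L p G C t l,
  circuitM P L p G C /\ (L = Su l /\ (entryM t l (Su v) /\ tableM L G C a t)).
Definition nonzero_atM P a := exists v, evaluatesM P a v /\ (v = zeroM -> False).
Definition in_sliceM (g : pv 5) e n d s m P := exists n1 d1 s1 x,
  unaryM n1 n /\ (unaryM d1 d /\ (unaryM s1 s /\ (is_stringM x m /\
  P = appl g [:: e; n1; d1; s1; x]))).
Definition decodesM g e n d s m := forall P, in_sliceM g e n d s m P -> CktM n d s P.
Definition in_gridM q n h := forall j, le (Su j) n -> exists x, le (Su x) q /\ entryM h j (mul twoM x).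
Definition grid_pointsM q n r H := forall i, le (Su i) r -> exists h, entryM H i h /\ in_gridM q n h.
Definition hitting_setM g e n d s m r H := forall P, in_sliceM g e n d s m P ->
  (exists a, is_pointM n a /\ nonzero_atM P a) ->
  exists i h, le (Su i) r /\ (entryM H i h /\ nonzero_atM P h).

Definition small_hitting_setsM g := forall e n d s q r m,
  (in_LogM n /\ (in_LogM d /\ (in_LogM s /\ (in_LogM q /\ (in_LogM r /\ in_LogM m))))) ->
  decodesM g e n d s m ->
  le (mul (mul twoM d) n) q ->
  le (Su (add m (mul n (len q)))) r ->
  exists H, grid_pointsM q n r H /\ hitting_setM g e n d s m r H.

End Mirror.

(** * The formulas denote these notions *)

Section Den.

Variables (M : model).
Implicit Types st : seq M.

Lemma den_unary st tu' tn' u n :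
  den st tu' u -> den st tn' n ->
  denP st (unary tu' tn') (unaryM u n).
Proof. rewrite /unary /unaryM; den_unfold=> *; den. Qed.
#[local] Hint Resolve den_unary : den.
Lemma den_is_string st tx' tm' x m :
  den st tx' x -> den st tm' m ->
  denP st (is_string tx' tm') (is_stringM x m).
Proof. rewrite /is_string /is_stringM; den_unfold=> *; den. Qed.
#[local] Hint Resolve den_is_string : den.
Lemma den_is_pair st tz' tx' ty' z x y :
  den st tz' z -> den st tx' x -> den st ty' y ->
  denP st (is_pair tz' tx' ty') (is_pairM z x y).
Proof. rewrite /is_pair /is_pairM; den_unfold=> *; den. Qed.
#[local] Hint Resolve den_is_pair : den.
Lemma den_entry st tw' ti' tv' w i v :
  den st tw' w -> den st ti' i -> den st tv' v ->
  denP st (entry tw' ti' tv') (entryM w i v).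
Proof. rewrite /entry /entryM; den_unfold=> *; den. Qed.
#[local] Hint Resolve den_entry : den.
Lemma den_int_parts st tz' tp' tq' z p q :
  den st tz' z -> den st tp' p -> den st tq' q ->
  denP st (int_parts tz' tp' tq') (int_partsM z p q).
Proof. rewrite /int_parts /int_partsM; den_unfold=> *; den. Qed.
#[local] Hint Resolve den_int_parts : den.
Lemma den_is_int st tz' z :
  den st tz' z ->
  denP st (is_int tz') (is_intM z).
Proof. rewrite /is_int /is_intM; den_unfold=> *; den. Qed.
#[local] Hint Resolve den_is_int : den.
Lemma den_int_add st tx' ty' tz' x y z :
  den st tx' x -> den st ty' y -> den st tz' z ->
  denP st (int_add tx' ty' tz') (int_addM x y z).
Proof. rewrite /int_add /int_addM; den_unfold=> *; den. Qed.
#[local] Hint Resolve den_int_add : den.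
Lemma den_int_mul st tx' ty' tz' x y z :
  den st tx' x -> den st ty' y -> den st tz' z ->
  denP st (int_mul tx' ty' tz') (int_mulM x y z).
Proof. rewrite /int_mul /int_mulM; den_unfold=> *; den. Qed.
#[local] Hint Resolve den_int_mul : den.
Lemma den_circuit st tP' tL' tp' tG' tC' P L p G C :
  den st tP' P -> den st tL' L -> den st tp' p -> den st tG' G -> den st tC' C ->
  denP st (circuit tP' tL' tp' tG' tC') (circuitM P L p G C).
Proof. rewrite /circuit /circuitM; den_unfold=> *; den. Qed.
#[local] Hint Resolve den_circuit : den.
Lemma den_gate st tG' ti' ttag' tj' tk' G i tag j k :
  den st tG' G -> den st ti' i -> den st ttag' tag -> den st tj' j -> den st tk' k ->
  denP st (gate tG' ti' ttag' tj' tk') (gateM G i tag j k).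
Proof. rewrite /gate /gateM; den_unfold=> *; den. Qed.
#[local] Hint Resolve den_gate : den.
Lemma den_well_formed st tn' tL' tp' tG' tC' n L p G C :
  den st tn' n -> den st tL' L -> den st tp' p -> den st tG' G -> den st tC' C ->
  denP st (well_formed tn' tL' tp' tG' tC') (well_formedM n L p G C).
Proof. rewrite /well_formed /var_gate /par_gate /add_gate /mul_gate /Defs.three /well_formedM /threeM; den_unfold=> *; den. Qed.
#[local] Hint Resolve den_well_formed : den.
Lemma den_degrees st tG' tL' ttag' tj' tD' G L tag j D :
  den st tG' G -> den st tL' L -> den st ttag' tag -> den st tj' j -> den st tD' D ->
  denP st (degrees tG' tL' ttag' tj' tD') (degreesM G L tag j D).
Proof. rewrite /degrees /add_gate /mul_gate /Defs.three /degreesM /threeM; den_unfold=> *; den. Qed.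
#[local] Hint Resolve den_degrees : den.
Lemma den_Ckt st tn' td' ts' tP' n d s P :
  den st tn' n -> den st td' d -> den st ts' s -> den st tP' P ->
  denP st (Ckt tn' td' ts' tP') (CktM n d s P).
Proof. rewrite /Ckt /CktM; den_unfold=> *; den. Qed.
#[local] Hint Resolve den_Ckt : den.
Lemma den_is_point st tn' ta' n a :
  den st tn' n -> den st ta' a ->
  denP st (is_point tn' ta') (is_pointM n a).
Proof. rewrite /is_point /is_pointM; den_unfold=> *; den. Qed.
#[local] Hint Resolve den_is_point : den.
Lemma den_evaluates st tP' ta' tv' P a v :
  den st tP' P -> den st ta' a -> den st tv' v ->
  denP st (evaluates tP' ta' tv') (evaluatesM P a v).
Proof. rewrite /evaluates /var_gate /par_gate /add_gate /mul_gate /Defs.three /evaluatesM /tableM /threeM; den_unfold=> *; den. Qed.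
#[local] Hint Resolve den_evaluates : den.
Lemma den_nonzero_at st tP' ta' P a :
  den st tP' P -> den st ta' a ->
  denP st (nonzero_at tP' ta') (nonzero_atM P a).
Proof. rewrite /nonzero_at /nonzero_atM; den_unfold=> *; den. Qed.
#[local] Hint Resolve den_nonzero_at : den.

Lemma den_in_slice g st te' tn' td' ts' tm' tP' e n d s m P :
  den st te' e -> den st tn' n -> den st td' d -> den st ts' s -> den st tm' m -> den st tP' P ->
  denP st (in_slice g te' tn' td' ts' tm' tP') (in_sliceM g e n d s m P).
Proof. rewrite /in_slice /in_sliceM => *; den. Qed.
#[local] Hint Resolve den_in_slice : den.

Lemma den_small_hitting_sets g : denP (M := M) [::] (small_hitting_sets g) (small_hitting_setsM M g).
Proof.
rewrite /small_hitting_sets /in_Log /decodes /grid_points /in_grid /hitting_set; den_unfold.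
rewrite /small_hitting_setsM /in_LogM /decodesM /grid_pointsM /in_gridM /hitting_setM.
den.
Qed.

End Den.

Lemma small_hitting_sets_sound g :
  (forall M : model, small_hitting_setsM M g) -> proves S12_dWPHP nil (close (small_hitting_sets g)).
Proof.
move=> h; apply: completeness => [A s|M hM rho]; first exact: S12_dWPHP_fsubst.
exact/(denP_close rho (@den_small_hitting_sets (Model hM) g))/h.
Qed.

(** * Integers *)

Section Ints.

Variable M : model.
Implicit Types (x y z u v w i j p q t d : M) (K : M -> Prop) (rho : nat -> M).

Definition ipos z : M := ite (parity z = zeroM) (halfM z) zeroM.
Definition ineg z : M := ite (parity z = zeroM) zeroM (halfM z).
Definition intv z : Z M := (zi (ipos z) - zi (ineg z))%R.
Definition mkint p q : M := ite (le q p) (mul twoM (subM p q)) (Su (mul twoM (subM q p))).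
Definition iadd x y : M := mkint (add (ipos x) (ipos y)) (add (ineg x) (ineg y)).
Definition isub x y : M := mkint (add (ipos x) (ineg y)) (add (ineg x) (ipos y)).
Definition imul x y : M := mkint (add (mul (ipos x) (ipos y)) (mul (ineg x) (ineg y)))
  (add (mul (ipos x) (ineg y)) (mul (ineg x) (ipos y))).

Lemma ipos_double p : ipos (mul twoM p) = p.
Proof. by rewrite /ipos parity_even iteT // half_double. Qed.
Lemma ineg_double p : ineg (mul twoM p) = zeroM.
Proof. by rewrite /ineg parity_even iteT. Qed.
Lemma ipos_doubleS p : ipos (Su (mul twoM p)) = zeroM.
Proof. by rewrite /ipos parity_odd iteF //; apply: one_neq0. Qed.
Lemma ineg_doubleS p : ineg (Su (mul twoM p)) = p.
Proof. by rewrite /ineg parity_odd iteF ?half_doubleS //; apply: one_neq0. Qed.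

Lemma intv_double p : intv (mul twoM p) = zi p.
Proof. by rewrite /intv ipos_double ineg_double zi0 subr0. Qed.
Lemma intv_doubleS p : intv (Su (mul twoM p)) = (- zi p)%R.
Proof. by rewrite /intv ipos_doubleS ineg_doubleS zi0 sub0r. Qed.

(** The number 1 would code -0 and is the only one that codes no integer. Hence integers are handled
    through total functions [ipos] and [ineg] with the side condition [z <> oneM]. *)
Lemma int_partsP z p q : int_partsM z p q <-> z <> oneM /\ p = ipos z /\ q = ineg z.
Proof.
split=> [[[-> ->]|[-> [-> nq]]]|[nz [-> ->]]].
- rewrite ipos_double ineg_double; split=> // h.
  by case: (@nlt M oneM); case: (pselect (p = zeroM)) => [e|/le_one h1];
    [rewrite e basic_mul0 in h|]; mz.
- rewrite ipos_doubleS ineg_doubleS; split=> // h; apply: nq.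
  by have h1 := Su_inj h; mz.
case: (half_cases z) => e; rewrite -e.
  by left; rewrite ipos_double ineg_double.
right; rewrite ipos_doubleS ineg_doubleS; split=> //; split=> // h; apply: nz.
by rewrite -e h basic_mul0.
Qed.

Lemma is_intP z : is_intM z <-> z <> oneM.
Proof.
split=> [[p [q /int_partsP[]]] //|h].
by exists (ipos z), (ineg z); apply/int_partsP.
Qed.

Lemma intv_inj x y : x <> oneM -> y <> oneM -> intv x = intv y -> x = y.
Proof.
move=> hx hy; case: (half_cases x) => ex; case: (half_cases y) => ey;
  rewrite -{1}ex -{1}ey ?intv_double ?intv_doubleS => e.
- by rewrite -ex -ey (zi_inj e).
- exfalso; apply: hy; rewrite -ey; suff -> : halfM y = zeroM by rewrite basic_mul0.
  by mz0; lra.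
- exfalso; apply: hx; rewrite -ex; suff -> : halfM x = zeroM by rewrite basic_mul0.
  by mz0; lra.
- by rewrite -ex -ey (zi_inj (oppr_inj e)).
Qed.

Lemma intv_mkint p q : intv (mkint p q) = (zi p - zi q)%R.
Proof.
rewrite /mkint; case: (pselect (le q p)) => h.
  by rewrite iteT // intv_double zi_sub.
have h' : le p q by apply: le_Su_le; apply/not_le_lt.
by rewrite iteF // intv_doubleS zi_sub // opprB.
Qed.
Lemma mkint_neq1 p q : mkint p q <> oneM.
Proof.
rewrite /mkint; case: (pselect (le q p)) => h.
  rewrite iteT // => e; have [] := @div_mod_uniq M twoM (subM p q) zeroM zeroM oneM
    ltac:(mz) ltac:(mz) ltac:(mz).
  by move=> _ /esym/one_neq0.
rewrite iteF //; move/not_le_lt: h => h e; have h1 := subMK (le_Su_le h).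
by mz.
Qed.

Lemma intv_iadd x y : intv (iadd x y) = (intv x + intv y)%R.
Proof. by rewrite intv_mkint /intv !ziD; ring. Qed.
Lemma intv_isub x y : intv (isub x y) = (intv x - intv y)%R.
Proof. by rewrite intv_mkint /intv !ziD; ring. Qed.
Lemma intv_imul x y : intv (imul x y) = (intv x * intv y)%R.
Proof. by rewrite intv_mkint /intv !ziD !ziM; ring. Qed.

Lemma int_addP x y z : int_addM x y z <-> x <> oneM /\ y <> oneM /\ z = iadd x y.
Proof.
split=> [[p [q [p' [q' [p'' [q'' [/int_partsP[hx [-> ->]] [/int_partsP[hy [-> ->]]
   [/int_partsP[hz [-> ->]] e]]]]]]]]]|[hx [hy ->]]].
  split=> //; split=> //; apply: intv_inj => //; first exact: mkint_neq1.
  by move: e => /(congr1 (@zi M)); rewrite intv_iadd /intv !ziD => e; lra.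
exists (ipos x), (ineg x), (ipos y), (ineg y), (ipos (iadd x y)), (ineg (iadd x y)).
split; first exact/int_partsP.
split; first exact/int_partsP.
split; first by apply/int_partsP; split=> //; apply: mkint_neq1.
by have := intv_iadd x y; rewrite /intv => h; mz.
Qed.

Lemma int_mulP x y z : int_mulM x y z <-> x <> oneM /\ y <> oneM /\ z = imul x y.
Proof.
split=> [[p [q [p' [q' [p'' [q'' [/int_partsP[hx [-> ->]] [/int_partsP[hy [-> ->]]
   [/int_partsP[hz [-> ->]] e]]]]]]]]]|[hx [hy ->]]].
  split=> //; split=> //; apply: intv_inj => //; first exact: mkint_neq1.
  by move: e => /(congr1 (@zi M)); rewrite intv_imul /intv !(ziD, ziM) => e; lra.
exists (ipos x), (ineg x), (ipos y), (ineg y), (ipos (imul x y)), (ineg (imul x y)).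
split; first exact/int_partsP.
split; first exact/int_partsP.
split; first by apply/int_partsP; split=> //; apply: mkint_neq1.
by have := intv_imul x y; rewrite /intv => h; mz.
Qed.

Lemma zi_half z : zi (halfM z) = `|intv z|%R.
Proof.
case: (half_cases z) => <-; rewrite ?intv_double ?intv_doubleS ?half_double ?half_doubleS ?normrN;
  by rewrite ger0_norm // zi_ge0.
Qed.

Lemma intv_eq0 z : z <> oneM -> intv z = 0%R -> z = zeroM.
Proof.
move=> hz h; apply: intv_inj => //; first by move=> /esym/one_neq0.
by rewrite h -(basic_mul0 twoM) intv_double zi0.
Qed.
Lemma intv0 : intv zeroM = 0%R.
Proof. by rewrite -(basic_mul0 twoM) intv_double zi0. Qed.

Lemma half_iadd x y : le (halfM (iadd x y)) (add (halfM x) (halfM y)).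
Proof. by apply/zi_le; rewrite ziD !zi_half intv_iadd ler_normD. Qed.
Lemma half_imul x y : halfM (imul x y) = mul (halfM x) (halfM y).
Proof. by apply: zi_inj; rewrite ziM !zi_half intv_imul normrM. Qed.
Lemma le_double_half z : le z (Su (mul twoM (halfM z))).
Proof. by case: (half_cases z) => {1}<-; [apply: le_S|apply: mle_refl]. Qed.

(** Divisor 0 is included: divisibility by 0 means being 0, so that congruence modulo 0 is
    equality. *)
Definition dvdZ (a b : Z M) := exists c, b = (a * c)%R.

Lemma dvdZ0 (a : Z M) : dvdZ a 0%R. Proof. by exists 0%R; rewrite mulr0. Qed.
Lemma dvdZD (a b c : Z M) : dvdZ a b -> dvdZ a c -> dvdZ a (b + c)%R.
Proof. by move=> [u ->] [v ->]; exists (u + v)%R; rewrite mulrDr. Qed.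
Lemma dvdZN (a b : Z M) : dvdZ a b -> dvdZ a (- b)%R.
Proof. by move=> [u ->]; exists (- u)%R; rewrite mulrN. Qed.
Lemma dvdZM (a b c : Z M) : dvdZ a b -> dvdZ a (b * c)%R.
Proof. by move=> [u ->]; exists (u * c)%R; rewrite mulrA. Qed.
Lemma dvdZ0l (b : Z M) : dvdZ 0%R b -> b = 0%R.
Proof. by move=> [u ->]; rewrite mul0r. Qed.

Lemma zi_or_opp (r : Z M) : exists x, r = zi x \/ r = (- zi x)%R.
Proof.
case: (lerP 0%R r) => h; first by have [x hx] := zi_ex h; exists x; left.
have [x hx] : exists x, (- r)%R = zi x by apply: zi_ex; lra.
by exists x; right; rewrite -hx opprK.
Qed.

(** Divisibility in the ring becomes an equation between PV functions, to which induction
    applies. *)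
Lemma modM_eq0 x d : modM x d = zeroM <-> dvdZ (zi d) (zi x).
Proof.
split=> [h|[c e]].
  by exists (zi (divM x d)); rewrite -ziM {1}(divM_eq x d) h basic_add0.
case: (pselect (d = zeroM)) => [ed|nd].
  by rewrite ed modM0; apply: zi_inj; rewrite e ed zi0 mul0r.
have [k [ek|ek]] := zi_or_opp c.
  have [] // := @divM_uniq M x d k zeroM; first by apply: le_one.
  by apply: zi_inj; rewrite e ek !zE addr0.
have hd := le_one nd; have : x = zeroM.
  by have e' := e; rewrite ek in e'; have h0 := zi_ge0 (mul d k); rewrite ziM in h0; mz0; lra.
by move=> ->; rewrite modM_small.
Qed.

Lemma modM_half_isub x y d : modM (halfM (isub x y)) d = zeroM <-> dvdZ (zi d) (intv x - intv y)%R.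
Proof.
rewrite modM_eq0 zi_half intv_isub; case: ger0P => _ //.
by split=> /dvdZN; rewrite ?opprK.
Qed.

End Ints.

Lemma PV_ipos (M : model) : PV1 (@ipos M).
Proof. by move=> K a ha; rewrite /ipos; apply: PF_ite; [apply: PD_eq; [apply: PV_parity|]|..]; pf. Qed.
Lemma PV_ineg (M : model) : PV1 (@ineg M).
Proof. by move=> K a ha; rewrite /ineg; apply: PF_ite; [apply: PD_eq; [apply: PV_parity|]|..]; pf. Qed.
Lemma PV_mkint (M : model) : PV2 (@mkint M).
Proof. by move=> K a b ha hb; rewrite /mkint; pf. Qed.
#[global] Hint Extern 2 (PF _ (fun _ => ipos _)) => apply PV_ipos : pf.
#[global] Hint Extern 2 (PF _ (fun _ => ineg _)) => apply PV_ineg : pf.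
#[global] Hint Extern 2 (PF _ (fun _ => mkint _ _)) => apply PV_mkint : pf.
Lemma PV_iadd (M : model) : PV2 (@iadd M).
Proof. by move=> K a b ha hb; rewrite /iadd; pf. Qed.
Lemma PV_isub (M : model) : PV2 (@isub M).
Proof. by move=> K a b ha hb; rewrite /isub; pf. Qed.
Lemma PV_imul (M : model) : PV2 (@imul M).
Proof. by move=> K a b ha hb; rewrite /imul; pf. Qed.
#[global] Hint Extern 2 (PF _ (fun _ => iadd _ _)) => apply PV_iadd : pf.
#[global] Hint Extern 2 (PF _ (fun _ => isub _ _)) => apply PV_isub : pf.
#[global] Hint Extern 2 (PF _ (fun _ => imul _ _)) => apply PV_imul : pf.

(** * Logarithmic numbers and course-of-values induction below them *)

Section Logs.

Variable M : model.
Implicit Types (x y z u v w i j k t B L : M) (K : M -> Prop) (rho : nat -> M).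

Definition inlog i := exists z, le i (len z).

Lemma inlog_le i j : le i j -> inlog j -> inlog i.
Proof. by move=> h [z hz]; exists z; apply: mle_trans hz. Qed.
Lemma inlog_mul i j : inlog i -> inlog j -> inlog (mul i j).
Proof.
move=> [x hx] [y hy]; exists (smash x y); rewrite basic_len_smash.
exact: mle_trans (le_mul2 hx hy) (le_S _).
Qed.
Lemma inlog_one : inlog oneM.
Proof. by exists oneM; rewrite basic_len1; apply: mle_refl. Qed.
Lemma inlog_len x : inlog (len x).
Proof. by exists x; apply: mle_refl. Qed.
Lemma inlog_S i : inlog i -> inlog (Su i).
Proof.
move=> [x hx]; exists (Su (mul twoM x)); rewrite len_doubleS.
exact/le_SS.
Qed.
Lemma inlog_add i j : inlog i -> inlog j -> inlog (add i j).
Proof.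
move=> hi hj; apply: inlog_le (inlog_mul (inlog_S hi) (inlog_S hj)).
by have h := basic_ge0 (mul i j); mz.
Qed.
Lemma in_LogMP i : in_LogM i <-> inlog i.
Proof.
split=> [[z <-]|[z h]]; first exact: inlog_len.
by have [u [_ hu]] := len_down h; exists u.
Qed.

(** The hypothesis for all smaller numbers is a universal quantifier bounded by a length, which does
    not leave Sigma^b_1; ordinary length induction then proves it. *)
Lemma SLIND (A : M -> Prop) z L : le L (len z) -> Sg (fun rho => A (rho 0)) ->
  (forall i, le (Su i) L -> (forall k, le (Su k) i -> A k) -> A i) ->
  forall i, le (Su i) L -> A i.
Proof.
move=> hL sA h i hi.
suff: forall k, le k (len z) -> le (Su k) (Su i) -> A k.
  by apply; [apply: mle_trans (le_Su_le hi) hL|apply: mle_refl].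
suff: le (Su i) L -> forall k, le k (len z) -> le (Su k) (Su i) -> A k by apply.
have : le (Su i) (len z) by apply: mle_trans hi hL.
move: (Su i); apply: LIND.
- apply: Sg_imp; first by sb.
  apply: (Sg_all (b := fun=> z)); first by pf.
  by apply: Sg_imp; [sb|apply: (Sg_comp sA); pf].
- by move=> _ k _ h'; mz.
move=> j hj IH hjL k hk hkj.
case: (pselect (k = j)) => [->|ne].
  apply: h => // l hl; apply: IH => //; first exact: le_Su_le.
  by apply: mle_trans hj; apply: mle_trans (le_Su_le hl) (le_S _).
apply: IH => //; first exact: le_Su_le.
by apply: le_neq_lt => //; apply/le_SS.
Qed.

(** A digit is not changed by later steps, so what was computed from the partial table is read off
    the final one. *)
Lemma cov_dig K (h B : (nat -> M) -> M) : PF K h -> PF K B ->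
  exists T : M -> M -> (nat -> M) -> M,
  PF K (fun rho => T (rho 0) (rho 1) (fun n => rho n.+2)) /\
  forall z rho, B rho <> zeroM -> forall i, le i (len z) ->
    le (Su (T z i rho)) (powB z (B rho) i) /\
    (forall j, le (Su j) i ->
      dig z (B rho) (T z i rho) j =
        minM (h (econs2 (T z j rho) j rho)) (subM (B rho) oneM) /\
      forall k, le (Su k) j -> dig z (B rho) (T z j rho) k = dig z (B rho) (T z i rho) k).
Proof.
move=> hh hB; have [T [pT hT]] := cov_ex hh hB; exists T; split=> // z rho nB.
have [T0 TS] := hT z rho nB.
pose c j := minM (h (econs2 (T z j rho) j rho)) (subM (B rho) oneM).
have cB i : le (Su i) (len z) -> le (Su (c i)) (B rho).
  move=> _; have h1 := min_le_r (h (econs2 (T z i rho) i rho)) (subM (B rho) oneM).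
  by have h2 := subMK (le_one nB); rewrite /c; mz.
have pT' : PF anyc (fun env => T z (env 0) rho).
  have pT0 : PF anyc (fun rho => T (rho 0) (rho 1) (fun n => rho n.+2)) by apply: PF_sub pT.
  apply: (PF_subst pT0 (s := fun n env => if n is m.+1 then
    if m is k.+1 then rho k else env 0 else z)).
  by case=> [|[|n]]; pf.
move=> i hi; split; first exact: (table_lt pT' T0 TS cB hi).
move=> j hj; split; first exact: (dig_table nB pT' T0 TS cB hi hj).
move=> k hk; have lj : le j (len z) by apply: mle_trans (le_Su_le hj) hi.
rewrite (dig_table nB pT' T0 TS cB lj hk) (dig_table nB pT' T0 TS cB hi) //.
by apply: mle_trans hk (le_Su_le hj).
Qed.

End Logs.

(** * Circuits *)

Section CircuitFunctions.

Variable M : model.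
Implicit Types (P G C L p z i j k tag a t v : M).

Definition cL P : M := len (p1 P).
Definition cp P : M := len (p1 (p2 P)).
Definition cG P : M := p1 (p2 (p2 P)).
Definition cC P : M := p2 (p2 (p2 P)).

Lemma circuitMP P L p G C : circuitM P L p G C -> [/\ L = cL P, p = cp P, G = cG P & C = cC P].
Proof.
move=> [u [v [w [w' [[hu _] [[hv _] [/is_pairMP[eu ew] [/is_pairMP[ev ew'] /is_pairMP[-> ->]]]]]]]]].
by rewrite /cL /cp /cG /cC -ew -ew' -ev -eu hu hv.
Qed.

Definition gt z G i : M := p1 (ent z G i).
Definition gj z G i : M := p1 (p2 (ent z G i)).
Definition gk z G i : M := p2 (p2 (ent z G i)).

Lemma gateMP z G i tag j k : le i (len z) ->
  gateM G i tag j k <-> [/\ tag = gt z G i, j = gj z G i & k = gk z G i].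
Proof.
move=> hi; split=> [[g [w [/(entryMP _ _ hi) -> [/is_pairMP[-> ->] /is_pairMP[-> ->]]]]]|[-> -> ->]] //.
exists (ent z G i), (p2 (ent z G i)); split; first exact/(entryMP _ _ hi).
by split; apply/is_pairMP.
Qed.

End CircuitFunctions.

Lemma PV_gt (M : model) : PV3 (@gt M).
Proof. by move=> K a b c ha hb hc; rewrite /gt; pf. Qed.
Lemma PV_gj (M : model) : PV3 (@gj M).
Proof. by move=> K a b c ha hb hc; rewrite /gj; pf. Qed.
Lemma PV_gk (M : model) : PV3 (@gk M).
Proof. by move=> K a b c ha hb hc; rewrite /gk; pf. Qed.
Lemma PV_cL (M : model) : PV1 (@cL M).
Proof. by move=> K a ha; rewrite /cL; pf. Qed.
Lemma PV_cG (M : model) : PV1 (@cG M).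
Proof. by move=> K a ha; rewrite /cG; pf. Qed.
Lemma PV_cC (M : model) : PV1 (@cC M).
Proof. by move=> K a ha; rewrite /cC; pf. Qed.
#[global] Hint Extern 2 (PF _ (fun _ => gt _ _ _)) => apply PV_gt : pf.
#[global] Hint Extern 2 (PF _ (fun _ => gj _ _ _)) => apply PV_gj : pf.
#[global] Hint Extern 2 (PF _ (fun _ => gk _ _ _)) => apply PV_gk : pf.
#[global] Hint Extern 2 (PF _ (fun _ => cL _)) => apply PV_cL : pf.
#[global] Hint Extern 2 (PF _ (fun _ => cG _)) => apply PV_cG : pf.
#[global] Hint Extern 2 (PF _ (fun _ => cC _)) => apply PV_cC : pf.

Lemma tags_distinct (M : model) : [/\ zeroM <> oneM :> M, zeroM <> twoM :> M, zeroM <> threeM M,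
  oneM <> twoM :> M & oneM <> threeM M] /\ twoM <> threeM M.
Proof. by rewrite /threeM; split; [split|]; move=> h; mz. Qed.

Ltac tags := exfalso;
  match goal with z : carrier (model_structure ?M) |- _ =>
    have [[? ? ? ? ?] ?] := tags_distinct M; congruence end.

Section Circuit.

Variable M : model.
Variables n L p G C z : M.
Implicit Types (i j k a t v x y lo hi d D tag : M).

Hypothesis hL : le L (len z).
Hypothesis hn : le n (len z).
Hypothesis hp : le p (len z).
Hypothesis wf : well_formedM n L p G C.

Inductive gate_spec i : Prop :=
| GVar of gt z G i = zeroM & gk z G i = zeroM & le (Su (gj z G i)) n
| GPar of gt z G i = oneM & gk z G i = zeroM & le (Su (gj z G i)) p
| GAdd of gt z G i = twoM & le (Su (gj z G i)) i & le (Su (gk z G i)) i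
| GMul of gt z G i = threeM M & le (Su (gj z G i)) i & le (Su (gk z G i)) i.

Lemma lt_L_len i : le (Su i) L -> le i (len z).
Proof. by move=> hi; apply: mle_trans (le_Su_le hi) hL. Qed.

Lemma wf_gate i : le (Su i) L -> gate_spec i.
Proof.
move=> hi; have li := lt_L_len hi; have [_ [h _]] := wf.
case: (h i hi) => [[j [hj /(gateMP _ _ _ _ li)[e1 e2 e3]]]|[[j [hj /(gateMP _ _ _ _ li)[e1 e2 e3]]]|]].
- by apply: GVar; rewrite -?e2.
- by apply: GPar; rewrite -?e2.
move=> [j [k [hj [hk []]]]] /(gateMP _ _ _ _ li)[e1 e2 e3].
  by apply: GAdd; rewrite -?e2 -?e3.
by apply: GMul; rewrite -?e2 -?e3.
Qed.

Lemma wf_par j : le (Su j) p -> ent z C j <> oneM.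
Proof.
move=> hj; have [_ [_ h]] := wf; have [c [hc /is_intP hi]] := h j hj.
have lj : le j (len z) by apply: mle_trans (le_Su_le hj) hp.
by move/(entryMP _ _ lj): hc => <-.
Qed.

Lemma point_int a j : is_pointM n a -> le (Su j) n -> ent z a j <> oneM.
Proof.
move=> h hj; have [c [hc /is_intP hi]] := h j hj.
have lj : le j (len z) by apply: mle_trans (le_Su_le hj) hn.
by move/(entryMP _ _ lj): hc => <-.
Qed.

Definition tabz a t := forall i v, le (Su i) L -> ent z t i = Su v ->
  (gt z G i = zeroM /\ v = ent z a (gj z G i)) \/
  (gt z G i = oneM /\ v = ent z C (gj z G i)) \/
  (exists x y, [/\ ent z t (gj z G i) = Su x, ent z t (gk z G i) = Su y, x <> oneM, y <> oneM &
    (gt z G i = twoM /\ v = iadd x y) \/ (gt z G i = threeM M /\ v = imul x y)]).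

Lemma gj_len i : le (Su i) L -> le (gj z G i) (len z).
Proof.
move=> hi; have li := lt_L_len hi.
case: (wf_gate hi) => [_ _ h|_ _ h|_ h _|_ h _]; apply: mle_trans (le_Su_le h) _ => //.
Qed.
Lemma gk_len i : le (Su i) L -> le (gk z G i) (len z).
Proof.
move=> hi; have li := lt_L_len hi.
case: (wf_gate hi) => [_ -> _|_ -> _|_ _ h|_ _ h]; try exact: basic_ge0;
  exact: mle_trans (le_Su_le h) _.
Qed.

Lemma tableMP a t : tableM L G C a t <-> tabz a t.
Proof.
split=> h i v.
  move=> hi hv; have li := lt_L_len hi; have lj := gj_len hi; have lk := gk_len hi.
  have hv' : entryM t i (Su v) by apply/(entryMP _ _ li).
  case: (h i v (conj hi hv')) => [[j [/(gateMP _ _ _ _ li)[-> -> _]]]|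
    [[j [/(gateMP _ _ _ _ li)[-> -> _]]]|[j [k [x [y [hx [hy hop]]]]]]]].
  - by move/(entryMP _ _ lj) => ->; left.
  - by move/(entryMP _ _ lj) => ->; right; left.
  right; right; exists x, y.
  have [e2 e3] : j = gj z G i /\ k = gk z G i.
    by case: hop => [[/(gateMP _ _ _ _ li)[]]|[/(gateMP _ _ _ _ li)[]]].
  subst j k; move/(entryMP _ _ lj): hx => ->; move/(entryMP _ _ lk): hy => ->.
  case: hop => [[/(gateMP _ _ _ _ li)[-> _ _] /int_addP[h1 [h2 ->]]]|
    [/(gateMP _ _ _ _ li)[-> _ _] /int_mulP[h1 [h2 ->]]]]; split=> //; by [left|right].
move=> [hi]; have li := lt_L_len hi; have lj := gj_len hi; have lk := gk_len hi.
move=> /(entryMP _ _ li) /esym hv.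
case: (h i v hi hv) => [[e ->]|[[e ->]|[x [y [hx hy h1 h2 hop]]]]].
- left; exists (gj z G i); split; last exact/(entryMP _ _ lj).
  apply/(gateMP _ _ _ _ li); split=> //.
  by case: (wf_gate hi) => // e' *; tags.
- right; left; exists (gj z G i); split; last exact/(entryMP _ _ lj).
  apply/(gateMP _ _ _ _ li); split=> //.
  by case: (wf_gate hi) => // e' *; tags.
right; right; exists (gj z G i), (gk z G i), x, y.
split; first exact/(entryMP _ _ lj).
split; first exact/(entryMP _ _ lk).
by case: hop => -[e ->]; [left|right]; (split; first exact/(gateMP _ _ _ _ li));
  [apply/int_addP|apply/int_mulP].
Qed.

Lemma table_int a t i v : is_pointM n a -> tabz a t -> le (Su i) L -> ent z t i = Su v -> v <> oneM.
Proof.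
move=> ha ht hi hv; case: (ht i v hi hv) => [[e ->]|[[e ->]|[x [y [hx hy h1 h2 [[e ->]|[e ->]]]]]]].
- by case: (wf_gate hi) => [_ _ h'|e' *|e' *|e' *]; [apply: point_int|tags..].
- by case: (wf_gate hi) => [e' *|_ _ h'|e' *|e' *]; [tags|apply: wf_par|tags..].
- exact: mkint_neq1.
- exact: mkint_neq1.
Qed.

Lemma tabz_var a t i v : tabz a t -> le (Su i) L -> ent z t i = Su v -> gt z G i = zeroM ->
  v = ent z a (gj z G i).
Proof.
by move=> ht hi hv e; case: (ht i v hi hv) => [[]|[[]|[x [y [_ _ _ _ []]]]]] // => [?|[? _]|[? _]]; tags.
Qed.
Lemma tabz_par a t i v : tabz a t -> le (Su i) L -> ent z t i = Su v -> gt z G i = oneM ->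
  v = ent z C (gj z G i).
Proof.
by move=> ht hi hv e; case: (ht i v hi hv) => [[]|[[]|[x [y [_ _ _ _ []]]]]] // => [?|[? _]|[? _]]; tags.
Qed.
Lemma tabz_add a t i v : tabz a t -> le (Su i) L -> ent z t i = Su v -> gt z G i = twoM ->
  exists x y, [/\ ent z t (gj z G i) = Su x, ent z t (gk z G i) = Su y & v = iadd x y].
Proof.
move=> ht hi hv e; case: (ht i v hi hv) => [[? _]|[[? _]|[x [y [h1 h2 _ _ [[_ ->]|[? _]]]]]]]; try tags.
by exists x, y.
Qed.
Lemma tabz_mul a t i v : tabz a t -> le (Su i) L -> ent z t i = Su v -> gt z G i = threeM M ->
  exists x y, [/\ ent z t (gj z G i) = Su x, ent z t (gk z G i) = Su y & v = imul x y].
Proof.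
move=> ht hi hv e; case: (ht i v hi hv) => [[? _]|[[? _]|[x [y [h1 h2 _ _ [[? _]|[_ ->]]]]]]]; try tags.
by exists x, y.
Qed.

(* For [d = 0] this is the uniqueness of the value of a circuit at a point. *)
Lemma table_congruence a a' t t' d : tabz a t -> tabz a' t' ->
  (forall j, le (Su j) n -> dvdZ (zi d) (intv (ent z a j) - intv (ent z a' j))%R) ->
  forall i, le (Su i) L -> forall v v', ent z t i = Su v -> ent z t' i = Su v' ->
    dvdZ (zi d) (intv v - intv v')%R.
Proof.
move=> ht ht' hd.
(* The congruence is restated as an equation between PV functions of the gate, since the induction
   runs inside the model. *)
suff H i : le (Su i) L -> ent z t i <> zeroM -> ent z t' i <> zeroM ->
    modM (halfM (isub (subM (ent z t i) oneM) (subM (ent z t' i) oneM))) d = zeroM.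
  move=> i hi v v' hv hv'; have := H i hi; rewrite hv hv' => /(_ (@Su_neq0 _ _) (@Su_neq0 _ _)).
  have e x : subM (Su x) oneM = x.
    by apply: (@maddI _ oneM); rewrite subMK ?madd1r //; apply: le_one; apply: Su_neq0.
  by rewrite !e modM_half_isub.
move: i; apply: (SLIND hL).
  by apply: Sg_SB; apply: SB_imp; [|apply: SB_imp]; sb.
move=> i hi IH nt nt'.
have [v hv] : exists v, ent z t i = Su v.
  by exists (subM (ent z t i) oneM); rewrite -madd1r subMK //; apply: le_one.
have [v' hv'] : exists v, ent z t' i = Su v.
  by exists (subM (ent z t' i) oneM); rewrite -madd1r subMK //; apply: le_one.
have e x : subM (Su x) oneM = x.
  by apply: (@maddI _ oneM); rewrite subMK ?madd1r //; apply: le_one; apply: Su_neq0.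
rewrite hv hv' !e modM_half_isub.
have IH' k x x' : le (Su k) i -> ent z t k = Su x -> ent z t' k = Su x' ->
    dvdZ (zi d) (intv x - intv x')%R.
  move=> hk hx hx'; have := IH k hk; rewrite hx hx' => /(_ (@Su_neq0 _ _) (@Su_neq0 _ _)).
  by rewrite !e modM_half_isub.
case: (wf_gate hi) => [e1 _ l1|e1 _ l1|e1 l1 l2|e1 l1 l2].
- by rewrite (tabz_var ht hi hv e1) (tabz_var ht' hi hv' e1); apply: hd.
- by rewrite (tabz_par ht hi hv e1) (tabz_par ht' hi hv' e1) subrr; apply: dvdZ0.
- have [x [y [hx hy ->]]] := tabz_add ht hi hv e1.
  have [x' [y' [hx' hy' ->]]] := tabz_add ht' hi hv' e1; rewrite !intv_iadd.
  have -> : (intv x + intv y - (intv x' + intv y') = (intv x - intv x') + (intv y - intv y'))%R by ring.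
  by apply: dvdZD; [apply: IH' hx hx'|apply: IH' hy hy'].
- have [x [y [hx hy ->]]] := tabz_mul ht hi hv e1.
  have [x' [y' [hx' hy' ->]]] := tabz_mul ht' hi hv' e1; rewrite !intv_imul.
  have -> : (intv x * intv y - (intv x' * intv y') =
    (intv x - intv x') * intv y + (intv y - intv y') * intv x')%R by ring.
  by apply: dvdZD; apply: dvdZM; [apply: IH' hx hx'|apply: IH' hy hy'].
Qed.

End Circuit.

Lemma ite_le (M : model) (A : Prop) (x y b : M) : le x b -> le y b -> le (ite A x y) b.
Proof. by move=> h h'; case: (pselect A) => hA; [rewrite iteT|rewrite iteF]. Qed.

(** ** Syntactic degrees *)

Section Degrees.

Variable M : model.
Variables n L p G C z : M.
Implicit Types (i j k a t v x y lo hi d D tag : M).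

Hypothesis hL : le L (len z).
Hypothesis hN : le (add n p) (len z).
Hypothesis wf : well_formedM n L p G C.

Let hn : le n (len z). Proof. exact: mle_trans (le_addr _ _) hN. Qed.
Let hp : le p (len z). Proof. exact: mle_trans (le_addl _ _) hN. Qed.

(** Variables and parameters are numbered together: variables below [n], parameters from [n] to
    [n + p]. *)
Definition leaf_index i : M := ite (gt z G i = zeroM) (gj z G i) (add n (gj z G i)).

(** Degrees are taken jointly in the inputs with index in the interval [lo, hi). Single inputs and
    the total degree are the extreme cases, and splitting intervals leads from the former to the
    latter. *)
Definition deg_step dj dk lo hi i : M :=
  ite (gt z G i = twoM) (ite (le dj dk) dk dj)
    (ite (gt z G i = threeM M) (add dj dk)
      (ite (le lo (leaf_index i) /\ le (Su (leaf_index i)) hi) oneM zeroM)).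

Lemma deg_step_leaf dj dk lo hi i : gt z G i = zeroM \/ gt z G i = oneM ->
  deg_step dj dk lo hi i = ite (le lo (leaf_index i) /\ le (Su (leaf_index i)) hi) oneM zeroM.
Proof.
move=> h; have h2 : gt z G i <> twoM by case: h => -> ?; tags.
have h3 : gt z G i <> threeM M by case: h => -> ?; tags.
by rewrite /deg_step (iteF _ _ h2) (iteF _ _ h3).
Qed.
Lemma deg_step_add dj dk lo hi i : gt z G i = twoM ->
  deg_step dj dk lo hi i = ite (le dj dk) dk dj.
Proof. by move=> h; rewrite /deg_step iteT. Qed.
Lemma deg_step_mul dj dk lo hi i : gt z G i = threeM M ->
  deg_step dj dk lo hi i = add dj dk.
Proof. by move=> h; rewrite /deg_step iteF ?iteT // h => ?; tags. Qed.

Lemma deg_ex : exists deg : M -> M -> M -> M,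
  (forall a b c : (nat -> M) -> M, PF anyc a -> PF anyc b -> PF anyc c ->
     PF anyc (fun rho => deg (a rho) (b rho) (c rho))) /\
  forall lo hi i, le (Su i) L ->
    deg lo hi i = deg_step (deg lo hi (gj z G i)) (deg lo hi (gk z G i)) lo hi i.
Proof.
(* The degree at gate [i] is at most 2^i, and a digit that was cut would be B - 1, which is larger
   than 2^|z|: hence no digit is cut. *)
pose B := mul (threeM M) (E2 z).
pose h (env : nat -> M) := deg_step (dig z B (env 0) (gj z G (env 1)))
  (dig z B (env 0) (gk z G (env 1))) (env 2) (env 3) (env 1).
have ph : PF anyc h.
  rewrite /h /deg_step /leaf_index /threeM.
  by apply: PF_ite; [pf|pf|]; apply: PF_ite; [pf|pf|]; apply: PF_ite; [|pf|pf];
    apply: PD_and; apply: PD_le; try pf; try (apply: PF_S); apply: PF_ite; pf.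
have pB : PF anyc (fun=> B) by pf.
have [T [pT hT]] := cov_dig ph pB.
exists (fun lo hi i => dig z B (T z L (lenv [:: lo; hi])) i); split.
  move=> a b c ha hb hc; apply: PV_dig => //; try pf.
  by apply (PF_lenv (gs := [:: fun=> z; fun=> L; a; b]) pT); do !constructor => //; apply: PF_const.
move=> lo hi; set rho := lenv _.
have nB : B <> zeroM by apply: mul_neq0; [apply: Su_neq0|apply: E2_neq0].
have [_ hd] := hT z rho nB L hL.
pose dg i := dig z B (T z L rho) i.
have step i : le (Su i) L -> dg i = minM (deg_step (dg (gj z G i)) (dg (gk z G i)) lo hi i) (subM B oneM).
  move=> hi'; have [e1 e2] := hd i hi'; rewrite /dg e1; congr minM; rewrite /h /econs2 /=.
  case: (wf_gate hL wf hi') => [g1 _ _|g1 _ _|g1 l1 l2|g1 l1 l2].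
  - by rewrite !deg_step_leaf //; left.
  - by rewrite !deg_step_leaf //; right.
  - by rewrite !deg_step_add // !e2.
  - by rewrite !deg_step_mul // !e2.
have bound i : le (Su i) L -> le (dg i) (pw z i).
  move: i; apply: (SLIND hL).
    by apply/Sg_SB/SB_le; rewrite /dg; pf.
  move=> i hi' IH; rewrite step //; apply: mle_trans (min_le_l _ _) _.
  have li := lt_L_len hL hi'.
  have leaf A : le (ite A oneM zeroM) (pw z i).
    apply: mle_trans (pw_ge1 z i); case: (pselect A) => hA; first by rewrite iteT //; apply: mle_refl.
    by rewrite iteF //; apply: basic_ge0.
  case: (wf_gate hL wf hi') => [g1 _ _|g1 _ _|g1 l1 l2|g1 l1 l2].
  - by rewrite deg_step_leaf //; left.
  - by rewrite deg_step_leaf //; right.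
  - rewrite deg_step_add //; apply: ite_le.
      by apply: mle_trans (IH _ l2) (pw_le (le_Su_le l2) li).
    by apply: mle_trans (IH _ l1) (pw_le (le_Su_le l1) li).
  - rewrite deg_step_mul //; apply: mle_trans (le_add2 (IH _ l1) (IH _ l2)) _.
    have h1 := pw_le l1 li; have h2 := pw_le l2 li.
    rewrite pwS in h1; last exact: mle_trans l1 li.
    rewrite pwS in h2; last exact: mle_trans l2 li.
    by mz.
move=> i hi'; rewrite -/(dg i) step //; rewrite min_l //.
have h0 := bound i hi'; rewrite step // in h0.
have li := lt_L_len hL hi'.
have h1 := pw_le li (mle_refl (len z)); rewrite pw_E2 in h1; last exact: mle_refl.
have h2 := E2_ge1 z; have h3 := subMK (le_one nB).
apply: contrapT => /not_le_lt h4.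
rewrite min_r in h0; last exact: le_Su_le.
by rewrite /B /threeM in h3 h0; mz.
Qed.

Definition deg := sval (cid deg_ex).
Lemma PF_deg (a b c : (nat -> M) -> M) : PF anyc a -> PF anyc b -> PF anyc c ->
  PF anyc (fun rho => deg (a rho) (b rho) (c rho)).
Proof. by case: (svalP (cid deg_ex)) => h _; apply: h. Qed.
Lemma deg_eq lo hi i : le (Su i) L ->
  deg lo hi i = deg_step (deg lo hi (gj z G i)) (deg lo hi (gk z G i)) lo hi i.
Proof. by case: (svalP (cid deg_ex)) => _; apply. Qed.

Lemma deg_var lo hi i : le (Su i) L -> gt z G i = zeroM ->
  deg lo hi i = ite (le lo (gj z G i) /\ le (Su (gj z G i)) hi) oneM zeroM.
Proof.
move=> hi' e; rewrite deg_eq // deg_step_leaf; last by left.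
by rewrite /leaf_index (iteT _ _ e).
Qed.
Lemma deg_par lo hi i : le (Su i) L -> gt z G i = oneM ->
  deg lo hi i = ite (le lo (add n (gj z G i)) /\ le (Su (add n (gj z G i))) hi) oneM zeroM.
Proof.
move=> hi' e; rewrite deg_eq // deg_step_leaf; last by right.
have ne : gt z G i <> zeroM by rewrite e => ?; tags.
by rewrite /leaf_index (iteF _ _ ne).
Qed.
Lemma deg_add lo hi i : le (Su i) L -> gt z G i = twoM ->
  deg lo hi i = ite (le (deg lo hi (gj z G i)) (deg lo hi (gk z G i)))
    (deg lo hi (gk z G i)) (deg lo hi (gj z G i)).
Proof. by move=> hi' e; rewrite deg_eq // deg_step_add. Qed.
Lemma deg_mul lo hi i : le (Su i) L -> gt z G i = threeM M ->
  deg lo hi i = add (deg lo hi (gj z G i)) (deg lo hi (gk z G i)).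
Proof. by move=> hi' e; rewrite deg_eq // deg_step_mul. Qed.

Lemma deg_add_ge lo hi i : le (Su i) L -> gt z G i = twoM ->
  le (deg lo hi (gj z G i)) (deg lo hi i) /\ le (deg lo hi (gk z G i)) (deg lo hi i).
Proof.
move=> hi' e; rewrite (deg_add _ _ hi' e).
case: (pselect (le (deg lo hi (gj z G i)) (deg lo hi (gk z G i)))) => h.
  by rewrite (iteT _ _ h); split; [|apply: mle_refl].
by rewrite (iteF _ _ h); split; [apply: mle_refl|apply: le_Su_le; apply/not_le_lt].
Qed.
Lemma deg_add_le lo hi i b : le (Su i) L -> gt z G i = twoM ->
  le (deg lo hi (gj z G i)) b -> le (deg lo hi (gk z G i)) b -> le (deg lo hi i) b.
Proof. by move=> hi' e h1 h2; rewrite (deg_add _ _ hi' e); apply: ite_le. Qed.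

Lemma deg_empty lo i : le (Su i) L -> deg lo lo i = zeroM.
Proof.
move: i; apply: (SLIND hL).
  by apply/Sg_SB/SB_eq; [apply: PF_deg|]; pf.
have N x : ~ (le lo x /\ le (Su x) lo) by move=> [h1 h2]; mz.
move=> i hi0 IH; case: (wf_gate hL wf hi0) => [e _ _|e _ _|e l1 l2|e l1 l2].
- by rewrite (deg_var _ _ hi0 e) iteF.
- by rewrite (deg_par _ _ hi0 e) iteF.
- by rewrite (deg_add _ _ hi0 e) !IH // iteT //; apply: mle_refl.
- by rewrite (deg_mul _ _ hi0 e) !IH // basic_add0.
Qed.

(** Only subadditivity can be expected: at an addition gate the two parts of the interval may take
    their maxima at different operands. *)
Lemma deg_split lo mid hi i : le (Su i) L ->
  le (deg lo hi i) (add (deg lo mid i) (deg mid hi i)).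
Proof.
move: i; apply: (SLIND hL).
  by apply/Sg_SB/SB_le; [|apply: PF_add]; apply: PF_deg; pf.
have N x : le (ite (le lo x /\ le (Su x) hi) oneM zeroM : M)
    (add (ite (le lo x /\ le (Su x) mid) oneM zeroM) (ite (le mid x /\ le (Su x) hi) oneM zeroM)).
  case: (pselect (le lo x /\ le (Su x) hi)) => [[h1 h2]|h]; last by rewrite iteF //; apply: basic_ge0.
  rewrite iteT //; case: (le_or_lt mid x) => h3.
    by rewrite [X in add _ X]iteT //; apply: le_addl.
  by rewrite [X in add X _]iteT //; apply: le_addr.
move=> i hi0 IH; case: (wf_gate hL wf hi0) => [e _ _|e _ _|e l1 l2|e l1 l2].
- by rewrite !(deg_var _ _ hi0 e).
- by rewrite !(deg_par _ _ hi0 e).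
- have [h1 h2] := deg_add_ge lo mid hi0 e; have [h3 h4] := deg_add_ge mid hi hi0 e.
  apply: deg_add_le => //; first exact: mle_trans (IH _ l1) (le_add2 h1 h3).
  exact: mle_trans (IH _ l2) (le_add2 h2 h4).
- rewrite !(deg_mul _ _ hi0 e); have h1 := IH _ l1; have h2 := IH _ l2; by mz.
Qed.

Definition tdeg i := deg zeroM (add n p) i.

Lemma tdeg_ge1 i : le (Su i) L -> le oneM (tdeg i).
Proof.
move: i; apply: (SLIND hL).
  by apply/Sg_SB/SB_le; [|apply: PF_deg]; pf.
move=> i hi0 IH; rewrite /tdeg; case: (wf_gate hL wf hi0) => [e _ l|e _ l|e l1 l2|e l1 l2].
- rewrite (deg_var _ _ hi0 e) iteT; [exact: mle_refl|split; first exact: basic_ge0].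
  by apply: mle_trans l _; apply: le_addr.
- rewrite (deg_par _ _ hi0 e) iteT; [exact: mle_refl|split; first exact: basic_ge0].
  by mz.
- by have [h1 h2] := deg_add_ge zeroM (add n p) hi0 e; apply: mle_trans (IH _ l1) h1.
- by rewrite (deg_mul _ _ hi0 e); apply: mle_trans (IH _ l1) (le_addr _ _).
Qed.

Definition input_index tag j := ite (tag = zeroM) j (add n j).

(** The conditions on [D] determine its entries gate by gate, so any list witnessing membership in
    the class agrees with the computed degrees. *)
Lemma degreesMP tag j D : (tag = zeroM /\ le (Su j) n) \/ (tag = oneM /\ le (Su j) p) ->
  degreesM G L tag j D -> forall i, le (Su i) L ->
  ent z D i = deg (input_index tag j) (Su (input_index tag j)) i.
Proof.
move=> ht hD; set k := input_index tag j.
have N x y : x = y -> ite (le y x /\ le (Su x) (Su y)) oneM zeroM = oneM :> M.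
  by move=> ->; rewrite iteT //; split; apply: mle_refl.
have N' x y : x <> y -> ite (le y x /\ le (Su x) (Su y)) oneM zeroM = zeroM :> M.
  by move=> ne; rewrite iteF // => -[h1 /le_SS h2]; apply: ne; apply: mle_anti.
apply: (SLIND hL).
  by apply/Sg_SB/SB_eq; [|apply: PF_deg]; pf.
move=> i hi0 IH; have li := lt_L_len hL hi0.
have [e [/(entryMP _ _ li) -> [h1 [h2 [h3 h4]]]]] := hD i hi0.
have lj := gj_len hL hn hp wf hi0; have lk := gk_len hL wf hi0.
have gm := (gateMP G _ _ _ li).
case: (wf_gate hL wf hi0) => [g1 g2 l|g1 g2 l|g1 l1 l2|g1 l1 l2].
- rewrite (deg_var _ _ hi0 g1); case: (pselect (tag = zeroM /\ j = gj z G i)) => [[t1 t2]|t1].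
    rewrite h1; first by rewrite N // /k /input_index iteT.
    by apply/gm; rewrite t1 t2 g1 g2.
  rewrite (h2 zeroM (gj z G i)); last first.
    split; first exact: basic_ge0.
    split; first by apply/gm; rewrite g1 g2.
    by apply: contrapT => t2; apply: t1; split; apply: contrapT => t3; apply: t2; [left|right] => e0; apply: t3.
  rewrite N' // /k /input_index; case: ht => [[t2 t3]|[t2 t3]].
    by rewrite iteT // => e0; apply: t1.
  have nt : tag <> zeroM by rewrite t2 => ?; tags.
  by rewrite (iteF _ _ nt) => e0; mz.
- rewrite (deg_par _ _ hi0 g1); case: (pselect (tag = oneM /\ j = gj z G i)) => [[t1 t2]|t1].
    have nt : tag <> zeroM by rewrite t1 => ?; tags.
    rewrite h1; first by rewrite N // /k /input_index (iteF _ _ nt) t2.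
    by apply/gm; rewrite t1 t2 g1 g2.
  rewrite (h2 oneM (gj z G i)); last first.
    split; first exact: mle_refl.
    split; first by apply/gm; rewrite g1 g2.
    by apply: contrapT => t2; apply: t1; split; apply: contrapT => t3; apply: t2; [left|right] => e0; apply: t3.
  rewrite N' // /k /input_index; case: ht => [[t2 t3]|[t2 t3]].
    by rewrite iteT // => e0; mz.
  have nt : tag <> zeroM by rewrite t2 => ?; tags.
  by rewrite (iteF _ _ nt) => e0; apply: t1; split=> //; apply: esym; apply: (maddI e0).
- have [|a [b [/(entryMP _ _ lj) ea [/(entryMP _ _ lk) eb [h5 h6]]]]] := h3 (gj z G i) (gk z G i).
    by apply/gm; rewrite g1.
  rewrite (deg_add _ _ hi0 g1) -!IH // -ea -eb; case: (pselect (le a b)) => hab.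
    by rewrite iteT // h5.
  by rewrite iteF // h6 //; apply/le_Su_le/not_le_lt.
- have [|a [b [/(entryMP _ _ lj) ea [/(entryMP _ _ lk) eb h5]]]] := h4 (gj z G i) (gk z G i).
    by apply/gm; rewrite g1.
  by rewrite (deg_mul _ _ hi0 g1) -!IH // -ea -eb.
Qed.

(** The interval of all inputs is built up one input at a time. *)
Lemma tdeg_le l d : le (Su l) L ->
  (forall k, le (Su k) (add n p) -> le (deg k (Su k) l) d) -> le (tdeg l) (mul (add n p) d).
Proof.
move=> hl hd; rewrite /tdeg.
suff: forall k, le k (len z) -> le k (add n p) -> le (deg zeroM k l) (mul k d).
  by apply=> //; apply: mle_refl.
apply: LIND.
- apply/Sg_SB/SB_imp; first by sb.
  by apply: SB_le; [apply: PF_deg|]; pf.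
- by move=> _; rewrite deg_empty //; apply: basic_ge0.
move=> k hk IH hk'; apply: mle_trans (deg_split _ k _ hl) _.
have h1 := IH (le_Su_le hk'); have h2 := hd k hk'.
by mz.
Qed.

End Degrees.

(** ** Evaluation *)

Section EvalFunction.

Variable M : model.
Implicit Types (i j k a t v x y z P tag : M).

(* The table entry of a gate from those of its arguments; 0 stands for no value. *)
Definition ev_gate tag va vc x y : M :=
  ite (tag = zeroM) (Su va) (ite (tag = oneM) (Su vc)
    (ite (x = zeroM \/ y = zeroM) zeroM
      (Su (ite (tag = twoM) (iadd (subM x oneM) (subM y oneM)) (imul (subM x oneM) (subM y oneM)))))).
(** A value too long for its block is recorded as missing instead of being truncated, so that the
    computed table never contains a wrong value. *)
Definition ev_cut B v : M := ite (le (Su v) B) v zeroM.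

Lemma ev_cut_le B v : B <> zeroM -> le (ev_cut B v) (subM B oneM).
Proof.
move=> nB; have h := subMK (le_one nB); rewrite /ev_cut.
by case: (pselect (le (Su v) B)) => h1; [rewrite iteT //; mz|rewrite iteF //; apply: basic_ge0].
Qed.
Lemma ev_gate_var va vc x y : ev_gate zeroM va vc x y = Su va.
Proof. by rewrite /ev_gate iteT. Qed.
Lemma ev_gate_par va vc x y : ev_gate oneM va vc x y = Su vc.
Proof. by rewrite /ev_gate iteF ?iteT //; apply: one_neq0. Qed.
Lemma ev_gate_undef va vc x y tag : tag = twoM \/ tag = threeM M -> x = zeroM \/ y = zeroM ->
  ev_gate tag va vc x y = zeroM.
Proof.
move=> ht hx; have n0 : tag <> zeroM by case: ht => -> ?; tags.
have n1 : tag <> oneM by case: ht => -> ?; tags.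
by rewrite /ev_gate (iteF _ _ n0) (iteF _ _ n1) iteT.
Qed.
Lemma subM_Su x : subM (Su x) oneM = x.
Proof. by apply: (@maddI _ oneM); rewrite subMK ?madd1r //; apply: le_one; apply: Su_neq0. Qed.
Lemma ev_gate_add va vc x y : ev_gate twoM va vc (Su x) (Su y) = Su (iadd x y).
Proof.
rewrite /ev_gate iteF; last by move=> ?; tags.
rewrite iteF; last by move=> ?; tags.
by rewrite iteF; [rewrite iteT // !subM_Su|case=> /Su_neq0].
Qed.
Lemma ev_gate_mul va vc x y : ev_gate (threeM M) va vc (Su x) (Su y) = Su (imul x y).
Proof.
rewrite /ev_gate iteF; last by move=> ?; tags.
rewrite iteF; last by move=> ?; tags.
rewrite iteF; last by case=> /Su_neq0.
by rewrite iteF; [rewrite !subM_Su|move=> ?; tags].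
Qed.

(** At a variable or parameter gate [gj] and [gk] are not numbers of earlier gates, and [ev_gate]
    ignores the table entries read there; this explains the alternatives in the hypotheses. *)
Lemma evT_ex : exists F : M -> M -> M -> M -> M, PV4 F /\
  forall z y P a, le (cL P) (len z) ->
    le (Su (F z y P a)) (powB z (E2 y) (cL P)) /\
    forall i, le (Su i) (cL P) -> le (Su (gj z (cG P) i)) i \/ gt z (cG P) i = zeroM \/ gt z (cG P) i = oneM ->
      le (Su (gk z (cG P) i)) i \/ gt z (cG P) i = zeroM \/ gt z (cG P) i = oneM ->
      let t := F z y P a in
      dig z (E2 y) t i = ev_cut (E2 y) (ev_gate (gt z (cG P) i)
        (ent z a (gj z (cG P) i)) (ent z (cC P) (gj z (cG P) i))
        (dig z (E2 y) t (gj z (cG P) i)) (dig z (E2 y) t (gk z (cG P) i))).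
Proof.
pose h (env : nat -> M) := ev_cut (E2 (env 3)) (ev_gate (gt (env 2) (cG (env 4)) (env 1))
  (ent (env 2) (env 5) (gj (env 2) (cG (env 4)) (env 1)))
  (ent (env 2) (cC (env 4)) (gj (env 2) (cG (env 4)) (env 1)))
  (dig (env 2) (E2 (env 3)) (env 0) (gj (env 2) (cG (env 4)) (env 1)))
  (dig (env 2) (E2 (env 3)) (env 0) (gk (env 2) (cG (env 4)) (env 1)))).
have ph : PF noc h.
  have pg : PF noc (fun env : nat -> M => ev_gate (gt (env 2) (cG (env 4)) (env 1))
    (ent (env 2) (env 5) (gj (env 2) (cG (env 4)) (env 1)))
    (ent (env 2) (cC (env 4)) (gj (env 2) (cG (env 4)) (env 1)))
    (dig (env 2) (E2 (env 3)) (env 0) (gj (env 2) (cG (env 4)) (env 1)))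
    (dig (env 2) (E2 (env 3)) (env 0) (gk (env 2) (cG (env 4)) (env 1)))).
    rewrite /ev_gate.
    apply: PF_ite; [pf|pf|]; apply: PF_ite; [pf|pf|]; apply: PF_ite; [|pf|].
      by apply: PD_or; apply: PD_eq; pf.
    by apply: PF_S; apply: PF_ite; pf.
  by rewrite /h /ev_cut; apply: PF_ite; [apply: PD_le; [apply: PF_S|]|..] => //; pf.
have pB : PF noc (fun env : nat -> M => E2 (env 1)) by pf.
have [T [pT hT]] := cov_dig ph pB.
exists (fun z y P a => T z (cL P) (lenv [:: z; y; P; a])); split.
  move=> K az ay aP aa hz hy hP ha.
  by apply (PF_lenv (gs := [:: az; fun rho => cL (aP rho); az; ay; aP; aa]) (PF_noc K pT));
    do !constructor => //; pf.
move=> z y P a hL; set rho := lenv _.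
have nB : E2 y <> zeroM by apply: E2_neq0.
have [h0 hd] := hT z rho nB _ hL; split=> // i hi hj hk t.
have [e1 e2] := hd i hi; rewrite e1 min_l; last exact: ev_cut_le.
rewrite /h /econs2 /= /lenv /=; congr ev_cut.
case: hj => [hj|[->|->]]; [|by rewrite !ev_gate_var|by rewrite !ev_gate_par].
case: hk => [hk|[->|->]]; [|by rewrite !ev_gate_var|by rewrite !ev_gate_par].
by rewrite !e2.
Qed.

(** The table of values of the circuit [P] at the point [a], in blocks of [|y|] bits. *)
Definition evT := sval (cid evT_ex).
Lemma PV_evT : PV4 evT. Proof. by case: (svalP (cid evT_ex)). Qed.

Definition ev z y P a i : M := ent z (pair (evT z y P a) y) i.

Lemma ev_eq z y P a i : le (cL P) (len z) -> le (Su i) (cL P) ->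
  le (Su (gj z (cG P) i)) i \/ gt z (cG P) i = zeroM \/ gt z (cG P) i = oneM ->
  le (Su (gk z (cG P) i)) i \/ gt z (cG P) i = zeroM \/ gt z (cG P) i = oneM ->
  ev z y P a i = ev_cut (E2 y) (ev_gate (gt z (cG P) i)
        (ent z a (gj z (cG P) i)) (ent z (cC P) (gj z (cG P) i))
        (ev z y P a (gj z (cG P) i)) (ev z y P a (gk z (cG P) i))).
Proof.
move=> hL hi hj hk; have [_ /(_ z y P a hL)[_ /(_ i hi hj hk) e]] := svalP (cid evT_ex).
have li : le i (len z) by apply: mle_trans (le_Su_le hi) hL.
rewrite /ev ent_pair // e; congr ev_cut.
case: hj => [hj|[->|->]]; [|by rewrite !ev_gate_var|by rewrite !ev_gate_par].
case: hk => [hk|[->|->]]; [|by rewrite !ev_gate_var|by rewrite !ev_gate_par].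
by rewrite !ent_pair //; apply: mle_trans (le_Su_le _) li; eassumption.
Qed.

End EvalFunction.

#[global] Hint Extern 2 (PF _ (fun _ => evT _ _ _ _)) => apply PV_evT : pf.
Lemma PV_ev (M : model) : PV5 (@ev M).
Proof. by move=> K a b c d e ha hb hc hd he; rewrite /ev; pf. Qed.
#[global] Hint Extern 2 (PF _ (fun _ => ev _ _ _ _ _)) => apply PV_ev : pf.

Section Eval.

Variable M : model.
Variables n z P : M.
Implicit Types (i j k a t v x y kap kk : M).

Notation L := (cL P).
Notation p := (cp P).
Notation G := (cG P).
Notation C := (cC P).

Hypothesis hL : le L (len z).
Hypothesis hN : le (add n p) (len z).
Hypothesis wf : well_formedM n L p G C.

Let hn : le n (len z). Proof. exact: mle_trans (le_addr _ _) hN. Qed.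
Let hp : le p (len z). Proof. exact: mle_trans (le_addl _ _) hN. Qed.

Lemma ev_gate_eq y a i : le (Su i) L ->
  ev z y P a i = ev_cut (E2 y) (ev_gate (gt z G i) (ent z a (gj z G i)) (ent z C (gj z G i))
    (ev z y P a (gj z G i)) (ev z y P a (gk z G i))).
Proof.
move=> hi; apply: ev_eq => //; case: (wf_gate hL wf hi) => [e _ _|e _ _|_ l1 l2|_ l1 l2];
  by [left|right; left|right; right].
Qed.

Lemma ev_cut_Su B v w : ev_cut B v = Su w -> v = Su w.
Proof.
rewrite /ev_cut; case: (pselect (le (Su v) B)) => h; first by rewrite iteT.
by rewrite iteF // => /esym/Su_neq0.
Qed.
Lemma eq_Su x : x <> zeroM -> exists v, x = Su v.
Proof. by move=> /le_one/subMK <-; exists (subM x oneM); rewrite madd1r. Qed.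

Lemma ev_int y a i v : is_pointM n a -> le (Su i) L -> ev z y P a i = Su v -> v <> oneM.
Proof.
move=> ha hi; rewrite ev_gate_eq // => /ev_cut_Su.
have op g : g = twoM \/ g = threeM M -> ev_gate g (ent z a (gj z G i)) (ent z C (gj z G i))
    (ev z y P a (gj z G i)) (ev z y P a (gk z G i)) = Su v -> v <> oneM.
  move=> hg; case: (pselect (ev z y P a (gj z G i) = zeroM \/ ev z y P a (gk z G i) = zeroM)) => h.
    by rewrite ev_gate_undef // => /esym/Su_neq0.
  have [x ->] : exists x, ev z y P a (gj z G i) = Su x by apply: eq_Su => e; apply: h; left.
  have [w ->] : exists x, ev z y P a (gk z G i) = Su x by apply: eq_Su => e; apply: h; right.
  by case: hg => ->; rewrite ?ev_gate_add ?ev_gate_mul => /Su_inj <-; apply: mkint_neq1.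
case: (wf_gate hL wf hi) => [e _ l|e _ l|e _ _|e _ _]; rewrite e.
- by rewrite ev_gate_var => /Su_inj <-; apply: (point_int hn).
- by rewrite ev_gate_par => /Su_inj <-; apply: (wf_par hp wf).
- by apply: op; left.
- by apply: op; right.
Qed.

(** Correctness requires no bound on sizes, since overflow is recorded as a missing value; size
    matters for the existence of a value at the output. *)
Lemma ev_tabz y a : is_pointM n a -> tabz L G C z a (pair (evT z y P a) y).
Proof.
move=> ha i v hi; rewrite -/(ev z y P a i) ev_gate_eq // => /ev_cut_Su.
have op g : g = twoM \/ g = threeM M -> le (Su (gj z G i)) i -> le (Su (gk z G i)) i ->
    ev_gate g (ent z a (gj z G i)) (ent z C (gj z G i))
      (ev z y P a (gj z G i)) (ev z y P a (gk z G i)) = Su v ->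
    exists x w, [/\ ev z y P a (gj z G i) = Su x, ev z y P a (gk z G i) = Su w, x <> oneM, w <> oneM &
      (g = twoM /\ v = iadd x w) \/ (g = threeM M /\ v = imul x w)].
  move=> hg l1 l2.
  case: (pselect (ev z y P a (gj z G i) = zeroM \/ ev z y P a (gk z G i) = zeroM)) => h.
    by rewrite ev_gate_undef // => /esym/Su_neq0.
  have [x ex] : exists x, ev z y P a (gj z G i) = Su x by apply: eq_Su => e; apply: h; left.
  have [w ew] : exists x, ev z y P a (gk z G i) = Su x by apply: eq_Su => e; apply: h; right.
  have hx : x <> oneM by apply: (ev_int ha _ ex); apply: mle_trans l1 (le_Su_le hi).
  have hw : w <> oneM by apply: (ev_int ha _ ew); apply: mle_trans l2 (le_Su_le hi).
  rewrite ex ew => hv; exists x, w; split=> //; move: hv.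
  by case: hg => ->; rewrite ?ev_gate_add ?ev_gate_mul => /Su_inj <-; [left|right].
case: (wf_gate hL wf hi) => [e _ l|e _ l|e l1 l2|e l1 l2].
- by rewrite e ev_gate_var => /Su_inj <-; left.
- by rewrite e ev_gate_par => /Su_inj <-; right; left.
- by move=> hv; right; right; apply: (op _ _ l1 l2 hv); left.
- by move=> hv; right; right; apply: (op _ _ l1 l2 hv); right.
Qed.

(** ** Size of the values *)

Section Bound.

Variables (y a j0 kap kk Tm : M).
Hypothesis ha : is_pointM n a.
Hypothesis h_arg : forall j, le (Su j) n -> j <> j0 -> le (halfM (ent z a j)) (pw z kap).
Hypothesis h_arg0 : le (Su j0) n -> le (halfM (ent z a j0)) (pw z (add kap kk)).
Hypothesis h_par : forall j, le (Su j) p -> le (halfM (ent z C j)) (pw z kap).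
Hypothesis h_size : le (add (mul (add (add L kap) kk) Tm) (threeM M)) (len y).
Hypothesis h_y : le (len y) (len z).

Notation T := (tdeg hL hN wf).
Notation e := (deg hL hN wf j0 (Su j0)).
(** Binary logarithm of a bound on the value of gate [i]. The long coordinate [j0] has [kk] extra
    bits, paid once per degree in that input. All other inputs have [kap] bits, paid by the total
    degree, and the summand [i] absorbs the doublings at additions. *)
Definition ev_exp i : M := add (mul (add i kap) (T i)) (mul kk (e i)).

Lemma PF_tdeg f : PF anyc f -> PF anyc (fun rho => T (f rho)).
Proof. by move=> hf; apply: PF_deg; pf. Qed.
Lemma PF_deg1 f : PF anyc f -> PF anyc (fun rho => e (f rho)).
Proof. by move=> hf; apply: PF_deg; pf. Qed.

Lemma ev_exp_le i : le (Su i) L -> le (T i) Tm -> le (e i) (T i) ->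
  le (add (ev_exp i) (threeM M)) (len y).
Proof.
move=> hi hT he; apply: mle_trans h_size; rewrite /ev_exp.
have h1 := le_mul2 (le_add2 (le_Su_le hi) (mle_refl kap)) hT.
have h2 := le_mul2 (mle_refl kk) (mle_trans he hT).
by mz.
Qed.

(** The code of an integer is at most twice its absolute value plus 1, and its successor is stored:
    three spare bits suffice. *)
Lemma ev_fits i v : le (Su i) L -> le (T i) Tm -> le (e i) (T i) ->
  le (halfM v) (pw z (ev_exp i)) -> ev_cut (E2 y) (Su v) = Su v.
Proof.
move=> hi hT he hv; apply: iteT.
have hX := ev_exp_le hi hT he.
have h1 := pw_le hX h_y; rewrite (pw_E2 h_y) /threeM /twoM /oneM !basic_addS basic_add0 in h1.
have hX' : le (Su (Su (Su (ev_exp i)))) (len z).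
  by apply: mle_trans h_y; apply: mle_trans hX; rewrite /threeM; mz.
rewrite (pwS hX') (pwS (le_Su_le hX')) (pwS (le_Su_le (le_Su_le hX'))) in h1.
have h2 := le_double_half v; have h3 := pw_ge1 z (ev_exp i).
by mz.
Qed.

Lemma e_le_T i : le (Su i) L -> le (e i) (T i).
Proof.
move: i; apply: (SLIND hL).
  by apply/Sg_SB/SB_le; [apply: PF_deg1|apply: PF_tdeg]; pf.
move=> i hi IH; have T1 := tdeg_ge1 hL hN wf hi.
have leaf A : le (ite A oneM zeroM) (T i) by apply: ite_le => //; apply: basic_ge0.
case: (wf_gate hL wf hi) => [g1 _ l|g1 _ l|g1 l1 l2|g1 l1 l2].
- by rewrite (deg_var hL hN wf _ _ hi g1).
- by rewrite (deg_par hL hN wf _ _ hi g1).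
- have [t1 t2] := deg_add_ge hL hN wf zeroM (add n p) hi g1.
  by apply: deg_add_le => //; [apply: mle_trans (IH _ l1) t1|apply: mle_trans (IH _ l2) t2].
- by rewrite /tdeg !(deg_mul hL hN wf _ _ hi g1); apply: le_add2; [apply: IH l1|apply: IH l2].
Qed.

(** Operands inherit the bound on the total degree. So all gates on which the output depends get a
    value, although other gates of the circuit may overflow. *)
Lemma ev_bound i : le (Su i) L -> le (T i) Tm ->
  [/\ ev z y P a i <> zeroM, le (halfM (subM (ev z y P a i) oneM)) (pw z (ev_exp i)) & le (e i) (T i)].
Proof.
move=> hi hT.
suff [h1 [h2 h3]] : ev z y P a i <> zeroM /\
   (le (halfM (subM (ev z y P a i) oneM)) (pw z (ev_exp i)) /\ le (e i) (T i)) by split.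
move: i hi hT; apply: (SLIND hL).
  apply/Sg_SB/SB_imp; first by apply: SB_le; [apply: PF_tdeg|]; pf.
  apply: SB_and; first by sb.
  apply: SB_and; last by apply: SB_le; [apply: PF_deg1|apply: PF_tdeg]; pf.
  apply: SB_le; first by pf.
  rewrite /pw; apply: PF_smash; last by pf.
  apply: PV_un; first by pf.
  by apply: PF_add; apply: PF_mul; try pf; [apply: PF_tdeg|apply: PF_deg1]; pf.
move=> i hi IH hT; have li := lt_L_len hL hi.
have he := e_le_T hi.
have size v : le (halfM v) (pw z (ev_exp i)) -> ev_cut (E2 y) (Su v) = Su v.
  exact: ev_fits.
suff [v [-> hv]] : exists v, ev z y P a i = Su v /\ le (halfM v) (pw z (ev_exp i)).
  by rewrite subM_Su; split; [apply: Su_neq0|].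
have hXz : le (ev_exp i) (len z).
  by apply: mle_trans h_y; apply: mle_trans (ev_exp_le hi hT he); apply: le_addr.
have T1 := tdeg_ge1 hL hN wf hi.
suff [v [hv1 hv2]] : exists v, ev_gate (gt z G i) (ent z a (gj z G i)) (ent z C (gj z G i))
    (ev z y P a (gj z G i)) (ev z y P a (gk z G i)) = Su v /\ le (halfM v) (pw z (ev_exp i)).
  by exists v; rewrite ev_gate_eq // hv1 size.
have leafX : le kap (ev_exp i).
  have h1 := le_mul2 (le_addl kap i) T1; have h2 := basic_ge0 (mul kk (e i)).
  by rewrite /ev_exp; mz.
case: (wf_gate hL wf hi) => [g1 _ l|g1 _ l|g1 l1 l2|g1 l1 l2]; rewrite g1.
- exists (ent z a (gj z G i)); rewrite ev_gate_var; split=> //.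
  case: (pselect (gj z G i = j0)) => [ej|nj]; last by apply: mle_trans (h_arg l nj) (pw_le leafX hXz).
  rewrite ej in l *; apply: mle_trans (h_arg0 l) (pw_le _ hXz).
  have -> : ev_exp i = add (mul (add i kap) (T i)) kk.
    rewrite /ev_exp deg_var // ej iteT ?mmulr1 //; split; exact: mle_refl.
  by have h1 := le_mul2 (le_addl kap i) T1; mz.
- exists (ent z C (gj z G i)); rewrite ev_gate_par; split=> //.
  by apply: mle_trans (h_par l) (pw_le leafX hXz).
- have [t1 t2] := deg_add_ge hL hN wf zeroM (add n p) hi g1.
  have [e1 e2] := deg_add_ge hL hN wf j0 (Su j0) hi g1.
  have [n1 [b1 _]] := IH _ l1 (mle_trans t1 hT); have [n2 [b2 _]] := IH _ l2 (mle_trans t2 hT).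
  have [x ex] := eq_Su n1; have [w ew] := eq_Su n2.
  move: b1 b2; rewrite ex ew !subM_Su => b1 b2.
  exists (iadd x w); rewrite ev_gate_add; split=> //.
  apply: mle_trans (half_iadd x w) _; apply: mle_trans (le_add2 b1 b2) _.
  (* Passing to an operand lowers the index by at least one, and the total degree is at least 1:
     this leaves one bit for the sum. *)
  have aux k : le (Su k) i -> le (T k) (T i) -> le (e k) (e i) -> le (Su (ev_exp k)) (ev_exp i).
    move=> hk hTk hek; rewrite /ev_exp.
    have h1 := le_mul2 (mle_refl (add k kap)) hTk; have h2 := le_mul2 (mle_refl kk) hek.
    have h3 := le_mul2 (le_add2 hk (mle_refl kap)) (mle_refl (T i)).
    by mz.
  have a1 := aux _ l1 t1 e1; have a2 := aux _ l2 t2 e2.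
  have p1 := pw_le a1 hXz; have p2 := pw_le a2 hXz.
  rewrite pwS in p1; last exact: mle_trans a1 hXz.
  rewrite pwS in p2; last exact: mle_trans a2 hXz.
  by mz.
- have t0 := deg_mul hL hN wf zeroM (add n p) hi g1.
  have e0 := deg_mul hL hN wf j0 (Su j0) hi g1.
  have t1 : le (T (gj z G i)) (T i) by rewrite /tdeg t0; apply: le_addr.
  have t2 : le (T (gk z G i)) (T i) by rewrite /tdeg t0; apply: le_addl.
  have [n1 [b1 _]] := IH _ l1 (mle_trans t1 hT); have [n2 [b2 _]] := IH _ l2 (mle_trans t2 hT).
  have [x ex] := eq_Su n1; have [w ew] := eq_Su n2.
  move: b1 b2; rewrite ex ew !subM_Su => b1 b2.
  exists (imul x w); rewrite ev_gate_mul; split=> //.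
  rewrite half_imul; apply: mle_trans (le_mul2 b1 b2) _.
  (* At a multiplication both degrees add up, and so do the exponents. *)
  have hs : le (add (ev_exp (gj z G i)) (ev_exp (gk z G i))) (ev_exp i).
    rewrite /ev_exp e0 /tdeg t0 -!/(tdeg _ _ _ _).
    have h1 := le_mul2 (le_add2 (le_Su_le l1) (mle_refl kap)) (mle_refl (T (gj z G i))).
    have h2 := le_mul2 (le_add2 (le_Su_le l2) (mle_refl kap)) (mle_refl (T (gk z G i))).
    by mz.
  rewrite -pwD; first exact: pw_le.
  exact: mle_trans hs hXz.
Qed.

End Bound.

End Eval.

(** * Counting the roots by divisibility *)

Section Count.

Variable M : model.
Implicit Types (i j k t x y z w : M).

Lemma seq_ex (v : M -> M) n y z : PF anyc (fun rho => v (rho 0)) -> le n (len z) ->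
  (forall j, le (Su j) n -> le (Su (v j)) (E2 y)) ->
  exists t, forall j, le (Su j) n -> ent z (pair t y) j = v j.
Proof.
move=> pv hn hv.
have ph : PF anyc (fun rho => v (rho 1)).
  by apply: (PF_subst pv (s := fun _ rho => rho 1)) => _; apply: PF_var.
have pB : PF anyc (fun rho : nat -> M => E2 y) by pf.
have [T [_ hT]] := cov_dig ph pB.
have [_ hd] := hT z (fun=> zeroM) (@E2_neq0 _ y) n hn.
exists (T z n (fun=> zeroM)) => j hj; have [e _] := hd j hj.
rewrite ent_pair; last exact: mle_trans (le_Su_le hj) hn.
rewrite e /econs2 /= min_l //.
by have h1 := hv j hj; have h2 := subMK (E2_ge1 y); mz.
Qed.

(* Products of the differences [X - v] over the roots [v < t]. *)
Section Roots.

Variables (z q kk W : M) (A : M -> Prop) (c : M -> M).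
Hypothesis A_PD : PD anyc (fun rho => A (rho 0)).
Hypothesis c_PF : PF anyc (fun rho => c (rho 0)).
Hypothesis c0 : c zeroM = zeroM.
Hypothesis cS : forall v, le (Su v) q -> c (Su v) = add (c v) (ite (A v) oneM zeroM).
Hypothesis q_z : le q (len z).
Hypothesis lq_z : le (mul (len q) (mul q q)) (len z).
Hypothesis kq_z : le (mul kk q) (len z).
Notation X := (pw z kk).
Hypothesis X_q : le (mul twoM q) X.
Hypothesis q_gt0 : le oneM q.
Hypothesis W_gt0 : le oneM W.
Hypothesis A_dvd : forall v, le (Su v) q -> A v -> dvdZ (zi X - zi v)%R (zi W).

Lemma PF_c f : PF anyc f -> PF anyc (fun rho => c (f rho)).
Proof. by move=> hf; apply: (PF_subst c_PF (s := fun _ => f)). Qed.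

Lemma Q_ex : exists Q : M -> M, [/\ forall f, PF anyc f -> PF anyc (fun rho => Q (f rho)),
  Q zeroM = oneM & forall t, le (Su t) q -> Q (Su t) = ite (A t) (mul (Q t) (subM X t)) (Q t)].
Proof.
have hA : PD anyc (fun rho => A (rho 1)).
  by apply: (PD_subst A_PD (s := fun _ rho => rho 1)) => _; apply: PF_var.
have ph : PF anyc (fun rho => ite (A (rho 1)) (mul (rho 0) (subM X (rho 1))) (rho 0)) by pf.
have pk : PF anyc (fun rho : nat -> M => smash z X) by pf.
have [R [pR R0 RS]] := iter_ex (PF_one anyc) ph pk.
pose Q t := R z t (fun=> zeroM); exists Q.
have pQ f : PF anyc f -> PF anyc (fun rho => Q (f rho)).
  move=> hf; apply: (PF_subst pR (s := fun n rho => if n is m.+1 then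
    if m is 0 then f rho else zeroM else z)).
  by case=> [|[|n]] //; pf.
have Q0 : Q zeroM = oneM by rewrite /Q R0 min_l //; apply: le_one; apply: smash_neq0.
have QS t : le (Su t) (len z) -> Q (Su t) = minM (ite (A t) (mul (Q t) (subM X t)) (Q t)) (smash z X).
  by move=> h; apply: RS.
have st t : le (Q t) (powB z X t) -> le (Su t) q ->
    le (ite (A t) (mul (Q t) (subM X t)) (Q t)) (powB z X (Su t)).
  move=> h1 h2; rewrite powBS; last exact: mle_trans h2 q_z.
  have h3 : le t X by mz.
  have h4 : le (subM X t) X by have h4 := subMK h3; mz.
  apply: ite_le; first exact: le_mul2.
  by rewrite -[X in le X _]mmulr1; apply: le_mul2 => //; apply: pw_ge1.
have bd t : le t (len z) -> le t q -> le (Q t) (powB z X t).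
  move: t; apply: LIND.
  - by apply/Sg_SB/SB_imp; [sb|apply: SB_le; [apply: pQ|]; pf].
  - by move=> _; rewrite Q0 powB0; apply: mle_refl.
  move=> t ht IH h; rewrite QS //; apply: mle_trans (min_le_l _ _) _.
  by apply: st => //; apply/IH/le_Su_le.
split=> // t ht; have htz := mle_trans ht q_z.
rewrite QS // min_l //; apply: mle_trans (powB_le_smash _ htz).
by apply: st => //; apply: bd; apply: le_Su_le.
Qed.

Lemma c_le t : le t q -> le (c t) t.
Proof.
move=> ht; have : le t q by []. 
have := mle_trans ht q_z; move: t {ht}; apply: LIND.
- by apply/Sg_SB/SB_imp; [sb|apply: SB_le; [apply: PF_c|]; pf].
- by move=> _; rewrite c0; apply: mle_refl.
move=> t ht IH h; rewrite cS // -maddr1; apply: le_add2; first exact/IH/le_Su_le.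
by apply: ite_le; [apply: mle_refl|apply: basic_ge0].
Qed.

Lemma lt_X t : le t q -> le (Su t) X.
Proof. by move=> h; mz. Qed.

(** The product of the X - v is at least (X / 2)^c. It is also at most W D with D of length about
    |q| q^2, because it divides W D != 0. The number D collects what is lost when the factors X - v
    are not coprime. *)
Lemma root_count :
  le (pw z (mul kk (c q))) (mul (pw z (c q)) (mul W (pw z (mul (len q) (mul q q))))).
Proof.
have [Q [pQ Q0 QS]] := Q_ex.
have ltz t : le t q -> le t (len z) by move=> h; apply: mle_trans q_z.
have lqt t : le t q -> le (mul (len q) t) (len z).
  move=> h; apply: mle_trans lq_z; apply: le_mul2; first exact: mle_refl.
  exact: mle_trans h (le_sqr q).
have Q_gt0 t : le t (len z) -> le t q -> le oneM (Q t).
  move: t; apply: LIND.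
  - by apply/Sg_SB/SB_imp; [sb|apply: SB_le; [pf|apply: pQ; pf]].
  - by move=> _; rewrite Q0; apply: mle_refl.
  move=> t ht IH h; rewrite QS //; have h1 := IH (le_Su_le h).
  case: (pselect (A t)) => hA; last by rewrite iteF.
  rewrite iteT //; have h2 := lt_X (le_Su_le h); have h3 := subMK (le_Su_le h2).
  by rewrite -[oneM]mmulr1; apply: le_mul2 => //; mz.
have q_pw : le q (pw z (len q)).
  by apply/le_Su_le/lt_pw_len; have h := lqt oneM q_gt0; rewrite mmulr1 in h.
(* modulo [X - t], the product is that of the differences [t - v] *)
have modt t : le (Su t) q -> forall x, le x (len z) -> le x t ->
    exists S, le S (Q x) /\ exists E, le E (Q x) /\
      (Q x = add (mul (subM X t) S) E /\ (le oneM E /\ le E (pw z (mul (len q) x)))).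
  move=> ht; have hX := subMK (le_Su_le (lt_X (le_Su_le ht))); have hX' := lt_X (le_Su_le ht).
  have Xt : le oneM (subM X t) by mz.
  apply: LIND.
  - apply: Sg_imp; first by sb.
    apply: (Sg_ex (b := fun rho => Q (rho 0))); first by apply: pQ; pf.
    apply: (Sg_ex (b := fun rho => Q (rho 1))); first by apply: pQ; pf.
    apply: Sg_SB; apply: SB_and.
      by apply: SB_eq; [apply: pQ|]; pf.
    by apply: SB_and; apply: SB_le; try pf; rewrite /pw; pf.
  - move=> _; exists zeroM; split; first exact: basic_ge0.
    exists oneM; rewrite Q0; split; first exact: mle_refl.
    by rewrite basic_mul0 madd0r; split=> //; rewrite basic_mul0 pw0; split; apply: mle_refl.
  move=> x hx IH hxt.
  have hxq : le (Su x) q by apply: mle_trans (le_Su_le ht).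
  have [S [hS [E [hE [e1 [e2 e3]]]]]] := IH (le_Su_le hxt).
  have mono : le (pw z (mul (len q) x)) (pw z (mul (len q) (Su x))).
    by apply: pw_le (lqt _ hxq); rewrite basic_mulS; apply: le_addr.
  rewrite QS //; case: (pselect (A x)) => hA; last first.
    rewrite !iteF //; exists S; split=> //; exists E; split=> //; split=> //; split=> //.
    exact: mle_trans mono.
  rewrite !iteT //.
  have tx := subMK (le_Su_le hxt); have Xx := subMK (le_Su_le (lt_X (le_Su_le hxq))).
  have tx1 : le oneM (subM t x) by mz.
  exists (add (Q x) (mul S (subM t x))); split.
    have hh : le (add (mul S (subM t x)) (mul (subM X t) (Q x))) (mul (Q x) (subM X x)).
      have h0 : subM X x = add (subM X t) (subM t x) by mz.
      by rewrite h0; have h1 := le_mul2 hS (mle_refl (subM t x)); mz.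
    apply: mle_trans hh; rewrite basic_addC; apply: le_add2; first exact: mle_refl.
    by rewrite -[X in le X _]mmul1r; apply: le_mul2 => //; apply: mle_refl.
  exists (mul E (subM t x)).
  have h0 : subM X x = add (subM X t) (subM t x) by mz.
  split; first by rewrite h0; apply: le_mul2 => //; apply: le_addl.
  split; first by rewrite h0 basic_mulDr {2}e1; mring.
  split; first by rewrite -[oneM]mmulr1; apply: le_mul2.
  rewrite basic_mulS pwD; last by rewrite -basic_mulS; apply: lqt.
  by apply: le_mul2 => //; apply: mle_trans q_pw; mz.
have lq2 t : le t q -> le (mul (len q) (mul q t)) (len z).
  by move=> h; apply: mle_trans lq_z; do 2 (apply: le_mul2 => //; try apply: mle_refl).
(* [Q t] divides [W D], with quotient [R]. The bounds on [D] and [R] keep the induction formula in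
   Sigma^b_1. *)
have main t : le t (len z) -> le t q ->
    exists D, le D (pw z (mul (len q) (mul q t))) /\
    exists R, le R (mul W (pw z (mul (len q) (mul q t)))) /\
      (mul (Q t) R = mul W D /\ le oneM D).
  move: t; apply: LIND.
  - apply: Sg_imp; first by sb.
    apply: (Sg_ex (b := fun rho => pw z (mul (len q) (mul q (rho 0))))); first by rewrite /pw; pf.
    apply: (Sg_ex (b := fun rho => mul W (pw z (mul (len q) (mul q (rho 1)))))); first by rewrite /pw; pf.
    apply: Sg_SB; apply: SB_and; last by sb.
    by apply: SB_eq; [apply: PF_mul; [apply: pQ|]|]; pf.
  - move=> _; exists oneM; rewrite !basic_mul0 pw0; split; first exact: mle_refl.
    exists W; rewrite Q0 !mmulr1 mmul1r; split; first exact: mle_refl.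
    by split=> //; apply: mle_refl.
  move=> t htz IH ht; have [D [hD [R [hR [e1 hD1]]]]] := IH (le_Su_le ht).
  have mono : le (pw z (mul (len q) (mul q t))) (pw z (mul (len q) (mul q (Su t)))).
    apply: pw_le (lq2 _ ht); apply: le_mul2; first exact: mle_refl.
    by apply: le_mul2; [apply: mle_refl|apply: le_S].
  rewrite QS //; case: (pselect (A t)) => hA; last first.
    rewrite iteF //; exists D; split; first exact: mle_trans mono.
    exists R; split; last by split.
    by apply: mle_trans hR _; apply: le_mul2 => //; apply: mle_refl.
  rewrite iteT //.
  have [S [_ [E [_ [e2 [e3 e4]]]]]] := modt t ht t (le_Su_le htz) (mle_refl t).
  have ltX := lt_X (le_Su_le ht); have hX := subMK (le_Su_le ltX).
  have Xt : le oneM (subM X t) by mz.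
  have [U eU] : exists U, W = mul (subM X t) U.
    have [u hu] := A_dvd ht hA.
    have [U [eU|eU]] := zi_or_opp u.
      by exists U; apply: zi_inj; rewrite ziM (zi_sub (le_Su_le ltX)) hu eU.
    exfalso; rewrite eU -(zi_sub (le_Su_le ltX)) mulrN -ziM in hu.
    by have h0 := zi_ge0 (mul (subM X t) U); mz0; lra.
  (* From Q R = W D, with Q = (X - t) S + E and W = (X - t) U: the multiple (X - t) S R is at most
     (X - t) U D, so their difference can be formed in the model. *)
  have hle : le (mul S R) (mul U D).
    apply: (basic_le_mul _ _ Xt).1; apply: (mle_trans (y := mul (Q t) R)).
      by rewrite e2 -mmulA; have h0 := basic_ge0 (mul E R); mz.
    by rewrite e1 eU mmulA; apply: mle_refl.
  have [R' eR'] := sub_ex hle.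
  (* X - t divides E R. This replaces the gcd argument: after multiplication by [E], the factor X -
     t can be moved from [R] to the product. *)
  have eER : mul E R = mul (subM X t) R'.
    apply: (@maddI _ (mul (subM X t) (mul S R))).
    transitivity (mul (Q t) R); first by rewrite e2; mring.
    by rewrite e1 eU mmulA -eR' basic_mulDr.
  have hDE : le (mul D E) (pw z (mul (len q) (mul q (Su t)))).
    rewrite basic_mulS basic_mulDr pwD; last by rewrite -basic_mulDr -basic_mulS; apply: lq2.
    apply: le_mul2 => //; apply: mle_trans e4 _; apply: pw_le; last exact: lqt (mle_refl q).
    by apply: le_mul2; [apply: mle_refl|apply: le_Su_le].
  have eR : mul (mul (Q t) (subM X t)) R' = mul W (mul D E).
    transitivity (mul (mul (Q t) R) E); last by rewrite e1 mmulA.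
    by rewrite mmulA -eER; mring.
  exists (mul D E); split=> //; exists R'; split.
    apply: (mle_trans (y := mul W (mul D E))); last exact: le_mul2 (mle_refl W) hDE.
    rewrite -eR -[X in le X _]mmul1r; apply: le_mul2; last exact: mle_refl.
    by rewrite -[oneM]mmulr1; apply: le_mul2 => //; apply: Q_gt0; apply: le_Su_le.
  by split=> //; rewrite -[oneM]mmulr1; apply: le_mul2.
have kc t : le t q -> le (mul kk (c t)) (len z).
  by move=> h; apply: mle_trans kq_z; apply: le_mul2; [apply: mle_refl|apply: mle_trans (c_le h) h].
(* Since 2 q <= X, each factor is at least X / 2, so each root contributes [kk - 1] bits. *)
have lower t : le t (len z) -> le t q ->
    le (pw z (mul kk (c t))) (mul (Q t) (pw z (c t))).
  move: t; apply: LIND.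
  - apply/Sg_SB/SB_imp; first by sb.
    have pc : PF anyc (fun rho => c (rho 0)) by [].
    by apply: SB_le; [|apply: PF_mul; [apply: pQ; pf|]]; rewrite /pw; apply: PF_smash; pf;
      apply: PV_un; pf; apply: PF_mul; pf.
  - by move=> _; rewrite c0 basic_mul0 pw0 Q0 mmulr1; apply: mle_refl.
  move=> t htz IH ht; have h1 := IH (le_Su_le ht).
  have k1 := kc _ ht; have k2 := c_le ht.
  rewrite QS // cS // in k1 k2 *; case: (pselect (A t)) => hA; last first.
    by rewrite !iteF // basic_add0 in k1 k2 *.
  rewrite !iteT // !maddr1 in k1 k2 *.
  rewrite basic_mulS in k1 *; rewrite pwD // pwS; last exact: mle_trans k2 (ltz _ ht).
  have ltX := lt_X (le_Su_le ht); have hX := subMK (le_Su_le ltX).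
  have h2 : le X (mul twoM (subM X t)) by mz.
  by apply: mle_trans (le_mul2 h1 h2) _; mz.
have [D [hD [R [_ [e1 hD1]]]]] := main q q_z (mle_refl q).
have R1 : le oneM R.
  apply: le_one => eR; move: e1; rewrite eR basic_mul0 => /esym/mul_eq0[] e0.
    by apply: (ge1_neq0 W_gt0).
  by apply: (ge1_neq0 hD1).
apply: mle_trans (lower q q_z (mle_refl q)) _; rewrite basic_mulC.
apply: le_mul2; first exact: mle_refl.
apply: (mle_trans (y := mul W D)); last exact: le_mul2 (mle_refl W) hD.
by rewrite -e1 -{1}[Q q]mmulr1; apply: le_mul2 => //; apply: mle_refl.
Qed.

End Roots.
End Count.

(** * Values of the circuits of the class *)

Section Values.

Variable M : model.
Implicit Types (i j k t x y z w a v : M).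
Variables (n d s P : M).
Hypothesis hC : CktM n d s P.

Notation L := (cL P).
Notation p := (cp P).
Notation G := (cG P).
Notation C := (cC P).
Notation out := (subM L oneM).

Lemma Ckt_circuit : circuitM P L p G C.
Proof. by have [_ [L' [p' [G' [C' [h _]]]]]] := hC; have [e1 e2 e3 e4] := circuitMP h; subst. Qed.
Lemma Ckt_wf : well_formedM n L p G C.
Proof. by have [_ [L' [p' [G' [C' [h [h2 _]]]]]]] := hC; have [e1 e2 e3 e4] := circuitMP h; subst. Qed.
Lemma Ckt_out : le (Su out) L.
Proof. by have [h _] := Ckt_wf; have h1 := subMK h; mz. Qed.
Lemma SuOut : Su out = L.
Proof. by have [h _] := Ckt_wf; rewrite -madd1r subMK. Qed.
Lemma Ckt_deg tag j : (tag = zeroM /\ le (Su j) n) \/ (tag = oneM /\ le (Su j) p) ->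
  exists D, degreesM G L tag j D /\ exists e, entryM D out e /\ le e d.
Proof.
have [_ [L' [p' [G' [C' [h [h2 h3]]]]]]] := hC; have [e1 e2 e3 e4] := circuitMP h; subst.
move=> /h3 [D [l [e [h4 [h5 h6]]]]]; exists D; split=> //; exists e.
by rewrite (_ : out = l) // h5 subM_Su.
Qed.
Lemma Ckt_size : [/\ le L s, le p s & le (len C) s].
Proof.
have [h _] := hC; rewrite /cL /cp /cC.
have l2 := p2_le P; have l3 := p2_le (p2 P).
split; apply: mle_trans h; apply: basic_len_le; first exact: p1_le.
  by apply: mle_trans (p1_le _) l2.
by apply: mle_trans (p2_le _) _; apply: mle_trans l3 l2.
Qed.

Section Size.
Variable z : M.
Hypothesis hL : le L (len z).
Hypothesis hN : le (add n p) (len z).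

Let hn : le n (len z). Proof. exact: mle_trans (le_addr _ _) hN. Qed.
Let hp : le p (len z). Proof. exact: mle_trans (le_addl _ _) hN. Qed.

Lemma deg_out k : le (Su k) (add n p) -> le (deg hL hN Ckt_wf k (Su k) out) d.
Proof.
move=> hk; have lo := mle_trans (le_Su_le Ckt_out) hL.
have [tag [j [ht e]]] : exists tag j, ((tag = zeroM /\ le (Su j) n) \/ (tag = oneM /\ le (Su j) p)) /\
    k = input_index n tag j.
  case: (le_or_lt n k) => h; last first.
    by exists zeroM, k; split; [left|rewrite /input_index iteT].
  have [j hj] := sub_ex h; exists oneM, j; split; first by right; split=> //; mz.
  by rewrite /input_index iteF //; apply: one_neq0.
have [D [hD [e0 [he0 hd]]]] := Ckt_deg ht.
have := degreesMP hL hN Ckt_wf ht hD Ckt_out; rewrite -e => <-.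
by move/(entryMP _ _ lo): he0 => <-.
Qed.

Lemma tdeg_out : le (tdeg hL hN Ckt_wf out) (mul (add n p) d).
Proof. by apply: tdeg_le Ckt_out _ => k; apply: deg_out. Qed.

(** Every circuit reads some variable or parameter, as even constants are plugged parameters; so its
    total degree is positive. *)
Lemma d_ge1 : le oneM d.
Proof.
apply: le_one => e; have h := tdeg_out; rewrite e basic_mul0 in h.
by have h1 := tdeg_ge1 hL hN Ckt_wf Ckt_out; mz.
Qed.

Variables (y kap : M).
Hypothesis h_par : forall j, le (Su j) p -> le (halfM (ent z C j)) (pw z kap).
Hypothesis h_size : le (add (mul (add L kap) (mul (add n p) d)) (threeM M)) (len y).
Hypothesis h_y : le (len y) (len z).

Lemma ev_defined a : is_pointM n a ->
  (forall j, le (Su j) n -> le (halfM (ent z a j)) (pw z kap)) -> ev z y P a out <> zeroM.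
Proof.
move=> ha hb.
have h0 : le (Su n) n -> le (halfM (ent z a n)) (pw z (add kap zeroM)) by move=> /nlt.
have hs : le (add (mul (add (add L kap) zeroM) (mul (add n p) d)) (threeM M)) (len y).
  by rewrite basic_add0.
by case: (ev_bound (fun j hj _ => hb j hj) h0 h_par hs h_y Ckt_out tdeg_out).
Qed.

Lemma ev_evaluates a v : is_pointM n a -> ev z y P a out = Su v -> evaluatesM P a v.
Proof.
move=> ha hv; have lo := mle_trans (le_Su_le Ckt_out) hL.
exists L, p, G, C, (pair (evT z y P a) y), out.
split; first exact: Ckt_circuit.
split; first by rewrite SuOut.
split; first exact/(entryMP _ _ lo).
by apply/(tableMP hL hn hp Ckt_wf); apply (ev_tabz hL hN Ckt_wf).
Qed.

End Size.

Lemma evaluates_table z a v : le L (len z) -> le (add n p) (len z) -> evaluatesM P a v ->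
  exists t, tabz L G C z a t /\ ent z t out = Su v.
Proof.
move=> hL hN [L' [p' [G' [C' [t [l [h [h1 [h2 h3]]]]]]]]].
have [e1 e2 e3 e4] := circuitMP h; subst; exists t; split.
  by rewrite e1 in h3; exact: ((tableMP hL (mle_trans (le_addr _ _) hN) (mle_trans (le_addl _ _) hN) Ckt_wf a t).1 h3).
have lo := mle_trans (le_Su_le Ckt_out) hL.
by apply/esym/(entryMP _ _ lo); rewrite -e1 subM_Su.
Qed.

(** The values are congruent modulo [x] if the coordinates are. The coordinates are compared at all
    sufficiently long [z], because the length needed to read both tables is fixed only inside the
    proof. *)
Lemma evaluates_congruence a a' v v' x : evaluatesM P a v -> evaluatesM P a' v' ->
  (exists z0, forall z, le (len z0) (len z) -> forall j, le (Su j) n ->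
    dvdZ (zi x) (intv (ent z a j) - intv (ent z a' j))%R) ->
  inlog n -> dvdZ (zi x) (intv v - intv v')%R.
Proof.
move=> hv hv' [z0 hz0] ln.
have [z hz] : inlog (add (add L (add n p)) (len z0)).
  by do !apply: inlog_add => //; apply: inlog_len.
have hL : le L (len z) by mz.
have hN : le (add n p) (len z) by mz.
have hz' : le (len z0) (len z) by mz.
have [t [ht1 ht2]] := evaluates_table hL hN hv; have [t' [ht1' ht2']] := evaluates_table hL hN hv'.
exact: (table_congruence hL Ckt_wf ht1 ht1' (hz0 z hz') Ckt_out ht2 ht2').
Qed.

Lemma evaluates_int a v : inlog n -> is_pointM n a -> evaluatesM P a v -> v <> oneM.
Proof.
move=> ln ha hv.
have [z hz] : inlog (add L (add n p)) by do !apply: inlog_add => //; apply: inlog_len.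
have hL : le L (len z) by mz.
have hN : le (add n p) (len z) by mz.
have [t [ht1 ht2]] := evaluates_table hL hN hv.
exact: (table_int hL (mle_trans (le_addr _ _) hN) (mle_trans (le_addl _ _) hN) Ckt_wf ha ht1 Ckt_out ht2).
Qed.

Lemma evaluates_uniq a v v' : inlog n -> is_pointM n a ->
  evaluatesM P a v -> evaluatesM P a v' -> v = v'.
Proof.
move=> ln ha hv hv'; apply: intv_inj; [exact: evaluates_int ha hv|exact: evaluates_int ha hv'|].
have : dvdZ (zi zeroM) (intv v - intv v')%R.
  apply: evaluates_congruence hv hv' _ ln; exists zeroM => z _ j _.
  by rewrite subrr; apply: dvdZ0.
by rewrite zi0 => /dvdZ0l /eqP; rewrite subr_eq0 => /eqP.
Qed.

Lemma ent_half_le z w j : le (len (p2 w)) (len z) -> le (halfM (ent z w j)) (pw z (len (p2 w))).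
Proof.
move=> h; rewrite pw_E2 //; apply: mle_trans (half_le _) _.
by apply: le_Su_le; apply: ent_lt.
Qed.

(** Each coordinate and each plugged integer has at most the block length of its sequence; with [d]
    in Log the total degree is in Log, and so is the room needed for all relevant values. *)
Lemma evaluates_total a : inlog n -> inlog d -> is_pointM n a -> exists v, evaluatesM P a v.
Proof.
move=> ln ld ha.
pose kap := add (len (p2 a)) (len (p2 C)).
pose sz := add (mul (add L kap) (mul (add n p) d)) (threeM M).
have lL : inlog L by apply: inlog_len.
have lp : inlog p by apply: inlog_len.
have lk : inlog kap by apply: inlog_add; apply: inlog_len.
have l3 : inlog (threeM M) by do 2 apply: inlog_S; apply: inlog_one.
have lsz : inlog sz.
  by apply: inlog_add => //; apply: inlog_mul; [apply: inlog_add|apply: inlog_mul => //; apply: inlog_add].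
have [y hy] := (in_LogMP sz).2 lsz.
have [z hz] : inlog (add (add L (add n p)) (add kap sz)).
  by apply: inlog_add (inlog_add lL (inlog_add ln lp)) (inlog_add lk lsz).
have hL : le L (len z) by mz.
have hN : le (add n p) (len z) by mz.
have hk : le kap (len z) := mle_trans (mle_trans (le_addr kap sz) (le_addl _ _)) hz.
have hyz : le (len y) (len z).
  by rewrite hy; apply: mle_trans (mle_trans (le_addl sz kap) (le_addl _ _)) hz.
have hsy : le sz (len y) by rewrite hy; apply: mle_refl.
have bd w j : le (len (p2 w)) kap -> le (halfM (ent z w j)) (pw z kap).
  by move=> h; apply: mle_trans (ent_half_le j (mle_trans h hk)) (pw_le h hk).
have := @ev_defined z hL hN y kap (fun j _ => bd C j (le_addl _ _)) hsy hyz a ha (fun j _ => bd a j (le_addr _ _)).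
by move=> /eq_Su [v hv]; exists v; apply: ev_evaluates hv.
Qed.

(** A table stores the successor of the value, so nonzero values are entries at least 2.
    Nonvanishing thereby becomes a PV predicate of the circuit and the point. *)
Lemma nonzero_atP z y kap a : inlog n -> le L (len z) -> le (add n p) (len z) ->
  (forall j, le (Su j) p -> le (halfM (ent z C j)) (pw z kap)) ->
  le (add (mul (add L kap) (mul (add n p) d)) (threeM M)) (len y) -> le (len y) (len z) ->
  is_pointM n a -> (forall j, le (Su j) n -> le (halfM (ent z a j)) (pw z kap)) ->
  nonzero_atM P a <-> le twoM (ev z y P a out).
Proof.
move=> ln hL hN hp hsz hy ha hb.
have [v hv] := eq_Su (ev_defined hL hN hp hsz hy ha hb).
have hev := ev_evaluates hL hN ha hv; rewrite hv le_SS; split=> [[v' [hv' nv]]|h].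
  by apply: le_one; rewrite (evaluates_uniq ln ha hev hv').
by exists v; split=> // e; rewrite e in h; apply: (@nlt M zeroM).
Qed.

End Values.

(** * Few roots on a line *)

Section Line.

Variable M : model.
Implicit Types (i j k t x y z w a v : M).

Lemma dvdZ_small d (b : Z M) : dvdZ (zi d) b -> (`|b| < zi d)%R -> b = 0%R.
Proof.
move=> [c ->] h; suff -> : c = 0%R by rewrite mulr0.
have [k hk] := zi_or_opp c; rewrite normrM (ger0_norm (zi_ge0 d)) in h.
have {}h : (zi (mul d k) < zi d)%R by case: hk h => ->; rewrite ?normrN ziM (ger0_norm (zi_ge0 k)).
have k0 : k = zeroM.
  apply: contrapT => /le_one hk1; have h1 := le_mul2 (mle_refl d) hk1.
  by rewrite mmulr1 in h1; move/zi_lt: h => h; apply: (@nlt M (mul d k)); apply: mle_trans h h1.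
by case: hk => ->; rewrite k0 zi0 ?oppr0.
Qed.

Lemma le_pw_self z x : le x (len z) -> le (Su x) (pw z x).
Proof.
move=> h; have h1 := mle_trans (le_len x) h.
by apply: mle_trans (lt_pw_len h1) (pw_le (le_len x) h).
Qed.

(** [pts v] is the point of the line through [a0] whose coordinate [j0] is [v]. The set [A] is any
    definable set of zeros on the line and [c] its counting function. Asking only that [P] vanishes
    on [A] lets the lemma serve both to bound a set of zeros and to show that not all points of a
    line are zeros. *)
Lemma line_roots n d s q P (a0 j0 : M) (pts c : M -> M) (A : M -> Prop) :
  CktM n d s P -> inlog n -> inlog d -> inlog q ->
  is_pointM n a0 -> le (Su j0) n -> nonzero_atM P a0 ->
  (forall v, le (Su v) q -> is_pointM n (pts v)) ->
  (forall z v, le n (len z) -> le (Su v) q -> ent z (pts v) j0 = mul twoM v) ->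
  (forall z v j, le n (len z) -> le (Su v) q -> le (Su j) n -> j <> j0 ->
    ent z (pts v) j = ent z a0 j) ->
  PD anyc (fun rho => A (rho 0)) ->
  (forall v, le (Su v) q -> A v -> ~ nonzero_atM P (pts v)) ->
  PF anyc (fun rho => c (rho 0)) ->
  c zeroM = zeroM ->
  (forall v, le (Su v) q -> c (Su v) = add (c v) (ite (A v) oneM zeroM)) ->
  le (c q) d.
Proof.
move=> hC ln ld lq a0_point j0_lt a0_nonzero pts_point pts_j0 pts_ne A_PD A_root c_PF c0 cS.
case: (pselect (q = zeroM)) => [e|/le_one q1]; first by rewrite e c0; apply: basic_ge0.
have [v0 [hv0 nv0]] := a0_nonzero.
have iv0 := evaluates_int hC ln a0_point hv0.
have lL : inlog (cL P) by apply: inlog_len.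
have lp : inlog (cp P) by apply: inlog_len.
have [kap ek] : exists k, k = add (len (p2 a0)) (len (p2 (cC P))) by eexists.
have lk : inlog kap by rewrite ek; apply: inlog_add; apply: inlog_len.
have [Tm eT] : exists t, t = mul (add n (cp P)) d by eexists.
have lT : inlog Tm by rewrite eT; apply: inlog_mul => //; apply: inlog_add.
have [Q3 eQ] : exists t, t = mul (len q) (mul q q) by eexists.
have lQ : inlog Q3 by rewrite eQ; apply: inlog_mul (inlog_mul lq lq); apply: inlog_len.
(* [kk] exceeds everything in the final estimate that is not a multiple of [kk], and also kap +
   |v0|, by which the value at X is nonzero, and q, by which 2 q <= X. *)
have [kk ekk] : exists k, k = Su (add (add (mul (add (cL P) kap) Tm) Q3) (add q (add kap (len v0)))) by eexists.
have lkk : inlog kk.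
  rewrite ekk; apply: inlog_S; apply: inlog_add; first by apply: inlog_add => //; apply: inlog_mul => //; apply: inlog_add.
  by apply: inlog_add => //; apply: inlog_add => //; apply: inlog_len.
have [sz es] : exists t, t = add (mul (add (add (cL P) kap) kk) Tm) (threeM M) by eexists.
have lsz : inlog sz.
  rewrite es; apply: inlog_add; first by apply: inlog_mul => //; do !apply: inlog_add => //.
  by do 2 apply: inlog_S; apply: inlog_one.
have [y hy] := (in_LogMP sz).2 lsz.
(* The coordinate X is coded by 2 X, which fits in blocks of [kk + 2] bits. *)
have [y' hy'] := (in_LogMP (Su (Su kk))).2 (inlog_S (inlog_S lkk)).
have [z hz] : inlog (add (add (add (cL P) (add n (cp P))) (add sz (add q Q3))) (add (mul kk q) (Su (Su (mul kk (Su d)))))).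
  apply: inlog_add; [apply: inlog_add; [|apply: inlog_add; [|apply: inlog_add]]|] => //.
    by apply: inlog_add => //; apply: inlog_add.
  apply: inlog_add; first exact: inlog_mul.
  by do 2 apply: inlog_S; apply: inlog_mul => //; apply: inlog_S.
have hz' : le (add (add (cL P) (add n (cp P))) (add sz (add q Q3))) (len z) := mle_trans (le_addr _ _) hz.
have hz2 : le (add (mul kk q) (Su (Su (mul kk (Su d))))) (len z) := mle_trans (le_addl _ _) hz.
have hL : le (cL P) (len z) by clear - hz'; mz.
have hN : le (add n (cp P)) (len z) by clear - hz'; mz.
have hn : le n (len z) by clear - hN; mz.
have hsz : le sz (len z) by clear - hz'; mz.
have hkk2 : le (Su (Su kk)) (len z).
  have pkd := basic_ge0 (mul kk d); have pkq := basic_ge0 (mul kk q).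
  by rewrite basic_mulS in hz2; clear - hz2 pkd pkq; mz.
have hkk : le kk (len z) by clear - hkk2; mz.
have hq : le q (len z) by clear - hz'; mz.
have hQ : le Q3 (len z) by clear - hz'; mz.
have hkq : le (mul kk q) (len z) := mle_trans (le_addr _ _) hz2.
have hkd : le (mul kk (Su d)) (len z) by have pkq := basic_ge0 (mul kk q); clear - hz2 pkq; mz.
have pLT := basic_ge0 (mul (add (cL P) kap) Tm).
have kap_kk : le kap kk by clear - ekk pLT; mz.
have hkap : le kap (len z) := mle_trans kap_kk hkk.
have v0_kk : le (Su (add kap (len v0))) kk by clear - ekk pLT; mz.
have q_kk : le (Su q) kk by clear - ekk pLT; mz.
have hyz : le (len y) (len z) by rewrite hy.
have [X eX] : exists X, X = pw z kk by eexists.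
have X1 : le oneM X by rewrite eX; apply: pw_ge1.
have X_q : le (mul twoM q) X.
  rewrite eX; apply: (mle_trans (y := pw z (Su q))); last exact: pw_le.
  rewrite pwS; last exact: mle_trans hkk.
  by apply: le_mul2 (mle_refl _) _; apply: le_Su_le; apply: le_pw_self.
have bd w j : le (len (p2 w)) kap -> le (halfM (ent z w j)) (pw z kap).
  by move=> h; apply: mle_trans (ent_half_le j (mle_trans h hkap)) (pw_le h hkap).
have ka : le (len (p2 a0)) kap by rewrite ek; apply: le_addr.
have kC : le (len (p2 (cC P))) kap by rewrite ek; apply: le_addl.
have vX : PF anyc (fun rho => ite (rho 0 = j0) (mul twoM X) (ent z a0 (rho 0))).
  by apply: PF_ite; [apply: PD_eq|..]; pf.
have [t ht] : exists t, forall j, le (Su j) n ->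
    ent z (pair t y') j = ite (j = j0) (mul twoM X) (ent z a0 j).
  apply: (seq_ex vX hn) => j hj.
  have e4 : E2 y' = mul twoM (mul twoM X).
    by rewrite -(pw_E2 (z := z)) hy' // !pwS ?eX //; apply: le_Su_le.
  case: (pselect (j = j0)) => h; [rewrite iteT //|rewrite iteF //]; first by rewrite e4; clear - X1; mz.
  apply: mle_trans (ent_lt _ _ _) _; rewrite -!(pw_E2 (z := z)) ?hy' //; last exact: mle_trans ka hkap.
  by apply: pw_le => //; clear - ka kap_kk; mz.
have [aX eaX] : exists a, a = pair t y' by eexists.
rewrite -eaX in ht => {eaX}.
have ht0 : ent z aX j0 = mul twoM X by rewrite ht // iteT.
have ht1 j : le (Su j) n -> j <> j0 -> ent z aX j = ent z a0 j by move=> hj ne; rewrite ht // iteF.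
have aX_point : is_pointM n aX.
  move=> j hj; have lj : le j (len z) := mle_trans (le_Su_le hj) hn.
  exists (ent z aX j); split; first exact/(entryMP _ _ lj).
  apply/is_intP; case: (pselect (j = j0)) => h; last by rewrite ht1 //; apply: (point_int hn a0_point).
  by rewrite h ht0; clear - X1; mz.
have [ev0 ev1 _] : [/\ ev z y P aX (subM (cL P) oneM) <> zeroM, le (halfM (subM (ev z y P aX (subM (cL P) oneM)) oneM))
    (pw z (ev_exp hL hN (Ckt_wf hC) j0 kap kk (subM (cL P) oneM))) & le (deg hL hN (Ckt_wf hC) j0 (Su j0) (subM (cL P) oneM)) (tdeg hL hN (Ckt_wf hC) (subM (cL P) oneM))].
  apply: (ev_bound (y := y) (Tm := Tm)) => //.
  - by move=> j hj ne; rewrite ht1 //; apply: bd.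
  - move=> _; rewrite ht0 half_double eX; apply: pw_le; first exact: le_addl.
    apply: mle_trans hsz; rewrite es eT.
    have T1 : le oneM Tm by rewrite eT; apply: mle_trans (tdeg_out hC hL hN); apply: tdeg_ge1 (Ckt_out hC).
    by have h1 := le_mul2 (mle_refl (add (add (cL P) kap) kk)) T1; rewrite -eT; clear - h1; mz.
  - by move=> j _; apply: bd.
  - by rewrite hy es; apply: mle_refl.
  - exact: Ckt_out hC.
  - by rewrite eT; apply: tdeg_out.
have [w hw] := eq_Su ev0; rewrite hw subM_Su in ev1.
have hevX := ev_evaluates hC hL hN aX_point hw.
have iw := evaluates_int hC ln aX_point hevX.
have [E eE] : exists E, E = add (mul (add (cL P) kap) Tm) (mul kk d) by eexists.
have hE : le (halfM w) (pw z E).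
  apply: mle_trans ev1 _; apply: pw_le; last by rewrite eE; apply: mle_trans hkd; rewrite basic_mulS; mz.
  rewrite eE /ev_exp; apply: le_add2.
    apply: le_mul2; last by rewrite eT; apply: tdeg_out.
    by apply: le_add2 (mle_refl _); apply: le_Su_le; apply: Ckt_out hC.
  apply: le_mul2 (mle_refl _) _; apply: deg_out => //.
  by apply: mle_trans j0_lt (le_addr _ _).
(* The values [w] at X and [v0] at [a0] are congruent modulo X minus the coordinate of [a0]. As |v0|
   is smaller than this modulus, [w = 0] would force [v0 = 0]. *)
have W1 : le oneM (halfM w).
  apply: le_one => w0; have iw0 : intv w = 0%R.
    by apply/eqP; rewrite -normr_eq0 -zi_half w0 zi0.
  have b1 : (`|intv (ent z a0 j0)| <= zi (pw z kap))%R by rewrite -zi_half; apply/zi_le/bd.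
  have b2 : (`|intv v0| < zi (pw z (len v0)))%R.
    rewrite -zi_half; apply/zi_lt; apply: (mle_trans (y := Su v0)); first exact/le_SS/half_le.
    apply: lt_pw_len.
    by apply: mle_trans hkk; clear - v0_kk; mz.
  have b3 : le (mul twoM (mul (pw z kap) (pw z (len v0)))) X.
    by rewrite eX -pwD -?pwS; [exact: pw_le|exact: mle_trans hkk|exact: mle_trans (le_Su_le v0_kk) hkk].
  have g1 := pw_ge1 z kap; have g2 := pw_ge1 z (len v0).
  have b4 : (zi (pw z kap) + zi (pw z (len v0)) <= zi X)%R.
    by move/zi_le: b3; rewrite !ziM zi2; move/zi_le: g1; move/zi_le: g2; rewrite zi1; nra.
  have [b5 b6] : (intv (ent z a0 j0) <= zi (pw z kap))%R /\ (- zi (pw z kap) <= intv (ent z a0 j0))%R.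
    by move: b1; rewrite ler_norml => /andP[].
  have [dl hdl] : exists dl, (zi X - intv (ent z a0 j0))%R = zi dl.
    by apply: zi_ex; move/zi_le: g2; rewrite zi1; lra.
  have : dvdZ (zi dl) (intv w - intv v0)%R.
    apply: (evaluates_congruence hC hevX hv0 _ ln); exists z => z1 hz1 j hj.
    have lj : le j (len z) := mle_trans (le_Su_le hj) hn.
    rewrite -!(ent_indep _ lj (mle_trans lj hz1)).
    case: (pselect (j = j0)) => h; last by rewrite ht1 // subrr; apply: dvdZ0.
    by rewrite h ht0 intv_double hdl; exists 1%R; rewrite mulr1.
  rewrite iw0 sub0r => /dvdZN; rewrite opprK => hd.
  apply: nv0; apply: intv_eq0 => //; apply: dvdZ_small hd _.
  by rewrite -hdl; clear - b2 b4 b5; lra.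
have dvd v : le (Su v) q -> A v -> dvdZ (zi (pw z kk) - zi v)%R (zi (halfM w)).
  move=> hv hA; have [u hu] := evaluates_total hC ln ld (pts_point v hv).
  have u0 : u = zeroM.
    by apply: contrapT => nu; apply: (A_root v hv hA); exists u.
  have vX' : le v X by clear - hv X_q; mz.
  rewrite -eX -(zi_sub vX').
  have : dvdZ (zi (subM X v)) (intv w - intv u)%R.
    apply: (evaluates_congruence hC hevX hu _ ln); exists z => z1 hz1 j hj.
    have lj : le j (len z) := mle_trans (le_Su_le hj) hn.
    rewrite -!(ent_indep _ lj (mle_trans lj hz1)).
    case: (pselect (j = j0)) => h; last by rewrite ht1 // pts_ne // subrr; apply: dvdZ0.
    by rewrite h ht0 pts_j0 // !intv_double zi_sub //; exists 1%R; rewrite mulr1.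
  rewrite u0 intv0 subr0 zi_half; case: ger0P => _ // h; exact: dvdZN.
rewrite eX in X_q; rewrite eQ in hQ.
have rc := root_count A_PD c_PF c0 cS hq hQ hkq X_q q1 W1 dvd.
have cq := c_le c_PF c0 cS hq (mle_refl q).
have E_kk : le (add q (add E Q3)) (mul kk (Su d)).
  by rewrite basic_mulS; clear - ekk eE; mz.
have cE : le (add (c q) (add E Q3)) (len z).
  by apply: mle_trans (le_add2 cq (mle_refl _)) (mle_trans E_kk hkd).
have b1 : le (pw z (mul kk (c q))) (pw z (add (c q) (add E Q3))).
  have cE' := mle_trans (le_addl _ _) cE.
  by apply: mle_trans rc _; rewrite !pwD // -eQ; apply: le_mul2 (mle_refl _) (le_mul2 hE (mle_refl _)).
have b2 := pw_le_inv (mle_trans (le_mul2 (mle_refl kk) cq) hkq) b1.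
(* The lengths give kk c <= c + E + |q| q^2, where E contains the term kk d. If c were at least d +
   1, [kk] would be bounded by the terms that it was chosen to exceed. *)
apply: contrapT => /not_le_lt hc.
have h1 := le_mul2 (mle_refl kk) hc; rewrite basic_mulS in h1.
by clear - ekk eE b2 cq h1 pLT; mz.
Qed.

End Line.

(** * Points of the grid *)

Section Replace.

Variable M : model.
Implicit Types (i j k t u v h z w y a low : M).

Lemma divM_mul t p B : p <> zeroM -> B <> zeroM -> divM t (mul p B) = divM (divM t p) B.
Proof.
move=> hp hB; have h1 := divM_eq t p; have h2 := divM_eq (divM t p) B.
have h3 := modM_lt t hp; have h4 := modM_lt (divM t p) hB.
have [] // := @divM_uniq M t (mul p B) (divM (divM t p) B)
  (add (modM t p) (mul p (modM (divM t p) B))).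
  by have h5 := le_mul2 (mle_refl p) h4; clear - h3 h5; mz.
by rewrite {1}h1 {1}h2; mring.
Qed.

Section Digits.

Variables (z B : M).
Hypothesis B_neq0 : B <> zeroM.
Notation pB := (powB z B).

Let pB_neq0 i : le i (len z) -> pB i <> zeroM.
Proof. exact: powB_neq0. Qed.

Lemma powB_split j i : le j i -> le i (len z) -> exists e, le e (len z) /\ pB i = mul (pB j) (pB e).
Proof.
move=> /sub_ex[e <-] hi; exists e; split; first exact: mle_trans (le_addl _ _) hi.
by rewrite powBD.
Qed.

Lemma dig_modM t j i : le (Su j) i -> le i (len z) -> dig z B (modM t (pB i)) j = dig z B t j.
Proof.
move=> hj hi; have [e [he e1]] := powB_split hj hi.
rewrite powBS in e1; last exact: mle_trans hj hi.
have nj : pB j <> zeroM by apply/pB_neq0/(mle_trans (le_Su_le hj) hi).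
rewrite /dig [in RHS](divM_eq t (pB i)) {2}e1 basic_addC.
have -> : mul (mul (mul (pB j) B) (pB e)) (divM t (pB i)) =
    mul (pB j) (mul B (mul (pB e) (divM t (pB i)))) by mring.
by rewrite divM_addM // modM_addM.
Qed.

Lemma dig_mod_eq t t' j i : le (Su j) i -> le i (len z) -> modM t (pB i) = modM t' (pB i) ->
  dig z B t j = dig z B t' j.
Proof. by move=> hj hi e; rewrite -(dig_modM t hj hi) e dig_modM. Qed.

Lemma dig_div_eq t t' j i : le i j -> le j (len z) -> divM t (pB i) = divM t' (pB i) ->
  dig z B t j = dig z B t' j.
Proof.
move=> hij hj e; have [k [hk ek]] := powB_split hij hj.
have hi := mle_trans hij hj.
by rewrite /dig ek !divM_mul ?e //; apply: pB_neq0.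
Qed.

(* [low] with the digit [i] replaced by [v] and the next ones by those of [a]. *)
Definition splice i low v a : M :=
  add (add (modM low (pB i)) (mul v (pB i))) (mul (divM a (pB (Su i))) (pB (Su i))).
(** The digits of [h] below [i] and those of [a] from [i] on: a path from [a] to [h] changing one
    coordinate at a time. *)
Definition hybrid i h a : M := add (modM h (pB i)) (mul (divM a (pB i)) (pB i)).

Lemma splice_divmod i low v a : le (Su i) (len z) -> le (Su v) B ->
  [/\ modM (splice i low v a) (pB i) = modM low (pB i),
      dig z B (splice i low v a) i = v &
      divM (splice i low v a) (pB (Su i)) = divM a (pB (Su i))].
Proof.
move=> hi hv; have li := le_Su_le hi; have ni := pB_neq0 li.
have e : splice i low v a = add (mul (pB i) (add v (mul B (divM a (pB (Su i)))))) (modM low (pB i)).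
  by rewrite /splice [pB (Su i)]powBS //; mring.
have [e1 e2] := divM_uniq (modM_lt low ni) e.
split=> //; first by rewrite /dig e1 modM_addM // modM_small.
rewrite [pB (Su i) in LHS]powBS // divM_mul // e1 divM_addM // divM_small // madd0r //.
Qed.

Lemma splice_dig i low v a j : le (Su i) (len z) -> le (Su v) B -> le (Su j) (len z) ->
  (le (Su j) i -> dig z B (splice i low v a) j = dig z B low j) /\
  (le (Su i) j -> dig z B (splice i low v a) j = dig z B a j).
Proof.
move=> hi hv hj; have [e1 _ e2] := splice_divmod low a hi hv; split=> h.
  by apply: dig_mod_eq h (le_Su_le hi) _.
by apply: dig_div_eq h (le_Su_le hj) _.
Qed.

Lemma hybrid_dig i h a j : le i (len z) -> le (Su j) (len z) ->
  (le (Su j) i -> dig z B (hybrid i h a) j = dig z B h j) /\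
  (le i j -> dig z B (hybrid i h a) j = dig z B a j).
Proof.
move=> hi hj; have ni := pB_neq0 hi.
have [e1 e2] : divM (hybrid i h a) (pB i) = divM a (pB i) /\ modM (hybrid i h a) (pB i) = modM h (pB i).
  by apply: divM_uniq; [apply: modM_lt|rewrite /hybrid; mring].
split=> hij; first exact: dig_mod_eq hij hi _.
exact: dig_div_eq hij (le_Su_le hj) _.
Qed.

Lemma hybrid_S i h a : le (Su i) (len z) -> splice i h (dig z B h i) a = hybrid (Su i) h a.
Proof. by move=> hi; rewrite /splice /hybrid modM_powBS //; mring. Qed.

Lemma hybrid0 h a : hybrid zeroM h a = a.
Proof.
rewrite /hybrid powB0; have h1 := modM_lt h (@one_neq0 M).
by have h2 := divM_eq a oneM; have h3 := modM_lt a (@one_neq0 M); clear - h1 h2 h3; mz.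
Qed.

Lemma hybrid_full n h a : le (Su h) (pB n) -> le (Su a) (pB n) -> hybrid n h a = h.
Proof. by move=> hh ha; rewrite /hybrid modM_small // divM_small // basic_mulC basic_mul0 basic_add0. Qed.

(** Digit [i] is removed and the higher digits move down, so that a number with n digits becomes one
    with n - 1: this is where the factor q is saved. *)
Definition erase i h : M := add (modM h (pB i)) (mul (divM h (pB (Su i))) (pB i)).

Lemma erase_divmod i h : le i (len z) ->
  modM (erase i h) (pB i) = modM h (pB i) /\ divM (erase i h) (pB i) = divM h (pB (Su i)).
Proof.
move=> hi; apply/and_comm/divM_uniq; first exact/modM_lt/pB_neq0.
by rewrite /erase; mring.
Qed.

Lemma insert_erase i h : le (Su i) (len z) ->
  splice i (erase i h) (dig z B h i) (mul (divM (erase i h) (pB i)) (pB (Su i))) = h.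
Proof.
move=> hi; have [e1 e2] := erase_divmod h (le_Su_le hi).
have np : pB (Su i) <> zeroM by apply: pB_neq0.
rewrite /splice e1 e2.
have [-> _] : divM (mul (divM h (pB (Su i))) (pB (Su i))) (pB (Su i)) = divM h (pB (Su i)) /\
    modM (mul (divM h (pB (Su i))) (pB (Su i))) (pB (Su i)) = zeroM.
  by apply: divM_uniq; [apply: le_one|mring].
rewrite [in RHS](divM_eq h (pB (Su i))) modM_powBS //; mring.
Qed.

Lemma erase_lt i h n : le (Su i) (Su n) -> le (Su n) (len z) -> le (Su h) (pB (Su n)) ->
  le (Su (erase i h)) (pB n).
Proof.
move=> hi hn hh; have li : le (Su i) (len z) := mle_trans hi hn.
have [e [he ee]] := powB_split hi hn.
have ni := pB_neq0 (le_Su_le li).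
have e1 : pB n = mul (pB i) (pB e).
  have nB := le_one B_neq0.
  have eB : mul B (pB n) = mul B (mul (pB i) (pB e)).
    by rewrite basic_mulC -powBS // ee powBS //; mring.
  by apply: mle_anti; apply: (basic_le_mul _ _ nB).1; rewrite eB; apply: mle_refl.
have h1 : le (Su (divM h (pB (Su i)))) (pB e).
  apply: contrapT => h2; have h3 := divM_eq h (pB (Su i)).
  have h4 := (le_SS _ _).1 ((not_le_lt _ _).1 h2).
  have h5 := le_mul2 (mle_refl (pB (Su i))) h4.
  by rewrite ee in hh; mz.
have h2 := modM_lt h ni; have h3 := le_mul2 h1 (mle_refl (pB i)).
by rewrite e1 /erase; mz.
Qed.

End Digits.
End Replace.

Section Points.

Variable M : model.
Implicit Types (i j k t u v h a b w x y z n d s q kap P : M).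

(** The value depends only on the coordinates and not on the code of the point: this is congruence
    modulo 0. *)
Lemma nonzero_ext n d s P a b : CktM n d s P -> inlog n -> inlog d -> is_pointM n b ->
  (exists z0, forall z, le (len z0) (len z) -> forall j, le (Su j) n -> ent z a j = ent z b j) ->
  is_pointM n a -> nonzero_atM P a -> nonzero_atM P b.
Proof.
move=> hC ln ld hb [z0 e] ha [v [hv nv]].
have [u hu] := evaluates_total hC ln ld hb; exists u; split=> // eu; apply: nv.
have : dvdZ (zi zeroM) (intv v - intv u)%R.
  apply: (evaluates_congruence hC hv hu _ ln); exists z0 => z hz j hj.
  by rewrite (e z hz j hj) subrr; apply: dvdZ0.
rewrite eu intv0 subr0 zi0 => /dvdZ0l; apply: intv_eq0.
exact: (evaluates_int hC ln ha hv).
Qed.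

Lemma pair_le x x' y : le x x' -> le (pair x y) (pair x' y).
Proof.
move=> l; have h1 := is_pairM_pair x y; have h2 := is_pairM_pair x' y.
have h3 := le_add2 l (mle_refl y); have h4 := le_mul2 h3 ((le_SS _ _).2 h3).
by rewrite /is_pairM in h1 h2; move: (pair x y) (pair x' y) h1 h2 => u v h1 h2; mz.
Qed.

Lemma double_neq1 x : mul twoM x <> oneM.
Proof. by move=> e; apply: (@one_neq0 M); rewrite -(parity_odd zeroM) basic_mul0 -/oneM -e parity_even. Qed.

(** ** Mixed points *)

Section Seq.

Variables (z w q : M).
Hypothesis q_neq0 : q <> zeroM.
Hypothesis q_w : le (mul twoM q) w.

Lemma mixed_ex : exists F : M -> M -> M -> M,
  (forall f1 f2 f3, PF anyc f1 -> PF anyc f2 -> PF anyc f3 -> PF anyc (fun rho => F (f1 rho) (f2 rho) (f3 rho))) /\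
  forall a i h, le (Su (F a i h)) (powB z (E2 w) (len z)) /\
    forall j, le (Su j) (len z) -> dig z (E2 w) (F a i h) j =
      minM (ite (le (Su j) i) (mul twoM (dig z q h j)) (ent z a j)) (subM (E2 w) oneM).
Proof.
have ph : PF anyc (fun rho => ite (le (Su (rho 1)) (rho 3)) (mul twoM (dig z q (rho 4) (rho 1)))
    (ent z (rho 2) (rho 1))).
  by apply: PF_ite; [apply: PD_le|..]; pf.
have pB : PF anyc (fun rho : nat -> M => E2 w) by pf.
have [T [pT hT]] := cov_dig ph pB.
exists (fun a i h => T z (len z) (lenv [:: a; i; h])); split=> [f1 f2 f3 h1 h2 h3|a i h].
  apply: (PF_lenv (gs := [:: fun=> z; fun=> len z; f1; f2; f3]) pT).
  by do !constructor => //; pf.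
have [h1 h2] := hT z (lenv [:: a; i; h]) (@E2_neq0 _ w) _ (mle_refl (len z)); split=> // j hj.
by have [-> _] := h2 j hj.
Qed.
Definition mixed_digits := sval (cid mixed_ex).

(* The coordinates are the digits of [h] below [i], coded as integers by their doubles, and those
   of [a] from [i] on. *)
Definition mixed a i h : M := pair (mixed_digits a i h) w.

Lemma PF_mixed f1 f2 f3 : PF anyc f1 -> PF anyc f2 -> PF anyc f3 ->
  PF anyc (fun rho => mixed (f1 rho) (f2 rho) (f3 rho)).
Proof.
by move=> h1 h2 h3; rewrite /mixed /mixed_digits; case: (svalP (cid mixed_ex)) => p _; pf.
Qed.

Lemma mixed_le a i h : le (mixed a i h) (pair (powB z (E2 w) (len z)) w).
Proof.
by have [/le_Su_le l _] := (svalP (cid mixed_ex)).2 a i h; apply: pair_le.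
Qed.

Lemma ent_mixed a i h j : le (Su j) (len z) -> (le i j -> le (len (p2 a)) (len w)) ->
  ent z (mixed a i h) j = ite (le (Su j) i) (mul twoM (dig z q h j)) (ent z a j).
Proof.
move=> hj ha; rewrite /mixed ent_pair; last exact: le_Su_le.
rewrite ((svalP (cid mixed_ex)).2 a i h).2 // min_l //.
have h1 := subMK (E2_ge1 w).
case: (le_or_lt i j) => hij.
  rewrite iteF; last by move=> h2; apply: (@nlt M j); apply: mle_trans h2 hij.
  have h2 := ent_lt z a j; have h3 := smash_le oneM (ha hij); rewrite -!/(E2 _) in h3.
  by mz.
by rewrite iteT //; have h2 := dig_lt z h j q_neq0; have h3 := lt_E2 w; mz.
Qed.

End Seq.

(** ** Nonzero values at points of the grid *)

Definition nz z y P t := le twoM (ev z y P t (subM (cL P) oneM)).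

Lemma PD_nz z y f g : PF anyc f -> PF anyc g -> PD anyc (fun rho => nz z y (f rho) (g rho)).
Proof. by move=> hf hg; rewrite /nz; apply: PD_le; pf. Qed.

(* [z] and [y] are large enough for the evaluation of circuits in [Ckt (n, d, s)] at points
   whose coordinates have length at most [kap]. *)
Definition large n d s kap z y := [/\ le (add n s) (len z), le kap (len z), le s kap,
  le (add (mul (add s kap) (mul (add n s) d)) (threeM M)) (len y) & le (len y) (len z)].

Lemma nzP n d s kap P z y t : CktM n d s P -> inlog n -> large n d s kap z y -> is_pointM n t ->
  (forall j, le (Su j) n -> le (halfM (ent z t j)) (pw z kap)) ->
  nonzero_atM P t <-> nz z y P t.
Proof.
move=> hC ln [h1 h2 h3 h4 h5] ht hb; have [l1 l2 l3] := Ckt_size hC.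
have hs : le s (len z) := mle_trans (le_addl _ _) h1.
apply: (nonzero_atP hC ln _ _ (kap := kap)) => //.
- exact: mle_trans l1 hs.
- exact: mle_trans (le_add2 (mle_refl n) l2) h1.
- move=> j _; have l4 : le (len (p2 (cC P))) s by apply: mle_trans l3; apply: basic_len_le; apply: p2_le.
  by apply: mle_trans (ent_half_le j (mle_trans l4 hs)) (pw_le (mle_trans l4 h3) h2).
apply: mle_trans h4; apply: le_add2 (mle_refl _).
by apply: le_mul2 (le_add2 l1 (mle_refl _)) (le_mul2 (le_add2 (mle_refl _) l2) (mle_refl _)).
Qed.

Lemma large_ex n d s kap u : inlog n -> inlog d -> inlog s -> inlog kap -> inlog u -> le s kap ->
  exists z y, large n d s kap z y /\ le u (len z).
Proof.
move=> ln ld ls lk lu hk.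
have [sz es] : exists t, t = add (mul (add s kap) (mul (add n s) d)) (threeM M) by eexists.
have lsz : inlog sz.
  rewrite es; apply: inlog_add; last by do 2 apply: inlog_S; apply: inlog_one.
  by apply: inlog_mul; [apply: inlog_add|apply: inlog_mul => //; apply: inlog_add].
have [y hy] := (in_LogMP sz).2 lsz.
have [z hz] : inlog (add (add (add n s) kap) (add sz u)).
  by apply: inlog_add (inlog_add lsz lu); apply: inlog_add => //; apply: inlog_add.
exists z, y; rewrite /large hy -es; split; last by clear - hz; mz.
by split=> //; try apply: mle_refl; clear - hz; mz.
Qed.

(* Coordinates can be moved to the grid one by one, since a circuit that does not vanish on a line
   has at most [d] zeros on it. *)
Lemma nonzero_on_grid n d s q P a : CktM n d s P -> inlog n -> inlog d -> inlog s -> inlog q ->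
  le (Su d) q -> is_pointM n a -> nonzero_atM P a ->
  exists z0, forall z, le (len z0) (len z) -> exists h, le (Su h) (powB z q n) /\ forall b, is_pointM n b -> (forall j, le (Su j) n -> ent z b j = mul twoM (dig z q h j)) ->
      nonzero_atM P b.
Proof.
move=> hC ln ld ls lq dq ha hnz.
have q0 : q <> zeroM by move=> e; rewrite e in dq; clear - dq; mz.
have [w ew] : exists w, w = add (mul twoM q) (p2 a) by eexists.
have qw : le (mul twoM q) w by rewrite ew; apply: le_addr.
have aw : le (len (p2 a)) (len w) by rewrite ew; apply/basic_len_le/le_addl.
have [kap ek] : exists k, k = add s (len w) by eexists.
have lk : inlog kap by rewrite ek; apply: inlog_add => //; apply: inlog_len.
have sk : le s kap by rewrite ek; apply: le_addr.
have wk : le (len w) kap by rewrite ek; apply: le_addl.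
have [z [y [lg _]]] := large_ex ln ld ls lk ln sk.
exists z => z1 hz1.
have [hns hk _ _ _] := lg.
have hn : le n (len z) := mle_trans (le_addr _ _) hns.
have ent_m i h j : le (Su j) n -> ent z (mixed z w q a i h) j =
    ite (le (Su j) i) (mul twoM (dig z q h j)) (ent z a j).
  by move=> hj; apply: ent_mixed => //; apply: mle_trans hn.
have pt_m i h : is_pointM n (mixed z w q a i h).
  move=> j hj; have hj' := mle_trans (le_Su_le hj) hn.
  exists (ent z (mixed z w q a i h) j); split; first exact/(entryMP _ _ hj').
  apply/is_intP; rewrite ent_m //; case: (pselect (le (Su j) i)) => hji; last first.
    by rewrite iteF //; apply: (point_int hn ha).
  by rewrite iteT //; apply: double_neq1.
have nzm i h : nonzero_atM P (mixed z w q a i h) <-> nz z y P (mixed z w q a i h).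
  apply: (nzP hC ln lg (pt_m i h)) => j hj.
  apply: mle_trans (ent_half_le _ _) _; rewrite /mixed p2_pair; first exact: mle_trans wk hk.
  exact: pw_le.
(* The digits of [h] are found one after the other; those already found replace the first
   coordinates of [a]. *)
have main i : le i (len z) -> le i n -> exists h, le h (powB z q i) /\
    (le (Su h) (powB z q i) /\ nz z y P (mixed z w q a i h)).
  move: i; apply: LIND.
  - apply: Sg_imp; first by sb.
    apply: (Sg_ex (b := fun rho => powB z q (rho 0))); first by pf.
    apply/Sg_SB/SB_and; first by sb.
    by apply/SB_PD/PD_nz; [pf|apply: PF_mixed; pf].
  - move=> _; exists zeroM; split; first exact: basic_ge0.
    split; first by rewrite powB0; apply: mle_refl.
    apply/nzm; apply: (nonzero_ext hC ln ld (pt_m _ _) _ ha hnz); exists z => z' hz' j hj.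
    have hj' := mle_trans (le_Su_le hj) hn.
    rewrite -!(ent_indep _ hj' (mle_trans hj' hz')) ent_m // iteF // => h.
    by clear - h; mz.
  move=> i hi IH hin; have [h [_ [h1 h2]]] := IH (le_Su_le hin).
  have li := le_Su_le hi; have ni := powB_neq0 q0 li.
  suff [v [hv hv']] : exists v, le (Su v) q /\ nz z y P (mixed z w q a (Su i) (add h (mul (powB z q i) v))).
    exists (add h (mul (powB z q i) v)).
    have h3 : le (Su (add h (mul (powB z q i) v))) (powB z q (Su i)).
      by rewrite powBS //; have h3 := le_mul2 (mle_refl (powB z q i)) hv; clear - h1 h3; mz.
    by split; [apply: le_Su_le|split].
  apply: contrapT => hv.
  have dlow v j : le (Su j) i -> dig z q (add h (mul (powB z q i) v)) j = dig z q h j.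
    by move=> hj; apply: dig_mod_eq hj li _; rewrite ?modM_addM.
  have dtop v : le (Su v) q -> dig z q (add h (mul (powB z q i) v)) i = v.
    by move=> hv'; rewrite /dig divM_addM // divM_small // madd0r modM_small.
  (* If no digit worked, all q points of the line would be zeros: [A] is everything and the counting
     function is the identity. *)
  have : le q d.
    apply: (line_roots (a0 := mixed z w q a i h) (j0 := i) (c := fun v => v) (A := fun=> True)
      (pts := fun v => mixed z w q a (Su i) (add h (mul (powB z q i) v))) hC ln ld lq) => //.
    - exact/nzm.
    - move=> z' v hz' hv'.
      rewrite (ent_indep _ (mle_trans (le_Su_le hin) hz') li) ent_m // iteT ?dtop //; exact: mle_refl.
    - move=> z' v j hz' hv' hj ne.
      have hj' := mle_trans (le_Su_le hj) hn; have hj2 := mle_trans (le_Su_le hj) hz'.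
      rewrite !(ent_indep _ hj2 hj') !ent_m //; case: (le_or_lt i j) => hij.
        have hji : le (Su i) j by apply: le_neq_lt => // e; apply: ne.
        by rewrite !iteF // => l; clear - l hji; mz.
      by rewrite (iteT _ _ (mle_trans hij (le_S _))) iteT // dlow.
    - by apply: PD_ext (PD_eq (PF_zero _) (PF_zero _)).
    - by move=> v hv' _ /nzm h'; apply: hv; exists v.
    - exact: PF_var.
    - by move=> v _; rewrite iteT // maddr1.
  by move=> h3; clear - dq h3; mz.
have [h [_ [h1 h2]]] := main n hn (mle_refl n).
have hn1 := mle_trans hn hz1.
exists h; split; first by rewrite -(powB_indep q hn hn1).
move=> b hb eb; apply: (nonzero_ext hC ln ld hb _ (pt_m n h)); last exact/nzm.
exists z1 => z' hz' j hj; have hj' := mle_trans (le_Su_le hj) hn.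
have hj1 := mle_trans hj' hz1; have hj2 := mle_trans hj1 hz'.
rewrite -(ent_indep _ hj' hj2) -(ent_indep b hj1 hj2) ent_m // iteT // eb //.
by rewrite /dig (powB_indep q hj1 hj').
Qed.

End Points.

(** * The weak pigeonhole principle for definable functions *)

Section Symbols.

Variable M : model.
Implicit Types (x y c : M).

Fixpoint pv_term n (s : nat -> pv n) (t : term) : pv n :=
  match t with
  | Var i => s i
  | App k f ts => pv_comp f (fun i => pv_term s (ts i))
  end.

Lemma interp_pv_term n (s : nat -> pv n) t (xs : 'I_n -> M) :
  interp (pv_term s t) xs = eval (fun i => interp (s i) xs) t.
Proof.
elim: t => [|k f ts IH] //=; rewrite interp_comp; congr interp.
by apply/funext => i; apply: IH.
Qed.

Lemma eval_bound (t : term) : exists N, forall rho rho' : nat -> M,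
  (forall i, i < N -> rho i = rho' i) -> eval rho t = eval rho' t.
Proof.
elim: t => [i|k f ts IH]; first by exists i.+1 => rho rho'; apply.
have /fin_all_exists[N hN] := IH; exists (\max_i N i) => rho rho' e /=; congr interp.
apply/funext => i; apply: hN => j hj; apply: e; apply: leq_trans hj _; exact: leq_bigmax.
Qed.

Definition proj1_pv : pv 2 := pv_proj ord0.
Definition proj2_pv : pv 2 := pv_proj (lift ord0 ord0).
Definition zero_pv : pv 2 := pv_comp pv_zero (fun i : 'I_0 => proj1_pv).

Lemma PV1_symbol (F : M -> M) : PV1 F -> exists f : pv 2,
  forall (G : pv 2) (xs : 'I_2 -> M),
    interp (pv_comp f (fun=> G)) xs = F (interp G xs).
Proof.
move=> /(_ noc _ (PF_var _ 0)) [t [r [hr ht]]].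
have r0 i : r i = zeroM by case: (hr i).
exists (pv_term (fun i => if odd i then zero_pv else proj1_pv) t) => G xs.
rewrite interp_comp interp_pv_term (ht (fun=> interp G xs)); congr eval.
apply/funext => i; rewrite /mix r0; case: odd; last by rewrite interp_proj.
by rewrite interp_comp interp0.
Qed.

(** The axiom [dWPHP] has a single parameter, so the finitely many parameters of a definable
    function are packed into one by iterated pairing. *)
Fixpoint pack (r : nat -> M) N : M :=
  if N is N'.+1 then pair (r 0) (pack (fun i => r i.+1) N') else zeroM.
Fixpoint unpack i c : M := if i is j.+1 then unpack j (p2 c) else p1 c.

Lemma unpack_pack (r : nat -> M) N i : i < N -> unpack i (pack r N) = r i.
Proof.
elim: N r i => // N IH r [|i] hi /=; first by rewrite p1_pair.
by rewrite p2_pair IH.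
Qed.

(** Each parameter of the term is replaced by the symbol that unpacks it from the second argument;
    only the variables that occur in the term have to be recovered. *)
Lemma pv2_ex (F : M -> M) : PF anyc (fun rho => F (rho 0)) ->
  exists (f : pv 2) c, forall x, F x = appl f [:: x; c].
Proof.
move=> [t [r [_ ht]]]; have [N hN] := eval_bound t.
have [f1 hf1] := PV1_symbol (@PV_p1 M); have [f2 hf2] := PV1_symbol (@PV_p2 M).
pose comp1 (f G : pv 2) := pv_comp f (fun=> G).
pose sym i : pv 2 := comp1 f1 (iter i (comp1 f2) proj2_pv).
have hsym i (xs : 'I_2 -> M) : interp (sym i) xs = unpack i (xs (lift ord0 ord0)).
  rewrite hf1.
  suff e : forall k, interp (iter k (comp1 f2) proj2_pv) xs = iter k (@p2 M) (xs (lift ord0 ord0)).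
    by rewrite e; elim: i (xs _) => [|i IH] c //=; rewrite -IH -iterS iterSr.
  by elim=> [|k IH] /=; [rewrite interp_proj|rewrite hf2 IH].
exists (pv_term (fun i => if odd i then sym i./2 else proj1_pv) t), (pack r N) => x.
rewrite (ht (fun=> x)) /appl interp_pv_term; apply: hN => i hi.
rewrite /mix; case: ifP => oi; last by rewrite interp_proj.
rewrite hsym /= unpack_pack //.
by apply: leq_ltn_trans hi; lia.
Qed.

Lemma dwphp_PF (F : M -> M) a b : PF anyc (fun rho => F (rho 0)) -> le (mul twoM a) b -> le oneM a ->
  exists y, le oneM y /\ le y b /\ forall x, le oneM x -> le x a -> F x <> y.
Proof.
move=> /pv2_ex[f [c e]] h1 h2; have [y [h3 [h4 h5]]] := use_dwphp f c h1 h2.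
by exists y; split=> //; split=> // x h6 h7; rewrite e; apply: h5.
Qed.

End Symbols.

(** * Enumeration of roots *)

Section Enumerate.

Variable M : model.
Implicit Types (x u v z t i j : M) (env : nat -> M).
Variables z q : M.
Hypothesis q_z : le q (len z).

(** Iteration over the numbers below |z| when the value after [v] steps is at most [v]: then [z]
    itself is a bound that never cuts. *)
Lemma rec_len_ex (h : M -> M -> (nat -> M) -> M) :
  PF anyc (fun rho => h (rho 0) (rho 1) (fun k => rho k.+2)) ->
  (forall x v env, le x v -> le (h x v env) (Su v)) ->
  exists R : M -> (nat -> M) -> M, PF anyc (fun rho => R (rho 0) (fun k => rho k.+1)) /\
    forall env, R zeroM env = zeroM /\
      forall v, le (Su v) (len z) -> R (Su v) env = h (R v env) v env.
Proof.
move=> ph hb; have pz : PF anyc (fun rho : nat -> M => z) by pf.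
have [R [pR R0 RS]] := iter_ex (PF_zero anyc) ph pz.
exists (R z); split=> [|env].
  by apply: (PF_subst pR (s := fun n rho => if n is m.+1 then rho m else z)); case=> [|n]; pf.
have e0 : R z zeroM env = zeroM by rewrite R0 min_l //; apply: basic_ge0.
have pRe : PF anyc (fun rho => R z (rho 0) env).
  apply: (PF_subst pR (s := fun n rho => if n is m.+1 then if m is k.+1 then env k else rho 0 else z)).
  by case=> [|[|n]]; pf.
have bd v : le v (len z) -> le (R z v env) v.
  move: v; apply: LIND.
  - by apply/Sg_SB/SB_le; pf.
  - by rewrite e0; apply: mle_refl.
  by move=> v hv IH; rewrite RS //; apply: mle_trans (min_le_l _ _) (hb _ _ _ IH).
split=> // v hv; rewrite RS // min_l //.
apply: mle_trans (mle_trans hv (le_len z)); apply: hb; apply/bd/le_Su_le/hv.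
Qed.

(** As q is in Log, the roots below q can be scanned. [c v] is the number of roots below [v], hence
    the rank of a root [v], and [root] inverts the rank. *)
Lemma enum_ex (A : M -> (nat -> M) -> Prop) : PD anyc (fun rho => A (rho 0) (fun k => rho k.+1)) ->
  exists c root : M -> (nat -> M) -> M,
  [/\ PF anyc (fun rho => c (rho 0) (fun k => rho k.+1)),
      PF anyc (fun rho => root (rho 0) (fun k => rho k.+1)),
      forall env, c zeroM env = zeroM,
      forall env v, le (Su v) q -> c (Su v) env = add (c v env) (ite (A v env) oneM zeroM) &
      forall env v, le (Su v) q -> A v env ->
        le (Su (c v env)) (c q env) /\ root (c v env) env = v].
Proof.
move=> pA.
have [c [pc hc]] : exists R : M -> (nat -> M) -> M, PF anyc (fun rho => R (rho 0) (fun k => rho k.+1)) /\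
    forall env, R zeroM env = zeroM /\
      forall v, le (Su v) (len z) -> R (Su v) env = add (R v env) (ite (A v env) oneM zeroM).
  apply: (@rec_len_ex (fun x v env => add x (ite (A v env) oneM zeroM))) => [|x v env h].
    apply: PF_add; first by pf.
    by apply: PF_ite; [apply: (PD_subst pA (s := fun n rho => rho n.+1)) => n|..]; pf.
  rewrite -maddr1; apply: le_add2 h _.
  by apply: ite_le; [apply: mle_refl|apply: basic_ge0].
have pce f env : PF anyc f -> PF anyc (fun rho => c (f rho) env).
  move=> hf; apply: (PF_subst pc (s := fun n rho => if n is m.+1 then env m else f rho)).
  by case=> [|n] //; pf.
have [F [pF hF]] : exists R : M -> (nat -> M) -> M, PF anyc (fun rho => R (rho 0) (fun k => rho k.+1)) /\
    forall env, R zeroM env = zeroM /\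
      forall v, le (Su v) (len z) -> R (Su v) env =
        ite (A v (fun k => env k.+1) /\ c v (fun k => env k.+1) = env 0) v (R v env).
  apply: (@rec_len_ex (fun x v env => ite (A v (fun k => env k.+1) /\ c v (fun k => env k.+1) = env 0) v x)).
    apply: PF_ite; [apply: PD_and|..]; try pf.
      apply: (PD_subst pA (s := fun n rho => if n is m.+1 then rho m.+3 else rho 1)).
      by case=> [|n]; pf.
    apply: PD_eq; last by pf.
    apply: (PF_subst pc (s := fun n rho => if n is m.+1 then rho m.+3 else rho 1)).
    by case=> [|n]; pf.
  by move=> x v env h; apply: ite_le; [apply: le_S|apply: mle_trans h (le_S _)].
(* The scan has the rank as its additional variable 0 and keeps the last root of that rank; a later
   root has a larger rank. *)
pose root j env := F q (econs j env).
exists c, root; split=> //.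
- apply: (PF_subst pF (s := fun n rho => if n is m.+1 then econs (rho 0) (fun k => rho k.+1) m else q)).
  by case=> [|[|n]]; pf.
- by move=> env; case: (hc env).
- by move=> env v hv; apply: (hc env).2; apply: mle_trans hv q_z.
move=> env v hv hA; have [c0 cS] := hc env.
have vz := mle_trans hv q_z.
have c_lt u : le u (len z) -> le (Su v) u -> le (Su (c v env)) (c u env).
  move: u; apply: LIND.
  - by apply/Sg_SB/SB_imp; [sb|apply: SB_le; [apply: PF_S|]; apply: pce; pf].
  - by move=> h; mz.
  move=> u hu IH h; case: (pselect (u = v)) => e.
    by rewrite e cS // iteT // maddr1; apply: mle_refl.
  rewrite cS //; apply: mle_trans (le_addr _ _); apply: IH.
  by apply: le_neq_lt; [exact/le_SS|move=> e'; apply: e].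
split; first exact: c_lt.
have [F0 FS] := hF (econs (c v env) env).
suff : forall t, le t (len z) -> le (Su v) t -> F t (econs (c v env) env) = v by apply.
apply: LIND.
- apply/Sg_SB/SB_imp; first by sb.
  apply: SB_eq; last by pf.
  apply: (PF_subst pF (s := fun n rho => if n is m.+1 then econs (c v env) env m else rho 0)).
  by case=> [|n]; pf.
- by move=> h; mz.
move=> t ht IH h; rewrite FS //; case: (pselect (t = v)) => e.
  by rewrite e iteT.
have h' : le (Su v) t by apply: le_neq_lt; [exact/le_SS|move=> e'; apply: e].
rewrite iteF; first exact: IH.
case=> _ /= e'; have := c_lt t (le_Su_le ht) h'; rewrite e'; exact: (@nlt M).
Qed.

End Enumerate.

(** * Compression of the points where a circuit vanishes *)

Section Decode.

Variable M : model.
Implicit Types (x u v t i j h a b c P : M).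
Variables z y w q n' d s kap : M.
Notation n := (Su n').
Hypothesis large_zy : large n d s kap z y.
Hypotheses (ln : inlog n) (ld : inlog d) (lq : inlog q).
Hypothesis q_gt0 : le oneM q.
Hypothesis q_w : le (mul twoM q) w.
Hypothesis w_kap : le (len w) kap.
Hypothesis q_z : le q (len z).

Let q_neq0 : q <> zeroM. Proof. exact: ge1_neq0. Qed.
Let n_z : le n (len z).
Proof. by case: large_zy => h _ _ _ _; apply: mle_trans (le_addr _ _) h. Qed.

Definition pt h : M := mixed z w q zeroM n h.

Lemma PF_pt f : PF anyc f -> PF anyc (fun rho => pt (f rho)).
Proof. by move=> hf; apply: PF_mixed; pf. Qed.

Lemma ent_pt h j : le (Su j) n -> ent z (pt h) j = mul twoM (dig z q h j).
Proof.
move=> hj; have hj' := mle_trans hj n_z; rewrite /pt ent_mixed //; first by rewrite iteT.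
by move=> h1; case: (@nlt M j (mle_trans hj h1)).
Qed.

Lemma pt_point h : is_pointM n (pt h).
Proof.
move=> j hj; have hj' := mle_trans (le_Su_le hj) n_z.
exists (ent z (pt h) j); split; first exact/(entryMP _ _ hj').
by apply/is_intP; rewrite ent_pt //; apply: double_neq1.
Qed.

Lemma nz_pt P h : CktM n d s P -> nonzero_atM P (pt h) <-> nz z y P (pt h).
Proof.
move=> hC; apply: (nzP hC ln large_zy (pt_point h)) => j hj.
have [_ hk _ _ _] := large_zy.
apply: mle_trans (ent_half_le _ _) _; rewrite /pt /mixed p2_pair; first exact: mle_trans w_kap hk.
exact: pw_le.
Qed.

Notation Qn := (powB z q n).

(* If a circuit vanishes at [h] but not at [a], it vanishes at a point of the line through two
   consecutive hybrids of [h] and [a] but not identically: [h] is then determined by the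
   coordinate of this line, the rank of the root and the other digits of [h]. *)
Lemma decoder_ex : exists D : M -> M -> M -> M,
  (forall f1 f2 f3, PF anyc f1 -> PF anyc f2 -> PF anyc f3 ->
     PF anyc (fun rho => D (f1 rho) (f2 rho) (f3 rho))) /\
  forall P a h, CktM n d s P -> le (Su a) Qn -> le (Su h) Qn ->
    nz z y P (pt a) -> ~ nz z y P (pt h) ->
    exists c, le (Su c) (mul (mul n d) (powB z q n')) /\ D P a c = h.
Proof.
(* The decoder has only the erased point. This suffices to describe the line, which uses the digits
   of [h] below [i], where erasing changes nothing, and those of [a] above [i]. *)
pose A v (env : nat -> M) := ~ nz z y (env 0) (pt (splice z q (env 1) (env 2) v (env 3))).
have pA : PD anyc (fun rho => A (rho 0) (fun k => rho k.+1)).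
  by apply/PD_not/PD_nz; [pf|apply: PF_pt; rewrite /splice; pf].
have [c [root [pc pr c0 cS cr]]] := enum_ex q_z pA.
pose B0 := powB z q n'.
have nB : B0 <> zeroM by apply: powB_neq0 => //; apply: le_Su_le.
(* A code is (i d + j) q^(n-1) + rest with line [i], rank [j] and the remaining digits. The root of
   rank [j] is the erased digit; the digits of [rest] from [i] on are then moved up again. *)
exists (fun P a t => let rest := modM t B0 in let ij := divM t B0 in
  let i := divM ij d in let j := modM ij d in
  splice z q i rest (root j (lenv [:: P; i; rest; a]))
    (mul (divM rest (powB z q i)) (powB z q (Su i)))).
split=> [f1 f2 f3 h1 h2 h3|P a h hC ha hh nza nzh].
  have pB : PF anyc (fun rho : nat -> M => B0) by pf.
  have pi : PF anyc (fun rho => divM (divM (f3 rho) B0) d) by pf.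
  have pR : PF anyc (fun rho => root (modM (divM (f3 rho) B0) d)
      (lenv [:: f1 rho; divM (divM (f3 rho) B0) d; modM (f3 rho) B0; f2 rho])).
    apply: (PF_lenv (gs := [:: fun rho => modM (divM (f3 rho) B0) d; f1;
      fun rho => divM (divM (f3 rho) B0) d; fun rho => modM (f3 rho) B0; f2]) pr).
    by do !constructor => //; pf.
  by rewrite /splice; pf.
(* Along the hybrids from [a] to [h] there is a first step at which the circuit starts to vanish; it
   is found by length induction on a PV predicate. *)
have [i [hi [nz1 nz2]]] : exists i, le (Su i) n /\
    (nz z y P (pt (hybrid z q i h a)) /\ ~ nz z y P (pt (hybrid z q (Su i) h a))).
  apply: contrapT => hno; apply: nzh; rewrite -(hybrid_full hh ha).
  suff : forall i, le i (len z) -> le i n -> nz z y P (pt (hybrid z q i h a)).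
    by apply=> //; apply: mle_refl.
  apply: LIND.
  - apply/Sg_SB/SB_imp; first by sb.
    by apply/SB_PD/PD_nz; [pf|apply: PF_pt; rewrite /hybrid; pf].
  - by move=> _; rewrite hybrid0.
  move=> i hi IH hin; apply: contrapT => nz2; apply: hno; exists i; split=> //; split=> //.
  exact/IH/le_Su_le.
have hiz := mle_trans hi n_z; have iz := le_Su_le hiz.
pose env := lenv [:: P; i; erase z q i h; a].
have sE v : splice z q i (erase z q i h) v a = splice z q i h v a.
  by rewrite /splice (erase_divmod q_neq0 _ iz).1.
pose v := dig z q h i.
have hv : le (Su v) q by apply: dig_lt.
have Av : A v env by rewrite /A /env /= sE hybrid_S.
have [c1 c2] := cr env v hv Av.
(* The hybrid before the step lies on the line and is not a zero, so the line has at most [d] roots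
   and ranks fit into a digit below [d]. *)
have cd : le (c q env) d.
  apply: (line_roots (a0 := pt (hybrid z q i h a)) (j0 := i) (c := fun v => c v env)
    (A := fun v => A v env) (pts := fun v => pt (splice z q i h v a)) hC ln ld lq) => //.
  - exact: pt_point.
  - exact/nz_pt.
  - by move=> u _; apply: pt_point.
  - move=> z' u hz' hu; rewrite (ent_indep _ (mle_trans (le_Su_le hi) hz') iz) ent_pt //.
    by have [_ -> _] := splice_divmod q_neq0 h a hiz hu.
  - move=> z' u j hz' hu hj ne; have hjz := mle_trans hj n_z; have hj' := le_Su_le hjz.
    rewrite !(ent_indep _ (mle_trans (le_Su_le hj) hz') hj') !ent_pt //.
    have [s1 s2] := splice_dig q_neq0 h a hiz hu hjz; have [h1 h2] := hybrid_dig q_neq0 h a iz hjz.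
    case: (le_or_lt i j) => hij; last by rewrite s1 ?h1.
    by rewrite s2 ?h2 //; apply: le_neq_lt => // e; apply: ne.
  - apply: (PD_subst pA (s := fun n rho => if n is m.+1 then env m else rho 0)).
    by case=> [|k]; pf.
  - by move=> u hu hA /(nz_pt _ hC); rewrite -sE.
  - apply: (PF_subst pc (s := fun n rho => if n is m.+1 then env m else rho 0)).
    by case=> [|k]; pf.
  - by move=> u hu; apply: cS.
have jd : le (Su (c v env)) d := mle_trans c1 cd.
pose rest := erase z q i h.
have hr : le (Su rest) B0 by apply: erase_lt.
pose t := add (mul B0 (add (mul d i) (c v env))) rest.
have [t1 t2] := divM_uniq hr (erefl t).
have [t3 t4] := divM_uniq jd (erefl (add (mul d i) (c v env))).
exists t; split; last by rewrite /= t2 t1 t3 t4 c2; apply: insert_erase.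
have aux T B r X : le (mul (Su T) B) X -> le (Su r) B -> le (Su (add (mul B T) r)) X.
  by move=> *; mz.
have h1 := le_mul2 (mle_refl d) hi.
have h2 : le (Su (add (mul d i) (c v env))) (mul n d) by rewrite basic_mulS in h1; mz.
exact: aux (le_mul2 h2 (mle_refl B0)) hr.
Qed.

End Decode.

(** * Small hitting sets in a model *)

Section Main.

Variable M : model.
Implicit Types (x u v t i j k h a b c z y w n d s q r m e P H B C T X Y : M).

Lemma powB_le_pw z B i : le i (len z) -> le (mul i (len B)) (len z) ->
  le (powB z B i) (pw z (mul i (len B))).
Proof.
move: i; apply: LIND.
- by apply/Sg_SB/SB_imp; [sb|rewrite /pw; sb].
- by move=> _; rewrite powB0; apply: pw_ge1.
move=> i hi IH h; have e : mul (Su i) (len B) = add (mul i (len B)) (len B) by mring.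
rewrite e in h *; rewrite powBS // pwD //.
apply: le_mul2 (IH (mle_trans (le_addr _ _) h)) (le_Su_le (lt_pw_len (mle_trans (le_addl _ _) h))).
Qed.

Lemma pw_powB_le z B B' i : le (mul twoM B') B -> le i (len z) ->
  le (mul (pw z i) (powB z B' i)) (powB z B i).
Proof.
move=> hB; move: i; apply: LIND.
- by apply/Sg_SB; rewrite /pw; sb.
- by rewrite !powB0 pw0 mmulr1; apply: mle_refl.
move=> i hi IH; rewrite !powBS // pwS //.
have -> : mul (mul twoM (pw z i)) (mul (powB z B' i) B') = mul (mul (pw z i) (powB z B' i)) (mul twoM B').
  by mring.
exact: le_mul2.
Qed.

Lemma base_lt C B T X : le (mul (Su T) B) X -> le (Su C) B -> le (Su (add (mul B T) C)) X.
Proof. by move=> *; mz. Qed.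

Lemma unary_ex n : in_LogM n -> exists u, unaryM u n.
Proof. by move=> [z <-]; exists (un z (len z)); split; [apply/len_un/mle_refl|apply: Su_un]. Qed.

Lemma slice_nonempty (g : pv 5) e n d s m : in_LogM n -> in_LogM d -> in_LogM s -> in_LogM m ->
  exists P, in_sliceM g e n d s m P.
Proof.
move=> /unary_ex[n1 hn] /unary_ex[d1 hd] /unary_ex[s1 hs] /in_LogMP/inlog_S/in_LogMP[x hx].
by exists (appl g [:: e; n1; d1; s1; x]), n1, d1, s1, x.
Qed.

Lemma string_split z m x : le (Su m) (len z) -> is_stringM x m ->
  exists2 x', le (Su x') (pw z m) & x = add (pw z m) x'.
Proof.
move=> hm hx; have hx' : le (len x) (len z) by rewrite hx.
have nx : x <> zeroM by move=> e; move: hx; rewrite e /is_stringM mlen0 => /esym/Su_neq0.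
have h1 := lt_pw_len hx'; have h2 := le_pw_len nx hx'; rewrite hx pwS // in h1 h2.
have h3 : le (pw z m) x by mz.
by exists (subM x (pw z m)); have h4 := subMK h3; mz.
Qed.

(** At least one variable is assumed, because compression leaves n - 1 coordinates of each point. *)
Lemma hitting_set_ex (g : pv 5) e n' d s q r m :
  inlog (Su n') -> inlog d -> inlog s -> inlog q -> inlog r -> inlog m -> decodesM g e (Su n') d s m ->
  le oneM d -> le (mul (mul twoM d) (Su n')) q -> le (Su (add m (mul (Su n') (len q)))) r ->
  exists H, grid_pointsM q (Su n') r H /\ hitting_setM g e (Su n') d s m r H.
Proof.
move=> ln ld ls lq lr lm slice_Ckt d_gt0 q_ge r_ge.
have dn : le (mul d oneM) (mul d (Su n')) by apply: le_mul2 (mle_refl _) _; apply/le_SS/basic_ge0.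
rewrite mmulr1 in dn.
have dq : le (Su d) q.
  have h : mul (mul twoM d) (Su n') = mul twoM (mul d (Su n')) by mring.
  by rewrite h in q_ge; clear - q_ge dn d_gt0; mz.
have q1 : le oneM q by clear - dq; mz.
have q0 := ge1_neq0 q1.
pose w := mul twoM q.
have [kap ek] : exists k, k = add s (len w) by eexists.
have lk : inlog kap by rewrite ek; apply: inlog_add => //; apply: inlog_len.
have sk : le s kap by rewrite ek; apply: le_addr.
have wk : le (len w) kap by rewrite ek; apply: le_addl.
have [u eu] : exists u, u = add (add q (Su r)) (add (Su m) (add d (mul (Su n') (len q)))) by eexists.
have lu : inlog u.
  rewrite eu; apply: inlog_add; first by apply: inlog_add => //; apply: inlog_S.
  by apply: inlog_add; [apply: inlog_S|apply: inlog_add => //; apply: inlog_mul => //; apply: inlog_len].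
have [z [y [lg uz]]] := large_ex ln ld ls lk lu sk.
have pnq := basic_ge0 (mul (Su n') (len q)).
have [hns hk _ _ _] := lg.
have qz : le q (len z) by apply: mle_trans uz; rewrite eu; clear - pnq; mz.
have rz : le r (len z) by apply: mle_trans uz; rewrite eu; clear - pnq; mz.
have mz' : le (Su m) (len z) by apply: mle_trans uz; rewrite eu; clear - pnq; mz.
have dz : le d (len z) by apply: mle_trans uz; rewrite eu; clear - pnq; mz.
have nqz : le (mul (Su n') (len q)) (len z) by apply: mle_trans uz; rewrite eu; clear - pnq; mz.
have nz' : le (Su n') (len z) := mle_trans (le_addr _ _) hns.
have sz : le s (len z) := mle_trans (le_addl _ _) hns.
have [D [pD hD]] := decoder_ex lg ln ld lq q1 (mle_refl w) wk qz.
pose ptn := pt z w q n'.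
have [Qn eQn] : exists Q, Q = powB z q (Su n') by eexists.
have [Q' eQ'] : exists Q, Q = mul (mul (Su n') d) (powB z q n') by eexists.
rewrite -eQn -eQ' in hD.
have nQn : Qn <> zeroM by rewrite eQn; apply: powB_neq0.
have nQ' : Q' <> zeroM.
  rewrite eQ'; apply: mul_neq0; last by apply: powB_neq0 => //; apply: le_Su_le.
  by apply: mul_neq0 (@Su_neq0 _ _) (ge1_neq0 d_gt0).
have Q'Qn : le (mul twoM Q') Qn.
  rewrite eQn eQ' powBS // (basic_mulC _ q) -mmulA; apply: le_mul2 _ (mle_refl _).
  by have <- : mul (mul twoM d) (Su n') = mul twoM (mul (Su n') d) by mring.
pose n1 := un z (Su n'); pose d1 := un z d; pose s1 := un z s.
have [Nm eNm] : exists N, N = pw z m by eexists.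
have [N2 eN2] : exists N, N = pw z (mul (Su n') (len q)) by eexists.
have [QR eQR] : exists N, N = powB z Q' r by eexists.
have nN2 : N2 <> zeroM by rewrite eN2; apply/ge1_neq0/pw_ge1.
have nQR : QR <> zeroM by rewrite eQR; apply: powB_neq0.
have QnN2 : le Qn N2 by rewrite eQn eN2; apply: powB_le_pw.
(* An argument x in [1, ...] is read as x - 1 = (x' 2^(n|q|) + a) Q'^r + C, where the string is
   coded by 2^m + x', the leading 1 being understood, and [C] lists r compressed points. For [a] the
   room 2^(n|q|) is at least q^n. *)
pose Pof x := appl g [:: e; n1; d1; s1; add Nm (divM (divM (subM x oneM) QR) N2)].
pose aof x := modM (divM (subM x oneM) QR) N2.
pose Cof x := modM (subM x oneM) QR.
have pP f : PF anyc f -> PF anyc (fun rho => Pof (f rho)).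
  move=> hf; apply: (@PF_appl M anyc 5 g [:: fun=> e; fun=> n1; fun=> d1; fun=> s1;
    fun rho => add Nm (divM (divM (subM (f rho) oneM) QR) N2)]).
  by do !constructor; pf.
have ph : PF anyc (fun rho => D (Pof (rho 2)) (aof (rho 2)) (dig z Q' (Cof (rho 2)) (rho 1))).
  by apply: pD; [apply: pP; pf|rewrite /aof; pf|rewrite /Cof; pf].
have pB : PF anyc (fun rho : nat -> M => Qn) by pf.
have [T [pT hT]] := cov_dig ph pB.
(* The r decoded points are the digits of the result in base q^n. The successor adapts it to the
   range [b] of the pigeonhole principle, which starts at 1. *)
pose F x := Su (T z r (lenv [:: x])).
have pF : PF anyc (fun rho => F (rho 0)).
  apply: PF_S; apply: (PF_lenv (gs := [:: fun=> z; fun=> r; fun rho => rho 0]) pT).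
  by do !constructor; pf.
(* From 2 Q' <= q^n one gets 2^r Q'^r <= (q^n)^r, and r >= m + n|q| + 1 leaves the factor 2 required
   by the principle. *)
have ab : le (mul twoM (mul (mul Nm N2) QR)) (powB z Qn r).
  apply: mle_trans (pw_powB_le Q'Qn rz); rewrite -eQR -mmulA; apply: le_mul2 _ (mle_refl _).
  have h := mle_trans r_ge rz; rewrite eNm eN2 -pwD; last exact: le_Su_le.
  by rewrite -pwS //; apply: pw_le.
have a1 : le oneM (mul (mul Nm N2) QR).
  by apply: le_one; apply: mul_neq0 nQR; apply: mul_neq0 nN2; rewrite eNm; apply/ge1_neq0/pw_ge1.
have [y0 [y1 [y2 y3]]] := dwphp_PF pF ab a1.
(* The r digits of [Y] in base q^n are the points of the hitting set. *)
have [Y eY] : exists Y, y0 = Su Y by apply: eq_Su; apply: ge1_neq0.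
rewrite eY in y2 y3.
have pv : PF anyc (fun rho => ptn (dig z Qn Y (rho 0))) by apply: PF_pt; pf.
(* Codes of grid points have a common bound, and its length serves as the block length of [H]. *)
have [t ht] := seq_ex (y := pair (powB z (E2 w) (len z)) w) pv rz (fun k _ =>
  mle_trans ((le_SS _ _).2 (mixed_le z w q zeroM (Su n') (dig z Qn Y k))) (lt_E2 _)).
exists (pair t (pair (powB z (E2 w) (len z)) w)); move: (pair t _) ht => H ht.
have Hent k : le (Su k) r -> entryM H k (ptn (dig z Qn Y k)).
  by move=> hk'; apply/(entryMP _ _ (mle_trans (le_Su_le hk') rz)); rewrite ht.
split=> [k hk'|P hP [a0 [ha0 nza0]]].
  exists (ptn (dig z Qn Y k)); split; first exact: Hent.
  move=> j hj; exists (dig z q (dig z Qn Y k) j); split; first exact: dig_lt.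
  apply/(entryMP _ _ (mle_trans (le_Su_le hj) nz')).
  by rewrite (ent_pt lg q1 (mle_refl w)).
apply: contrapT => hno.
have hC := slice_Ckt P hP.
have nzP' h := nz_pt lg ln q1 (mle_refl w) wk h hC.
have fails k : le (Su k) r -> ~ nz z y P (ptn (dig z Qn Y k)).
  by move=> hk' /nzP' h; apply: hno; exists k, (ptn (dig z Qn Y k)); split=> //; split=> //; apply: Hent.
have [a [ha nza]] : exists a, le (Su a) Qn /\ nz z y P (ptn a).
  have [z0 hz0] := nonzero_on_grid hC ln ld ls lq dq ha0 nza0.
  have [z1 hz1] := inlog_add (inlog_len z0) (inlog_len z).
  have [a [h1 h2]] := hz0 z1 (mle_trans (le_addr _ _) hz1).
  have hzz1 := mle_trans (le_addl _ _) hz1; have nz1 := mle_trans nz' hzz1.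
  exists a; rewrite eQn (powB_indep q nz' nz1); split=> //; apply/nzP'/h2.
    exact: (pt_point lg q1 (mle_refl w)).
  move=> j hj; have hj' := mle_trans (le_Su_le hj) nz'; have hj1 := mle_trans hj' hzz1.
  by rewrite -(ent_indep _ hj' hj1) (ent_pt lg q1 (mle_refl w)) // /dig (powB_indep q hj' hj1).
have [n1' [d1' [s1' [x0 [[hn1 un1] [[hd1 ud1] [[hs1 us1] [hx0 eP]]]]]]]] := hP.
(* Unary strings are determined by their lengths, so the arguments of [g] are those built into
   [Pof]. *)
rewrite (un_uniq nz' hn1 un1) (un_uniq dz hd1 ud1) (un_uniq sz hs1 us1) in eP.
have [x' hx' ex0] := string_split mz' hx0; rewrite -eNm in hx' ex0.
(* The decoder gives a code for each point separately. Induction on the number of points collects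
   them as digits in base Q' of one number, which replaces an appeal to choice in the model. *)
have [C [_ [hC1 hC2]]] : exists C, le C (powB z Q' r) /\ (le (Su C) (powB z Q' r) /\
    forall k, le k (len z) -> le (Su k) r -> D P a (dig z Q' C k) = dig z Qn Y k).
  suff : forall i, le i (len z) -> le i r -> exists C, le C (powB z Q' i) /\ (le (Su C) (powB z Q' i) /\
    forall k, le k (len z) -> le (Su k) i -> D P a (dig z Q' C k) = dig z Qn Y k).
    by apply=> //; apply: mle_refl.
  apply: LIND.
  - apply: Sg_imp; first by sb.
    apply: (Sg_ex (b := fun rho => powB z Q' (rho 0))); first by pf.
    apply/Sg_SB/SB_and; first by sb.
    apply: (SB_all (b := fun=> z)); first by pf.
    apply: SB_imp; first by sb.
    by apply: SB_eq; [apply: pD; pf|pf].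
  - move=> _; exists zeroM; split; first exact: basic_ge0.
    by split=> [|k _ hk']; [rewrite powB0; apply: mle_refl|mz].
  move=> i hi IH hir; have [C [_ [h1 h2]]] := IH (le_Su_le hir).
  have li := le_Su_le hi; have ni := powB_neq0 nQ' li.
  have [c [hc ec]] := hD P a (dig z Qn Y i) hC ha (dig_lt z Y i nQn) nza (fails i hir).
  exists (add C (mul (powB z Q' i) c)).
  have h3 : le (Su (add C (mul (powB z Q' i) c))) (powB z Q' (Su i)).
    by rewrite basic_addC powBS //; apply: base_lt h1; rewrite basic_mulC; apply: le_mul2 (mle_refl _) hc.
  split; [exact: le_Su_le|split=> // k hkz hki].
  case: (pselect (k = i)) => ke.
    by rewrite ke /dig divM_addM // divM_small // madd0r modM_small.
  have hk' : le (Su k) i by apply: le_neq_lt => //; exact/le_SS.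
  by rewrite -h2 //; congr D; apply: dig_mod_eq hk' li _; rewrite ?modM_addM.
rewrite -eQR in hC1.
pose xx := Su (add (mul QR (add (mul N2 x') a)) C).
have xx1 : le xx (mul (mul Nm N2) QR).
  apply: base_lt hC1; apply: le_mul2 _ (mle_refl _); apply: base_lt (mle_trans ha QnN2).
  exact: le_mul2 hx' (mle_refl _).
apply: (y3 xx) => //; first by apply/le_SS/basic_ge0.
have [e1 e2] := divM_uniq hC1 (erefl (add (mul QR (add (mul N2 x') a)) C)).
have [e3 e4] := divM_uniq (mle_trans ha QnN2) (erefl (add (mul N2 x') a)).
have eP' : Pof xx = P by rewrite /Pof subM_Su e1 e3 -ex0.
have ea' : aof xx = a by rewrite /aof subM_Su e1 e4.
have eC' : Cof xx = C by rewrite /Cof subM_Su e2.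
have [hT1 hT2] := hT z (lenv [:: xx]) nQn r rz.
rewrite /F; congr Su.
(* Two numbers below (q^n)^r are equal if their r digits are. So [Y] is decoded from [xx], although
   its successor is not in the range of [F]. *)
rewrite -(modM_small hT1) -(modM_small y2); apply: dig_ext => // k hkr.
have [-> _] := hT2 k hkr; rewrite /econs2 /= /lenv /= eP' ea' eC' hC2 ?min_l //.
  by have h1 := dig_lt z Y k nQn; have h2 := subMK (le_one nQn); mz.
exact: mle_trans (le_Su_le hkr) rz.
Qed.

Lemma small_hitting_sets_model (g : pv 5) : small_hitting_setsM M g.
Proof.
move=> e n d s q r m [Ln [Ld [Ls [Lq [Lr Lm]]]]] hdec hq hr.
have [ln [ld ls]] : inlog n /\ (inlog d /\ inlog s) by split; [|split]; apply/in_LogMP.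
have [lq [lr lm]] : inlog q /\ (inlog r /\ inlog m) by split; [|split]; apply/in_LogMP.
(* The slice contains at least one circuit, because strings of length m exist; through it the class
   condition yields d >= 1. *)
have [P0 hP0] := slice_nonempty g e Ln Ld Ls Lm; have hC0 := hdec P0 hP0.
case: (pselect (n = zeroM)) => [n0|/eq_Su[n' en]]; last first.
  have d1 : le oneM d.
    have [z hz] : inlog (add (cL P0) (add n (cp P0))).
      by apply: inlog_add (inlog_len _) (inlog_add ln (inlog_len _)).
    exact: (d_ge1 hC0 (mle_trans (le_addr _ _) hz) (mle_trans (le_addl _ _) hz)).
  by rewrite en in ln hdec hq hr *; apply: hitting_set_ex.
have [z hz] := lr.
have r1 : le (Su zeroM) r by apply: mle_trans hr; apply/le_SS/basic_ge0.
have no j : ~ le (Su j) n by rewrite n0; apply: (@not_le_lt M _ _).2; apply/le_SS/basic_ge0.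
(* Without variables the value of a circuit does not depend on the point, so any sequence will do;
   index 0 is available because r >= 1. *)
exists zeroM; split=> [i hi|P hP [a [ha nza]]].
  exists (ent z zeroM i); split; last by move=> j /no.
  exact/(entryMP _ _ (mle_trans (le_Su_le hi) hz)).
exists zeroM, (ent z zeroM zeroM); split=> //; split; first exact/(entryMP _ _ (basic_ge0 _)).
apply: (nonzero_ext (hdec P hP) ln ld _ _ ha nza) => [j /no //|].
by exists zeroM => z' _ j /no.
Qed.

End Main.

Theorem theorem4p4 (g : pv 5) :
  proves S12_dWPHP nil (close (small_hitting_sets g)).
Proof. by apply: small_hitting_sets_sound => M; apply: small_hitting_sets_model. Qed.
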